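(* Let $n\ge 2$, $\theta\in(0,1)$, let $\Omega\subset\mathbb{R}^n$ be a bounded $C^{2,\theta}$ domain with outward unit normal $\vec{\mathbf n}$, let $c\in C^1(\overline\Omega)$, and let $u_0\in C^{2,\theta}(\overline\Omega)$ satisfy $\frac{\partial u_0}{\partial\vec{\mathbf n}}=0$ on $\partial\Omega$. Let $u$ be the unique viscosity solution of $$\begin{cases} u_t=|Du|\,\mathrm{div}\left(\frac{Du}{|Du|}\right)+c(x)|Du| & \text{in }\Omega\times(0,\infty),\\ \frac{\partial u}{\partial\vec{\mathbf n}}=0 & \text{on }\partial\Omega\times[0,\infty),\\ u(x,0)=u_0(x) & \text{on }\overline\Omega.\end{cases}$$ Then there exists a constant $M>0$, and for each $T>0$ there exists a constant $C_T>0$ depending on $T$, such that $$|u(x,t)-u(x,s)|\le M|t-s|,\qquad |u(x,t)-u(y,t)|\le C_T|x-y|$$ for all $x,y\in\overline\Omega$ and $t,s\in[0,T]$.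
   Context: Viscosity solutions. Let $\mathcal S^n$ be the set of real symmetric $n\times n$ matrices and, for $x\in\overline\Omega$, $p\in\mathbb{R}^n\setminus\{0\}$, $X\in\mathcal S^n$, put $F(x,p,X)=\mathrm{trace}\left(\left(I-\frac{p\otimes p}{|p|^2}\right)X\right)+c(x)|p|$. For $(x,p,X)\in\overline\Omega\times\mathbb{R}^n\times\mathcal S^n$ let $F_*(x,p,X)=\liminf_{(y,q,Y)\to(x,p,X)}F(y,q,Y)$ and $F^*(x,p,X)=\limsup_{(y,q,Y)\to(x,p,X)}F(y,q,Y)$. An upper semicontinuous $u:\overline\Omega\times[0,\infty)\to\mathbb{R}$ is a viscosity subsolution if $u(\cdot,0)\le u_0$ on $\overline\Omega$ and, for any $\varphi\in C^2(\overline\Omega\times[0,\infty))$, whenever $(\hat x,\hat t)\in\overline\Omega\times(0,\infty)$ is a maximizer of $u-\varphi$: if $\hat x\in\Omega$ then $\varphi_t-F^*(\hat x,D\varphi,D^2\varphi)\le 0$ at $(\hat x,\hat t)$; if $\hat x\in\partial\Omega$ then $\min\{\varphi_t-F^*(\hat x,D\varphi,D^2\varphi),\ \frac{\partial\varphi}{\partial\vec{\mathbf n}}\}\le 0$ at $(\hat x,\hat t)$. A lower semicontinuous $u$ is a viscosity supersolution if $u(\cdot,0)\ge u_0$ on $\overline\Omega$ and, for any such $\varphi$, whenever $(\hat x,\hat t)\in\overline\Omega\times(0,\infty)$ is a minimizer of $u-\varphi$: if $\hat x\in\Omega$ then $\varphi_t-F_*(\hat x,D\varphi,D^2\varphi)\ge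 0$; if $\hat x\in\partial\Omega$ then $\max\{\varphi_t-F_*(\hat x,D\varphi,D^2\varphi),\ \frac{\partial\varphi}{\partial\vec{\mathbf n}}\}\ge 0$ at $(\hat x,\hat t)$. A continuous $u$ is a viscosity solution if it is both a viscosity subsolution and a viscosity supersolution. Existence and uniqueness of the viscosity solution, and the comparison principle (every subsolution is $\le$ every supersolution on $\overline\Omega\times[0,\infty)$), are well known in this setting. *)

(* Defs.v *)
From HB Require Import structures.
From mathcomp Require Import all_boot all_order all_algebra.
From mathcomp Require Import all_classical all_reals all_analysis.

Set Implicit Arguments.
Unset Strict Implicit.
Unset Printing Implicit Defensive.

Import Order.TTheory GRing.Theory Num.Theory.
Import numFieldNormedType.Exports.

Local Open Scope classical_set_scope.
Local Open Scope ring_scope.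

(* The library norm on 'rV[R]_n is the sup norm (it induces the usual topology
   and the usual bounded sets); enorm is the Euclidean norm. *)
Definition dot (R : realType) (n : nat) (p q : 'rV[R]_n) : R :=
  \sum_(i < n) p 0 i * q 0 i.

Definition enorm (R : realType) (n : nat) (p : 'rV[R]_n) : R :=
  Num.sqrt (dot p p).

(* A is the open set in which derivatives are taken; the closed domain is
   closure A. *)
Section up_to_the_boundary.
Variables (R : realType) (V : normedModType R).
Implicit Types (A : set V) (f g : V -> R).

Definition extends_continuously A g : Prop :=
  exists h : V -> R,
    {within closure A, continuous h} /\ (forall x, A x -> h x = g x).

(* The value at x \in closure A of the continuous extension of g from A. *)
Definition extension A g (x : V) : R := lim (g @ within A (nbhs x)).

(* f is k times differentiable in A along all directions, and all the
   derivatives of order at most k extend continuously to closure A. *)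
Fixpoint derivatives_extend (k : nat) A f : Prop :=
  extends_continuously A f /\
  match k with
  | 0%N => True
  | k'.+1 => forall v : V, (forall x, A x -> derivable f x v) /\
                           derivatives_extend k' A ('D_v f)
  end.

(* f \in C^k(closure A) *)
Definition Cbar (k : nat) A f : Prop :=
  {within closure A, continuous f} /\ derivatives_extend k A f.

End up_to_the_boundary.

Section domains.
Variables (R : realType) (n : nat).
Implicit Types (Omega : set 'rV[R]_n) (f gamma : 'rV[R]_n -> R).

(* f \in C^{2,theta}(closure A) *)
Definition C2theta (theta : R) (A : set 'rV[R]_n) f : Prop :=
  Cbar 2 A f /\
  forall v w : 'rV[R]_n, exists K : R, forall x y, A x -> A y ->
    `|'D_w ('D_v f) x - 'D_w ('D_v f) y| <= K * enorm (x - y) `^ theta.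

Definition boundary Omega : set 'rV[R]_n := closure Omega `\` interior Omega.

Definition grad f (x : 'rV[R]_n) : 'rV[R]_n :=
  \row_i 'D_(delta_mx 0 i) f x.

(* In the Euclidean ball of radius r around x0, Omega is the part below the
   graph of gamma over the hyperplane orthogonal to the unit vector e, heights
   being measured along e.  A function on this hyperplane is represented by its
   extension to R^n that is constant along e. *)
Definition below_graph Omega (x0 e : 'rV[R]_n) (r : R) gamma : Prop :=
  [/\ enorm e = 1, 0 < r,
      forall y s, gamma (y + s *: e) = gamma y &
      forall y, enorm (y - x0) < r -> (Omega y <-> dot y e < gamma y)].

Definition bounded_C2theta_domain (theta : R) Omega : Prop :=
  [/\ Omega !=set0, open Omega, connected Omega, bounded_set Omega &
      forall x0, boundary Omega x0 -> exists e r gamma,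
        below_graph Omega x0 e r gamma /\ C2theta theta setT gamma].

(* As gamma is constant along e, grad gamma x0 is orthogonal to e. *)
Definition outward_unit_normal Omega (x0 nu : 'rV[R]_n) : Prop :=
  exists e r gamma,
    [/\ below_graph Omega x0 e r gamma, Cbar 1 setT gamma &
        nu = (enorm (e - grad gamma x0))^-1 *: (e - grad gamma x0)].

(* Gradient at a point of closure Omega. *)
Definition gradbar Omega f (x : 'rV[R]_n) : 'rV[R]_n :=
  \row_i extension Omega ('D_(delta_mx 0 i) f) x.

End domains.

Section viscosity.
Variables (R : realType) (n : nat).
Variables (Omega : set 'rV[R]_n) (nu : 'rV[R]_n -> 'rV[R]_n).
Variables (c u0 : 'rV[R]_n -> R).
Local Notation spacetime := ('rV[R]_n * R)%type.
Implicit Types (phi u : spacetime -> R) (z : spacetime).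

Definition cylinder : set spacetime := [set z | Omega z.1 /\ 0 < z.2].
Definition closed_cylinder : set spacetime :=
  [set z | closure Omega z.1 /\ 0 <= z.2].

Definition space_dir (i : 'I_n) : spacetime := (delta_mx 0 i, 0).
Definition time_dir : spacetime := (0, 1).

(* Derivatives of a test function, at points of the closed cylinder. *)
Definition dt phi z : R := extension cylinder ('D_time_dir phi) z.
Definition Dx phi z : 'rV[R]_n :=
  \row_i extension cylinder ('D_(space_dir i) phi) z.
Definition D2x phi z : 'M[R]_n :=
  \matrix_(i, j) extension cylinder ('D_(space_dir j) ('D_(space_dir i) phi)) z.
Definition dnu phi z : R := dot (Dx phi z) (nu z.1).

Definition F (x p : 'rV[R]_n) (X : 'M[R]_n) : R :=
  \tr ((1%:M - (enorm p ^+ 2)^-1 *: (p^T *m p)) *m X) + c x * enorm p.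

(* Points tending to (x, p, X) inside the domain of F. *)
Definition F_filter (x p : 'rV[R]_n) (X : 'M[R]_n) :
    set_system ('rV[R]_n * 'rV[R]_n * 'M[R]_n) :=
  within [set w | [/\ closure Omega w.1.1, w.1.2 != 0 & w.2^T = w.2]]
         (nbhs (x, p, X)).

Definition F_upper (x p : 'rV[R]_n) (X : 'M[R]_n) : \bar R :=
  limf_esup (fun w => (F w.1.1 w.1.2 w.2)%:E) (F_filter x p X).

Definition F_lower (x p : 'rV[R]_n) (X : 'M[R]_n) : \bar R :=
  limf_einf (fun w => (F w.1.1 w.1.2 w.2)%:E) (F_filter x p X).

Definition maximizer (g : spacetime -> R) z : Prop :=
  closed_cylinder z /\ forall z', closed_cylinder z' -> g z' <= g z.
Definition minimizer (g : spacetime -> R) z : Prop :=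
  closed_cylinder z /\ forall z', closed_cylinder z' -> g z <= g z'.

Definition lsc (g : spacetime -> R) : Prop :=
  lower_semicontinuous (fun z : subspace closed_cylinder => (g z)%:E).
Definition usc (g : spacetime -> R) : Prop := lsc (fun z => - g z).

Definition viscosity_subsolution u : Prop :=
  [/\ usc u,
      forall x, closure Omega x -> u (x, 0) <= u0 x &
      forall phi, Cbar 2 cylinder phi ->
      forall z, maximizer (fun z' => u z' - phi z') z -> 0 < z.2 ->
        let residual :=
          ((dt phi z)%:E - F_upper z.1 (Dx phi z) (D2x phi z))%E in
        (Omega z.1 -> (residual <= 0)%E) /\
        (boundary Omega z.1 -> (Order.min residual (dnu phi z)%:E <= 0)%E)].

Definition viscosity_supersolution u : Prop :=
  [/\ lsc u,
      forall x, closure Omega x -> u0 x <= u (x, 0) &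
      forall phi, Cbar 2 cylinder phi ->
      forall z, minimizer (fun z' => u z' - phi z') z -> 0 < z.2 ->
        let residual :=
          ((dt phi z)%:E - F_lower z.1 (Dx phi z) (D2x phi z))%E in
        (Omega z.1 -> (0 <= residual)%E) /\
        (boundary Omega z.1 -> (0 <= Order.max residual (dnu phi z)%:E)%E)].

Definition viscosity_solution u : Prop :=
  [/\ {within closed_cylinder, continuous u},
      viscosity_subsolution u & viscosity_supersolution u].

End viscosity.

(* Main.v *)
Require Import Defs.
From mathcomp Require Import all_boot all_order all_algebra.
From mathcomp Require Import all_classical all_reals all_analysis.
From mathcomp Require Import ring lra.

Set Implicit Arguments.
Unset Strict Implicit.
Unset Printing Implicit Defensive.

Import Order.TTheory GRing.Theory Num.Theory.
Import numFieldNormedType.Exports.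

Local Open Scope classical_set_scope.
Local Open Scope ring_scope.

(* Let v be a subsolution for c and w one for -c, for instance w(x,t) = -u(x,t) or
   w(x,t) = -u(x,t+h).  If v(x,0) + w(y,0) <= m0 + L |x-y|^4, doubling the variables
   shows v(x,t) + w(y,t) <= m0 + L (1+t)^m (g(x)+g(y)) |x-y|^4 with m independent of
   L.  The quartic penalty makes a maximum with x = y harmless for the singular
   operator, because then the gradient and the Hessian of the penalty vanish, and the
   weight g, with g = 1 and large normal derivative on the boundary, beats the
   curvature of the boundary.  Optimizing over L gives a Lipschitz bound in space for
   w = -u, and L -> oo gives u(x,t) - u(x,t+h) <= M h once |u(x,h) - u0(x)| <= M h,
   which is a barrier argument with the test function u0(x) + M t.

   The theorem on sums needed for the doubling is proved without Aleksandrov's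
   theorem.  Near a nonvanishing gradient the operator is dominated by one with a
   constant matrix, and for the Laplacian the theorem follows by comparing both
   functions with one harmonic polynomial.  The coupled functions are first replaced
   by sup-convolutions. *)

(** * Euclidean vectors and second order jets *)

(** The decisive point is a count of orders. Put r = |x - y|. At a maximum with x different from y
    the Hessian of the penalty is of order L r^2, while the time derivative of the weight (1+t)^m
    can absorb only order L r^4. The gap is closed by evaluating the Hessian only along pairs (v P,
    v Q), where P and Q project orthogonally to the two gradients: these have size L r^3 and are
    opposite up to L r^4, so v P - v Q = O(r), which gains two orders. All terms are linear in L, so
    L drops out of the condition on m. In the theorem on sums this pairing appears as a common
    variable. The two sup-convolutions are taken at e P and e Q for the same e, with P and Q first
    made invertible by adding a small multiple of the identity. In the variable e each is a
    subsolution of a Laplace equation and their sum lies below a quadratic form; the Laplacian of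
    that form is the trace along the pairs (v P, v Q). *)

Section dot_product.
Variables (R : realType).
Implicit Types n : nat.

Lemma dotE n (p q : 'rV[R]_n) : dot p q = (p *m q^T) 0 0.
Proof. by rewrite mxE; apply: eq_bigr => i _; rewrite !mxE. Qed.

Lemma dotC n (p q : 'rV[R]_n) : dot p q = dot q p.
Proof. by apply: eq_bigr => i _; rewrite mulrC. Qed.

Lemma dotDl n (p q r : 'rV[R]_n) : dot (p + q) r = dot p r + dot q r.
Proof. by rewrite !dotE mulmxDl mxE. Qed.

Lemma dotDr n (p q r : 'rV[R]_n) : dot r (p + q) = dot r p + dot r q.
Proof. by rewrite !(dotC r) dotDl. Qed.

Lemma dotZl n a (p q : 'rV[R]_n) : dot (a *: p) q = a * dot p q.
Proof. by rewrite !dotE -scalemxAl mxE. Qed.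

Lemma dotZr n a (p q : 'rV[R]_n) : dot p (a *: q) = a * dot p q.
Proof. by rewrite dotC dotZl dotC. Qed.

Lemma dotNl n (p q : 'rV[R]_n) : dot (- p) q = - dot p q.
Proof. by rewrite -scaleN1r dotZl mulN1r. Qed.

Lemma dotNr n (p q : 'rV[R]_n) : dot p (- q) = - dot p q.
Proof. by rewrite dotC dotNl dotC. Qed.

Lemma dotBl n (p q r : 'rV[R]_n) : dot (p - q) r = dot p r - dot q r.
Proof. by rewrite dotDl dotNl. Qed.

Lemma dotBr n (p q r : 'rV[R]_n) : dot r (p - q) = dot r p - dot r q.
Proof. by rewrite dotDr dotNr. Qed.

Lemma dot0l n (q : 'rV[R]_n) : dot 0 q = 0.
Proof. by rewrite -(scale0r q) dotZl mul0r. Qed.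

Lemma dot0r n (q : 'rV[R]_n) : dot q 0 = 0.
Proof. by rewrite dotC dot0l. Qed.

Lemma dot_ge0 n (p : 'rV[R]_n) : 0 <= dot p p.
Proof. by apply: sumr_ge0 => i _; rewrite -expr2 sqr_ge0. Qed.

Lemma dot_eq0 n (p : 'rV[R]_n) : (dot p p == 0) = (p == 0).
Proof.
apply/idP/eqP => [|->]; last by rewrite dot0l.
rewrite psumr_eq0; last by move=> i _; rewrite -expr2 sqr_ge0.
move/allP => h; apply/rowP => i; rewrite mxE.
by have /= := h i (mem_index_enum _); rewrite mulf_eq0 orbb => /eqP.
Qed.

Lemma dot_gt0 n (p : 'rV[R]_n) : p != 0 -> 0 < dot p p.
Proof. by move=> p0; rewrite lt_neqAle dot_ge0 eq_sym dot_eq0 p0. Qed.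

Lemma dot_mull m n (A : 'M[R]_(m, n)) (d : 'rV_m) (e : 'rV_n) :
  dot (d *m A) e = dot d (e *m A^T).
Proof. by rewrite !dotE trmx_mul trmxK mulmxA. Qed.

Lemma dot_delta n (p : 'rV[R]_n) i : dot p (delta_mx 0 i) = p 0 i.
Proof.
rewrite /dot (bigD1 i)//= mxE !eqxx mulr1 big1 ?addr0// => j ji.
by rewrite mxE (negbTE ji) andbF mulr0.
Qed.

Lemma dot_CS n (p q : 'rV[R]_n) : dot p q ^+ 2 <= dot p p * dot q q.
Proof.
have [->|p0] := eqVneq p 0; first by rewrite !dot0l expr0n mul0r.
have pp := dot_gt0 p0.
have := dot_ge0 (dot p p *: q - dot p q *: p).
rewrite dotBl !dotBr !dotZl !dotZr (dotC q p) => h.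
have {}h : 0 <= dot p p * (dot p p * dot q q - dot p q ^+ 2) by nra.
by rewrite -subr_ge0; rewrite pmulr_rge0 in h.
Qed.

Lemma enorm_ge0 n (p : 'rV[R]_n) : 0 <= enorm p.
Proof. exact: sqrtr_ge0. Qed.

Lemma enorm_sq n (p : 'rV[R]_n) : enorm p ^+ 2 = dot p p.
Proof. by rewrite sqr_sqrtr// dot_ge0. Qed.

Lemma enorm_eq0 n (p : 'rV[R]_n) : (enorm p == 0) = (p == 0).
Proof. by rewrite -dot_eq0 -enorm_sq sqrf_eq0. Qed.

Lemma enorm_gt0 n (p : 'rV[R]_n) : p != 0 -> 0 < enorm p.
Proof. by move=> p0; rewrite lt_neqAle enorm_ge0 eq_sym enorm_eq0 p0. Qed.

Lemma enorm0 n : enorm (0 : 'rV[R]_n) = 0.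
Proof. by apply/eqP; rewrite enorm_eq0. Qed.

Lemma dot_enorm n (p q : 'rV[R]_n) : `|dot p q| <= enorm p * enorm q.
Proof.
rewrite -(@ler_pXn2r _ 2)// ?nnegrE ?mulr_ge0 ?enorm_ge0//.
by rewrite exprMn !enorm_sq real_normK ?num_real// dot_CS.
Qed.

Lemma enormD n (p q : 'rV[R]_n) : enorm (p + q) <= enorm p + enorm q.
Proof.
rewrite -(@ler_pXn2r _ 2)// ?nnegrE ?addr_ge0 ?enorm_ge0//.
rewrite sqrrD !enorm_sq dotDl !dotDr (dotC q p).
have := le_trans (ler_norm _) (dot_enorm p q); lra.
Qed.

Lemma enormZ n a (p : 'rV[R]_n) : enorm (a *: p) = `|a| * enorm p.
Proof.
by rewrite /enorm dotZl dotZr mulrA -expr2 sqrtrM ?sqr_ge0// sqrtr_sqr.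
Qed.

Lemma enormN n (p : 'rV[R]_n) : enorm (- p) = enorm p.
Proof. by rewrite -scaleN1r enormZ normrN1 mul1r. Qed.

Lemma enormBC n (p q : 'rV[R]_n) : enorm (p - q) = enorm (q - p).
Proof. by rewrite -enormN opprB. Qed.

Lemma coord_norm n (p : 'rV[R]_n) i : `|p 0 i| <= `|p|.
Proof.
by rewrite [leRHS]/Num.norm /= mx_normrE; apply: (le_bigmax _ (fun j => `|p j.1 j.2|) (0, i)).
Qed.

Lemma norm_leP n (p : 'rV[R]_n) c : 0 <= c -> (forall i, `|p 0 i| <= c) -> `|p| <= c.
Proof.
move=> c0 h; rewrite [leLHS]/Num.norm /= mx_normrE.
by apply/bigmax_leP; split => // -[i j] _ /=; rewrite (ord1 i).
Qed.

Lemma norm_sq_le_dot n (p : 'rV[R]_n) : `|p| ^+ 2 <= dot p p.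
Proof.
rewrite -enorm_sq ler_pXn2r ?nnegrE ?enorm_ge0//.
apply: norm_leP => [|i]; first exact: enorm_ge0.
rewrite -(@ler_pXn2r _ 2)// ?nnegrE ?enorm_ge0// enorm_sq real_normK ?num_real//.
rewrite /dot (bigD1 i)//= expr2 lerDl.
by apply: sumr_ge0 => j _; rewrite -expr2 sqr_ge0.
Qed.

Lemma norm_le_enorm n (p : 'rV[R]_n) : `|p| <= enorm p.
Proof. by rewrite -(@ler_pXn2r _ 2)// ?nnegrE ?enorm_ge0// enorm_sq norm_sq_le_dot. Qed.

Lemma dot_norm_le n (p q : 'rV[R]_n) : `|dot p q| <= n%:R * (`|p| * `|q|).
Proof.
apply: le_trans (ler_norm_sum _ _ _) _.
apply: le_trans (_ : \sum_(i < n) `|p| * `|q| <= _).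
  by apply: ler_sum => i _; rewrite normrM ler_pM// coord_norm.
by rewrite sumr_const card_ord mulr_natl.
Qed.

Lemma enorm_le_norm n (p : 'rV[R]_n) : enorm p <= (n%:R + 1) * `|p|.
Proof.
rewrite -(@ler_pXn2r _ 2)// ?nnegrE ?mulr_ge0 ?enorm_ge0//.
rewrite enorm_sq; have := le_trans (ler_norm _) (dot_norm_le p p).
have : 0 <= `|p| by []. have : (0 : R) <= n%:R by [].
by move=> *; nra.
Qed.

Definition qf n (A : 'M[R]_n) (d : 'rV[R]_n) : R := dot (d *m A) d.

Lemma qfD n (A B : 'M[R]_n) d : qf (A + B) d = qf A d + qf B d.
Proof. by rewrite /qf mulmxDr dotDl. Qed.

Lemma qfZ n a (A : 'M[R]_n) d : qf (a *: A) d = a * qf A d.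
Proof. by rewrite /qf -scalemxAr dotZl. Qed.

Lemma qfN n (A : 'M[R]_n) d : qf (- A) d = - qf A d.
Proof. by rewrite -scaleN1r qfZ mulN1r. Qed.

Lemma qf0 n d : qf (0 : 'M[R]_n) d = 0.
Proof. by rewrite /qf mulmx0 dot0l. Qed.

Lemma qf0r n (A : 'M[R]_n) : qf A 0 = 0.
Proof. by rewrite /qf dot0r. Qed.

Lemma qf_scalar n a (d : 'rV[R]_n) : qf a%:M d = a * dot d d.
Proof. by rewrite /qf mul_mx_scalar dotZl. Qed.

Lemma qf_scale n (A : 'M[R]_n) a d : qf A (a *: d) = a ^+ 2 * qf A d.
Proof. by rewrite /qf -scalemxAl dotZl dotZr mulrA expr2. Qed.

Lemma qf_outer n (p q : 'rV[R]_n) d : qf (p^T *m q) d = dot p d * dot q d.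
Proof.
rewrite /qf mulmxA.
have -> : d *m p^T = (dot p d)%:M by rewrite [LHS]mx11_scalar -dotE dotC.
by rewrite mul_scalar_mx dotZl.
Qed.

Lemma qf_mul m n (L : 'M[R]_(m, n)) (A : 'M[R]_n) (d : 'rV_m) :
  qf (L *m A *m L^T) d = qf A (d *m L).
Proof. by rewrite /qf !mulmxA dot_mull trmxK. Qed.

Lemma qf_le n (A : 'M[R]_n) : exists2 K, 0 < K & forall d, `|qf A d| <= K * dot d d.
Proof.
exists (1 + \sum_i \sum_j `|A i j|).
  by rewrite ltr_pwDl// sumr_ge0// => i _; rewrite sumr_ge0.
move=> d; rewrite mulrDl mul1r.
apply: le_trans (_ : _ <= (\sum_i \sum_j `|A i j|) * dot d d) _; last first.
  by rewrite lerDr dot_ge0.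
rewrite /qf [dot (d *m A) d]/dot.
under eq_bigr do rewrite mxE mulr_suml.
rewrite exchange_big/= mulr_suml.
apply: le_trans (ler_norm_sum _ _ _) _; apply: ler_sum => i _.
rewrite mulr_suml; apply: le_trans (ler_norm_sum _ _ _) _; apply: ler_sum => j _.
rewrite mulrAC !normrM mulrC ler_wpM2l//.
apply: le_trans (norm_sq_le_dot d); rewrite expr2 ler_pM// coord_norm//.
Qed.

Lemma qf_row n (A : 'M[R]_n) (m : nat) (L : 'M[R]_(m, n)) :
  \tr (L *m A *m L^T) = \sum_i qf A (row i L).
Proof.
apply: eq_bigr => i _; rewrite /qf dotE -!row_mul.
by rewrite !mxE; apply: eq_bigr => j _; rewrite !mxE.
Qed.

Lemma norm_mulmx m n (L : 'M[R]_(m, n)) :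
  exists2 K, 0 < K & forall d : 'rV_m, `|d *m L| <= K * `|d|.
Proof.
exists (1 + \sum_i \sum_j `|L i j|).
  by rewrite ltr_pwDl// sumr_ge0// => i _; rewrite sumr_ge0.
move=> d; apply: norm_leP => [|j].
  by rewrite mulr_ge0// addr_ge0// sumr_ge0// => i _; rewrite sumr_ge0.
rewrite mxE mulrDl mul1r; apply: le_trans (ler_norm_sum _ _ _) _.
apply: le_trans (_ : (\sum_i \sum_j `|L i j|) * `|d| <= _); last by rewrite lerDr.
rewrite mulr_suml; apply: ler_sum => i _; rewrite normrM mulrC ler_pM ?coord_norm//.
by rewrite (bigD1 j)//= lerDl sumr_ge0.
Qed.

End dot_product.

Section jets.
Variable R : realType.
Implicit Types n : nat.

(** Taylor expansion at the single point [x] with Peano remainder; [X] may be non-symmetric. The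
    notion is closed under products, linear substitutions and cubes of positive parts, and still
    yields comparison at maxima. *)
Definition jet2 n (f : 'rV[R]_n -> R) (x p : 'rV[R]_n) (X : 'M[R]_n) : Prop :=
  forall e, 0 < e -> exists2 de, 0 < de & forall d, `|d| < de ->
    `|f (x + d) - f x - dot p d - 2^-1 * qf X d| <= e * dot d d.

Lemma jet2_lip n (f : 'rV[R]_n -> R) x p X : jet2 f x p X ->
  exists2 K, 0 < K & exists2 de, 0 < de & forall d, `|d| < de ->
    `|f (x + d) - f x| <= K * `|d| /\ `|f (x + d) - f x - dot p d| <= K * `|d| ^+ 2.
Proof.
move=> /(_ 1 ltr01)[de de0 h]; have [K K0 hK] := qf_le X.
have n0 : (0 : R) <= n%:R by [].
pose K1 := (1 + K) * (n%:R + 1).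
have K10 : 0 < K1 by rewrite mulr_gt0// ?addr_gt0// ltr_wpDl.
exists (K1 + n%:R * `|p|); first by rewrite ltr_wpDr// mulr_ge0.
exists (Num.min de 1); first by rewrite lt_min de0 ltr01.
move=> d; rewrite lt_min => /andP[dd d1].
have {}h := h _ dd; have {}hK := hK d.
have pd := dot_norm_le p d.
have dd2 := le_trans (ler_norm _) (dot_norm_le d d).
have d0 : 0 <= dot d d := dot_ge0 d.
have nd0 : 0 <= `|d| by [].
have a1 : `|f (x + d) - f x - dot p d| <= K1 * `|d| ^+ 2.
  have -> : f (x + d) - f x - dot p d =
   (f (x + d) - f x - dot p d - 2^-1 * qf X d) + 2^-1 * qf X d by ring.
  apply: le_trans (ler_normD _ _) _.
  have -> : `|2^-1 * qf X d| = 2^-1 * `|qf X d| by rewrite normrM ger0_norm.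
  apply: (@le_trans _ _ ((1 + K) * dot d d)); first by nra.
  rewrite /K1 -mulrA ler_pM2l ?addr_gt0//.
  have : 0 <= `|d| ^+ 2 by rewrite sqr_ge0.
  by move=> *; lra.
have pp0 : 0 <= n%:R * `|p| by rewrite mulr_ge0.
have d2 : `|d| ^+ 2 <= `|d| by rewrite expr2 ler_piMl// ltW.
split.
  have -> : f (x + d) - f x = (f (x + d) - f x - dot p d) + dot p d by ring.
  apply: le_trans (ler_normD _ _) _; rewrite mulrDl lerD//; last by rewrite -mulrA.
  by apply: (le_trans a1); rewrite ler_pM2l.
apply: (le_trans a1); rewrite ler_wpM2r ?sqr_ge0//; lra.
Qed.

Lemma jet2_ext n (f g : 'rV[R]_n -> R) x p X :
  (exists2 de, 0 < de & forall d, `|d| < de -> g (x + d) = f (x + d)) ->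
  jet2 f x p X -> jet2 g x p X.
Proof.
move=> [de de0 fg] h e /h[de' de'0 h'].
exists (Num.min de de'); first by rewrite lt_min de0.
move=> d; rewrite lt_min => /andP[d1 d2]; rewrite fg//.
rewrite -[g x](congr1 g (addr0 x)) fg ?normr0// addr0; exact: h'.
Qed.

Lemma jet2_cst n a (x : 'rV[R]_n) : jet2 (fun=> a) x 0 0.
Proof.
move=> e e0; exists 1 => // d _.
by rewrite subrr dot0l qf0 mulr0 !subr0 normr0 mulr_ge0 ?dot_ge0// ltW.
Qed.

Lemma jet2_dot n (c x : 'rV[R]_n) : jet2 (dot c) x c 0.
Proof.
move=> e e0; exists 1 => // d _.
suff -> : dot c (x + d) - dot c x - dot c d - 2^-1 * qf 0 d = 0.
  by rewrite normr0 mulr_ge0 ?dot_ge0// ltW.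
by rewrite qf0 dotDr; ring.
Qed.

Lemma jet2_qf n (A : 'M[R]_n) x : A^T = A -> jet2 (qf A) x (2 *: (x *m A)) (2 *: A).
Proof.
move=> As e e0; exists 1 => // d _.
suff -> : qf A (x + d) - qf A x - dot (2 *: (x *m A)) d - 2^-1 * qf (2 *: A) d = 0.
  by rewrite normr0 mulr_ge0 ?dot_ge0// ltW.
rewrite qfZ mulrA mulVf// mul1r dotZl /qf mulmxDl dotDl !dotDr.
have -> : dot (d *m A) x = dot (x *m A) d by rewrite dot_mull As dotC.
by ring.
Qed.

Lemma jet2D n (f g : 'rV[R]_n -> R) x p q X Y : jet2 f x p X -> jet2 g x q Y ->
  jet2 (fun z => f z + g z) x (p + q) (X + Y).
Proof.
move=> hf hg e e0; have e20 : 0 < e / 2 by rewrite divr_gt0.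
have [d1 d10 h1] := hf _ e20; have [d2 d20 h2] := hg _ e20.
exists (Num.min d1 d2); first by rewrite lt_min d10.
move=> d; rewrite lt_min => /andP[/h1 {}h1 /h2 {}h2].
rewrite dotDl qfD [e]splitr mulrDl.
apply: le_trans (lerD h1 h2); apply: le_trans (ler_normD _ _).
by rewrite le_eqVlt; apply/orP; left; apply/eqP; congr `|_|; ring.
Qed.

Lemma jet2Z n a (f : 'rV[R]_n -> R) x p X : jet2 f x p X ->
  jet2 (fun z => a * f z) x (a *: p) (a *: X).
Proof.
move=> hf e e0; pose a' := 1 + `|a|.
have a'0 : 0 < a' by rewrite ltr_pwDl.
have [d1 d10 h1] := hf (e / a') (divr_gt0 e0 a'0).
exists d1 => // d /h1 {}h1.
have -> : a * f (x + d) - a * f x - dot (a *: p) d - 2^-1 * qf (a *: X) d =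
  a * (f (x + d) - f x - dot p d - 2^-1 * qf X d) by rewrite dotZl qfZ; ring.
rewrite normrM; apply: (@le_trans _ _ (a' * (e / a' * dot d d))).
  by rewrite ler_pM// /a' lerDr.
by rewrite le_eqVlt; apply/orP; left; apply/eqP; field; rewrite gt_eqF.
Qed.

Lemma jet2M n (f g : 'rV[R]_n -> R) x p q X Y : jet2 f x p X -> jet2 g x q Y ->
  jet2 (fun z => f z * g z) x (f x *: q + g x *: p)
    (f x *: Y + g x *: X + (p^T *m q + q^T *m p)).
Proof.
move=> hf hg e e0.
have [K1 K10 [d1 d10 l1]] := jet2_lip hf.
have [K2 K20 [d2 d20 l2]] := jet2_lip hg.
have e20 : 0 < e / 2 by rewrite divr_gt0.
have [d3 d30 h3] := jet2D (jet2Z (f x) hg) (jet2Z (g x) hf) e20.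
pose K := K1 * K2 + n%:R * `|p| * K2.
have K0 : 0 < K by rewrite ltr_wpDr ?mulr_gt0// !mulr_ge0// ltW.
pose d4 := e / 2 / K.
have d40 : 0 < d4 by rewrite !divr_gt0.
exists (Num.min (Num.min d1 d2) (Num.min d3 d4)).
  by rewrite !lt_min d10 d20 d30 d40.
move=> d; rewrite !lt_min => /andP[/andP[/l1[l11 l12] /l2[l21 l22]] /andP[/h3 {}h3 dd4]].
rewrite !qfD !qf_outer (mulrC (dot q d) (dot p d)).
have -> : f (x + d) * g (x + d) - f x * g x - dot (f x *: q + g x *: p) d -
   2^-1 * (qf (f x *: Y) d + qf (g x *: X) d + (dot p d * dot q d + dot p d * dot q d))
   = (f x * g (x + d) + g x * f (x + d) - (f x * g x + g x * f x) - dot (f x *: q + g x *: p) d -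
   2^-1 * qf (f x *: Y + g x *: X) d) +
   ((f (x + d) - f x - dot p d) * (g (x + d) - g x) + dot p d * (g (x + d) - g x - dot q d)).
  by rewrite qfD; field.
rewrite [e]splitr [leRHS]mulrDl; apply: le_trans (ler_normD _ _) (lerD h3 _).
apply: le_trans (ler_normD _ _) _; rewrite !normrM.
apply: (@le_trans _ _ (K * `|d| * `|d| ^+ 2)).
  have -> : K * `|d| * `|d| ^+ 2 = (K1 * `|d| ^+ 2) * (K2 * `|d|)
    + (n%:R * (`|p| * `|d|)) * (K2 * `|d| ^+ 2) by rewrite /K; ring.
  by rewrite lerD// ler_pM// dot_norm_le.
apply: ler_pM; rewrite ?norm_sq_le_dot ?sqr_ge0 ?mulr_ge0 ?(ltW K0)//.
by rewrite mulrC -ler_pdivlMr// ltW.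
Qed.

Lemma jet2_mulmx m n (L : 'M[R]_(m, n)) (f : 'rV[R]_n -> R) x p X :
  jet2 f (x *m L) p X ->
  jet2 (fun w => f (w *m L)) x (p *m L^T) (L *m X *m L^T).
Proof.
move=> hf e e0; have [K K0 hK] := norm_mulmx L.
have [B B0 hB] := qf_le (L *m L^T).
have [d1 d10 h1] := hf (e / B) (divr_gt0 e0 B0).
exists (d1 / K); first by rewrite divr_gt0.
move=> d dd; rewrite mulmxDl qf_mul dot_mull trmxK.
apply: le_trans (h1 _ _) _.
  by apply: le_lt_trans (hK d) _; rewrite mulrC -ltr_pdivlMr.
have := hB d; rewrite -{1}[L]mulmx1 qf_mul qf_scalar mul1r ger0_norm ?dot_ge0// => hBd.
by rewrite -mulrA ler_pM2l// ler_pdivrMl.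
Qed.

(** The cube is the lowest integer power of the positive part that is C^2; it serves for time
    penalties and for cut-offs. Where [f x = 0] the expansion vanishes, and the Lipschitz bound on
    [f] makes the remainder cubic. *)
Lemma jet2_pos3 n (f : 'rV[R]_n -> R) x p X : jet2 f x p X ->
  jet2 (fun z => Num.max (f z) 0 ^+ 3) x (3 * Num.max (f x) 0 ^+ 2 *: p)
    (3 * Num.max (f x) 0 ^+ 2 *: X + 6 * Num.max (f x) 0 *: (p^T *m p)).
Proof.
move=> hf; have [K K0 [d1 d10 l1]] := jet2_lip hf.
have [f0|f0|f0] := ltgtP (f x) 0.
- rewrite expr0n/= !mulr0 !scale0r addr0.
  apply: (@jet2_ext _ (fun=> 0)) (jet2_cst _ _).
  exists (Num.min d1 (- f x / K)).
    by rewrite lt_min d10 divr_gt0// oppr_gt0.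
  move=> d; rewrite lt_min => /andP[/l1[l11 _]]; rewrite ltr_pdivlMr// => dK.
  rewrite max_r ?expr0n//; have := le_trans (ler_norm _) l11; lra.
- apply: (@jet2_ext _ (fun z => f z * (f z * f z))).
    exists (Num.min d1 (f x / K)); first by rewrite lt_min d10 divr_gt0.
    move=> d; rewrite lt_min => /andP[/l1[l11 _]]; rewrite ltr_pdivlMr// => dK.
    rewrite max_l ?exprS ?expr0 ?mulr1//.
    by move: l11; rewrite ler_norml => /andP[? _]; lra.
  have := jet2M hf (jet2M hf hf).
  move: (f x) => y; congr jet2.
    by apply/rowP => i; rewrite !mxE; ring.
  by apply/matrixP => i j; rewrite !(mxE, big_ord1); ring.
- rewrite f0 expr0n/= !mulr0 !scale0r addr0 => e e0.
  pose d2 := e / K ^+ 3; have K30 : 0 < K ^+ 3 by rewrite exprn_gt0.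
  exists (Num.min d1 d2); first by rewrite lt_min d10 divr_gt0.
  move=> d; rewrite lt_min => /andP[/l1[l11 _] dd2].
  rewrite dot0l qf0 mulr0 !subr0 f0 maxxx expr0n/= subr0.
  rewrite f0 subr0 in l11.
  have m0 : 0 <= Num.max (f (x + d)) 0 by rewrite le_max lexx orbT.
  rewrite ger0_norm ?exprn_ge0//.
  have h1 : Num.max (f (x + d)) 0 <= K * `|d|.
    by rewrite ge_max (le_trans (ler_norm _) l11) mulr_ge0// ltW.
  apply: (@le_trans _ _ ((K * `|d|) ^+ 3)); first by rewrite lerXn2r// nnegrE (le_trans _ h1).
  rewrite exprMn [`|d| ^+ 3]exprS mulrA.
  apply: ler_pM; rewrite ?sqr_ge0 ?norm_sq_le_dot ?mulr_ge0 ?(ltW K0)//.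
  by rewrite mulrC -ler_pdivlMr// ltW.
Qed.

End jets.

Section quadratic_forms.
Variables (R : realType) (n : nat).
Implicit Types (A X : 'M[R]_n) (l p d : 'rV[R]_n).

Lemma qf_delta A i : qf A (delta_mx 0 i) = A i i.
Proof. by rewrite /qf dot_delta -rowE mxE. Qed.

Lemma trace_ge0 A : (forall d, 0 <= qf A d) -> 0 <= \tr A.
Proof. by move=> h; apply: sumr_ge0 => i _; rewrite -qf_delta. Qed.

Lemma small_scale (d : 'rV[R]_n) (de : R) : 0 < de ->
  exists2 t0 : R, 0 < t0 & forall t, `|t| <= t0 -> `|t *: d| < de.
Proof.
move=> de0; have d1 : 0 < `|d| + 1 by rewrite ltr_wpDl.
exists (de / 2 / (`|d| + 1)); first by rewrite !divr_gt0.
move=> t; rewrite ler_pdivlMr// => h; rewrite mx_normZ.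
have : `|t| * `|d| <= `|t| * (`|d| + 1) by rewrite ler_wpM2l// lerDl.
by change (mx_norm d) with `|d|; move=> h2; lra.
Qed.

(** Scaling separates the orders: along [- t *: l] the linear term dominates for small [t], which
    forces [l = 0]; then homogeneity of degree two makes a negative value of [qf A d] beat a
    sufficiently small [e]. *)
Lemma local_quadratic_ge0 l A :
  (forall e, 0 < e -> exists2 de, 0 < de & forall d, `|d| < de ->
     0 <= dot l d + 2^-1 * qf A d + e * dot d d) ->
  l = 0 /\ forall d, 0 <= qf A d.
Proof.
move=> h; have l0 : l = 0.
  have [de de0 hd] := h 1 ltr01; have [t0 t00 ht] := small_scale l de0.
  apply/eqP; rewrite -dot_eq0 eq_le dot_ge0 andbT leNgt; apply/negP => ll.
  pose C := `|2^-1 * qf A l + 1 * dot l l| + 1.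
  have C0 : 0 < C by rewrite ltr_wpDl.
  pose t := Num.min t0 (dot l l / C / 2).
  have tp : 0 < t by rewrite lt_min t00 !divr_gt0.
  have tt0 : `|- t| <= t0 by rewrite normrN gtr0_norm// ge_min lexx.
  have := hd _ (ht _ tt0); rewrite qf_scale dotZl !dotZr => hh.
  have t2 : t <= dot l l / C / 2 by rewrite ge_min lexx orbT.
  have t3 : t * C <= dot l l / 2 by rewrite -ler_pdivlMr// mulrAC.
  have := ler_norm (2^-1 * qf A l + 1 * dot l l).
  rewrite /C in t3 *; nra.
split=> // d; rewrite l0 in h.
rewrite leNgt; apply/negP => q0.
have dd : 0 < dot d d.
  rewrite dot_gt0//; apply/eqP => d0; move: q0; by rewrite d0 qf0r ltxx.
have e0 : 0 < - qf A d / 4 / dot d d by rewrite !divr_gt0 ?oppr_gt0.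
have [de de0 hd] := h _ e0; have [t0 t00 ht] := small_scale d de0.
have tt0 : `|t0| <= t0 by rewrite gtr0_norm.
have := hd _ (ht _ tt0).
rewrite dot0l add0r qf_scale dotZl dotZr.
have -> : - qf A d / 4 / dot d d * (t0 * (t0 * dot d d)) = t0 ^+ 2 * (- qf A d / 4).
  by field; rewrite gt_eqF.
have : 0 < t0 ^+ 2 by rewrite exprn_gt0.
clear -q0; move: (t0 ^+ 2) (qf A d) q0 => a b q0 a0 hh; nra.
Qed.

Lemma jet2_touch (f : 'rV[R]_n -> R) x p X q Y (de : R) : jet2 f x p X ->
  0 < de -> (forall d, `|d| < de -> f (x + d) <= f x + dot q d + 2^-1 * qf Y d) ->
  \tr X <= \tr Y.
Proof.
move=> hf de0 h.
have [_ h2] : q - p = 0 /\ forall d, 0 <= qf (Y - X) d.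
  apply: local_quadratic_ge0 => e e0; have [d1 d10 h1] := hf _ e0.
  exists (Num.min de d1); first by rewrite lt_min de0.
  move=> d; rewrite lt_min => /andP[/h {}h /h1 {}h1].
  rewrite qfD qfN dotBl; move: h1; rewrite ler_norml => /andP[h1 _]; lra.
by rewrite -subr_ge0 -linearB/= trace_ge0.
Qed.

End quadratic_forms.

(** * Polynomials and harmonic extension *)

Section polynomial_functions.
Variables (R : realType) (n : nat).
Local Notation V := 'rV[R]_n.

(** Polynomial functions of degree strictly less than the index. With the strict bound, index 0
    leaves only the zero function, and each differentiation lowers the index by a truncated
    predecessor. *)
Inductive polyd : nat -> (V -> R) -> Prop :=
| polyd0 s : polyd s (fun=> 0)
| polydC s a : polyd s.+1 (fun=> a)
| polydX s i f : polyd s f -> polyd s.+1 (fun x : V => x 0 i * f x)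
| polydD s f g : polyd s f -> polyd s g -> polyd s (fun x : V => f x + g x).

Lemma polyd_size0 s f : polyd s f -> s = 0%N -> f = fun=> 0.
Proof.
elim=> // {}s {}f g _ IHf _ IHg s0.
by rewrite IHf// IHg//; apply/funext => x; rewrite addr0.
Qed.

Lemma polyd_weaken s t f : (s <= t)%N -> polyd s f -> polyd t f.
Proof.
move=> + pf; elim: pf t => {s f}.
- by move=> s t _; exact: polyd0.
- by move=> s a [//|t] _; exact: polydC.
- by move=> s i f pf IH [//|t] st; apply: polydX; exact: IH.
- by move=> s f g _ IHf _ IHg t st; apply: polydD; [exact: IHf|exact: IHg].
Qed.

Lemma polydZ s a f : polyd s f -> polyd s (fun x : V => a * f x).
Proof.
elim=> {s f}.
- by move=> s; rewrite mulr0; exact: polyd0.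
- by move=> s b; exact: polydC.
- move=> s i f _ IH; rewrite (_ : (fun _ => _) = fun x : V => x 0 i * (a * f x)).
    exact: polydX.
  by apply/funext => x; rewrite mulrCA.
- move=> s f g _ IHf _ IHg.
  rewrite (_ : (fun _ => _) = fun x : V => a * f x + a * g x); first exact: polydD.
  by apply/funext => x; rewrite mulrDr.
Qed.

Lemma polyd_predX s i f : polyd s.-1 f -> polyd s (fun x : V => x 0 i * f x).
Proof.
case: s => [|s] pf; last exact: polydX.
rewrite (polyd_size0 pf)//; rewrite (_ : (fun _ => _) = fun=> 0); first exact: polyd0.
by apply/funext => x; rewrite mulr0.
Qed.

Lemma polyd_sum (I : Type) (r : seq I) s (F : I -> V -> R) :
  (forall i, polyd s (F i)) -> polyd s (fun x : V => \sum_(i <- r) F i x).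
Proof.
move=> h; elim: r => [|i r IH].
  rewrite (_ : (fun _ => _) = fun=> 0); first exact: polyd0.
  by apply/funext => x; rewrite big_nil.
rewrite (_ : (fun _ => _) = fun x : V => F i x + \sum_(j <- r) F j x).
  exact: polydD.
by apply/funext => x; rewrite big_cons.
Qed.

Lemma polydM s t f g : polyd s f -> polyd t g -> polyd (s + t) (fun x : V => f x * g x).
Proof.
move=> pf pg; elim: pf => {s f}.
- move=> s; rewrite (_ : (fun _ => _) = fun=> 0); first exact: polyd0.
  by apply/funext => x; rewrite mul0r.
- by move=> s a; apply: polydZ; apply: polyd_weaken pg; exact: leq_addl.
- move=> s i f _ IH; rewrite (_ : (fun _ => _) = fun x : V => x 0 i * (f x * g x)).
    by rewrite addSn; exact: polydX.
  by apply/funext => x; rewrite mulrA.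
- move=> s f h _ IHf _ IHg.
  rewrite (_ : (fun _ => _) = fun x : V => f x * g x + h x * g x); first exact: polydD.
  by apply/funext => x; rewrite mulrDl.
Qed.

Lemma polyd_delta s i j f : polyd s f -> polyd s (fun x : V => (i == j :> 'I_n)%:R * f x).
Proof. by move=> pf; exact: polydZ. Qed.

Lemma polyd_jet s f : polyd s f -> exists (G : V -> V) (H : V -> 'M[R]_n),
  [/\ forall x, jet2 f x (G x) (H x), forall i, polyd s.-1 (fun x : V => G x 0 i) &
      forall i j, polyd s.-2 (fun x : V => H x i j)].
Proof.
have z s' : polyd s' (fun=> 0) by exact: polyd0.
elim=> {s f}.
- move=> s; exists (fun=> 0), (fun=> 0); split => [x|i|i j]; first exact: jet2_cst.
    by rewrite (_ : (fun _ => _) = fun=> 0)//; apply/funext => x; rewrite mxE.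
  by rewrite (_ : (fun _ => _) = fun=> 0)//; apply/funext => x; rewrite mxE.
- move=> s a; exists (fun=> 0), (fun=> 0); split => [x|i|i j]; first exact: jet2_cst.
    by rewrite (_ : (fun _ => _) = fun=> 0)//; apply/funext => x; rewrite mxE.
  by rewrite (_ : (fun _ => _) = fun=> 0)//; apply/funext => x; rewrite mxE.
- move=> s k f pf [G [H [hj hG hH]]].
  pose ek : V := delta_mx 0 k.
  exists (fun x : V => x 0 k *: G x + f x *: ek).
  exists (fun x : V => x 0 k *: H x + f x *: 0 + (ek^T *m G x + (G x)^T *m ek)).
  split=> [x|i|i j].
  + have := jet2M (jet2_dot ek x) (hj x).
    by rewrite dotC dot_delta; apply: jet2_ext; exists 1 => // d _; rewrite dotC dot_delta.
  + rewrite (_ : (fun _ => _) = fun x : V => x 0 k * G x 0 i + (i == k)%:R * f x).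
      by apply: polydD; [exact: polyd_predX|exact: polyd_delta].
    by apply/funext => x; rewrite !mxE eqxx/= mulrC; congr (_ + _); rewrite mulrC.
  + rewrite (_ : (fun _ => _) = fun x : V => x 0 k * H x i j +
       ((i == k)%:R * G x 0 j + (j == k)%:R * G x 0 i)).
      apply: polydD; first exact: polyd_predX.
      by apply: polydD; exact: polyd_delta.
    apply/funext => x; rewrite !(mxE, big_ord1) eqxx/= mulr0 addr0.
    by congr (_ + (_ + _)); rewrite mulrC.
- move=> s f g _ [G [H [hj hG hH]]] _ [G' [H' [hj' hG' hH']]].
  exists (fun x : V => G x + G' x), (fun x : V => H x + H' x); split => [x|i|i j].
  + exact: jet2D.
  + rewrite (_ : (fun _ => _) = fun x : V => G x 0 i + G' x 0 i); first exact: polydD.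
    by apply/funext => x; rewrite mxE.
  + rewrite (_ : (fun _ => _) = fun x : V => H x i j + H' x i j); first exact: polydD.
    by apply/funext => x; rewrite mxE.
Qed.

Lemma polyd_step s f : polyd s.+1 f ->
  exists a (g : 'I_n -> V -> R), (forall i, polyd s (g i)) /\
    forall x, f x = a + \sum_i x 0 i * g i x.
Proof.
have z s' : polyd s' (fun=> 0) by exact: polyd0.
move E : s.+1 => t pf; elim: pf s E => {t f}.
- move=> t s _; exists 0, (fun _ _ => 0); split => // x.
  by rewrite big1 ?addr0// => i _; rewrite mulr0.
- move=> t a s _; exists a, (fun _ _ => 0); split => // x.
  by rewrite big1 ?addr0// => i _; rewrite mulr0.
- move=> t k f pf _ s [->].
  exists 0, (fun i x => (i == k)%:R * f x); split => [i|x]; first exact: polyd_delta.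
  rewrite add0r (bigD1 k)//= eqxx mul1r big1 ?addr0// => i /negbTE ->.
  by rewrite mul0r mulr0.
- move=> t f g _ IHf _ IHg s st.
  have [a [F [pF hF]]] := IHf _ st; have [b [G [pG hG]]] := IHg _ st.
  exists (a + b), (fun i x => F i x + G i x); split => [i|x]; first exact: polydD.
  rewrite hF hG addrACA; congr (_ + _); rewrite -big_split/=.
  by apply: eq_bigr => i _; rewrite mulrDr.
Qed.

(** Finite dimensionality as a finite spanning family, obtained by splitting off the constant term
    and factoring one coordinate out of the rest. *)
Lemma polyd_span s : exists (T : finType) (b : T -> V -> R), forall f, polyd s f ->
  exists c : T -> R, forall x, f x = \sum_t c t * b t x.
Proof.
elim: s => [|s [T [b hb]]].
  exists void, (fun _ _ => 0) => f /polyd_size0 ->//.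
  by exists (fun=> 0) => x; rewrite big1// => i _; rewrite mulr0.
exists (unit + 'I_n * T)%type, (fun t (x : V) => if t is inr (i, u) then x 0 i * b u x else 1).
move=> f /polyd_step[a [g [pg hf]]].
have /choice[c hc] : forall i, exists c : T -> R, forall x, g i x = \sum_t c t * b t x.
  by move=> i; exact: hb.
exists (fun t => if t is inr (i, u) then c i u else a) => x.
rewrite big_sumType/= big_const cardE enumT/= unlock/= mulr1 addr0 hf; congr (_ + _).
transitivity (\sum_(t : 'I_n * T) c t.1 t.2 * (x 0 t.1 * b t.2 x)); last first.
  by apply: eq_bigr => -[].
rewrite -(pair_bigA _ (fun i u => c i u * (x 0 i * b u x)))/=.
apply: eq_bigr => i _; rewrite hc mulr_sumr; apply: eq_bigr => u _; ring.
Qed.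

(** One more function than spanning elements gives a nonzero row in the kernel of the coefficient
    matrix. The relation is shifted to begin at its first nonzero coefficient, because [b 0] is
    inverted when the Poisson equation is solved. *)
Lemma polyd_dependent s (g : nat -> V -> R) : (forall i, polyd s (g i)) ->
  exists (m j : nat) (b : nat -> R), b 0%N != 0 /\
    forall x, \sum_(i < m) b i * g (i + j)%N x = 0 /\ (0 < m)%N.
Proof.
move=> pg; have [T [b hb]] := polyd_span s.
have /choice[c hc] : forall i, exists c : T -> R, forall x, g i x = \sum_t c t * b t x.
  by move=> i; exact: hb.
pose m := #|T|; pose A : 'M[R]_(m.+1, m) := \matrix_(i, j) c i (enum_val j).
have kA : kermx A != 0.
  rewrite -mxrank_eq0 mxrank_ker subn_eq0 -ltnNge ltnS.
  exact: rank_leq_col.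
have [i0 ri0] : exists i, row i (kermx A) != 0.
  by move/rowV0Pn: kA => [v /submxP[D vE] v0]; apply/existsP; apply: contraNT v0;
    rewrite negb_exists => /forallP h; rewrite vE; have -> : kermx A = 0 by
    [apply/row_matrixP => i; rewrite row0; apply/eqP; have := h i; rewrite negbK]; rewrite mulmx0.
pose v := row i0 (kermx A).
have vA : v *m A = 0 by rewrite /v -row_mul mulmx_ker row0.
pose a k := if insub k is Some i then v 0 (i : 'I_m.+1) else 0.
have aE (i : 'I_m.+1) : a i = v 0 i by rewrite /a valK.
have ex : exists k, a k != 0.
  move/rV0Pn: ri0 => [k hk]; exists k; by rewrite aE.
have dep x : \sum_(i < m.+1) a i * g i x = 0.
  under eq_bigr do rewrite aE hc mulr_sumr.
  rewrite exchange_big/= big1// => t _.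
  have := congr1 (fun M : 'rV[R]_m => M 0 (enum_rank t)) vA; rewrite !mxE => h.
  under eq_bigr do rewrite mulrA.
  rewrite -mulr_suml; suff -> : \sum_(i < m.+1) v 0 i * c i t = 0 by rewrite mul0r.
  by rewrite -[RHS]h; apply: eq_bigr => i _; rewrite [A _ _]mxE enum_rankK.
pose j := ex_minn ex.
have [aj jmin] : a j != 0 /\ forall k, (k < j)%N -> a k = 0.
  rewrite /j; case: ex_minnP => k ak kmin; split => // l lk.
  by apply/eqP; apply: contraTT lk => /kmin; rewrite -leqNgt.
have jm : (j < m.+1)%N.
  by rewrite ltnNge; apply: contraNN aj => mj; rewrite /a insubF//; rewrite ltnNge mj.
exists (m.+1 - j)%N, j, (fun i => a (i + j)%N); split => [//|x]; split; last by rewrite subn_gt0.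
have := dep x; rewrite -(big_mkord xpredT (fun i => a i * g i x)).
rewrite (big_cat_nat (n := j))//=; last exact: ltnW.
rewrite big1_seq ?add0r; last first.
  by move=> i /andP[_]; rewrite mem_index_iota => /andP[_ /jmin ->]; rewrite mul0r.
by rewrite -{1}[j]add0n big_addn big_mkord.
Qed.

End polynomial_functions.

(** * Continuity on a set and uniformity by compactness *)

Section continuity_on.
Variables (R : realType) (V : normedModType R).
Implicit Types (K : set V) (f g : V -> R).

Definition cont_on K f : Prop := forall x, K x -> forall e : R, 0 < e ->
  exists2 de : R, 0 < de & forall y, K y -> `|y - x| < de -> `|f y - f x| < e.

Lemma cont_onP K f : {within K, continuous f} <-> cont_on K f.
Proof.
split=> [/subspace_continuousP cf x Kx e e0|cf].
- move: cf => /(_ _ Kx) => /cvgrPdist_lt/(_ _ e0).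
  rewrite near_withinE => /nbhs_normP[de /= de0 h].
  exists de => // y Ky yx; rewrite distrC; apply: h => //.
  by rewrite /= distrC.
- apply/subspace_continuousP => x Kx.
  apply/cvgrPdist_lt => e e0; have [de de0 h] := cf _ Kx _ e0.
  rewrite near_withinE.
  by apply/nbhs_normP; exists de => //= y yx Ky; rewrite distrC h// distrC.
Qed.

Lemma continuousP_norm f x : {for x, continuous f} <->
  forall e : R, 0 < e ->
    exists2 de : R, 0 < de & forall y, `|y - x| < de -> `|f y - f x| < e.
Proof.
split=> [/cvgrPdist_lt h e /h/nbhs_normP[de /= de0 {}h]|h].
  by exists de => // y yx; rewrite distrC; apply: h; rewrite /= distrC.
apply/cvgrPdist_lt => e /h[de de0 {}h]; apply/nbhs_normP; exists de => // y /= yx.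
by rewrite distrC h// distrC.
Qed.

Lemma cont_on_max K f : K !=set0 -> compact K -> cont_on K f ->
  exists2 x, K x & forall y, K y -> f y <= f x.
Proof.
move=> K0 cK /cont_onP cf; have [x xK h] := compact_EVT_max K0 cK cf.
by exists x => [|y Ky]; [exact: set_mem|apply: h; exact: mem_set].
Qed.

Lemma cont_on_sub K K' f : K `<=` K' -> cont_on K' f -> cont_on K f.
Proof.
move=> KK cf x /KK Kx e e0; have [de de0 h] := cf _ Kx _ e0.
by exists de => // y /KK; exact: h.
Qed.

Lemma cont_onD K f g : cont_on K f -> cont_on K g -> cont_on K (fun x => f x + g x).
Proof.
move=> cf cg x Kx e e0; have e20 : 0 < e / 2 by rewrite divr_gt0.
have [d1 d10 h1] := cf _ Kx _ e20; have [d2 d20 h2] := cg _ Kx _ e20.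
exists (Num.min d1 d2); first by rewrite lt_min d10.
move=> y Ky; rewrite lt_min => /andP[/(h1 _ Ky) l1 /(h2 _ Ky) l2].
by rewrite opprD addrACA (le_lt_trans (ler_normD _ _))// [e]splitr ltrD.
Qed.

Lemma cont_onN K f : cont_on K f -> cont_on K (fun x => - f x).
Proof.
move=> cf x Kx e e0; have [d1 d10 h1] := cf _ Kx _ e0.
by exists d1 => // y Ky yx; rewrite -opprD normrN h1.
Qed.

Lemma cont_onB K f g : cont_on K f -> cont_on K g -> cont_on K (fun x => f x - g x).
Proof. by move=> cf cg; exact: (cont_onD cf (cont_onN cg)). Qed.

Lemma cont_on_cst K a : cont_on K (fun=> a).
Proof. by move=> x _ e e0; exists 1 => // y _ _; rewrite subrr normr0. Qed.

Lemma cont_on_continuous K f : continuous f -> cont_on K f.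
Proof. by move=> cf; apply/cont_onP/continuous_subspaceT. Qed.

(** Covering argument in reusable form: for properties monotone in a constant, local constants
    combine into one. It yields bounds, moduli of continuity and global Lipschitz constants
    alike. *)
Lemma compact_uniform K (P : R -> V -> Prop) : compact K ->
  (forall C C' x, C <= C' -> P C x -> P C' x) ->
  (forall x, K x -> exists2 de : R, 0 < de & exists C, forall y, K y -> `|y - x| < de -> P C y) ->
  exists2 C, 0 < C & forall x, K x -> P C x.
Proof.
move=> cK Pm hP.
have [M [_ hM]] : \forall C \near +oo, K `<=` (fun y => K y -> P C y).
  apply: ((compact_near_coveringP K).1 cK _ _ (fun C y => K y -> P C y)) => x Kx.
  have [de de0 [C hC]] := hP x Kx.
  exists ([set y | `|y - x| < de], [set C' | C < C']); first split => /=.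
  - by apply/nbhs_normP; exists de => //= y /=; rewrite distrC.
  - by exists C; split => //; exact: num_real.
  - by move=> [y C'] [/= h1 h2] Ky; apply: (Pm C) (ltW h2) _; exact: hC.
exists (Num.max M 0 + 1); first by rewrite ltr_wpDl// le_max lexx orbT.
move=> x Kx; apply: (hM _ _ x Kx Kx).
by rewrite (le_lt_trans (_ : _ <= Num.max M 0))// ?ltrDl// le_max lexx.
Qed.

Lemma cont_on_bounded K f : compact K -> cont_on K f ->
  exists2 C, 0 < C & forall x, K x -> `|f x| <= C.
Proof.
move=> cK cf; apply: (compact_uniform (P := fun C x => `|f x| <= C)) => //.
  by move=> C C' x CC h; exact: le_trans h CC.
move=> x Kx; have [de de0 h] := cf _ Kx _ ltr01; exists de => //.
exists (`|f x| + 1) => y Ky yx; rewrite -[f y](subrK (f x)) addrC.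
by rewrite (le_trans (ler_normD _ _))// lerD2l ltW// h.
Qed.

(** The constant of [compact_uniform] plays the role of an inverse modulus, which makes the property
    monotone in it; the maximum with 1 allows it to be inverted at the end. *)
Lemma cont_on_unif K f : compact K -> cont_on K f -> forall e, 0 < e ->
  exists2 de : R, 0 < de & forall x y, K x -> K y -> `|y - x| < de -> `|f y - f x| < e.
Proof.
move=> cK cf e e0.
have [||C C0 hC] := compact_uniform (K := K)
  (P := fun C x => forall y, K y -> `|y - x| * Num.max C 1 < 1 -> `|f y - f x| < e) cK.
- move=> C C' x CC h y Ky yx; apply: h => //; apply: le_lt_trans yx.
  by rewrite ler_wpM2l// ge_max !le_max CC/= lexx !orbT.
- move=> x Kx; have e20 : 0 < e / 2 by rewrite divr_gt0.
  have [de de0 h] := cf _ Kx _ e20.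
  exists (de / 2); first by rewrite divr_gt0.
  exists (2 / de) => y Ky yx z Kz zy.
  have d1 : `|y - x| < de by apply: lt_le_trans yx _; lra.
  have d2 : `|z - x| < de.
    have -> : z - x = (z - y) + (y - x) by rewrite addrA subrK.
    apply: le_lt_trans (ler_normD _ _) _.
    have : `|z - y| * (2 / de) < 1.
      by apply: le_lt_trans zy; rewrite ler_wpM2l// le_max lexx.
    by rewrite mulrA ltr_pdivrMr// mul1r; lra.
  have -> : f z - f y = (f z - f x) - (f y - f x) by ring.
  apply: le_lt_trans (ler_normB _ _) _; rewrite [e]splitr ltrD// h//.
exists (Num.max C 1)^-1; first by rewrite invr_gt0 lt_max ltr01 orbT.
move=> x y Kx Ky yx; apply: hC => //.
by rewrite -ltr_pdivlMr ?lt_max ?ltr01 ?orbT// mul1r.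
Qed.

End continuity_on.

(** * The Laplace equation on a ball *)

Section laplacian.
Variables (R : realType) (n : nat).
Local Notation V := 'rV[R]_n.
Implicit Types (f g : V -> R) (x : V).

Definition has_lap f x (L : R) : Prop := exists p X, jet2 f x p X /\ \tr X = L.

Lemma has_lapD f g x K L : has_lap f x K -> has_lap g x L ->
  has_lap (fun z => f z + g z) x (K + L).
Proof.
move=> [p [X [hf tX]]] [q [Y [hg tY]]]; exists (p + q), (X + Y).
by split; [exact: jet2D|rewrite linearD/= tX tY].
Qed.

Lemma has_lapZ a f x K : has_lap f x K -> has_lap (fun z => a * f z) x (a * K).
Proof.
move=> [p [X [hf tX]]]; exists (a *: p), (a *: X).
by split; [exact: jet2Z|rewrite linearZ/= tX].
Qed.

Lemma has_lap0 x : has_lap (fun=> 0) x 0.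
Proof. by exists 0, 0; split; [exact: jet2_cst|rewrite linear0]. Qed.

Lemma has_lap_sum m (F : nat -> V -> R) x (L : nat -> R) :
  (forall i, has_lap (F i) x (L i)) ->
  has_lap (fun z => \sum_(i < m) F i z) x (\sum_(i < m) L i).
Proof.
move=> h; elim: m => [|m IH].
  rewrite big_ord0 (_ : (fun _ => _) = fun=> 0); first exact: has_lap0.
  by apply/funext => z; rewrite big_ord0.
rewrite big_ord_recr/= (_ : (fun _ => _) = fun z : V => \sum_(i < m) F i z + F m z).
  exact: has_lapD.
by apply/funext => z; rewrite big_ord_recr.
Qed.

Lemma has_lap_cst a x : has_lap (fun=> a) x 0.
Proof. by exists 0, 0; split; [exact: jet2_cst|rewrite linear0]. Qed.

Lemma has_lap_qf (A : 'M[R]_n) x : has_lap (fun z => 2^-1 * qf A z) x (\tr A).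
Proof.
have Es d : qf A d = qf (2^-1 *: (A + A^T)) d.
  rewrite qfZ qfD; have -> : qf A^T d = qf A d by rewrite /qf dot_mull trmxK dotC.
  by field.
have As : (2^-1 *: (A + A^T))^T = 2^-1 *: (A + A^T).
  by rewrite linearZ/= linearD/= trmxK addrC.
rewrite (_ : (fun _ => _) = fun z : V => 2^-1 * qf (2^-1 *: (A + A^T)) z); last first.
  by apply/funext => z; rewrite Es.
have -> : \tr A = 2^-1 * \tr (2 *: (2^-1 *: (A + A^T))).
  by rewrite !linearZ/= linearD/= mxtrace_tr; field.
by apply: has_lapZ; eexists; eexists; split; [exact: jet2_qf|].
Qed.

Lemma has_lap_dot x : has_lap (fun z => dot z z) x (2 * n%:R).
Proof.
have -> : 2 * n%:R = \tr ((2 : R)%:M : 'M[R]_n) by rewrite mxtrace_scalar mulr_natr.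
rewrite (_ : (fun _ => _) = fun z : V => 2^-1 * qf 2%:M z); first exact: has_lap_qf.
by apply/funext => z; rewrite qf_scalar mulrA mulVf// mul1r.
Qed.

Lemma has_lap_polyd s f : polyd s f ->
  exists2 L : V -> R, polyd s.-2 L & forall x, has_lap f x (L x).
Proof.
move=> /polyd_jet[G [H [hj _ hH]]]; exists (fun x => \tr (H x)).
  by apply: polyd_sum => i; exact: hH.
by move=> x; exists (G x), (H x); split.
Qed.

Definition ball2 (r : R) : set V := [set x | dot x x <= r ^+ 2].

Lemma ball2_norm (r : R) x : 0 <= r -> ball2 r x -> `|x| <= r.
Proof.
move=> r0 xr; rewrite -(@ler_pXn2r _ 2)// ?nnegrE//.
exact: le_trans (norm_sq_le_dot x) xr.
Qed.

Lemma jet2_continuous f x p X : jet2 f x p X -> {for x, continuous f}.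
Proof.
move=> /jet2_lip[K K0 [de de0 h]]; apply/continuousP_norm => e e0.
exists (Num.min de (e / K)); first by rewrite lt_min de0 divr_gt0.
move=> y; rewrite lt_min => /andP[y1 y2].
have [l _] := h _ y1; rewrite subrKC in l.
by apply: le_lt_trans l _; rewrite mulrC -ltr_pdivlMr.
Qed.

Lemma dot_cont : continuous (fun x : V => dot x x).
Proof. by move=> x; have [p [X [/jet2_continuous]]] := has_lap_dot x. Qed.

Lemma compact_ball2 (r : R) : 0 <= r -> compact (ball2 r).
Proof.
move=> r0; apply: bounded_closed_compact.
  exists r; split; first exact: num_real.
  by move=> M rM x /(ball2_norm r0) xr; exact: le_trans xr (ltW rM).
rewrite (_ : ball2 r = (fun x : V => dot x x) @^-1` [set y | y <= r ^+ 2])//.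
apply: closed_comp; last exact: closed_le.
by move=> x _; exact: dot_cont.
Qed.

Lemma polyd_continuous s f : polyd s f -> continuous f.
Proof.
by move=> pf x; have [G [H [hj _ _]]] := polyd_jet pf; exact: jet2_continuous (hj x).
Qed.

Lemma near_ball2 (r : R) x : dot x x < r ^+ 2 ->
  exists2 de : R, 0 < de & forall d, `|d| < de -> dot (x + d) (x + d) < r ^+ 2.
Proof.
move=> xr; have rx : 0 < r ^+ 2 - dot x x by rewrite subr_gt0.
have [de de0 h] := (continuousP_norm _ _).1 (@dot_cont x) _ rx; exists de => // d dd.
have := h (x + d); rewrite addrC addKr => /(_ dd).
by move=> /(le_lt_trans (ler_norm _)); lra.
Qed.

(* U satisfies Laplace(U) >= f in the viscosity sense in the open ball. *)
Definition lap_sub (U : V -> R) (r f : R) : Prop :=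
  forall x p X, X^T = X -> dot x x < r ^+ 2 ->
    (exists2 de : R, 0 < de & forall d, `|d| < de ->
       U (x + d) <= U x + dot p d + 2^-1 * qf X d) -> f <= \tr X.

(** At an interior positive maximum of [U - G] the jet of [G], raised by [e] times the squared
    distance to absorb its Peano remainder, touches [U] from above. The strict gap [L < f] leaves
    room for the trace of that addition. *)
Lemma lap_sub_le (U G : V -> R) (r f : R) : 0 < r ->
  cont_on (ball2 r) U -> cont_on (ball2 r) G -> lap_sub U r f ->
  (forall x, dot x x < r ^+ 2 -> exists2 L, L < f & has_lap G x L) ->
  (forall x, dot x x = r ^+ 2 -> U x <= G x) ->
  forall x, ball2 r x -> U x <= G x.
Proof.
move=> r0 cU cG sU hG bd x xr.
have [x0 x0r mx] := cont_on_max (ex_intro _ x xr) (compact_ball2 (ltW r0)) (cont_onB cU cG).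
rewrite -subr_le0; apply: le_trans (mx _ xr) _; rewrite leNgt; apply/negP => pos.
have {}x0r : dot x0 x0 < r ^+ 2.
  rewrite lt_neqAle x0r andbT; apply/eqP => /bd; rewrite -subr_le0; lra.
have [L Lf [p [X [hj tX]]]] := hG _ x0r.
(* The addition contributes 2 e n to the trace, which this choice keeps below f - L. *)
pose e : R := (f - L) / (2 * (n%:R + 1)).
have n1 : (0 : R) < n%:R + 1 by rewrite ltr_wpDl.
have e0 : 0 < e by rewrite divr_gt0 ?subr_gt0// mulr_gt0.
have [d1 d10 h1] := hj _ e0; have [d2 d20 h2] := near_ball2 x0r.
pose X' : 'M[R]_n := 2^-1 *: (X + X^T) + (2 * e)%:M.
have : f <= \tr X'.
  apply: (sU x0 p) => //.
    by rewrite /X' linearD/= tr_scalar_mx linearZ/= linearD/= trmxK (addrC X).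
  exists (Num.min d1 d2); first by rewrite lt_min d10.
  move=> d; rewrite lt_min => /andP[/h1 {}h1 /h2 /ltW /mx].
  rewrite /X' qfD qf_scalar qfZ qfD.
  have -> : qf X^T d = qf X d by rewrite /qf dot_mull trmxK dotC.
  by move: h1; rewrite ler_norml => /andP[_ h1]; lra.
rewrite /X' mxtraceD mxtraceZ mxtraceD mxtrace_tr mxtrace_scalar tX -mulr_natr.
have : e * (2 * (n%:R + 1)) = f - L by rewrite /e divfK// gt_eqF// mulr_gt0.
have : 0 <= e * n%:R by rewrite mulr_ge0// ltW.
by move=> *; lra.
Qed.

Hypothesis n0 : (0 < n)%N.

Lemma harmonic_zero (F : V -> R) (r : R) : 0 < r -> cont_on (ball2 r) F ->
  (forall x, dot x x < r ^+ 2 -> has_lap F x 0) ->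
  (forall x, dot x x = r ^+ 2 -> F x = 0) ->
  forall x, ball2 r x -> F x = 0.
Proof.
move=> r0.
have main (G : V -> R) : cont_on (ball2 r) G ->
  (forall x, dot x x < r ^+ 2 -> has_lap G x 0) ->
  (forall x, dot x x = r ^+ 2 -> G x = 0) ->
  forall x, ball2 r x -> G x <= 0.
  move=> cG lG bG x xr; apply/ler_addgt0Pl => e e0; rewrite addr0.
  (* The barrier a (r^2 - |x|^2) vanishes on the sphere, stays below e, and has negative Laplacian,
     which supplies the strictness that [lap_sub_le] requires. *)
  pose a := e / r ^+ 2; have r20 : 0 < r ^+ 2 by rewrite exprn_gt0.
  have a0 : 0 < a by rewrite divr_gt0.
  apply: (@le_trans _ _ (a * (r ^+ 2 + (-1) * dot x x))); last first.
    rewrite /a mulrAC ler_pdivrMr// ler_pM2l// mulN1r gerDl oppr_le0; exact: dot_ge0.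
  apply: (@lap_sub_le _ (fun x => a * (r ^+ 2 + (-1) * dot x x)) r 0) xr => //.
  - apply: cont_on_continuous => z.
    have [p [X [hj _]]] := has_lapZ a (has_lapD (has_lap_cst (r ^+ 2) z) (has_lapZ (-1) (has_lap_dot z))).
    exact: jet2_continuous hj.
  - move=> z p X _ zr [de de0 h]; have [q [Y [hY <-]]] := lG _ zr.
    exact: jet2_touch hY de0 h.
  - move=> z zr; exists (a * (0 + (-1) * (2 * n%:R))).
      have nR : (0 : R) < n%:R by rewrite ltr0n.
      have := mulr_gt0 a0 nR; lra.
    apply: has_lapZ; apply: has_lapD; first exact: has_lap_cst.
    by apply: has_lapZ; exact: has_lap_dot.
  - by move=> z zr; rewrite bG// zr mulN1r subrr mulr0.
move=> cF lF bF x xr; apply/eqP; rewrite eq_le main//= -oppr_le0.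
apply: (main (fun z => - F z)) => //.
- exact: cont_onN.
- move=> z /lF /(has_lapZ (-1)); rewrite mulr0.
  by rewrite (_ : (fun _ => _) = fun z : V => - F z)//; apply/funext => u; rewrite mulN1r.
- by move=> z /bF ->; rewrite oppr0.
Qed.

Lemma polyd_bubble (r : R) s f : polyd s f ->
  polyd s.+2 (fun x => (r ^+ 2 - dot x x) * f x).
Proof.
move=> pf; rewrite (_ : (fun _ => _) =
    fun x : V => r ^+ 2 * f x + (-1) * \sum_i x 0 i * (x 0 i * f x)).
  apply: polydD; first by apply: polydZ; apply: polyd_weaken pf; rewrite -addn2 leq_addr.
  by apply: polydZ; apply: polyd_sum => i; do 2 apply: polydX.
apply/funext => x; rewrite mulrBl mulN1r; congr (_ - _).
by rewrite /dot mulr_suml; apply: eq_bigr => i _; rewrite mulrA.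
Qed.

(* w |-> Laplace((r^2 - |x|^2) w) does not raise the degree and is injective by the
   maximum principle, hence surjective on polynomials of bounded degree. *)
Lemma poisson_polyd (r : R) s g : 0 < r -> polyd s g ->
  exists (t : nat) w, polyd t w /\ forall x, dot x x < r ^+ 2 ->
    has_lap (fun z => (r ^+ 2 - dot z z) * w z) x (g x).
Proof.
move=> r0 pg; pose E := {f : V -> R | polyd s f}.
have stepE (f : E) : exists f' : E, forall x,
    has_lap (fun z => (r ^+ 2 - dot z z) * sval f z) x (sval f' x).
  have [L pL hL] := has_lap_polyd (polyd_bubble r (svalP f)).
  by exists (exist _ L pL).
have [T hT] := choice stepE.
pose G i := sval (iter i T (exist _ g pg)).
have pG i : polyd s (G i) by exact: svalP.
have hG i x : has_lap (fun z => (r ^+ 2 - dot z z) * G i z) x (G i.+1 x) by exact: hT.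
have [m [j [b [b0 hb]]]] := polyd_dependent pG.
have m0 : (0 < m)%N by have [] := hb 0.
have {hb} dep x : \sum_(i < m) b i * G (i + j)%N x = 0 by have [] := hb x.
have lapsum k x : has_lap (fun z => (r ^+ 2 - dot z z) * (\sum_(i < m) b i * G (i + k)%N z)) x
    (\sum_(i < m) b i * G (i + k.+1)%N x).
  rewrite (_ : (fun _ => _) =
     fun z : V => \sum_(i < m) b i * ((r ^+ 2 - dot z z) * G (i + k)%N z)).
    apply: (@has_lap_sum m (fun i z => b i * ((r ^+ 2 - dot z z) * G (i + k)%N z))
      x (fun i => b i * G (i + k.+1)%N x)) => i.
    by apply: has_lapZ; rewrite addnS.
  apply/funext => z; rewrite mulr_sumr; apply: eq_bigr => i _; rewrite mulrCA//.
have polysum k : polyd s (fun z => \sum_(i < m) b i * G (i + k)%N z).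
  by apply: polyd_sum => i; exact: polydZ.
(* The relation at shift [j.+1] is the Laplacian of r^2 - |x|^2 times the one at shift [j]. The
   maximum principle makes this map injective, so the relation descends to shift 0. *)
have {dep} dep x : dot x x < r ^+ 2 -> \sum_(i < m) b i * G i x = 0.
  have {dep} : forall x, dot x x < r ^+ 2 -> \sum_(i < m) b i * G (i + j)%N x = 0 by [].
  elim: j x => [x /(_ x)|j IH x h]; first by under eq_bigr do rewrite addn0; exact.
  apply: IH => {}x xr.
  suff : (r ^+ 2 - dot x x) * (\sum_(i < m) b i * G (i + j)%N x) = 0.
    by move=> /eqP; rewrite mulf_eq0 subr_eq0 gt_eqF//= => /eqP.
  apply: (@harmonic_zero (fun x => (r ^+ 2 - dot x x) * (\sum_(i < m) b i * G (i + j)%N x)) r) => //.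
  - apply: cont_on_continuous; apply: polyd_continuous.
    exact: (polyd_bubble r (polysum j)).
  - by move=> z zr; have := lapsum j z; rewrite h.
  - by move=> z ->; rewrite subrr mul0r.
  - exact: ltW.
(* Solving the relation for [G 0 = g] expresses [g] by [G i.+1], and each [G i.+1] is the image of
   [G i]; the same combination of the [G i] is therefore a preimage of [g]. *)
pose w z := - (b 0%N)^-1 * \sum_(i < m.-1) b i.+1 * G i z.
exists s, w; split; first by apply: polydZ; apply: polyd_sum => i; exact: polydZ.
move=> x xr.
have -> : g x = - (b 0%N)^-1 * \sum_(i < m.-1) b i.+1 * G i.+1 x.
  have := dep x xr; case: m m0 {dep lapsum polysum w} => // m _.
  rewrite big_ord_recl/= => /eqP; rewrite addrC addr_eq0 => /eqP h.
  rewrite (_ : \sum_(i < m) _ = - (b 0%N * g x)); first by field.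
  exact: h.
rewrite (_ : (fun _ => _) = fun z : V => - (b 0%N)^-1 *
    \sum_(i < m.-1) b i.+1 * ((r ^+ 2 - dot z z) * G i z)).
  apply: has_lapZ; apply: (@has_lap_sum m.-1 (fun i z => b i.+1 * ((r ^+ 2 - dot z z) * G i z))
      x (fun i => b i.+1 * G i.+1 x)) => i.
  exact: has_lapZ.
apply/funext => z; rewrite /w mulrCA; congr (_ * _).
by rewrite mulr_sumr; apply: eq_bigr => i _; rewrite mulrCA.
Qed.

(** The Dirichlet problem with polynomial data is solved inside the polynomials: from [P] one
    subtracts a multiple of r^2 - |x|^2 that has the same Laplacian. *)
Lemma harmonic_extension (r : R) s P : 0 < r -> polyd s P ->
  exists H : V -> R, [/\ continuous H, forall x, dot x x = r ^+ 2 -> H x = P x &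
    forall x, dot x x < r ^+ 2 -> has_lap H x 0].
Proof.
move=> r0 pP; have [L pL hL] := has_lap_polyd pP.
have [t [w [pw hw]]] := poisson_polyd r0 pL.
exists (fun x => P x + (-1) * ((r ^+ 2 - dot x x) * w x)); split.
- apply: polyd_continuous (maxn s t.+2) _ _; apply: polydD.
    by apply: polyd_weaken pP; rewrite leq_maxl.
  by apply: polydZ; apply: polyd_weaken (polyd_bubble r pw); rewrite leq_maxr.
- by move=> x ->; rewrite subrr mul0r mulr0 addr0.
- move=> x xr; have := has_lapD (hL x) (has_lapZ (-1) (hw x xr)).
  by rewrite mulN1r subrr.
Qed.

End laplacian.

(** * Uniform approximation by polynomials on a ball *)

Lemma abs_iteration (R : realType) (a q E E' : R) : 0 <= q -> q <= a -> a <= 1 ->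
  a - q <= E -> E <= 1 -> E - E ^+ 2 / 2 <= E' ->
  let q' := q + 2^-1 * (a * a + (-1) * (q * q)) in
  [/\ 0 <= q', q' <= a & a - q' <= E'].
Proof.
move=> q0 qa a1 aE E1 EE' /=.
(* With d = a - q the new error is d (1 - (a + q)/2) <= d - d^2/2, because a + q >= d; and s - s^2/2
   is increasing on [0, 1]. *)
have h1 : 0 <= (a - q) * (a + q) by rewrite mulr_ge0; lra.
have h2 : 0 <= (a - q) * (2 - (a + q)) by rewrite mulr_ge0; lra.
have h3 : 0 <= (a - q) * q by rewrite mulr_ge0; lra.
have h4 : 0 <= (E - (a - q)) * (2 - (E + (a - q))) by rewrite mulr_ge0; lra.
by split; lra.
Qed.

Section weierstrass.
Variables (R : realType) (n : nat) (r : R).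
Hypothesis r0 : 0 < r.
Local Notation V := 'rV[R]_n.
Implicit Types (F G P : V -> R).

Definition papprox F : Prop := forall e : R, 0 < e ->
  exists s P, polyd s P /\ forall x, ball2 r x -> `|F x - P x| <= e.

Lemma papprox_polyd s P : polyd s P -> papprox P.
Proof. by move=> pP e e0; exists s, P; split => // x _; rewrite subrr normr0 ltW. Qed.

Lemma papproxD F G : papprox F -> papprox G -> papprox (fun x => F x + G x).
Proof.
move=> hF hG e e0; have e20 : 0 < e / 2 by rewrite divr_gt0.
have [s [P [pP hP]]] := hF _ e20; have [t [Q [pQ hQ]]] := hG _ e20.
exists (maxn s t), (fun x => P x + Q x); split.
  by apply: polydD; [apply: polyd_weaken pP; exact: leq_maxl|apply: polyd_weaken pQ; exact: leq_maxr].
move=> x xr; rewrite opprD addrACA (le_trans (ler_normD _ _))// [e]splitr.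
by rewrite lerD ?hP ?hQ.
Qed.

Lemma papproxZ a F : papprox F -> papprox (fun x => a * F x).
Proof.
move=> hF e e0; pose b := `|a| + 1; have b0 : 0 < b by rewrite ltr_wpDl.
have [s [P [pP hP]]] := hF _ (divr_gt0 e0 b0).
exists s, (fun x => a * P x); split; first exact: polydZ.
move=> x xr; rewrite -mulrBr normrM; apply: (@le_trans _ _ (b * (e / b))).
  by rewrite ler_pM ?hP// /b lerDl.
by rewrite mulrC divfK// gt_eqF.
Qed.

(* The iteration q -> q + (t^2 - q^2)/2 increases to |t| on [-1, 1], with error
   at most 2/(k+2) after k steps. *)
Lemma polyd_abs s P (B : R) : polyd s P -> 0 < B -> (forall x, ball2 r x -> `|P x| <= B) ->
  forall k : nat, exists t Q, polyd t Q /\ forall x, ball2 r x ->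
    [/\ 0 <= Q x, Q x <= `|P x / B| & `|P x / B| - Q x <= 2 / (k.+2)%:R].
Proof.
move=> pP B0 hB; elim=> [|k [t [Q [pQ hQ]]]].
  exists 0%N, (fun=> 0); split; first exact: polyd0.
  move=> x /hB; rewrite subr0 divff ?pnatr_eq0// normrM [`|B^-1|]gtr0_norm ?invr_gt0// => h.
  by split => //; [rewrite divr_ge0// ltW|rewrite ler_pdivrMr// mul1r].
pose T x := P x * B^-1.
have pT : polyd s T.
  by rewrite /T (_ : (fun _ => _) = fun x : V => B^-1 * P x); [exact: polydZ|apply/funext => x; rewrite mulrC].
exists (maxn t (maxn (s + s) (t + t))), (fun x => Q x + 2^-1 * (T x * T x + (-1) * (Q x * Q x))).
split.
  apply: polydD; first by apply: polyd_weaken pQ; exact: leq_maxl.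
  apply: polydZ; apply: polydD.
    by apply: polyd_weaken (polydM pT pT); rewrite !leq_max leqnn !orbT.
  by apply: polydZ; apply: polyd_weaken (polydM pQ pQ); rewrite !leq_max leqnn !orbT.
move=> x xr; have [h1 h2 h3] := hQ _ xr; rewrite -/(T x) in h2 h3 *.
have T1 : `|T x| <= 1.
  by rewrite /T normrM [`|B^-1|]gtr0_norm ?invr_gt0// ler_pdivrMr// mul1r hB.
have -> : T x * T x = `|T x| * `|T x| by rewrite -normrM ger0_norm// -expr2 sqr_ge0.
pose E : R := 2 / k.+2%:R.
(* The sequence 2/N dominates the recursion d -> d - d^2/2, since 2/(N+1) exceeds 2/N - (2/N)^2/2 by
   2/(N^2 (N+1)). *)
have kE : E - E ^+ 2 / 2 <= 2 / k.+3%:R.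
  have N0 : (0 : R) < k.+2%:R by rewrite ltr0n.
  have N1 : (0 : R) < k.+3%:R by rewrite ltr0n.
  have NE : (k.+3%:R : R) = k.+2%:R + 1 by rewrite -natr1.
  rewrite -subr_ge0 /E; rewrite NE in N1 *; move: (k.+2%:R : R) N0 N1 => N N0 N1.
  have -> : 2 / (N + 1) - (2 / N - (2 / N) ^+ 2 / 2) = 2 / (N ^+ 2 * (N + 1)).
    by field; rewrite !gt_eqF.
  by rewrite divr_ge0// mulr_ge0 ?sqr_ge0// ltW.
have E1 : E <= 1 by rewrite /E ler_pdivrMr ?ltr0n// mul1r ler_nat.
exact: abs_iteration h1 h2 T1 h3 E1 kE.
Qed.

Lemma polyd_bounded s P : polyd s P ->
  exists2 B : R, 0 < B & forall x, ball2 r x -> `|P x| <= B.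
Proof.
move=> pP; apply: cont_on_bounded; first exact: compact_ball2 (ltW r0).
by apply: cont_on_continuous; exact: polyd_continuous pP.
Qed.

Lemma papprox_abs F : papprox F -> papprox (fun x => `|F x|).
Proof.
move=> hF e e0; have e20 : 0 < e / 2 by rewrite divr_gt0.
have [s [P [pP hP]]] := hF _ e20.
have [B B0 hB] := polyd_bounded pP.
pose k := Num.truncn (4 * B / e).
have hk : 2 / k.+2%:R <= e / 2 / B.
  have : 4 * B / e < k.+1%:R by rewrite truncnS_gt.
  rewrite ltr_pdivrMr// => h; rewrite ler_pdivrMr ?ltr0n//.
  rewrite mulrAC ler_pdivlMr// -[k.+2%:R]natr1.
  by move: (k.+1%:R : R) h => N h; nra.
have [t [Q [pQ hQ]]] := polyd_abs pP B0 hB k.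
exists t, (fun x => B * Q x); split; first exact: polydZ.
move=> x xr; have [h1 h2 h3] := hQ _ xr.
have -> : `|F x| - B * Q x = (`|F x| - `|P x|) + B * (`|P x / B| - Q x).
  by rewrite normrM [`|B^-1|]gtr0_norm ?invr_gt0//; field; rewrite gt_eqF.
apply: le_trans (ler_normD _ _) _; rewrite [e]splitr lerD//.
  exact: le_trans (ler_dist_dist _ _) (hP _ xr).
rewrite normrM gtr0_norm// ger0_norm ?subr_ge0//.
by rewrite mulrC -ler_pdivlMr// (le_trans h3).
Qed.

Lemma papprox_max F G : papprox F -> papprox G -> papprox (fun x => Num.max (F x) (G x)).
Proof.
move=> hF hG; rewrite (_ : (fun _ => _) =
    fun x : V => 2^-1 * (F x + G x + `|F x + (-1) * G x|)).
  apply: papproxZ; apply: papproxD; first exact: papproxD.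
  by apply: papprox_abs; apply: papproxD => //; exact: papproxZ.
by apply/funext => x; rewrite maxr_absE mulN1r mulrC.
Qed.

(** The l^1 distance is used for cones because, as a sum of absolute values of coordinates, it is
    approximable by [papprox_abs]; it is equivalent to the norm by the two bounds below. *)
Definition d1 (x y : V) : R := \sum_i `|x 0 i - y 0 i|.

Lemma norm_le_d1 x y : `|x - y| <= d1 x y.
Proof.
apply: norm_leP => [|i]; first by apply: sumr_ge0.
by rewrite !mxE /d1 (bigD1 i)//= lerDl sumr_ge0.
Qed.

Lemma d1_le x y : d1 x y <= n%:R * `|x - y|.
Proof.
rewrite /d1; apply: (@le_trans _ _ (\sum_(i < n) `|x - y|)).
  by apply: ler_sum => i _; have := coord_norm (x - y) i; rewrite !mxE.
by rewrite sumr_const card_ord mulr_natl.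
Qed.

Lemma papprox_d1 y : papprox (fun x => d1 x y).
Proof.
rewrite /d1; elim: (index_enum _) => [|i s IH].
  by rewrite (_ : (fun _ => _) = fun=> 0); [exact: (papprox_polyd (@polyd0 R n 0%N))|
    apply/funext => x; rewrite big_nil].
rewrite (_ : (fun _ => _) = fun x : V => `|x 0 i * 1 + - y 0 i| + \sum_(j <- s) `|x 0 j - y 0 j|); last first.
  by apply/funext => x; rewrite big_cons mulr1.
apply: papproxD => //; apply: papprox_abs.
by apply: (papprox_polyd (s := 2)); apply: polydD; [apply: polydX|]; exact: polydC.
Qed.

(* A Lipschitz function is almost the maximum of the finitely many cones
   F y - C |x - y|_1, y in a fine net. *)
Lemma papprox_lipschitz F (C : R) : 0 < C ->
  (forall x y, ball2 r x -> ball2 r y -> `|F x - F y| <= C * `|x - y|) -> papprox F.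
Proof.
move=> C0 hF e e0; have n1 : (0 : R) < n%:R + 1 by rewrite ltr_wpDl.
(* A cone with vertex y loses at most C |x - y| + C n |x - y| at x, which is at most e/2 when |x -
   y| < de. *)
pose de := e / 2 / (C * (n%:R + 1)).
have de0 : 0 < de by rewrite !divr_gt0// mulr_gt0.
have cb := compact_ball2 (n := n) (ltW r0).
rewrite compact_cover in cb.
have [||D DB cov] := cb V (@ball2 R n r) (fun y => ball y de).
- by move=> y _; exact: ball_open.
- by move=> x xr; exists x => //; exact: ballxx.
pose T (x y : V) := F y - C * d1 x y.
have net (s : seq V) : (forall y, y \in s -> ball2 r y) -> exists G, papprox G /\
    forall x, ball2 r x -> G x <= F x /\ forall y, y \in s -> T x y <= G x.
  have hT y : ball2 r y -> papprox (T^~ y) /\ forall x, ball2 r x -> T x y <= F x.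
    move=> yr; split.
      rewrite (_ : T^~ y = fun x : V => F y + (- C) * d1 x y).
        apply: papproxD; last by apply: papproxZ; exact: papprox_d1.
        exact: (papprox_polyd (@polydC R n 0 _)).
      by apply/funext => x; rewrite mulNr.
    move=> x xr; rewrite /T lerBlDr -lerBlDl (le_trans (ler_norm _))//.
    by rewrite (le_trans (hF _ _ yr xr))// ler_pM2l// distrC norm_le_d1.
  elim: s => [|y s IH] hs.
    have z : ball2 r (0 : V) by rewrite /ball2 /= dot0l sqr_ge0.
    have [h1 h2] := hT _ z; exists (T^~ 0); split => // x xr; split => //; exact: h2.
  have [|G [aG hG]] := IH; first by move=> z zs; apply: hs; rewrite in_cons zs orbT.
  have [|h1 h2] := hT y; first by apply: hs; rewrite mem_head.
  exists (fun x => Num.max (T x y) (G x)); split; first exact: papprox_max.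
  move=> x xr; have [g1 g2] := hG _ xr; split; first by rewrite ge_max h2.
  move=> z; rewrite in_cons => /orP[/eqP ->|/g2]; first by rewrite le_max lexx.
  by rewrite le_max => ->; rewrite orbT.
have [|G [aG hG]] := net (finmap.enum_fset D).
  by move=> y /DB; rewrite inE.
have [s [P [pP hP]]] := aG (e / 2) (divr_gt0 e0 (ltr0Sn _ 1)).
exists s, P; split => // x xr.
have -> : F x - P x = (F x - G x) + (G x - P x) by ring.
apply: le_trans (ler_normD _ _) _; rewrite [e]splitr lerD ?hP//.
have [g1 g2] := hG _ xr; rewrite ger0_norm ?subr_ge0//.
have [y /= yD] := cov _ xr; rewrite -ball_normE/= distrC => yx.
have yr : ball2 r y by have := DB _ yD; rewrite inE.
have := g2 _ yD; rewrite /T => h; rewrite lerBlDr -lerBlDl.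
rewrite lerBlDl; apply: (@le_trans _ _ (F y + C * `|x - y|)).
  by rewrite -lerBlDl (le_trans (ler_norm _))// hF.
have d1x := d1_le x y.
have : C * (n%:R + 1) * `|x - y| <= e / 2.
  by rewrite mulrC -ler_pdivlMr ?mulr_gt0// ltW.
have : C * d1 x y <= C * (n%:R * `|x - y|) by rewrite ler_pM2l.
by move=> *; lra.
Qed.

End weierstrass.

(** * Sums of subsolutions of Laplace equations *)

Section laplace_sums.
Variables (R : realType) (n : nat).
Hypothesis n0 : (0 < n)%N.
Local Notation V := 'rV[R]_n.

Definition lip_on (K : set V) (F : V -> R) : Prop :=
  exists2 C : R, 0 < C & forall x y, K x -> K y -> `|F x - F y| <= C * `|x - y|.

Lemma lip_on_cont (K : set V) F : lip_on K F -> cont_on K F.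
Proof.
move=> [C C0 h] x Kx e e0; exists (e / C); first by rewrite divr_gt0.
move=> y Ky yx; apply: le_lt_trans (h _ _ Ky Kx) _.
by rewrite mulrC -ltr_pdivlMr.
Qed.

(* Both functions are compared with one harmonic function that is close to U on
   the sphere; this replaces the theorem on sums for the Laplace operator. *)
Lemma lap_sub_add (U W : V -> R) (r f g : R) (B : 'M[R]_n) : 0 < r ->
  lip_on (ball2 r) U -> lip_on (ball2 r) W -> lap_sub U r f -> lap_sub W r g ->
  (forall x, ball2 r x -> U x + W x <= 2^-1 * qf B x) -> 0 <= U 0 + W 0 ->
  f + g <= \tr B.
Proof.
move=> r0 lU lW sU sW UW UW0; rewrite leNgt; apply/negP => lt.
pose eta := (f + g - \tr B) / 4; have eta0 : 0 < eta by rewrite divr_gt0// subr_gt0.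
have nR : (0 : R) < n%:R by rewrite ltr0n.
pose eps := eta / (2 * n%:R); have eps0 : 0 < eps by rewrite divr_gt0// mulr_gt0.
have r20 : 0 < r ^+ 2 by rewrite exprn_gt0.
have [C C0 hC] := lU.
have [|s [P [pP hP]]] := papprox_lipschitz r0 C0 hC (e := eps * r ^+ 2 / 4).
  by rewrite divr_gt0// mulr_gt0.
have [H [cH HP lH]] := harmonic_extension n0 r0 pP.
(* With this k the quadratic correction makes the Laplacian of [G1] equal to f - eta, and that of
   [G2] equal to tr B + 2 eta - f = g - 2 eta. Both are strictly too small, so [lap_sub_le] applies
   to [U] and to [W]. *)
pose k := (f - eta) / (2 * n%:R).
have ball0 : ball2 r (0 : V) by rewrite /ball2 /= dot0l ltW.
pose G1 x := H x + (k * dot x x + (- k * r ^+ 2 + eps * r ^+ 2 / 4)).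
pose G2 x := 2^-1 * qf B x + ((eps - k) * dot x x +
  ((k - eps) * r ^+ 2 + eps * r ^+ 2 / 4 + (-1) * H x)).
have cG (G : V -> R) : (forall x, exists L, has_lap G x L) -> cont_on (ball2 r) G.
  move=> h; apply: cont_on_continuous => x; have [L [p [X [hj _]]]] := h x.
  exact: jet2_continuous hj.
have cH' : cont_on (ball2 r) H by exact: cont_on_continuous.
have U1 : forall x, ball2 r x -> U x <= G1 x.
  apply: (@lap_sub_le _ _ U G1 r f) => //.
  - exact: lip_on_cont.
  - apply: cont_onD => //; apply: cG => x; eexists.
    by apply: has_lapD; [apply: has_lapZ; exact: has_lap_dot|exact: has_lap_cst].
  - move=> x xr; exists (0 + (k * (2 * n%:R) + 0)).
      by rewrite add0r addr0 /k divfK ?gt_eqF ?mulr_gt0// ltrBlDr ltrDl.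
    apply: has_lapD; first exact: lH.
    by apply: has_lapD; [apply: has_lapZ; exact: has_lap_dot|exact: has_lap_cst].
  - move=> x xr; rewrite /G1 HP// xr.
    have /hP : ball2 r x by rewrite /ball2 /= xr.
    by rewrite ler_norml => /andP[_]; lra.
have W2 : forall x, ball2 r x -> W x <= G2 x.
  apply: (@lap_sub_le _ _ W G2 r g) => //.
  - exact: lip_on_cont.
  - apply: cont_onD; first by apply: cG => x; eexists; exact: has_lap_qf.
    apply: cont_onD; first by apply: cG => x; eexists; apply: has_lapZ; exact: has_lap_dot.
    apply: cont_onD; first exact: cont_on_cst.
    rewrite (_ : (fun _ => _) = fun x : V => - H x); first exact: cont_onN.
    by apply/funext => x; rewrite mulN1r.
  - move=> x xr; exists (\tr B + ((eps - k) * (2 * n%:R) + (0 + (-1) * 0))).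
      rewrite mulrBl /eps /k !divfK ?gt_eqF ?mulr_gt0// /eta; rewrite /eta in eta0; lra.
    apply: has_lapD; first exact: has_lap_qf.
    apply: has_lapD; first by apply: has_lapZ; exact: has_lap_dot.
    by apply: has_lapD; [exact: has_lap_cst|apply: has_lapZ; exact: lH].
  - move=> x xr; rewrite /G2 HP// xr.
    have xb : ball2 r x by rewrite /ball2 /= xr.
    have := UW _ xb; have := hP _ xb.
    rewrite ler_norml => /andP[]; lra.
(* At the centre the harmonic parts cancel and [G1 0 + G2 0] is - eps r^2 / 2, against
   [U 0 + W 0 >= 0]. *)
have := lerD (U1 _ ball0) (W2 _ ball0).
rewrite /G1 /G2 dot0l qf0r => h; have := mulr_gt0 eps0 r20; lra.
Qed.

End laplace_sums.

Lemma qf_gram (R : realType) m n (L : 'M[R]_(m, n)) d :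
  qf (L *m L^T) d = dot (d *m L) (d *m L).
Proof. by rewrite /qf mulmxA dot_mull trmxK. Qed.

(** * Sup-convolution and the theorem on sums *)

Section sup_convolution.
Variables (R : realType) (N : nat).
Local Notation V := 'rV[R]_N.
Variables (K : set V) (al : V -> R) (a la rho f : R) (sg : 'M[R]_N).
Hypothesis (cK : compact K) (K0 : K 0) (cal : cont_on K al) (al0 : al 0 = 0).
Hypothesis (a0 : 0 <= a) (ala : a < la) (rho0 : 0 < rho).
Hypothesis (growth : forall h, K h -> al h <= 2^-1 * (a * dot h h)).
Hypothesis (usg : sg \in unitmx).
Hypothesis Sal : forall h p X, K h -> `|h| < rho -> `|p| < rho -> X^T = X ->
  (forall d, - la * dot d d <= qf X d) ->
  (exists2 de : R, 0 < de & forall d, `|d| < de -> K (h + d) ->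
     al (h + d) <= al h + dot p d + 2^-1 * qf X d) ->
  f <= \tr (sg *m X *m sg^T).

(** The penalty is centred at [e *m sg], so that the operator tr(sg X sg^T) becomes the Laplacian in
    [e]. Compactness of [K] provides the maximizers [m e]. *)
Lemma sup_convE : exists (U : V -> R) (m : V -> V), forall e,
  [/\ K (m e), U e = al (m e) - 2^-1 * (la * dot (m e - e *m sg) (m e - e *m sg)) &
      forall h, K h -> al h - 2^-1 * (la * dot (h - e *m sg) (h - e *m sg)) <= U e].
Proof.
have ex e : exists m, K m /\ forall h, K h ->
    al h - 2^-1 * (la * dot (h - e *m sg) (h - e *m sg)) <=
    al m - 2^-1 * (la * dot (m - e *m sg) (m - e *m sg)).
  have [|||m Km hm] := @cont_on_max R V K
    (fun h => al h - 2^-1 * (la * dot (h - e *m sg) (h - e *m sg))).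
  - by exists 0.
  - exact: cK.
  - apply: cont_onB => //; apply: cont_on_continuous => h.
    rewrite (_ : (fun _ => _) = fun h : V => 2^-1 * la * dot h h +
        (dot (- la *: (e *m sg)) h + 2^-1 * la * dot (e *m sg) (e *m sg))).
      have [p [X [hj _]]] := has_lapZ (2^-1 * la) (has_lap_dot h).
      apply: (jet2_continuous (p := _) (X := _)).
      apply: jet2D; first exact: hj.
      by apply: jet2D; [exact: jet2_dot|exact: jet2_cst].
    by apply/funext => z; rewrite dotBl !dotBr dotZl (dotC z); field.
  - by exists m; split => // h /hm.
have [m hm] := choice ex.
exists (fun e => al (m e) - 2^-1 * (la * dot (m e - e *m sg) (m e - e *m sg))), m => e.
by have [? ?] := hm e; split.
Qed.

Variables (U : V -> R) (m : V -> V).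
Hypothesis Um : forall e,
  [/\ K (m e), U e = al (m e) - 2^-1 * (la * dot (m e - e *m sg) (m e - e *m sg)) &
      forall h, K h -> al h - 2^-1 * (la * dot (h - e *m sg) (h - e *m sg)) <= U e].

Let la0 : 0 < la. Proof. exact: le_lt_trans a0 ala. Qed.

Lemma sup_conv0 : 0 <= U 0.
Proof.
by have [_ _ /(_ 0 K0)] := Um 0; rewrite mul0mx subrr dot0l al0 !mulr0 subr0.
Qed.

(** Comparison with the competitor h = 0, together with the growth bound, gives (la - a) |m|^2 <= 2
    la m . (e sg). Since a < la, the maximizers tend to 0 with e. *)
Lemma sup_conv_arg e : enorm (m e) <= 2 * la / (la - a) * enorm (e *m sg).
Proof.
have [Km UE /(_ 0 K0)] := Um e.
rewrite UE al0 sub0r sub0r dotNl dotNr opprK => h.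
have g := growth Km.
have la' : 0 < la - a by rewrite subr_gt0.
have key : (la - a) * dot (m e) (m e) <= 2 * la * (enorm (m e) * enorm (e *m sg)).
  have := le_trans (ler_norm _) (dot_enorm (m e) (e *m sg)).
  rewrite -(ler_pM2l la0); move: h; rewrite dotBl !dotBr (dotC (e *m sg)); lra.
have [m0|m0] := eqVneq (m e) 0.
  by rewrite m0 enorm0 mulr_ge0 ?enorm_ge0// divr_ge0 ?mulr_ge0 ?ltW.
have em := enorm_gt0 m0.
rewrite mulrAC ler_pdivlMr// mulrC -(ler_pM2l em).
by move: key; rewrite -enorm_sq expr2 => ?; lra.
Qed.

(** The maximizer at [e] competes at [e'], so the difference of values is bounded by a difference of
    two penalties with bounded arguments. *)
Lemma sup_conv_lip r : 0 < r -> lip_on (ball2 r) U.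
Proof.
move=> r0; have [S S0 hS] := norm_mulmx sg.
have [M [_ hM]] := compact_bounded cK.
pose M1 := Num.max M 0 + 1.
have M10 : 0 < M1 by rewrite ltr_wpDl// le_max lexx orbT.
have hM1 h : K h -> `|h| <= M1.
  by move=> Kh; apply: hM Kh; rewrite (le_lt_trans (_ : _ <= Num.max M 0)) ?le_max ?lexx// ltrDl.
pose C := la * (N%:R + 1) * S * (2 * M1 + 2 * S * r).
have C0 : 0 < C.
  apply: mulr_gt0; last by rewrite addr_gt0 ?mulr_gt0.
  by apply: mulr_gt0 => //; apply: mulr_gt0 => //; rewrite ltr_wpDl.
have oneside e e' : ball2 r e -> ball2 r e' -> U e - U e' <= C * `|e - e'|.
  move=> er er'; have [Km UE _] := Um e; have [_ _ /(_ _ Km) h] := Um e'.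
  apply: (@le_trans _ _ (2^-1 * la * dot ((e - e') *m sg) (2 *: m e - (e + e') *m sg))).
    rewrite UE; move: h; rewrite !mulmxBl !mulmxDl.
    rewrite !(dotDl, dotDr, dotNl, dotNr, dotZr).
    rewrite (dotC (e *m sg) (m e)) (dotC (e' *m sg) (m e)) (dotC (e' *m sg) (e *m sg)); lra.
  have d := le_trans (ler_norm _) (dot_norm_le ((e - e') *m sg) (2 *: m e - (e + e') *m sg)).
  apply: (@le_trans _ _ (2^-1 * la * (N%:R * ((S * `|e - e'|) * (2 * M1 + 2 * S * r))))).
    rewrite ler_pM2l ?mulr_gt0//; apply: le_trans d _.
    rewrite ler_wpM2l// ler_pM// ?hS//.
    apply: le_trans (ler_normB _ _) _; rewrite lerD//.
      by rewrite normrZ gtr0_norm// ler_pM2l// hM1.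
    apply: le_trans (hS _) _; rewrite -mulrA mulrCA ler_pM2l//.
    have := ball2_norm (ltW r0) er; have := ball2_norm (ltW r0) er'.
    have := ler_normD e e'; lra.
  have nn : 0 <= `|e - e'| by [].
  have nN : (0 : R) <= N%:R by [].
  have w0 : 0 <= la * S * (2 * M1 + 2 * S * r) * `|e - e'|.
    by rewrite mulr_ge0// ltW// mulr_gt0 ?addr_gt0 ?mulr_gt0.
  have w1 : 0 <= N%:R * (la * S * (2 * M1 + 2 * S * r) * `|e - e'|) by rewrite mulr_ge0.
  rewrite /C; lra.
exists C => // x y xr yr; rewrite ler_norml oneside// andbT.
by rewrite lerNl opprB distrC oneside.
Qed.

Lemma sup_conv_lap_sub : exists2 r0 : R, 0 < r0 & lap_sub U r0 f.
Proof.
have [S S0 hS] := norm_mulmx sg; have [S' S'0 hS'] := norm_mulmx (invmx sg).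
pose B := (N%:R + 1) * S; have B0 : 0 < B by rewrite mulr_gt0// ltr_wpDl.
have hB e : enorm (e *m sg) <= B * enorm e.
  apply: le_trans (enorm_le_norm _) _; rewrite -mulrA ler_pM2l ?ltr_wpDl//.
  by apply: le_trans (hS _) _; rewrite ler_pM2l// norm_le_enorm.
pose q := 2 * la / (la - a); have q0 : 0 < q by rewrite divr_gt0 ?mulr_gt0// subr_gt0.
(* The maximizer has size at most q |x sg| and the gradient [v] at most la (q + 1) |x sg|; for |x| <
   rho / D both stay below [rho], where [Sal] is available. *)
pose D := (la + 1) * (q + 1) * B.
have D0 : 0 < D by rewrite !mulr_gt0// ?addr_gt0.
exists (rho / D); first by rewrite divr_gt0.
move=> x p X Xs xr [de de0 touch].
have ex : enorm x < rho / D.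
  rewrite -(@ltr_pXn2r _ 2)// ?nnegrE ?enorm_ge0 ?divr_ge0 ?(ltW D0) ?(ltW rho0)//.
  by rewrite enorm_sq.
have exs : (la + 1) * (q + 1) * enorm (x *m sg) < rho.
  apply: (@le_lt_trans _ _ ((la + 1) * (q + 1) * (B * enorm x))).
    by rewrite ler_pM2l ?mulr_gt0 ?addr_gt0// hB.
  by rewrite mulrA -/D mulrC -ltr_pdivlMr.
have [Km UE hm] := Um x.
have em : enorm (m x) <= q * enorm (x *m sg) by exact: sup_conv_arg.
have w0 := enorm_ge0 (x *m sg).
have qw : 0 <= q * enorm (x *m sg) by rewrite mulr_ge0// ltW.
have lqw : 0 <= la * (q * enorm (x *m sg)) by rewrite mulr_ge0// ltW.
have lw : 0 <= la * enorm (x *m sg) by rewrite mulr_ge0// ltW.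
pose v := la *: (m x - x *m sg).
(* With the maximizer kept fixed and [x] moved, [U] lies above a concave paraboloid of opening [la].
   Contact with the upper test function determines [p] and bounds [X] from below. *)
have [pE XE] : p - v *m sg^T = 0 /\ forall d, 0 <= qf (X + la *: (sg *m sg^T)) d.
  apply: local_quadratic_ge0 => e e0; exists de => // d dd.
  have [_ _ /(_ _ Km)] := Um (x + d); have := touch _ dd.
  rewrite UE qfD qfZ qf_gram.
  have -> : dot (p - v *m sg^T) d = dot p d - dot v (d *m sg) by rewrite dotBl dot_mull trmxK.
  have -> : m x - (x + d) *m sg = m x - x *m sg - d *m sg by rewrite mulmxDl opprD addrA.
  rewrite /v; move: (m x - x *m sg) => w.
  rewrite dotZl dotBl !dotBr (dotC (d *m sg) w).
  have : 0 <= e * dot d d by rewrite mulr_ge0 ?dot_ge0// ltW.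
  lra.
have {}pE : p = v *m sg^T by apply/eqP; rewrite -subr_eq0 pE.
have -> : \tr X = \tr (sg *m (invmx sg *m X *m (invmx sg)^T) *m sg^T).
  by rewrite !mulmxA mulmxV// mul1mx -mulmxA -trmx_mul mulmxV// trmx1 mulmx1.
apply: (Sal (h := m x) (p := v)) => //.
- apply: le_lt_trans (norm_le_enorm _) _; lra.
- apply: le_lt_trans (norm_le_enorm _) _; rewrite enormZ gtr0_norm//.
  have : la * enorm (m x - x *m sg) <= la * (q * enorm (x *m sg) + enorm (x *m sg)).
    rewrite ler_pM2l// -(enormN (x *m sg)); apply: le_trans (enormD _ _) _.
    by rewrite enormN lerD2r.
  by move=> ?; lra.
- by rewrite !trmx_mul trmxK Xs mulmxA.
- move=> d; rewrite qf_mul; have := XE (d *m invmx sg).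
  rewrite qfD qfZ qf_gram mulmxKV//; lra.
(* Moving [m x] by d and [x] by d sg^-1 together leaves the penalty unchanged, so the contact of [U]
   at [x] is transferred to [al] at [m x]. *)
exists (de / S'); first by rewrite divr_gt0.
move=> d dd Kmd; have [_ _ /(_ _ Kmd)] := Um (x + d *m invmx sg).
have /touch : `|d *m invmx sg| < de.
  by apply: le_lt_trans (hS' _) _; rewrite mulrC -ltr_pdivlMr.
have -> : m x + d - (x + d *m invmx sg) *m sg = m x - x *m sg.
  by rewrite mulmxDl mulmxKV// opprD addrACA subrr addr0.
rewrite UE pE qf_mul [dot (v *m _) _]dot_mull trmxK mulmxKV//; lra.
Qed.

End sup_convolution.

Section coupling.
Variables (R : realType) (N : nat).
Hypothesis N0 : (0 < N)%N.
Local Notation V := 'rV[R]_N.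

Lemma dot_row_mx m1 m2 (p1 q1 : 'rV[R]_m1) (p2 q2 : 'rV[R]_m2) :
  dot (row_mx p1 p2) (row_mx q1 q2) = dot p1 q1 + dot p2 q2.
Proof. by rewrite !dotE tr_row_mx mul_row_col mxE. Qed.

(** The increment of the form is controlled in the shape in which the sup-convolution penalty can
    absorb it, with one constant for the mixed and the pure quadratic term. *)
Definition bounded_form M (A : 'M[R]_M) (a : R) := forall w d,
  qf A (w + d) <= qf A w + 2 * a * (enorm w * enorm d) + a * dot d d.

(** Both sup-convolutions are functions of one variable [e] in dimension N, read through [sg] and
    [ta], so [lap_sub_add] applies to them. The term a^2/(la - a) is the price of sup-convolving the
    form [A]. *)
Lemma coupling (K1 K2 : set V) (al be : V -> R) (A : 'M[R]_(N + N)) (a la rho f g : R)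
  (sg ta : 'M[R]_N) :
  compact K1 -> compact K2 -> K1 0 -> K2 0 -> cont_on K1 al -> cont_on K2 be ->
  al 0 = 0 -> be 0 = 0 -> 0 <= a -> a < la -> 0 < rho -> bounded_form A a ->
  sg \in unitmx -> ta \in unitmx ->
  (forall h k, K1 h -> K2 k -> al h + be k <= 2^-1 * qf A (row_mx h k)) ->
  (forall h p X, K1 h -> `|h| < rho -> `|p| < rho -> X^T = X ->
    (forall d, - la * dot d d <= qf X d) ->
    (exists2 de : R, 0 < de & forall d, `|d| < de -> K1 (h + d) ->
       al (h + d) <= al h + dot p d + 2^-1 * qf X d) ->
    f <= \tr (sg *m X *m sg^T)) ->
  (forall h p X, K2 h -> `|h| < rho -> `|p| < rho -> X^T = X ->
    (forall d, - la * dot d d <= qf X d) ->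
    (exists2 de : R, 0 < de & forall d, `|d| < de -> K2 (h + d) ->
       be (h + d) <= be h + dot p d + 2^-1 * qf X d) ->
    g <= \tr (ta *m X *m ta^T)) ->
  f + g <= \tr (row_mx sg ta *m (A + (a ^+ 2 / (la - a))%:M) *m (row_mx sg ta)^T).
Proof.
move=> cK1 cK2 K10 K20 cal cbe al0 be0 a0 ala rho0 bA usg uta hA S1 S2.
have la0 : 0 < la - a by rewrite subr_gt0.
have g0 (d : 'rV[R]_(N + N)) : qf A d <= a * dot d d.
  by have := bA 0 d; rewrite add0r qf0r enorm0 mul0r mulr0 !add0r.
have g1 h : K1 h -> al h <= 2^-1 * (a * dot h h).
  move=> Kh; have := hA _ _ Kh K20; rewrite be0 addr0 => /le_trans; apply.
  by rewrite ler_pM2l// (le_trans (g0 _))// dot_row_mx dot0l addr0.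
have g2 h : K2 h -> be h <= 2^-1 * (a * dot h h).
  move=> Kh; have := hA _ _ K10 Kh; rewrite al0 add0r => /le_trans; apply.
  by rewrite ler_pM2l// (le_trans (g0 _))// dot_row_mx dot0l add0r.
have [U [m Um]] := sup_convE la sg cK1 K10 cal.
have [W [m' Wm]] := sup_convE la ta cK2 K20 cbe.
have [r1 r10 sU] := sup_conv_lap_sub K10 al0 a0 ala rho0 g1 usg S1 Um.
have [r2 r20 sW] := sup_conv_lap_sub K20 be0 a0 ala rho0 g2 uta S2 Wm.
pose r := Num.min r1 r2; have r0 : 0 < r by rewrite lt_min r10.
have sub_mono (Z : V -> R) (s h : R) : r <= s -> lap_sub Z s h -> lap_sub Z r h.
  move=> rs hZ x p X Xs xr; apply: hZ => //; apply: lt_le_trans xr _.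
  by rewrite ler_pXn2r// nnegrE ltW// (lt_le_trans r0).
apply: (lap_sub_add N0 r0 (sup_conv_lip cK1 a0 ala Um r0) (sup_conv_lip cK2 a0 ala Wm r0)).
- by apply: sub_mono sU; rewrite ge_min lexx.
- by apply: sub_mono sW; rewrite ge_min lexx orbT.
- move=> e _; have [Km -> _] := Um e; have [Km' -> _] := Wm e.
  rewrite qf_mul qfD qf_scalar mul_mx_row.
  have h := hA _ _ Km Km'.
  pose w := row_mx (e *m sg) (e *m ta); pose d := row_mx (m e - e *m sg) (m' e - e *m ta).
  have wd : row_mx (m e) (m' e) = w + d by rewrite /w /d add_row_mx !subrKC.
  have dd : dot d d = dot (m e - e *m sg) (m e - e *m sg) + dot (m' e - e *m ta) (m' e - e *m ta).
    by rewrite dot_row_mx.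
  have := bA w d; rewrite -wd => hwd.
  rewrite -/w; have -> : dot w w = enorm w ^+ 2 by rewrite enorm_sq.
  (* Here [d] is the deviation of the maximizers from w = (e sg, e ta). The penalty la |d|^2 leaves
     (la - a) |d|^2 against the mixed term 2 a |w| |d|; completing the square bounds the remainder
     by a multiple of |w|^2. *)
  have amgm : 2 * a * (enorm w * enorm d) <= a ^+ 2 / (la - a) * enorm w ^+ 2 + (la - a) * enorm d ^+ 2.
    rewrite -subr_ge0.
    have -> : a ^+ 2 / (la - a) * enorm w ^+ 2 + (la - a) * enorm d ^+ 2 -
        2 * a * (enorm w * enorm d) = (a * enorm w - (la - a) * enorm d) ^+ 2 / (la - a).
      by field; rewrite gt_eqF.
    by rewrite divr_ge0 ?sqr_ge0// ltW.
  rewrite [enorm d ^+ 2]enorm_sq dd in amgm; rewrite dd in hwd; lra.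
- by rewrite addr_ge0 ?(sup_conv0 K10 al0 Um) ?(sup_conv0 K20 be0 Wm).
Qed.

Lemma bounded_form_ex M (A : 'M[R]_M) : exists2 a, 0 < a & bounded_form A a.
Proof.
have [K K0 hK] := norm_mulmx (A + A^T); have [Q Q0 hQ] := qf_le A.
pose k := (M%:R + 1) * K; have k0 : 0 < k by rewrite mulr_gt0// ltr_wpDl.
exists (k + Q); first by rewrite addr_gt0.
move=> w d.
have -> : qf A (w + d) = qf A w + dot (w *m (A + A^T)) d + qf A d.
  rewrite /qf mulmxDl mulmxDr !dotDl !dotDr.
  have -> : dot (w *m A^T) d = dot (d *m A) w by rewrite dot_mull trmxK dotC.
  by ring.
have h1 : dot (w *m (A + A^T)) d <= k * (enorm w * enorm d).
  apply: le_trans (ler_norm _) _; apply: le_trans (dot_enorm _ _) _.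
  rewrite mulrA ler_wpM2r ?enorm_ge0//; apply: le_trans (enorm_le_norm _) _.
  rewrite -mulrA ler_pM2l ?ltr_wpDl//; apply: le_trans (hK _) _.
  by rewrite ler_pM2l// norm_le_enorm.
have h2 := le_trans (ler_norm _) (hQ d).
have d0 := dot_ge0 d; have wd : 0 <= enorm w * enorm d by rewrite mulr_ge0 ?enorm_ge0.
have : 0 <= k * (enorm w * enorm d) by rewrite mulr_ge0// ltW.
have : 0 <= Q * (enorm w * enorm d) by rewrite mulr_ge0// ltW.
have : 0 <= k * dot d d by rewrite mulr_ge0// ltW.
by move=> *; lra.
Qed.

End coupling.

Lemma closed_normP (R : realType) (V : normedModType R) (A : set V) :
  closed A <-> forall x, (forall e : R, 0 < e -> exists2 y, A y & `|y - x| < e) -> A x.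
Proof.
split=> [cA x h|h x clx].
  apply: cA => B /nbhs_normP[e /= e0 hB]; have [y Ay yx] := h _ e0.
  by exists y; split => //; apply: hB; rewrite /= distrC.
apply: h => e e0; have [|y [Ay yx]] := clx (ball x e); first exact: nbhsx_ballx.
by exists y => //; rewrite distrC; move: yx; rewrite -ball_normE.
Qed.

Lemma ler_linear_perturb (R : realType) (F T K : R) :
  (forall s : R, 0 < s -> s <= 1 -> F <= T + s * K) -> F <= T.
Proof.
move=> h; rewrite leNgt; apply/negP => TF.
pose k := `|K| + 1; have k0 : 0 < k by rewrite ltr_wpDl.
pose s := Num.min 1 ((F - T) / k / 2).
have s0 : 0 < s by rewrite lt_min ltr01 !divr_gt0// subr_gt0.
have s1 : s <= 1 by rewrite ge_min lexx.
have s2 : s * k <= (F - T) / 2.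
  by rewrite -ler_pdivlMr// mulrAC ge_min lexx orbT.
have := h _ s0 s1; have := ler_norm K; rewrite /k in s2.
have : s * K <= s * `|K| by rewrite ler_pM2l// ler_norm.
lra.
Qed.

(** * Projections orthogonal to the gradient *)

Section unit_vectors.
Variables (R : realType).

Definition uvec n (p : 'rV[R]_n) : 'rV[R]_n := (enorm p)^-1 *: p.

Lemma enorm_uvec n (p : 'rV[R]_n) : p != 0 -> enorm (uvec p) = 1.
Proof.
move=> p0; rewrite enormZ ger0_norm ?invr_ge0 ?enorm_ge0// mulVf//.
by rewrite enorm_eq0.
Qed.

Lemma dot_uvec n (p : 'rV[R]_n) : p != 0 -> dot (uvec p) (uvec p) = 1.
Proof. by move=> /enorm_uvec h; rewrite -enorm_sq h expr1n. Qed.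

Lemma ler_dist_enorm n (p q : 'rV[R]_n) : `|enorm p - enorm q| <= enorm (p - q).
Proof.
have h (a b : 'rV[R]_n) : enorm a - enorm b <= enorm (a - b).
  by rewrite lerBlDr -{1}[a](subrK b) enormD.
rewrite ler_norml h andbT lerNl opprB enormBC; exact: h.
Qed.

Lemma uvec_dist n (p q : 'rV[R]_n) : p != 0 -> q != 0 ->
  enorm (uvec p - uvec q) <= 2 * enorm (p - q) / enorm p.
Proof.
move=> p0 q0; have ep := enorm_gt0 p0; have eq := enorm_gt0 q0.
have -> : uvec p - uvec q = (enorm p)^-1 *: (p - q) + ((enorm p)^-1 - (enorm q)^-1) *: q.
  by rewrite /uvec scalerBr scalerBl addrA subrK.
apply: le_trans (enormD _ _) _; rewrite !enormZ.
rewrite [`|(enorm p)^-1|]ger0_norm ?invr_ge0 ?enorm_ge0//.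
have -> : (enorm p)^-1 - (enorm q)^-1 = (enorm q - enorm p) / (enorm p * enorm q).
  by field; rewrite !gt_eqF.
rewrite normrM [`|_^-1|]gtr0_norm ?invr_gt0 ?mulr_gt0//.
have -> : `|enorm q - enorm p| / (enorm p * enorm q) * enorm q = `|enorm q - enorm p| / enorm p.
  by field; rewrite !gt_eqF.
rewrite mulrC -mulrDl ler_pM2r ?invr_gt0//.
have := ler_dist_enorm q p; rewrite enormBC; lra.
Qed.

(** Tested on e_i + e_j and e_i - e_j. On positive semidefinite matrices the trace thus controls
    every entry, so errors from freezing the gradient are proportional to the trace and can be
    absorbed by it. *)
Lemma psd_entry n (Z : 'M[R]_n) i j : Z^T = Z -> (forall d, 0 <= qf Z d) ->
  `|Z i j| <= \tr Z.
Proof.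
move=> Zs Z0; have dg k : 0 <= Z k k by rewrite -qf_delta.
have zij : Z j i = Z i j by rewrite -[in RHS]Zs mxE.
have e (s : R) : qf Z (delta_mx 0 i + s *: delta_mx 0 j) = Z i i + 2 * s * Z i j + s ^+ 2 * Z j j.
  rewrite /qf mulmxDl -scalemxAl -!rowE !(dotDl, dotDr, dotZl, dotZr) !dot_delta !mxE zij.
  by ring.
have [<-|ij] := eqVneq i j.
  rewrite ger0_norm// /mxtrace (bigD1 i)//= lerDl.
  by apply: sumr_ge0 => k _.
have tr : Z i i + Z j j <= \tr Z.
  rewrite /mxtrace (bigD1 i)//= (bigD1 j) 1?eq_sym//= addrA lerDl.
  by apply: sumr_ge0 => k _.
have := Z0 (delta_mx 0 i + 1 *: delta_mx 0 j); have := Z0 (delta_mx 0 i + (-1) *: delta_mx 0 j).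
rewrite !e ler_norml; have := dg i; have := dg j; lra.
Qed.

Lemma psd_qf_dist n (Z : 'M[R]_n) v w : Z^T = Z -> (forall d, 0 <= qf Z d) ->
  enorm v = 1 -> enorm w = 1 ->
  `|qf Z v - qf Z w| <= 2 * n%:R ^+ 2 * enorm (v - w) * \tr Z.
Proof.
move=> Zs Z0 v1 w1.
have -> : qf Z v - qf Z w = dot ((v - w) *m Z) (v + w).
  rewrite /qf mulmxBl dotBl !dotDr.
  have -> : dot (w *m Z) v = dot (v *m Z) w by rewrite dot_mull Zs dotC.
  by ring.
apply: le_trans (dot_norm_le _ _) _.
have -> : 2 * n%:R ^+ 2 * enorm (v - w) * \tr Z = n%:R * (n%:R * enorm (v - w) * \tr Z * 2) by ring.
rewrite ler_wpM2l//.
have t0 : 0 <= \tr Z by exact: trace_ge0.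
apply: ler_pM => //.
  apply: norm_leP => [|j]; first by rewrite !mulr_ge0 ?enorm_ge0.
  rewrite mxE; apply: le_trans (ler_norm_sum _ _ _) _.
  apply: (@le_trans _ _ (\sum_(i < n) enorm (v - w) * \tr Z)).
    apply: ler_sum => i _; rewrite normrM ler_pM// ?psd_entry//.
    exact: le_trans (coord_norm _ _) (norm_le_enorm _).
  by rewrite sumr_const card_ord -[leLHS]mulr_natl mulrA.
apply: le_trans (norm_le_enorm _) _; apply: le_trans (enormD _ _) _.
by rewrite v1 w1; lra.
Qed.

Definition ortho_proj n (p : 'rV[R]_n) : 'M[R]_n := 1%:M - (uvec p)^T *m uvec p.

Lemma trmx_proj n (p : 'rV[R]_n) : (ortho_proj p)^T = ortho_proj p.
Proof. by rewrite /ortho_proj linearB/= trmx1 trmx_mul trmxK. Qed.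

Lemma proj_idem n (p : 'rV[R]_n) : p != 0 -> ortho_proj p *m ortho_proj p = ortho_proj p.
Proof.
move=> p0; rewrite {2}/ortho_proj mulmxBr mulmx1 {1}/ortho_proj mulmxBl mul1mx.
suff -> : (uvec p)^T *m uvec p *m ((uvec p)^T *m uvec p) = (uvec p)^T *m uvec p.
  by rewrite subrr subr0.
rewrite mulmxA -[_ *m uvec p *m _]mulmxA.
have -> : uvec p *m (uvec p)^T = 1%:M by rewrite [LHS]mx11_scalar -dotE dot_uvec.
by rewrite mulmx1.
Qed.

Lemma tr_proj_mul n (p : 'rV[R]_n) (Z : 'M[R]_n) : \tr (ortho_proj p *m Z) = \tr Z - qf Z (uvec p).
Proof.
rewrite /ortho_proj mulmxBl mul1mx linearB/=; congr (_ - _).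
by rewrite -mulmxA mxtrace_mulC /mxtrace big_ord1 -dotE /qf.
Qed.

Lemma mulmx_proj n (p d : 'rV[R]_n) : d *m ortho_proj p = d - dot d (uvec p) *: uvec p.
Proof.
rewrite /ortho_proj mulmxBr mulmx1 mulmxA; congr (_ - _).
by rewrite [d *m _]mx11_scalar -dotE mul_scalar_mx.
Qed.

(** Annihilates the gradient direction and also the time direction, in which the equation has no
    second derivative. The shift by [s%:M] restores invertibility in both. *)
Definition stproj n (p : 'rV[R]_n) : 'M[R]_(n + 1) := block_mx (ortho_proj p) 0 0 0.

Lemma trmx_stproj n (p : 'rV[R]_n) : (stproj p)^T = stproj p.
Proof. by rewrite /stproj tr_block_mx trmx_proj !trmx0. Qed.

Lemma stproj_idem n (p : 'rV[R]_n) : p != 0 -> stproj p *m stproj p = stproj p.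
Proof.
by move=> p0; rewrite /stproj mulmx_block !mulmx0 !mul0mx !addr0 proj_idem.
Qed.

Lemma tr_stproj_mul n (p : 'rV[R]_n) (Y : 'M[R]_(n + 1)) :
  \tr (stproj p *m Y) = \tr (ulsubmx Y) - qf (ulsubmx Y) (uvec p).
Proof.
rewrite -{1}[Y]submxK /stproj mulmx_block !mul0mx !addr0 mxtrace_block mxtrace0 addr0.
exact: tr_proj_mul.
Qed.

Lemma tr_psd_congr m n (L : 'M[R]_(m, n)) (Y : 'M[R]_n) : (forall d, 0 <= qf Y d) ->
  0 <= \tr (L *m Y *m L^T).
Proof. by move=> Y0; rewrite qf_row sumr_ge0. Qed.

Lemma stproj_unit n (p : 'rV[R]_n) (s : R) : p != 0 -> 0 < s ->
  stproj p + s%:M \in unitmx.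
Proof.
move=> p0 s0.
have : (stproj p + s%:M) *m (s^-1 *: (1%:M - (1 + s)^-1 *: stproj p)) = 1%:M.
  have s1 : 1 + s != 0 by rewrite gt_eqF// addr_gt0.
  rewrite -scalemxAr mulmxBr mulmx1 -scalemxAr mulmxDl stproj_idem// mul_scalar_mx.
  rewrite -{2}[stproj p]scale1r -scalerDl scalerA mulVf// scale1r addrC addKr.
  by rewrite scale_scalar_mx mulVf// gt_eqF.
by move/mulmx1_unit => [].
Qed.

(* (P + s)^2 >= P + s^2 dominates the projections at nearby gradients, so that the
   p-dependent operator can be replaced by one with a constant matrix. *)
Lemma tr_stproj_shift n (p p' : 'rV[R]_n) (Y : 'M[R]_(n + 1)) (s : R) :
  p != 0 -> p' != 0 -> 0 < s -> Y^T = Y -> (forall d, 0 <= qf Y d) ->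
  2 * n%:R ^+ 2 * enorm (uvec p - uvec p') <= s ^+ 2 ->
  \tr (ulsubmx Y) - qf (ulsubmx Y) (uvec p') <=
  \tr ((stproj p + s%:M) *m Y *m (stproj p + s%:M)^T).
Proof.
move=> p0 p'0 s0 Ys Y0 close.
have Zs : (ulsubmx Y)^T = ulsubmx Y by rewrite trmx_ulsub Ys.
have qul d : qf (ulsubmx Y) d = qf Y (row_mx d 0).
  rewrite /qf -{2}[Y]submxK mul_row_block !mul0mx !addr0 dot_row_mx.
  by rewrite dot0r addr0.
have Z0 d : 0 <= qf (ulsubmx Y) d by rewrite qul.
have trZ : \tr (ulsubmx Y) <= \tr Y.
  rewrite -[Y in leRHS]submxK mxtrace_block lerDl; apply: trace_ge0 => d.
  suff -> : qf (drsubmx Y) d = qf Y (row_mx 0 d) by [].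
  by rewrite /qf -{2}[Y]submxK mul_row_block !mul0mx !add0r dot_row_mx dot0r add0r.
have t0 := trace_ge0 Z0.
have h := psd_qf_dist Zs Z0 (enorm_uvec p0) (enorm_uvec p'0).
have {}h : qf (ulsubmx Y) (uvec p) - qf (ulsubmx Y) (uvec p') <= s ^+ 2 * \tr Y.
  apply: le_trans (ler_norm _) _; apply: le_trans h _.
  by apply: ler_pM => //; rewrite !mulr_ge0 ?enorm_ge0 ?sqr_ge0.
have PP : 0 <= \tr (stproj p *m Y).
  have -> : \tr (stproj p *m Y) = \tr (stproj p *m Y *m (stproj p)^T).
    by rewrite trmx_stproj [RHS]mxtrace_mulC mulmxA stproj_idem.
  exact: tr_psd_congr.
have -> : \tr ((stproj p + s%:M) *m Y *m (stproj p + s%:M)^T) =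
    \tr (stproj p *m Y) + 2 * s * \tr (stproj p *m Y) + s ^+ 2 * \tr Y.
  rewrite linearD/= trmx_stproj tr_scalar_mx mulmxDl mul_scalar_mx.
  rewrite mulmxDr !mulmxDl !mul_mx_scalar !mxtraceD -!scalemxAl !mxtraceZ.
  have -> : \tr (stproj p *m Y *m stproj p) = \tr (stproj p *m Y).
    by rewrite mxtrace_mulC mulmxA stproj_idem.
  rewrite (mxtrace_mulC Y); ring.
rewrite tr_stproj_mul in PP *.
have : 0 <= 2 * s * (\tr (ulsubmx Y) - qf (ulsubmx Y) (uvec p)).
  by rewrite mulr_ge0// mulr_ge0// ltW.
lra.
Qed.

End unit_vectors.

(** * Space-time points as row vectors *)

Section spacetime_rows.
Variables (R : realType) (n : nat).
Local Notation V := 'rV[R]_n.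
Local Notation Z := 'rV[R]_(n + 1).

Definition strow (y : V) (s : R) : Z := row_mx y s%:M.
Definition spart (h : Z) : V := lsubmx h.
Definition tpart (h : Z) : R := rsubmx h 0 0.

Lemma strowK h : strow (spart h) (tpart h) = h.
Proof. by rewrite /strow /tpart -mx11_scalar hsubmxK. Qed.

Lemma spart_strow y s : spart (strow y s) = y.
Proof. by rewrite /spart /strow row_mxKl. Qed.

Lemma tpart_strow y s : tpart (strow y s) = s.
Proof. by rewrite /tpart /strow row_mxKr mxE eqxx mulr1n. Qed.

Lemma spartD h k : spart (h + k) = spart h + spart k.
Proof. by rewrite /spart linearD. Qed.

Lemma tpartD h k : tpart (h + k) = tpart h + tpart k.
Proof. by rewrite /tpart linearD/= mxE. Qed.

Lemma spart0 : spart 0 = 0. Proof. by rewrite /spart linear0. Qed.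
Lemma tpart0 : tpart 0 = 0. Proof. by rewrite /tpart linear0 mxE. Qed.

Lemma spartB h k : spart (h - k) = spart h - spart k.
Proof. by rewrite /spart linearB. Qed.

Lemma tpartB h k : tpart (h - k) = tpart h - tpart k.
Proof. by rewrite /tpart linearB/= !mxE. Qed.

Lemma norm_spart h : `|spart h| <= `|h|.
Proof. by apply: norm_leP => // i; rewrite mxE; exact: coord_norm. Qed.

Lemma norm_tpart h : `|tpart h| <= `|h|.
Proof. by rewrite /tpart mxE; exact: coord_norm. Qed.

Lemma norm_strow y s e : 0 <= e -> `|y| <= e -> `|s| <= e -> `|strow y s| <= e.
Proof.
move=> e0 ye se; apply: norm_leP => // i.
rewrite mxE; case: (fintype.split i) => j; last by rewrite mxE (ord1 j) eqxx.
exact: le_trans (coord_norm _ _) ye.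
Qed.

Lemma norm_strow_lt y s e : `|y| < e -> `|s| < e -> `|strow y s| < e.
Proof.
move=> ye se; apply: (@le_lt_trans _ _ (Num.max `|y| `|s|)).
  by apply: norm_strow; rewrite le_max ?normr_ge0 ?lexx ?orbT.
by rewrite gt_max ye.
Qed.

Lemma dot_strow y s h : dot (strow y s) h = dot y (spart h) + s * tpart h.
Proof.
by rewrite -{1}[h]strowK dot_row_mx; congr (_ + _); rewrite /dot big_ord1 !mxE !eqxx.
Qed.

Lemma dot_split (h k : Z) : dot h k = dot (spart h) (spart k) + tpart h * tpart k.
Proof. by rewrite -{1}[h]strowK dot_strow. Qed.

(** A space-time Hessian has mixed terms, whereas [subsol] tests with a spatial matrix and a scalar
    [b] for time. The mixed terms are split between [e] in space and a large [b], and [b] does not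
    enter the conclusions of [subsol]. *)
Lemma qf_strow_le (X : 'M[R]_(n + 1)) (e : R) : 0 < e ->
  exists b : R, forall d, qf X d <= qf (ulsubmx X + e%:M) (spart d) + b * tpart d ^+ 2.
Proof.
move=> e0.
pose v := (ursubmx X)^T + dlsubmx X; pose b := dot v v / e + drsubmx X 0 0.
exists b => d; rewrite qfD qf_scalar -{1}[d]strowK.
have -> : qf X (strow (spart d) (tpart d)) = qf (ulsubmx X) (spart d) +
    tpart d * dot v (spart d) + drsubmx X 0 0 * tpart d ^+ 2.
  rewrite /qf /strow -{1}[X]submxK mul_row_block dot_row_mx !dotDl !mul_scalar_mx !dotZl.
  have -> : dot (spart d *m ursubmx X) (tpart d)%:M = tpart d * dot (ursubmx X)^T (spart d).
    by rewrite dot_mull -scalemx1 -scalemxAl mul1mx dotZr dotC.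
  have -> : dot (drsubmx X) (tpart d)%:M = drsubmx X 0 0 * tpart d.
    by rewrite /dot big_ord1 !mxE eqxx.
  ring.
rewrite -!addrA lerD2l /b mulrDl addrA lerD2r.
have := dot_ge0 (e *: spart d - tpart d *: v).
rewrite dotBl !dotBr !dotZl !dotZr (dotC (spart d) v) => h.
rewrite -(ler_pM2l e0) !mulrDr.
have -> : e * (dot v v / e * tpart d ^+ 2) = dot v v * tpart d ^+ 2 by field; rewrite gt_eqF.
have := mulr_ge0 (ltW e0) (dot_ge0 (spart d)).
have := mulr_ge0 (sqr_ge0 (tpart d)) (dot_ge0 v).
move: h; have := sqr_ge0 (tpart d); nra.
Qed.

End spacetime_rows.

(** * Subsolutions tested by quadratic polynomials *)

Section subsolutions.
Variables (R : realType) (n : nat).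
Local Notation V := 'rV[R]_n.
Local Notation Z := 'rV[R]_(n + 1).
Variables (D B : set V) (nu : V -> V).
Implicit Types (c : V -> R) (u w : V * R -> R).

(* Viscosity subsolutions of u_t = tr((I - p p/|p|^2) D^2 u) + c |p|, tested only
   by quadratic polynomials that touch locally and whose gradient points strictly
   outwards if the contact point is on the boundary B. *)
Definition subsol c (C : R) u : Prop := forall x t p X tau b, D x -> 0 < t -> X^T = X ->
  (exists2 de : R, 0 < de & forall y s, D y -> 0 <= s -> `|y - x| < de -> `|s - t| < de ->
     u (y, s) <= u (x, t) + dot p (y - x) + 2^-1 * qf X (y - x)
       + tau * (s - t) + b * (s - t) ^+ 2) ->
  (B x -> 0 < dot p (nu x)) ->
  (p != 0 -> tau <= \tr X - qf X (uvec p) + c x * enorm p) /\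
  tau <= C * (\sum_i \sum_j `|X i j| + enorm p).

Definition st_cont u : Prop := forall x t, D x -> 0 <= t -> forall e : R, 0 < e ->
  exists2 de : R, 0 < de & forall y s, D y -> 0 <= s -> `|y - x| < de -> `|s - t| < de ->
    `|u (y, s) - u (x, t)| < e.

Definition st_nbhd x t (r : R) : set Z :=
  [set h | [/\ `|h| <= r, D (x + spart h) & 0 <= t + tpart h]].

Lemma compact_st_nbhd x t r : closed D -> compact (st_nbhd x t r).
Proof.
move=> cD; apply: bounded_closed_compact.
  exists r; split; first exact: num_real.
  by move=> M rM h [hr _ _]; exact: le_trans hr (ltW rM).
apply/closed_normP => h hK; split.
- apply/ler_addgt0Pl => e e0; have [k [kr _ _] kh] := hK _ e0.
  rewrite -[h](subKr k) (le_trans (ler_normB _ _))// addrC lerD//.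
  exact: ltW.
- apply/(closed_normP D).1 => // e e0; have [k [_ Dk _] kh] := hK _ e0.
  exists (x + spart k) => //; rewrite opprD addrACA subrr add0r -spartB.
  exact: le_lt_trans (norm_spart _) kh.
- apply/ler_addgt0Pl => e e0; have [k [_ _ tk] kh] := hK _ e0.
  apply: le_trans tk _; rewrite addrCA lerD2l.
  rewrite -lerBlDr -tpartB (le_trans (ler_norm _))// (le_trans (norm_tpart _))//.
  exact: ltW.
Qed.

Definition st_shift u x t (p : V) (tau : R) (h : Z) : R :=
  u (x + spart h, t + tpart h) - u (x, t) - dot (strow p tau) h.

Lemma st_shift0 u x t p tau : st_shift u x t p tau 0 = 0.
Proof. by rewrite /st_shift spart0 tpart0 !addr0 subrr dot0r subrr. Qed.

Lemma cont_on_st u x t r : st_cont u ->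
  cont_on (st_nbhd x t r) (fun h => u (x + spart h, t + tpart h)).
Proof.
move=> cu h [_ Dh th] e e0; have [de de0 hde] := cu _ _ Dh th _ e0.
exists de => // k [_ Dk tk] kh; apply: hde => //.
  rewrite opprD addrACA subrr add0r -spartB.
  exact: le_lt_trans (norm_spart _) kh.
rewrite opprD addrACA subrr add0r -tpartB.
exact: le_lt_trans (norm_tpart _) kh.
Qed.

Lemma cont_on_st_shift u x t p tau r : st_cont u ->
  cont_on (st_nbhd x t r) (st_shift u x t p tau).
Proof.
move=> cu; apply: cont_onB.
  by apply: cont_onB; [exact: cont_on_st|exact: cont_on_cst].
apply: cont_on_continuous => h; apply: jet2_continuous; exact: jet2_dot.
Qed.

(* Near a point where the gradient p does not vanish, the equation is replaced by
   an inequality with the constant matrix stproj p + s. *)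
Lemma subsol_frozen c C u x t p tau (la s r : R) :
  (forall y, D y -> forall e : R, 0 < e -> exists2 de : R, 0 < de &
     forall z, D z -> `|z - y| < de -> `|c z - c y| < e) ->
  subsol c C u -> D x -> 0 < t -> p != 0 -> 0 < la -> 0 < s -> 0 < r ->
  (forall y, B y -> enorm (nu y) <= 1) ->
  (exists2 m : R, 0 < m & exists2 de : R, 0 < de &
     forall y, B y -> `|y - x| < de -> m <= dot p (nu y)) ->
  exists2 rho : R, 0 < rho & forall rho', 0 < rho' -> rho' <= rho ->
  forall h q X, st_nbhd x t r h -> `|h| < rho' -> `|q| < rho' -> X^T = X ->
    (forall d, - la * dot d d <= qf X d) ->
    (exists2 de : R, 0 < de & forall d, `|d| < de -> st_nbhd x t r (h + d) ->
       st_shift u x t p tau (h + d) <= st_shift u x t p tau h + dot q d + 2^-1 * qf X d) ->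
    tau - c x * enorm p - s - la * (2 * s * n%:R + s ^+ 2 * (n%:R + 1)) <=
    \tr ((stproj p + s%:M) *m X *m (stproj p + s%:M)^T).
Proof.
move=> cc su Dx t0 p0 la0 s0 r0 nu1 [m m0 [de1 de10 hm]].
have ep := enorm_gt0 p0.
have n1 : (0 : R) < n%:R + 1 by rewrite ltr_wpDl.
have s40 : 0 < s / (4 * (enorm p + 1)) by rewrite divr_gt0// mulr_gt0// ltr_wpDl// ltW.
have [de2 de20 hc] := cc _ Dx _ s40.
pose cx := `|c x| + 1; have cx0 : 0 < cx by rewrite ltr_wpDl.
(* Radius for the perturbed gradient p': the entries keep p' away from 0, keep it pointing outwards,
   bound the change of c |p|, and bring its projection within the tolerance of [tr_stproj_shift]. *)
pose e0 := Num.min (Num.min (enorm p / 2) (m / 2))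
  (Num.min (s / (4 * cx)) (Num.min 1 (s ^+ 2 * enorm p / (4 * (n%:R + 1) ^+ 2)))).
have e00 : 0 < e0.
  by rewrite !lt_min !divr_gt0// ?mulr_gt0 ?exprn_gt0// ltr01.
pose rho := Num.min (Num.min (t / 2) (Num.min de1 de2)) (Num.min (Num.min (s / 4) r) (e0 / (n%:R + 1))).
exists rho; first by rewrite !lt_min !divr_gt0// de10 de20 r0.
move=> rho' rho'0 rho'rho h q X [hr Dh th] hrho qrho Xs Xla [de de0 touch].
have {}hrho : `|h| < rho by exact: lt_le_trans hrho rho'rho.
have {}qrho : `|q| < rho by exact: lt_le_trans qrho rho'rho.
move: hrho qrho; rewrite !lt_min => /andP[/andP[h1 /andP[h2 h3]] /andP[/andP[h4 h5] h6]].
move=> /andP[/andP[q1 /andP[q2 q3]] /andP[/andP[q4 q5] q6]].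
pose p' := p + spart q; pose tau' := tau + tpart q.
have pp' : enorm (p' - p) <= e0.
  rewrite /p' addrC addKr; apply: le_trans (enorm_le_norm _) _.
  rewrite mulrC -ler_pdivlMr//; apply: le_trans (norm_spart _) (ltW q6).
move: (pp'); rewrite !le_min => /andP[/andP[pp1 pp2] /andP[pp3 /andP[pp4 pp5]]].
have ep' : enorm p / 2 <= enorm p'.
  by have := ler_dist_enorm p' p; rewrite ler_norml => /andP[? _]; lra.
have p'0 : p' != 0.
  by rewrite -enorm_eq0 gt_eqF// (lt_le_trans _ ep')// divr_gt0.
have t'0 : 0 < t + tpart h.
  by have := le_lt_trans (norm_tpart h) h1; rewrite ltr_norml => /andP[]; lra.
(* The mixed space-time terms of [X] cost [e] in the spatial Hessian; this is removed by e -> 0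
   right after. *)
have key (e : R) : 0 < e -> tau' <= \tr (ulsubmx X + e%:M) - qf (ulsubmx X + e%:M) (uvec p')
    + c (x + spart h) * enorm p'.
  move=> ee0; have [b hb] := qf_strow_le X ee0.
  have [] // := su _ _ p' (ulsubmx X + e%:M) tau' (2^-1 * b) Dh t'0.
  - by rewrite linearD/= trmx_ulsub Xs tr_scalar_mx.
  - exists (Num.min de (r - `|h|)); first by rewrite lt_min de0 subr_gt0.
    move=> y z Dy z0; rewrite !lt_min => /andP[y1 y2] /andP[z1 z2].
    pose d := strow (y - (x + spart h)) (z - (t + tpart h)).
    have dd : `|d| < de by exact: norm_strow_lt.
    have dr : `|d| < r - `|h| by exact: norm_strow_lt.
    have sd : x + spart (h + d) = y by rewrite spartD spart_strow addrA subrKC.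
    have td : t + tpart (h + d) = z by rewrite tpartD tpart_strow addrA subrKC.
    have hd : st_nbhd x t r (h + d).
      split; rewrite ?sd ?td//; apply: le_trans (ler_normD _ _) _; lra.
    have := touch _ dd hd; rewrite /st_shift sd td dotDr.
    have := hb d; rewrite spart_strow tpart_strow => hbd.
    rewrite (dot_strow p tau d) [dot q d]dot_split spart_strow tpart_strow /p' dotDl /tau'; lra.
  - move=> By; have hnu := nu1 _ By.
    have hy : `|x + spart h - x| < de1.
      by rewrite addrC addKr (le_lt_trans (norm_spart _)).
    have hmy := hm _ By hy.
    have := dot_enorm (p' - p) (nu (x + spart h)); rewrite ler_norml => /andP[dl _].
    have -> : p' = (p' - p) + p by rewrite subrK.
    have : enorm (p' - p) * enorm (nu (x + spart h)) <= m / 2 * 1.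
      by apply: ler_pM => //; exact: enorm_ge0.
    rewrite dotDl; lra.
  - by move=> /(_ p'0).
have {}key : tau' <= \tr (ulsubmx X) - qf (ulsubmx X) (uvec p') + c (x + spart h) * enorm p'.
  apply: (ler_linear_perturb (K := n%:R)) => e ee0 _; apply: le_trans (key _ ee0) _.
  rewrite mxtraceD mxtrace_scalar qfD qf_scalar dot_uvec// mulr1 -mulr_natr; lra.
(* The lower bound on [X] given by sup-convolution makes [Y] positive semidefinite, as
   [tr_stproj_shift] requires. Undoing the shift produces la (n - 1) on both sides, and only terms
   that vanish with [s] remain. *)
pose Y := X + la%:M.
have Ys : Y^T = Y by rewrite /Y linearD/= Xs tr_scalar_mx.
have Y0 d : 0 <= qf Y d by rewrite /Y qfD qf_scalar; have := Xla d; lra.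
have close : 2 * n%:R ^+ 2 * enorm (uvec p - uvec p') <= s ^+ 2.
  have := uvec_dist p0 p'0; rewrite [enorm (p - p')]enormBC => ud.
  have u0 : 0 <= enorm (uvec p - uvec p') := enorm_ge0 _.
  apply: (@le_trans _ _ (2 * (n%:R + 1) ^+ 2 * (2 * e0 / enorm p))).
    apply: ler_pM => //.
      by rewrite ler_pM2l// ler_pXn2r ?nnegrE ?lerDl// ltW.
    by apply: le_trans ud _; rewrite ler_pM2r ?invr_gt0// ler_pM2l.
  have : e0 <= s ^+ 2 * enorm p / (4 * (n%:R + 1) ^+ 2) by rewrite !ge_min lexx !orbT.
  rewrite ler_pdivlMr ?mulr_gt0 ?exprn_gt0// => hh.
  by rewrite mulrA ler_pdivrMr//; lra.
have shift := tr_stproj_shift p0 p'0 s0 Ys Y0 close.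
have trX : \tr (ulsubmx X) - qf (ulsubmx X) (uvec p') =
    \tr (ulsubmx Y) - qf (ulsubmx Y) (uvec p') - la * (n%:R - 1).
  have -> : ulsubmx Y = ulsubmx X + la%:M by rewrite /Y scalar_mx_block -{1}[X]submxK add_block_mx block_mxKul.
  rewrite mxtraceD mxtrace_scalar qfD qf_scalar dot_uvec// -mulr_natr; ring.
have trP : \tr (stproj p : 'M[R]_(n + 1)) = n%:R - 1.
  rewrite -[stproj p]mulmx1 tr_stproj_mul scalar_mx_block block_mxKul.
  by rewrite mxtrace_scalar qf_scalar dot_uvec// mulr1.
have trS : \tr ((stproj p + s%:M) *m X *m (stproj p + s%:M)^T) =
    \tr ((stproj p + s%:M) *m Y *m (stproj p + s%:M)^T)
    - la * (n%:R - 1 + 2 * s * (n%:R - 1) + s ^+ 2 * (n%:R + 1)).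
  rewrite /Y mulmxDr mulmxDl mxtraceD mul_mx_scalar -scalemxAl mxtraceZ.
  have -> : \tr ((stproj p + s%:M) *m (stproj p + s%:M)^T) =
      n%:R - 1 + 2 * s * (n%:R - 1) + s ^+ 2 * (n%:R + 1).
    rewrite linearD/= trmx_stproj tr_scalar_mx mulmxDl !mulmxDr stproj_idem//.
    rewrite mul_scalar_mx mul_mx_scalar mul_scalar_mx !mxtraceD !mxtraceZ trP mxtrace_scalar.
    by rewrite -[s *+ _]mulr_natr natrD; ring.
  by ring.
have cdiff : `|c (x + spart h) * enorm p' - c x * enorm p| <= s / 2.
  have -> : c (x + spart h) * enorm p' - c x * enorm p =
    (c (x + spart h) - c x) * enorm p' + c x * (enorm p' - enorm p) by ring.
  apply: le_trans (ler_normD _ _) _; rewrite !normrM.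
  have hx : `|x + spart h - x| < de2 by rewrite addrC addKr (le_lt_trans (norm_spart _)).
  have := ltW (hc _ Dh hx); rewrite ler_pdivlMr ?mulr_gt0 ?ltr_wpDl ?(ltW ep)// => hcx.
  have e1 : `|enorm p'| <= enorm p + 1.
    have := ler_dist_enorm p' p; rewrite ler_norml => /andP[_ ?].
    by rewrite ger0_norm ?enorm_ge0//; lra.
  have a1 : `|c (x + spart h) - c x| * `|enorm p'| <= s / 4.
    apply: (@le_trans _ _ (`|c (x + spart h) - c x| * (enorm p + 1))); first by rewrite ler_wpM2l.
    by move: hcx; set k := `|_ - _|; nra.
  have a2 : `|c x| * `|enorm p' - enorm p| <= s / 4.
    apply: (@le_trans _ _ (cx * (s / (4 * cx)))); last first.
      by rewrite le_eqVlt; apply/orP; left; apply/eqP; field; rewrite gt_eqF.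
    apply: ler_pM => //; first by rewrite /cx lerDl.
    exact: le_trans (ler_dist_enorm _ _) pp3.
  lra.
have tq : `|tpart q| <= s / 4 by exact: le_trans (norm_tpart _) (ltW q4).
move: tq cdiff; rewrite !ler_norml => /andP[tq _] /andP[_ cdiff].
rewrite trS; have : 0 <= la * (2 * s) by rewrite !mulr_ge0// ltW.
move: key shift; rewrite trX /tau'; set T1 := \tr _; set T2 := \tr _; set Q := qf _ _.
move: cdiff; set c1 := c _ * _; set c2 := c x * _ => *; lra.
Qed.

End subsolutions.

(** * The theorem on sums for the curvature operator *)

Section theorem_on_sums.
Variables (R : realType) (n : nat).
Local Notation V := 'rV[R]_n.
Local Notation Z := 'rV[R]_(n + 1).
Variables (D B : set V) (nu : V -> V).
Implicit Types (c : V -> R) (u w : V * R -> R).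

(** Uniform over the boundary points near [x], because sup-convolution moves the contact points. *)
Definition points_outward (p x : V) : Prop := exists2 m : R, 0 < m &
  exists2 de : R, 0 < de & forall y, B y -> `|y - x| < de -> m <= dot p (nu y).

Definition cont_coef c : Prop := forall y, D y -> forall e : R, 0 < e ->
  exists2 de : R, 0 < de & forall z, D z -> `|z - y| < de -> `|c z - c y| < e.

(** Instead of a pair of matrices ordered by [A], the conclusion gives the trace of [A] over the
    paired directions (v P, v Q). Along these the penalty has a small second derivative. *)
Theorem theorem_on_sums c c' (C C' : R) u w x t y s p q tau ka (A : 'M[R]_((n + 1) + (n + 1))) :
  closed D -> cont_coef c -> cont_coef c' -> (forall z, B z -> enorm (nu z) <= 1) ->
  subsol D B nu c C u -> subsol D B nu c' C' w -> st_cont D u -> st_cont D w ->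
  D x -> D y -> 0 < t -> 0 < s -> p != 0 -> q != 0 ->
  points_outward p x -> points_outward q y ->
  (forall e : R, 0 < e -> exists2 de : R, 0 < de & forall h k : Z, `|h| < de -> `|k| < de ->
     D (x + spart h) -> 0 <= t + tpart h -> D (y + spart k) -> 0 <= s + tpart k ->
     st_shift u x t p tau h + st_shift w y s q ka k <=
       2^-1 * qf A (row_mx h k) + e * dot (row_mx h k) (row_mx h k)) ->
  tau + ka - c x * enorm p - c' y * enorm q <=
  \tr (row_mx (stproj p) (stproj q) *m A *m (row_mx (stproj p) (stproj q))^T).
Proof.
move=> cD cc cc' nu1 su sw cu cw Dx Dy t0 s0 p0 q0 pp pq touch.
set Ps := row_mx _ _; set F := _ - _.
pose G := \tr (Ps *m Ps^T).
have n1 : (0 : R) < n%:R + 1 by rewrite ltr_wpDl.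
(* let the error e of the jet tend to 0 last *)
apply: (ler_linear_perturb (K := 2 * G)) => e e0 _.
have [de de0 hde] := touch _ e0.
pose Ae := A + (2 * e)%:M.
have [a a0 ba] := bounded_form_ex Ae.
(* the parameter a + 1/l of the sup-convolution tends to infinity *)
apply: (ler_linear_perturb (K := a ^+ 2 * G)) => l l0 _.
pose la := a + l^-1.
have ala : a < la by rewrite ltrDl invr_gt0.
have la0 : 0 < la by rewrite (lt_trans a0).
have cl : a ^+ 2 / (la - a) = a ^+ 2 * l by rewrite /la addrAC subrr add0r invrK.
pose Q := Ae + (a ^+ 2 / (la - a))%:M.
pose J : 'M[R]_(n + 1, (n + 1) + (n + 1)) := row_mx 1%:M 1%:M.
pose T1 := \tr (Ps *m Q *m J^T) + \tr (J *m Q *m Ps^T).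
pose T2 := \tr (J *m Q *m J^T).
(* the regularization s of the projections tends to 0 first *)
have main (z : R) : 0 < z -> z <= 1 ->
    F <= \tr (Ps *m Q *m Ps^T) + z * (T1 + `|T2| + 2 + 2 * la * (2 * n%:R + (n%:R + 1))).
  move=> z0 z1.
  pose r0 := de / 2; have r00 : 0 < r0 by rewrite divr_gt0.
  have [r1 r10 h1] := subsol_frozen tau cc su Dx t0 p0 la0 z0 r00 nu1 pp.
  have [r2 r20 h2] := subsol_frozen ka cc' sw Dy s0 q0 la0 z0 r00 nu1 pq.
  pose rho := Num.min r1 r2; have rho0 : 0 < rho by rewrite lt_min r10.
  have in0 v b : D v -> 0 < b -> st_nbhd D v b r0 0.
    by move=> Dv b0; split; rewrite ?normr0 ?spart0 ?tpart0 ?addr0// ltW.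
  have H : tau - c x * enorm p - z - la * (2 * z * n%:R + z ^+ 2 * (n%:R + 1)) +
     (ka - c' y * enorm q - z - la * (2 * z * n%:R + z ^+ 2 * (n%:R + 1))) <=
     \tr (row_mx (stproj p + z%:M) (stproj q + z%:M) *m Q *m (row_mx (stproj p + z%:M) (stproj q + z%:M))^T).
    have rr1 : rho <= r1 by rewrite ge_min lexx.
    have rr2 : rho <= r2 by rewrite ge_min lexx orbT.
    apply: (@coupling R (n + 1) _ (st_nbhd D x t r0) (st_nbhd D y s r0)
      (st_shift u x t p tau) (st_shift w y s q ka) Ae a la rho) => //;
      [by rewrite addn1|exact: compact_st_nbhd|exact: compact_st_nbhd|exact: in0|exact: in0|
       exact: cont_on_st_shift|exact: cont_on_st_shift|exact: st_shift0|exact: st_shift0|exact: ltW|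
       exact: stproj_unit|exact: stproj_unit| |exact: h1|exact: h2].
    move=> h k [hr Dh th] [kr Dk tk]; rewrite /Ae qfD qf_scalar mulrDr.
    have -> : 2^-1 * (2 * e * dot (row_mx h k) (row_mx h k)) = e * dot (row_mx h k) (row_mx h k).
      by rewrite !mulrA mulVf// mul1r.
    by apply: hde => //; [apply: le_lt_trans hr _|apply: le_lt_trans kr _];
      rewrite /r0 ltr_pdivrMr// ltr_pMr// ltr1n.
  have PsJ : row_mx (stproj p + z%:M) (stproj q + z%:M) = Ps + z *: J.
    by rewrite /J scale_row_mx add_row_mx !scalemx1.
  move: H; rewrite PsJ.
  have -> : \tr ((Ps + z *: J) *m Q *m (Ps + z *: J)^T) =
      \tr (Ps *m Q *m Ps^T) + z * T1 + z ^+ 2 * T2.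
    have -> : (Ps + z *: J)^T = Ps^T + z *: J^T by apply/matrixP => i j; rewrite !mxE.
    rewrite /T1 /T2; move: (Q) => Q'.
    rewrite !mulmxDl !mulmxDr -!scalemxAr -!scalemxAl.
    rewrite !mxtraceD !mxtraceZ; ring.
  have z2 : z ^+ 2 <= z by rewrite expr2 ler_piMr// ltW.
  have b1 : z ^+ 2 * T2 <= z * `|T2|.
    apply: (@le_trans _ _ (z ^+ 2 * `|T2|)); first by rewrite ler_wpM2l ?sqr_ge0 ?ler_norm.
    by rewrite ler_wpM2r.
  have b2 : la * (z ^+ 2 * (n%:R + 1)) <= la * (z * (n%:R + 1)) by rewrite ler_pM2l// ler_pM2r.
  by rewrite /F => *; lra.
apply: le_trans (ler_linear_perturb main) _.
rewrite /Q /Ae !mulmxDr !mulmxDl !mxtraceD !mul_mx_scalar -!scalemxAl !mxtraceZ cl -/G.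
rewrite le_eqVlt; apply/orP; left; apply/eqP; ring.
Qed.

End theorem_on_sums.

(** * Doubling of variables *)

Section qjets.
Variable R : realType.
Implicit Types n : nat.

(** Gradient and Hessian are given by their values on an increment, so that derivatives of composite
    penalties are compared by [ring] on scalars instead of matrix identities. *)
Definition qjet n (f : 'rV[R]_n -> R) x (l q : 'rV[R]_n -> R) : Prop :=
  exists p A, [/\ jet2 f x p A, A^T = A, forall d, dot p d = l d & forall d, qf A d = q d].

Lemma qjet_eq n (f f' : 'rV[R]_n -> R) x l q l' q' : f =1 f' -> l =1 l' -> q =1 q' ->
  qjet f x l q -> qjet f' x l' q'.
Proof.
move=> ff ll qq [p [A [hj As hl hq]]]; exists p, A; split => //.
- by apply: jet2_ext hj; exists 1 => // d _.
- by move=> d; rewrite hl ll.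
- by move=> d; rewrite hq qq.
Qed.

Lemma qjet_sym n (f : 'rV[R]_n -> R) x p A : jet2 f x p A -> qjet f x (dot p) (qf A).
Proof.
move=> hj; have E d : qf (2^-1 *: (A + A^T)) d = qf A d.
  rewrite qfZ qfD; have -> : qf A^T d = qf A d by rewrite /qf dot_mull trmxK dotC.
  by field.
exists p, (2^-1 *: (A + A^T)); split => //.
- by move=> e /hj[de de0 h]; exists de => // d dd; rewrite E; exact: h.
- by apply/matrixP => i j; rewrite !mxE addrC.
Qed.

Lemma qjet_cst n a (x : 'rV[R]_n) : qjet (fun=> a) x (fun=> 0) (fun=> 0).
Proof.
exists 0, 0; split; first exact: jet2_cst.
- by rewrite trmx0.
- by move=> d; rewrite dot0l.
- by move=> d; rewrite qf0.
Qed.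

Lemma qjet_dot n (c x : 'rV[R]_n) : qjet (dot c) x (dot c) (fun=> 0).
Proof.
by exists c, 0; split=> //; [exact: jet2_dot|rewrite trmx0|move=> d; rewrite qf0].
Qed.

Lemma qjetD n (f g : 'rV[R]_n -> R) x l q l' q' : qjet f x l q -> qjet g x l' q' ->
  qjet (fun z => f z + g z) x (fun d => l d + l' d) (fun d => q d + q' d).
Proof.
move=> [p [A [hj As hl hq]]] [p' [A' [hj' As' hl' hq']]].
exists (p + p'), (A + A'); split; first exact: jet2D.
- by rewrite linearD/= As As'.
- by move=> d; rewrite dotDl hl hl'.
- by move=> d; rewrite qfD hq hq'.
Qed.

Lemma qjetZ n a (f : 'rV[R]_n -> R) x l q : qjet f x l q ->
  qjet (fun z => a * f z) x (fun d => a * l d) (fun d => a * q d).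
Proof.
move=> [p [A [hj As hl hq]]]; exists (a *: p), (a *: A); split; first exact: jet2Z.
- by rewrite linearZ/= As.
- by move=> d; rewrite dotZl hl.
- by move=> d; rewrite qfZ hq.
Qed.

Lemma qjetM n (f g : 'rV[R]_n -> R) x l q l' q' : qjet f x l q -> qjet g x l' q' ->
  qjet (fun z => f z * g z) x (fun d => f x * l' d + g x * l d)
    (fun d => f x * q' d + g x * q d + 2 * (l d * l' d)).
Proof.
move=> [p [A [hj As hl hq]]] [p' [A' [hj' As' hl' hq']]].
exists (f x *: p' + g x *: p), (f x *: A' + g x *: A + (p^T *m p' + p'^T *m p)).
split; first exact: jet2M.
- rewrite !linearD/= !linearZ/= As As' !trmx_mul !trmxK; congr (_ + _); exact: addrC.
- by move=> d; rewrite dotDl !dotZl hl hl'.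
- by move=> d; rewrite !qfD !qfZ !qf_outer hq hq' !hl !hl'; ring.
Qed.

Lemma qjet_lin m n (L : 'M[R]_(m, n)) (f : 'rV[R]_n -> R) x l q :
  qjet f (x *m L) l q ->
  qjet (fun w => f (w *m L)) x (fun d => l (d *m L)) (fun d => q (d *m L)).
Proof.
move=> [p [A [hj As hl hq]]]; exists (p *m L^T), (L *m A *m L^T); split.
- exact: jet2_mulmx.
- by rewrite !trmx_mul trmxK As mulmxA.
- by move=> d; rewrite dot_mull trmxK hl.
- by move=> d; rewrite qf_mul hq.
Qed.

(** Used for functions of time. The coefficient [k] stays anonymous, since the second order part
    vanishes on increments without time component and only those reach the trace. *)
Lemma qjet_pow n (f : 'rV[R]_n -> R) x l m : qjet f x l (fun=> 0) ->
  exists k, qjet (fun z => f z ^+ m) x (fun d => m%:R * f x ^+ m.-1 * l d) (fun d => k * l d ^+ 2).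
Proof.
move=> hf; elim: m => [|m [k IH]].
  exists 0; apply: qjet_eq (qjet_cst 1 x) => d; first by rewrite expr0.
    by rewrite !mul0r.
  by rewrite mul0r.
exists (f x * k + 2 * m%:R * f x ^+ m.-1); apply: qjet_eq (qjetM hf IH) => d.
- by rewrite exprS.
- rewrite /=; case: m {IH} => [|m]; first by rewrite expr0; ring.
  rewrite /= exprS -[m.+2%:R]natr1; ring.
- by rewrite mulr0 addr0; ring.
Qed.

Lemma qjet_pos3 n (f : 'rV[R]_n -> R) x l : qjet f x l (fun=> 0) ->
  exists k, qjet (fun z => Num.max (f z) 0 ^+ 3) x (fun d => 3 * Num.max (f x) 0 ^+ 2 * l d)
    (fun d => k * l d ^+ 2).
Proof.
move=> [p [A [hj As hl hq]]]; exists (6 * Num.max (f x) 0).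
apply: qjet_eq (qjet_sym (jet2_pos3 hj)) => d //.
  by rewrite dotZl hl.
by rewrite qfD !qfZ qf_outer hq hl mulr0 add0r -expr2 mulrA.
Qed.

Lemma qjet_dotself n (y x : 'rV[R]_n) : qjet (fun z => dot (z - y) (z - y)) x
  (fun d => 2 * dot (x - y) d) (fun d => 2 * dot d d).
Proof.
exists (2 *: (x - y)), 2%:M; split.
- move=> e e0; exists 1 => // d _.
  suff -> : dot (x + d - y) (x + d - y) - dot (x - y) (x - y) - dot (2 *: (x - y)) d -
     2^-1 * qf 2%:M d = 0 by rewrite normr0 mulr_ge0 ?dot_ge0// ltW.
  have -> : x + d - y = (x - y) + d by rewrite addrAC.
  move: (x - y) => z; by rewrite qf_scalar dotDl !dotDr dotZl (dotC d z); field.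
- by rewrite tr_scalar_mx.
- by move=> d; rewrite dotZl.
- by move=> d; rewrite qf_scalar.
Qed.

Lemma qf_entry_le n (A : 'M[R]_n) e : A^T = A -> 0 <= e ->
  (forall d, `|qf A d| <= e * dot d d) -> \sum_i \sum_j `|A i j| <= n%:R ^+ 2 * e.
Proof.
move=> As e0 h.
have ent i j : `|A i j| <= e.
  have aij : A j i = A i j by rewrite -[in RHS]As mxE.
  pose d (s : R) : 'rV[R]_n := delta_mx 0 i + s *: delta_mx 0 j.
  have q s : qf A (d s) = A i i + 2 * s * A i j + s ^+ 2 * A j j.
    rewrite /qf mulmxDl -scalemxAl -!rowE !(dotDl, dotDr, dotZl, dotZr) !dot_delta !mxE aij.
    by ring.
  (* Polarization: the squared lengths of e_i + e_j and e_i - e_j add up to 4, also when i = j. *)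
  have dd : dot (d 1) (d 1) + dot (d (-1)) (d (-1)) = 4.
    rewrite /d !(dotDl, dotDr, dotZl, dotZr) !dot_delta !mxE !eqxx/=; ring.
  have := h (d 1); have := h (d (-1)); rewrite !q !ler_norml => /andP[a1 a2] /andP[b1 b2].
  have E : e * dot (d 1) (d 1) + e * dot (d (-1)) (d (-1)) = e * 4 by rewrite -mulrDr dd.
  apply/andP; split; lra.
apply: (@le_trans _ _ (\sum_(i < n) \sum_(j < n) e)).
  by apply: ler_sum => i _; apply: ler_sum => j _.
by rewrite !sumr_const card_ord -mulrnA -[leLHS]mulr_natl natrM.
Qed.

End qjets.

(** * The quartic penalty and the boundary weight *)

Section geometry.
Variables (R : realType) (n : nat).
Local Notation V := 'rV[R]_n.
Variables (D B : set V) (nu : V -> V).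

(* Exterior sphere condition with constant C0, and a function g that compensates
   it: g = 1 and dg/dnu > 12 C0 on the boundary. *)
Record good_geometry (C0 C1 : R) (g : V -> R) (Dg : V -> V) (Hg : V -> 'M[R]_n) : Prop := {
  gg_compact : compact D;
  gg_sub : B `<=` D;
  gg_nu : forall x, B x -> enorm (nu x) <= 1;
  gg_C0 : 0 < C0;
  gg_C1 : 1 <= C1;
  gg_ext : forall x y, B x -> D y -> dot (y - x) (nu x) <= C0 * dot (y - x) (y - x);
  gg_jet : forall x, D x -> jet2 g x (Dg x) (Hg x);
  gg_cont : cont_on D g;
  gg_Dcont : {within D, continuous Dg};
  gg_half : forall x, D x -> 2^-1 <= g x;
  gg_le : forall x, D x -> g x <= C1;
  gg_D : forall x, D x -> enorm (Dg x) <= C1;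
  gg_H : forall x d, D x -> `|qf (Hg x) d| <= C1 * dot d d;
  gg_bd : forall x, B x -> g x = 1;
  gg_dnu : forall x, B x -> 12 * C0 + 1 <= dot (Dg x) (nu x)
}.

Variables (C0 C1 : R) (g : V -> R) (Dg : V -> V) (Hg : V -> 'M[R]_n).
Hypothesis gg : good_geometry C0 C1 g Dg Hg.

Definition psi (y x : V) : R := (g x + g y) * (dot (x - y) (x - y) * dot (x - y) (x - y)).

Definition Dpsi (y x : V) : V :=
  (dot (x - y) (x - y) ^+ 2) *: Dg x + (4 * (g x + g y) * dot (x - y) (x - y)) *: (x - y).

Lemma dot_Dpsi y x d : dot (Dpsi y x) d = dot (x - y) (x - y) ^+ 2 * dot (Dg x) d +
  4 * (g x + g y) * dot (x - y) (x - y) * dot (x - y) d.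
Proof. by rewrite /Dpsi [LHS]dotDl !dotZl. Qed.

(** On the boundary g x = 1, and uniform continuity gives g y < 2 for y nearby. The resulting bound
    3 explains the constant 12 = 4 * 3 in [gg_dnu]. *)
Lemma g_close : exists2 de : R, 0 < de &
  forall x y, B x -> D y -> enorm (x - y) < de -> g x + g y <= 3.
Proof.
have [de de0 h] := cont_on_unif (gg_compact gg) (gg_cont gg) ltr01.
exists de => // x y Bx Dy xy.
have := h x y (gg_sub gg Bx) Dy; rewrite -normrN opprB.
move=> /(_ (le_lt_trans (norm_le_enorm _) xy)); rewrite ltr_norml => /andP[_].
rewrite (gg_bd gg Bx); lra.
Qed.

(** With f = |x - y|^2, the exterior sphere condition costs at most 4 * 3 * C0 f^2 in the normal
    derivative, and the weight contributes at least (12 C0 + 1) f^2. *)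
Lemma Dpsi_outward x y de : (forall x y, B x -> D y -> enorm (x - y) < de -> g x + g y <= 3) ->
  B x -> D y -> enorm (x - y) < de ->
  dot (x - y) (x - y) ^+ 2 <= dot (Dpsi y x) (nu x).
Proof.
move=> h Bx Dy xy; have g3 := h _ _ Bx Dy xy.
have e := gg_ext gg Bx Dy; have dn := gg_dnu gg Bx; have c0 := gg_C0 gg.
have := gg_half gg Dy; have := gg_half gg (gg_sub gg Bx) => g1 g2.
rewrite dot_Dpsi.
have zn : - (C0 * dot (x - y) (x - y)) <= dot (x - y) (nu x).
  by rewrite -[x - y]opprB dotNl dotNr opprK dotNl lerN2.
have d0 := dot_ge0 (x - y).
move: (dot (x - y) (x - y)) (dot (x - y) (nu x)) (dot (Dg x) (nu x)) d0 zn dn => f zz dg f0 zn dn.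
have a1 : 4 * (g x + g y) * f * - (C0 * f) <= 4 * (g x + g y) * f * zz.
  by apply: ler_wpM2l => //; rewrite !mulr_ge0//; lra.
have a2 : (g x + g y) * (C0 * f ^+ 2) <= 3 * (C0 * f ^+ 2).
  by apply: ler_wpM2r => //; rewrite mulr_ge0 ?sqr_ge0// ltW.
have a3 : f ^+ 2 * (12 * C0 + 1) <= f ^+ 2 * dg by rewrite ler_wpM2l// sqr_ge0.
nra.
Qed.

Lemma qjet_psi y x : D x -> qjet (psi y) x (dot (Dpsi y x))
  (fun d => (g x + g y) * (4 * dot (x - y) (x - y) * dot d d + 8 * dot (x - y) d ^+ 2)
     + dot (x - y) (x - y) ^+ 2 * qf (Hg x) d
     + 8 * dot (x - y) (x - y) * (dot (Dg x) d * dot (x - y) d)).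
Proof.
move=> Dx; have jf := qjet_dotself y x.
have jg := qjetD (qjet_sym (gg_jet gg Dx)) (qjet_cst (g y) x).
apply: qjet_eq (qjetM jg (qjetM jf jf)) => d //.
  by rewrite dot_Dpsi; ring.
by rewrite /=; ring.
Qed.

Lemma psi_qjet_bound y x d : D x -> D y ->
  `|(g x + g y) * (4 * dot (x - y) (x - y) * dot d d + 8 * dot (x - y) d ^+ 2)
     + dot (x - y) (x - y) ^+ 2 * qf (Hg x) d
     + 8 * dot (x - y) (x - y) * (dot (Dg x) d * dot (x - y) d)| <=
  C1 * (24 * dot (x - y) (x - y) + dot (x - y) (x - y) ^+ 2
    + 8 * dot (x - y) (x - y) * enorm (x - y)) * dot d d.
Proof.
move=> Dx Dy; have := gg_half gg Dy; have := gg_half gg Dx => g1 g2.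
have h1 := gg_le gg Dx; have h2 := gg_le gg Dy; have hD := gg_D gg Dx; have hH := gg_H gg d Dx.
have c1 := gg_C1 gg.
have zd := dot_CS (x - y) d; have f0 := dot_ge0 (x - y); have dd0 := dot_ge0 d.
have gd : `|dot (Dg x) d * dot (x - y) d| <= C1 * enorm (x - y) * dot d d.
  rewrite normrM; apply: (@le_trans _ _ ((C1 * enorm d) * (enorm (x - y) * enorm d))).
    apply: ler_pM => //; last exact: dot_enorm.
    by apply: le_trans (dot_enorm _ _) _; rewrite ler_wpM2r ?enorm_ge0.
  by rewrite -[dot d d]enorm_sq le_eqVlt; apply/orP; left; apply/eqP; ring.
have z2 : 0 <= dot (x - y) d ^+ 2 by rewrite sqr_ge0.
move: (dot (x - y) (x - y)) (dot d d) (dot (x - y) d ^+ 2) (qf (Hg x) d) (dot (Dg x) d * dot (x - y) d)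
  (enorm (x - y)) f0 dd0 zd hH gd z2 (enorm_ge0 (x - y)) => f d2 zd qh l r f0 dd0 zd' hH gd z2 r0.
have b1 : `|(g x + g y) * (4 * f * d2 + 8 * zd)| <= C1 * (24 * f) * d2.
  rewrite ger0_norm; last by rewrite mulr_ge0 ?addr_ge0 ?mulr_ge0//; lra.
  apply: (@le_trans _ _ ((2 * C1) * (12 * (f * d2)))); last by lra.
  apply: ler_pM; rewrite ?addr_ge0 ?mulr_ge0//; lra.
have b2 : `|f ^+ 2 * qh| <= C1 * f ^+ 2 * d2.
  by rewrite normrM ger0_norm ?sqr_ge0// mulrC mulrAC ler_wpM2r ?sqr_ge0.
have b3 : `|8 * f * l| <= 8 * f * (C1 * r * d2).
  rewrite normrM [`|8 * f|]ger0_norm ?mulr_ge0//.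
  by rewrite ler_wpM2l// mulr_ge0.
apply: le_trans (ler_normD _ _) _; apply: le_trans (lerD (ler_normD _ _) (lexx _)) _; lra.
Qed.

Lemma Dpsi_le y x : D x -> D y -> enorm (Dpsi y x) <=
  C1 * (dot (x - y) (x - y) ^+ 2 + 8 * dot (x - y) (x - y) * enorm (x - y)).
Proof.
move=> Dx Dy; have := gg_half gg Dy; have := gg_half gg Dx => g1 g2.
have h1 := gg_le gg Dx; have h2 := gg_le gg Dy; have hD := gg_D gg Dx.
have f0 := dot_ge0 (x - y); have r0 := enorm_ge0 (x - y).
apply: le_trans (enormD _ _) _; rewrite !enormZ.
rewrite ger0_norm ?sqr_ge0// ger0_norm; last by rewrite !mulr_ge0//; lra.
have k1 := ler_wpM2l (sqr_ge0 (dot (x - y) (x - y))) hD.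
have : (g x + g y) * (dot (x - y) (x - y) * enorm (x - y)) <= (2 * C1) * (dot (x - y) (x - y) * enorm (x - y)).
  by apply: ler_wpM2r; [rewrite mulr_ge0|lra].
by move=> ?; lra.
Qed.

End geometry.

Section more_continuity.
Variables (R : realType) (V W : normedModType R).

Lemma cont_onM (K : set V) (f g : V -> R) : cont_on K f -> cont_on K g ->
  cont_on K (fun x => f x * g x).
Proof.
move=> /cont_onP/subspace_continuousP cf /cont_onP/subspace_continuousP cg.
apply/cont_onP/subspace_continuousP => x Kx.
by apply: cvgM; [exact: cf|exact: cg].
Qed.

Lemma cont_on_comp (K : set V) (D : set W) (F : V -> W) (f : W -> R) :
  (forall x, K x -> D (F x)) ->
  (forall x y, K x -> K y -> `|F y - F x| <= `|y - x|) -> cont_on D f ->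
  cont_on K (fun x => f (F x)).
Proof.
move=> KD FF cf x Kx e e0; have [de de0 h] := cf _ (KD _ Kx) _ e0.
exists de => // y Ky yx; apply: h; first exact: KD.
exact: le_lt_trans (FF _ _ Kx Ky) yx.
Qed.

End more_continuity.

Section estimates.
Variables (R : realType) (n : nat).
Local Notation V := 'rV[R]_n.
Local Notation Z := 'rV[R]_(n + 1).
Variables (D B : set V) (nu : V -> V).
Variables (C0 C1 : R) (g : V -> R) (Dg : V -> V) (Hg : V -> 'M[R]_n).
Hypothesis gg : good_geometry D B nu C0 C1 g Dg Hg.

Lemma dot_inj (p q : V) : (forall d, dot p d = dot q d) -> p = q.
Proof. by move=> h; apply/rowP => i; rewrite -!dot_delta h. Qed.

Lemma cont_on_dist y (K : set V) : cont_on K (fun x => dot (x - y) (x - y)).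
Proof.
apply: cont_on_continuous => x; have [p [A [hj _ _ _]]] := qjet_dotself y x.
exact: jet2_continuous hj.
Qed.

Lemma cont_on_psi y : cont_on D (psi g y).
Proof.
apply: cont_onM; last by apply: cont_onM; exact: cont_on_dist.
by apply: cont_onD; [exact: gg_cont gg|exact: cont_on_cst].
Qed.

(* The perturbation by the function kappa g makes the test functions strictly
   increasing in the normal direction. *)
Lemma touch_zero c C u x t D' tau b : 0 <= C -> subsol D B nu c C u -> st_cont D u ->
  D x -> 0 < t ->
  (exists2 de : R, 0 < de & forall y s, D y -> 0 <= s -> `|y - x| < de -> `|s - t| < de ->
     u (y, s) <= u (x, t) + D' * dot (y - x) (y - x) ^+ 2 + tau * (s - t) + b * (s - t) ^+ 2) ->
  tau <= 0.
Proof.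
move=> C_0 su cu Dx t0 [de de0 touch].
have [dg dg0 hdg] := g_close gg.
have cD : closed D by apply: compact_closed; [exact: norm_hausdorff|exact: gg_compact gg].
(* The extra 1 makes the contact strict: after a perturbation of size e^4 the new maximum satisfies
   |y - x|^4 + (s - t)^2 <= e^4. *)
pose D1 := `|D'| + 1; pose b1 := `|b| + 1.
have D10 : 1 <= D1 by rewrite lerDr.
have b10 : 1 <= b1 by rewrite lerDr.
have D1D : D' + 1 <= D1 by rewrite lerD2r ler_norm.
have b1b : b + 1 <= b1 by rewrite lerD2r ler_norm.
have c1 := gg_C1 gg.
have n1 : (0 : R) < n%:R + 1 by rewrite ltr_wpDl.
pose r := Num.min (Num.min (de / 2) (t / 2)) (Num.min (dg / 2) 1).
have r0 : 0 < r by rewrite !lt_min !divr_gt0// ltr01.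
have [rde [rt [rg r1]]] : r <= de / 2 /\ r <= t / 2 /\ r <= dg / 2 /\ r <= 1.
  by rewrite !ge_min !lexx !orbT.
(* All errors are O(e): 36 = (24 + 1 + 8) + 1 + 2 counts the Hessians of [psi], of the perturbation
   by [g] and of the added paraboloid; 10 = (1 + 8) + 1 counts the gradients; 2 b1 comes from the
   time derivative. *)
pose K := C * (n%:R ^+ 2 * (36 * (D1 * C1)) + 10 * (D1 * C1)) + 2 * b1.
apply: (@ler_linear_perturb _ _ _ (2^-1 * r * K)) => s s0 s1; rewrite add0r mulrA.
pose e := s * (2^-1 * r); rewrite -/e.
have e0 : 0 < e by rewrite mulr_gt0// mulr_gt0.
have er : e < r.
  apply: (@le_lt_trans _ _ (1 * (2^-1 * r))); last by lra.
  by rewrite ler_wpM2r// mulr_ge0// ltW.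
have e1 : e <= 1 by rewrite (le_trans (ltW er)).
clearbody e r D1 b1.
(* Normalized so that ka g <= e^4, the size of perturbation under which the maximum moves by at most
   e in space. *)
pose ka := e ^+ 4 / C1; have ka0 : 0 < ka by rewrite divr_gt0 ?exprn_gt0// (lt_le_trans ltr01).
have kaC : ka * C1 = e ^+ 4 by rewrite divfK// gt_eqF// (lt_le_trans ltr01).
have e2e : e ^+ 2 <= e by rewrite expr2 ler_piMr// ltW.
have e4e : e ^+ 4 <= e by rewrite (_ : 4%N = (2 * 2)%N)// exprM; apply: le_trans (_ : e ^+ 2 <= e) => //; rewrite ler_pXn2r ?nnegrE ?sqr_ge0 ?(ltW e0).
have kae : ka <= e.
  have : ka <= ka * C1 by rewrite ler_peMr// ltW.
  by rewrite kaC => /le_trans; apply.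
pose J y := D1 * psi g x y + ka * g y.
pose Xi h := u (x + spart h, t + tpart h) - (J (x + spart h) + (tau * tpart h + b1 * (tpart h * tpart h))).
have shiftle (h k : Z) : `|x + spart k - (x + spart h)| <= `|k - h|.
  by rewrite opprD addrACA subrr add0r -spartB norm_spart.
have nb0 : st_nbhd D x t r 0.
  by split; rewrite ?normr0 ?spart0 ?tpart0 ?addr0// ltW.
have ctp : cont_on (st_nbhd D x t r) (@tpart R n).
  move=> h _ a a0; exists a => // k _ kh; rewrite -tpartB.
  exact: le_lt_trans (norm_tpart _) kh.
have cXi : cont_on (st_nbhd D x t r) Xi.
  apply: cont_onB.
    exact: cont_on_st.
  apply: cont_onD.
    apply: (cont_on_comp (D := D) (f := J) (F := fun h => x + spart h)).
    - by move=> h [].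
    - by move=> h k _ _; exact: shiftle.
    - apply: cont_onD; apply: cont_onM; first exact: cont_on_cst.
      + exact: cont_on_psi.
      + exact: cont_on_cst.
      + exact: gg_cont gg.
  apply: cont_onD; apply: cont_onM; first exact: cont_on_cst.
  - exact: ctp.
  - exact: cont_on_cst.
  - exact: cont_onM.
have [h [hr Dy sy] hmax] := cont_on_max (ex_intro _ 0 nb0) (@compact_st_nbhd R n D x t r cD) cXi.
set y := x + spart h in Dy.
have yx : y - x = spart h by rewrite /y addrC addKr.
pose f := dot (y - x) (y - x); have f0 : 0 <= f := dot_ge0 _.
have gy := gg_half gg Dy; have gx := gg_half gg Dx.
have small : f ^+ 2 + tpart h ^+ 2 <= e ^+ 4.
  have := hmax _ nb0; rewrite /Xi /J spart0 tpart0 !addr0 !mulr0 addr0 -/y.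
  have -> : psi g x x = 0 by rewrite /psi subrr dot0l !mulr0.
  rewrite mulr0 add0r /psi -/f.
  have hde z : `|z : R| <= r -> `|z| < de by move=> zr; apply: le_lt_trans zr _; lra.
  have := touch y (t + tpart h) Dy sy.
  rewrite yx [t + tpart h - t]addrC addKr -{1}yx -/f => /(_ _ _) tt.
  have {}tt : u (y, t + tpart h) <= u (x, t) + D' * f ^+ 2 + tau * tpart h + b * tpart h ^+ 2.
    rewrite /f yx; apply: tt; apply: (@le_lt_trans _ _ r); try by clear -gg rde de0; lra.
      by rewrite yx; exact: le_trans (norm_spart _) hr.
    exact: le_trans (norm_tpart _) hr.
  have kg : ka * (g x - g y) <= e ^+ 4.
    rewrite -kaC ler_pM2l//; have := gg_le gg Dx; move: gy; clear -gg; lra.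
  have k1 : D1 * f ^+ 2 <= D1 * ((g y + g x) * f ^+ 2).
    by rewrite ler_pM2l ?(lt_le_trans ltr01)// ler_peMl ?sqr_ge0//; clear -gg gx gy; lra.
  have k2 : (D' + 1) * f ^+ 2 <= D1 * f ^+ 2 by rewrite ler_wpM2r ?sqr_ge0.
  have k3 : (b + 1) * tpart h ^+ 2 <= b1 * tpart h ^+ 2 by rewrite ler_wpM2r ?sqr_ge0.
  clear -gg k1 k2 k3 tt kg; move: k1 k2 k3 tt kg; rewrite -!expr2; lra.
have fe : f <= e ^+ 2.
  rewrite -(@ler_pXn2r _ 2)// ?nnegrE ?sqr_ge0// -exprM.
  have := sqr_ge0 (tpart h); clear -gg small; lra.
have te : `|tpart h| <= e ^+ 2.
  rewrite -(@ler_pXn2r _ 2)// ?nnegrE ?sqr_ge0// -exprM real_normK ?num_real//.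
  have := sqr_ge0 f; clear -gg small; lra.
have ze : enorm (y - x) <= e.
  by rewrite -(@ler_pXn2r _ 2)// ?nnegrE ?enorm_ge0 ?(ltW e0)// enorm_sq.
have {}hr : `|h| < r.
  rewrite -[h]strowK; apply: norm_strow_lt; last by apply: le_lt_trans te _; exact: le_lt_trans e2e er.
  by rewrite -yx; apply: le_lt_trans (norm_le_enorm _) _; exact: le_lt_trans ze er.
have {}sy : 0 < t + tpart h.
  by clear -gg te e2e er rt t0; move: te; rewrite ler_norml => /andP[]; lra.
have [p [A [jJ As hp hq]]] := qjetD (qjetZ D1 (qjet_psi gg x Dy)) (qjetZ ka (qjet_sym (gg_jet gg Dy))).
have pE : p = D1 *: Dpsi g Dg x y + ka *: Dg y.
  by apply: dot_inj => d; rewrite hp (dotDl (D1 *: Dpsi g Dg x y)) (dotZl D1) (dotZl ka).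
have qA d : `|qf A d| <= 34 * (D1 * C1) * e * dot d d.
  rewrite hq; apply: le_trans (ler_normD _ _) _.
  rewrite normrM [`|D1|]ger0_norm ?(le_trans ler01)// [`|ka * _|]normrM [`|ka|]gtr0_norm//.
  have b_1 := psi_qjet_bound gg d Dy Dx.
  have b_2 := gg_H gg d Dy.
  have dd0 := dot_ge0 d; rewrite -/f in b_1.
  apply: (@le_trans _ _ (D1 * (C1 * (24 * f + f ^+ 2 + 8 * f * enorm (y - x)) * dot d d)
      + ka * (C1 * dot d d))).
    by apply: lerD; rewrite ler_pM2l// (lt_le_trans ltr01).
  have m1 : 24 * f + f ^+ 2 + 8 * f * enorm (y - x) <= 33 * e.
    have x1 : f * enorm (y - x) <= e * 1.
      by apply: ler_pM => //; [exact: enorm_ge0|exact: le_trans fe e2e|exact: le_trans ze e1].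
    have x2 : f ^+ 2 <= e by rewrite (le_trans _ e4e)//; have := sqr_ge0 (tpart h); clear -gg small; lra.
    have := le_trans fe e2e; clear -gg x1 x2; lra.
  have m2 : D1 * (C1 * (24 * f + f ^+ 2 + 8 * f * enorm (y - x)) * dot d d) <=
      D1 * (C1 * (33 * e) * dot d d).
    rewrite ler_pM2l ?(lt_le_trans ltr01)// ler_wpM2r// ler_pM2l// (lt_le_trans ltr01)//.
  have m3 : ka * (C1 * dot d d) <= e * (D1 * C1 * dot d d).
    have q0 : 0 <= C1 * dot d d by rewrite mulr_ge0// (le_trans ler01).
    rewrite -mulrA; apply: ler_pM => //; first exact: ltW.
    by rewrite ler_peMl.
  clear -gg m2 m3; lra.
pose X := A + (2 * e)%:M.
have Xs : X^T = X by rewrite /X linearD/= As tr_scalar_mx.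
have DC0 : 0 < D1 * C1 by rewrite mulr_gt0// (lt_le_trans ltr01).
have DC1 : 1 <= D1 * C1 by rewrite mulr_ege1.
have sX : \sum_i \sum_j `|X i j| <= n%:R ^+ 2 * (36 * (D1 * C1) * e).
  apply: qf_entry_le => // [|d]; first by have := mulr_ge0 (ltW DC0) (ltW e0); clear -gg; lra.
  rewrite /X qfD qf_scalar; apply: le_trans (ler_normD _ _) _.
  rewrite [`|2 * e * _|]ger0_norm ?mulr_ge0 ?dot_ge0// ?(ltW e0)//.
  have := qA d; have : e * dot d d <= D1 * C1 * (e * dot d d).
    by rewrite ler_peMl// mulr_ge0 ?dot_ge0// ltW.
  clear -gg; lra.
have np : enorm p <= 10 * (D1 * C1) * e.
  rewrite pE; apply: le_trans (enormD _ _) _; rewrite !enormZ gtr0_norm ?(lt_le_trans ltr01)// gtr0_norm//.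
  have w1 := Dpsi_le gg Dy Dx; have w2 := gg_D gg Dy; rewrite -/f in w1.
  have x1 : f * enorm (y - x) <= e * 1.
    by apply: ler_pM => //; [exact: enorm_ge0|exact: le_trans fe e2e|exact: le_trans ze e1].
  have x2 : f ^+ 2 <= e by rewrite (le_trans _ e4e)//; have := sqr_ge0 (tpart h); clear -gg small; lra.
  have w3 : D1 * enorm (Dpsi g Dg x y) <= D1 * (C1 * (9 * e)).
    rewrite ler_pM2l ?(lt_le_trans ltr01)//; apply: le_trans w1 _.
    by rewrite ler_pM2l ?(lt_le_trans ltr01)//; clear -gg x1 x2; lra.
  have w4 : ka * enorm (Dg y) <= e * (D1 * C1).
    apply: ler_pM => //; [exact: ltW|exact: enorm_ge0|].
    by apply: le_trans w2 _; rewrite ler_peMl// (le_trans ler01).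
  clear -gg w3 w4; lra.
have [] := su y (t + tpart h) p X (tau + 2 * b1 * tpart h) b1 Dy sy Xs.
- have [d1 d10 hd1] := jJ _ e0.
  exists (Num.min d1 (r - `|h|)); first by rewrite lt_min d10 subr_gt0.
  move=> y2 s2 Dy2 s20; rewrite !lt_min => /andP[y1 y3] /andP[z1 z2].
  pose h2 := strow (y2 - x) (s2 - t).
  have xh2 : x + spart h2 = y2 by rewrite spart_strow subrKC.
  have th2 : t + tpart h2 = s2 by rewrite tpart_strow subrKC.
  have dd : `|h2 - h| < r - `|h|.
    have -> : h2 - h = strow (y2 - y) (s2 - (t + tpart h)).
      rewrite -[h2 - h]strowK spartB tpartB spart_strow tpart_strow.
      by congr strow; rewrite ?yx// opprD addrA.
    exact: norm_strow_lt.
  have nb2 : st_nbhd D x t r h2.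
    have h2r : `|h2| <= r.
      have hh := ler_normD (h2 - h) h; rewrite subrK in hh.
      by apply: le_trans hh _; rewrite -lerBrDr ltW.
    by split => //; [rewrite xh2|rewrite th2].
  have := hmax _ nb2; rewrite /Xi xh2 th2 -/y tpart_strow.
  have := hd1 _ y1; rewrite subrKC ler_norml => /andP[_]; rewrite -/(J y2) -/(J y).
  rewrite /X qfD qf_scalar; clear -gg; move: (J y2) (J y) (u _) (u _) => *; lra.
- move=> By; rewrite pE (dotDl (D1 *: Dpsi g Dg x y)) (dotZl D1) (dotZl ka).
  have dn := gg_dnu gg By; have c0 := gg_C0 gg.
  have out : 0 <= dot (Dpsi g Dg x y) (nu y).
    apply: le_trans (Dpsi_outward gg hdg By Dx _); first exact: sqr_ge0.
    by apply: le_lt_trans ze _; clear -gg er rg dg0; lra.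
  apply: ltr_wpDl; first by rewrite mulr_ge0// (le_trans ler01).
  by rewrite mulr_gt0//; clear -gg dn c0; lra.
move=> _ fin.
have fin2 : C * (\sum_i \sum_j `|X i j| + enorm p) <=
    C * (n%:R ^+ 2 * (36 * (D1 * C1) * e) + 10 * (D1 * C1) * e).
  by apply: ler_wpM2l => //; exact: lerD sX np.
have tb : b1 * `|tpart h| <= b1 * e.
  by rewrite ler_wpM2l ?(le_trans ler01)// (le_trans te).
have tb2 : - (b1 * `|tpart h|) <= b1 * tpart h.
  rewrite -mulrN ler_wpM2l ?(le_trans ler01)//.
  by have := ler_norm (- tpart h); rewrite normrN; lra.
have tt := le_trans fin fin2; clear -gg tt tb tb2; rewrite /K; lra.
Qed.

End estimates.

Section estimates.
Variables (R : realType) (n : nat).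
Local Notation V := 'rV[R]_n.
Local Notation Z := 'rV[R]_(n + 1).
Variables (D B : set V) (nu : V -> V).
Variables (C0 C1 : R) (g : V -> R) (Dg : V -> V) (Hg : V -> 'M[R]_n).
Hypothesis gg : good_geometry D B nu C0 C1 g Dg Hg.

(** [Dpsi_outward] bounds the gradient taken at each nearby boundary point; continuity of [Dpsi] in
    its space variable carries the bound over to the fixed gradient at [x]. *)
Lemma points_outward_Dpsi x y k dg :
  (forall x y, B x -> D y -> enorm (x - y) < dg -> g x + g y <= 3) ->
  D x -> D y -> x != y -> enorm (x - y) < dg -> 0 < k ->
  points_outward B nu (k *: Dpsi g Dg y x) x.
Proof.
move=> hdg Dx Dy xy xydg k0.
pose f0 := dot (x - y) (x - y).
have f00 : 0 < f0 by rewrite dot_gt0// subr_eq0.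
(* Near x the squared distance to y stays above f0/2, so the outward bound is at least f0^2/4 = 2 m;
   replacing the gradient costs less than m. *)
pose m := f0 ^+ 2 / 8; have m0 : 0 < m by rewrite divr_gt0// exprn_gt0.
have cf : {for x, continuous (fun z : V => dot (z - y) (z - y))}.
  by have [p [A [hj _ _ _]]] := qjet_dotself y x; exact: jet2_continuous hj.
have cP : Dpsi g Dg y @ within D (nbhs x) --> Dpsi g Dg y x.
  have cf' : dot (z - y) (z - y) @[z --> within D (nbhs x)] --> dot (x - y) (x - y).
    by apply: cvg_within_filter; exact: cf.
  have cg : g z @[z --> within D (nbhs x)] --> g x.
    by have /cont_onP/subspace_continuousP := gg_cont gg; apply.
  have cD : Dg z @[z --> within D (nbhs x)] --> Dg x.
    by have /subspace_continuousP := gg_Dcont gg; apply.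
  have cz : (fun z => z - y) @ within D (nbhs x) --> x - y.
    by apply: cvg_within_filter; apply: cvgB; [exact: cvg_id|exact: cvg_cst].
  apply: cvgD.
    by apply: cvgZ => //; rewrite !expr2; apply: cvgM.
  apply: cvgZ => //; apply: cvgM => //; apply: cvgM; first exact: cvg_cst.
  by apply: cvgD => //; exact: cvg_cst.
have n1 : (0 : R) < n%:R + 1 by rewrite ltr_wpDl.
have /cvgrPdist_lt/(_ (m / (n%:R + 1)) (divr_gt0 m0 n1)) := cP.
rewrite near_withinE => /nbhs_normP[d1 /= d10 h1].
have f2 : 0 < f0 / 2 by rewrite divr_gt0.
have [d2 d20 h2] := (continuousP_norm _ _).1 cf _ f2.
have dgz : 0 < (dg - enorm (x - y)) / (n%:R + 1) by rewrite divr_gt0// subr_gt0.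
exists (k * m / 2); first by rewrite divr_gt0// mulr_gt0.
exists (Num.min (Num.min d1 d2) ((dg - enorm (x - y)) / (n%:R + 1))).
  by rewrite !lt_min d10 d20.
move=> z Bz; rewrite !lt_min => /andP[/andP[z1 z2] z3].
have Dz := gg_sub gg Bz.
have zy : enorm (z - y) < dg.
  have -> : z - y = (z - x) + (x - y) by rewrite addrA subrK.
  apply: le_lt_trans (enormD _ _) _; rewrite -ltrBrDr.
  apply: le_lt_trans (enorm_le_norm _) _; by rewrite mulrC -ltr_pdivlMr.
have out := Dpsi_outward gg hdg Bz Dy zy.
have near : enorm (Dpsi g Dg y x - Dpsi g Dg y z) < m.
  apply: le_lt_trans (enorm_le_norm _) _; rewrite mulrC -ltr_pdivlMr//.
  by apply: h1 => //=; rewrite distrC.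
have := h2 _ z2; rewrite ltr_norml => /andP[hf _].
have nz := gg_nu gg Bz.
have := dot_enorm (Dpsi g Dg y x - Dpsi g Dg y z) (nu z); rewrite ler_norml => /andP[dd _].
have e1 : enorm (Dpsi g Dg y x - Dpsi g Dg y z) * enorm (nu z) <= m * 1.
  by apply: ler_pM; rewrite ?enorm_ge0// ltW.
rewrite (dotBl (Dpsi g Dg y x) (Dpsi g Dg y z)) in dd.
rewrite dotZl -mulrA ler_pM2l//.
have ff : f0 ^+ 2 / 4 <= dot (z - y) (z - y) ^+ 2.
  rewrite -/f0 in hf; move: hf f00; clear -gg; move: (dot _ _) f0 => a b; nra.
rewrite /m -/f0 in e1 *.
move: (sqr_ge0 f0) out ff e1 dd; clear -gg; move: (f0 ^+ 2) (dot (z - y) (z - y) ^+ 2) => *; lra.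
Qed.

(* The Hessian of (g x + g y) |x - y|^4 along the direction (a, b). *)
Definition hess_psi (x y a b : V) : R :=
  let f := dot (x - y) (x - y) in let l := dot (x - y) (a - b) in
  (g x + g y) * (4 * f * dot (a - b) (a - b) + 8 * l ^+ 2)
  + f ^+ 2 * (qf (Hg x) a + qf (Hg y) b)
  + 8 * f * l * (dot (Dg x) a + dot (Dg y) b).

(** The radial parts cancel. Each gradient has size r^3, r = |x - y|, but their sum has only size
    r^4; so their directions are opposite up to O(r). *)
Lemma Dpsi_add x y : Dpsi g Dg y x + Dpsi g Dg x y = dot (x - y) (x - y) ^+ 2 *: (Dg x + Dg y).
Proof.
rewrite /Dpsi -opprB dotNl dotNr opprK scalerN [g y + g x]addrC.
by rewrite addrACA addNr addr0 -scalerDr.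
Qed.

(** The radial part has length at least 4 r^3, since g x + g y >= 1, and the part along [Dg] at most
    C1 r^4 <= 2 r^3. *)
Lemma Dpsi_ge x y : D x -> D y -> C1 * enorm (x - y) <= 2 ->
  2 * dot (x - y) (x - y) * enorm (x - y) <= enorm (Dpsi g Dg y x).
Proof.
move=> Dx Dy r2; have := gg_half gg Dy; have := gg_half gg Dx => g1 g2.
have hD := gg_D gg Dx.
have r0 := enorm_ge0 (x - y).
pose w := (4 * (g x + g y) * dot (x - y) (x - y)) *: (x - y).
have -> : Dpsi g Dg y x = w - (- (dot (x - y) (x - y) ^+ 2 *: Dg x)).
  by rewrite opprK addrC.
have := ler_dist_enorm w (- (dot (x - y) (x - y) ^+ 2 *: Dg x)).
rewrite ler_norml => /andP[_]; apply: le_trans.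
rewrite enormN /w !enormZ -!enorm_sq.
rewrite [`|_ ^+ 2 ^+ 2|]ger0_norm ?sqr_ge0// ger0_norm; last by rewrite !mulr_ge0 ?sqr_ge0//; lra.
move: (enorm (x - y)) (enorm (Dg x)) hD r2 r0 (enorm_ge0 (Dg x)) => r d dC r2 r0 d0.
have a1 : r ^+ 3 * (r * d) <= r ^+ 3 * 2.
  rewrite ler_wpM2l ?exprn_ge0//; apply: le_trans r2; rewrite mulrC.
  by rewrite ler_wpM2r.
have a2 : r ^+ 3 * 4 <= r ^+ 3 * (4 * (g x + g y)).
  by rewrite ler_wpM2l ?exprn_ge0//; lra.
move: a1 a2; clear -gg; move: (g x + g y) => G.
have -> : r ^+ 3 * (r * d) = (r ^+ 2) ^+ 2 * d by ring.
have -> : r ^+ 3 * (4 * G) = 4 * G * r ^+ 2 * r by ring.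
have -> : r ^+ 3 * 4 = 4 * r ^+ 2 * r by ring.
have -> : r ^+ 3 * 2 = 2 * r ^+ 2 * r by ring.
move: (r ^+ 2 * r) => *; lra.
Qed.

Lemma uvecN (p : V) : uvec (- p) = - uvec p.
Proof. by rewrite /uvec enormN scalerN. Qed.

Lemma projN (p : V) : ortho_proj (- p) = ortho_proj p.
Proof.
rewrite /ortho_proj uvecN; have -> : (- uvec p)^T = - (uvec p)^T.
  by apply/matrixP => i j; rewrite !mxE.
by rewrite mulNmx mulmxN opprK.
Qed.

Lemma uvecZ k (p : V) : 0 < k -> uvec (k *: p) = uvec p.
Proof.
move=> k0; rewrite /uvec enormZ gtr0_norm// invfM scalerA mulrAC.
by rewrite mulVf ?mul1r// gt_eqF.
Qed.

Lemma projZ k (p : V) : 0 < k -> ortho_proj (k *: p) = ortho_proj p.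
Proof. by move=> k0; rewrite /ortho_proj uvecZ. Qed.

Lemma enorm_mul_proj (p v : V) : p != 0 -> enorm (v *m ortho_proj p) <= 2 * enorm v.
Proof.
move=> p0; rewrite mulmx_proj -enormN opprB.
apply: le_trans (enormD _ _) _; rewrite enormN enormZ enorm_uvec// mulr1.
have := dot_enorm v (uvec p); rewrite enorm_uvec// mulr1; lra.
Qed.

(** In general directions this Hessian is of order r^2. Here a - b = O(r), because the two gradients
    are nearly opposite, and every term not yet of order r^4 contains a - b often enough to reach
    it. *)
Lemma hess_psi_proj x y v : D x -> D y -> x != y -> enorm v <= 1 ->
  C1 * enorm (x - y) <= 2 ->
  hess_psi x y (v *m ortho_proj (Dpsi g Dg y x)) (v *m ortho_proj (Dpsi g Dg x y)) <=
  520 * C1 ^+ 3 * dot (x - y) (x - y) ^+ 2.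
Proof.
move=> Dx Dy xy v1 r2.
set p := Dpsi g Dg y x; set q := Dpsi g Dg x y.
set a := v *m ortho_proj p; set b := v *m ortho_proj q.
have r0 : 0 < enorm (x - y) by rewrite enorm_gt0// subr_eq0.
have c1 := gg_C1 gg.
pose f := dot (x - y) (x - y); have f0 : 0 < f by rewrite dot_gt0// subr_eq0.
have fr : f = enorm (x - y) ^+ 2 by rewrite enorm_sq.
have pr := Dpsi_ge Dx Dy r2; rewrite -/f -/p in pr.
have p0 : p != 0 by rewrite -enorm_eq0 gt_eqF// (lt_le_trans _ pr)// !mulr_gt0.
have qr : 2 * f * enorm (x - y) <= enorm q.
  have := @Dpsi_ge y x Dy Dx; rewrite [enorm (y - x)]enormBC => /(_ r2).
  by rewrite -[y - x]opprB dotNl dotNr opprK.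
have q0 : q != 0 by rewrite -enorm_eq0 gt_eqF// (lt_le_trans _ qr)// !mulr_gt0.
have h1 := gg_le gg Dx; have h2 := gg_le gg Dy.
have := gg_half gg Dy; have := gg_half gg Dx => g1 g2.
have pq : enorm (p + q) <= 2 * C1 * f ^+ 2.
  rewrite /p /q Dpsi_add enormZ ger0_norm ?sqr_ge0// mulrC -/f.
  rewrite ler_wpM2r ?sqr_ge0//; apply: le_trans (enormD _ _) _.
  have := gg_D gg Dx; have := gg_D gg Dy; lra.
have up : enorm (uvec p - uvec (- q)) <= 2 * C1 * enorm (x - y).
  have mq0 : - q != 0 by rewrite oppr_eq0.
  apply: le_trans (uvec_dist p0 mq0) _; rewrite opprK ler_pdivrMr ?enorm_gt0//.
  apply: (@le_trans _ _ (2 * (2 * C1 * f ^+ 2))); first by rewrite ler_pM2l.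
  have -> : 2 * (2 * C1 * f ^+ 2) = 2 * C1 * enorm (x - y) * (2 * f * enorm (x - y)).
    by rewrite fr; ring.
  by rewrite ler_pM2l// mulr_gt0// mulr_gt0// (lt_le_trans ltr01).
have ab : enorm (a - b) <= 4 * C1 * enorm (x - y).
  rewrite /a /b -(projN q) !mulmx_proj.
  set P := uvec p; set Q := uvec (- q).
  have nQ : enorm Q = 1 by rewrite enorm_uvec// oppr_eq0.
  have nP : enorm P = 1 by rewrite enorm_uvec.
  rewrite -/P -/Q in up; move: P Q up nQ nP => P Q up nQ nP.
  have -> : v - dot v P *: P - (v - dot v Q *: Q) = - (dot v P *: (P - Q) + dot v (P - Q) *: Q).
    by rewrite dotBr; apply/rowP => i; rewrite !mxE; ring.
  rewrite enormN; apply: le_trans (enormD _ _) _; rewrite !enormZ nQ mulr1.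
  have b1 : `|dot v P| <= 1.
    by apply: le_trans (dot_enorm _ _) _; rewrite nP mulr1.
  have b2 : `|dot v (P - Q)| <= enorm (P - Q).
    by apply: le_trans (dot_enorm _ _) _; rewrite ler_piMl ?enorm_ge0.
  have b3 : `|dot v P| * enorm (P - Q) <= 1 * enorm (P - Q) by rewrite ler_wpM2r ?enorm_ge0.
  move: up b2 b3; clear -gg; lra.
have a2 : enorm a <= 2 by apply: le_trans (enorm_mul_proj _ p0) _; lra.
have b2 : enorm b <= 2 by apply: le_trans (enorm_mul_proj _ q0) _; lra.
clearbody a b.
have ab2 : dot (a - b) (a - b) <= 16 * C1 ^+ 2 * f.
  rewrite -enorm_sq fr.
  have -> : 16 * C1 ^+ 2 * enorm (x - y) ^+ 2 = (4 * C1 * enorm (x - y)) ^+ 2 by ring.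
  rewrite ler_pXn2r ?nnegrE ?enorm_ge0// mulr_ge0 ?enorm_ge0// mulr_ge0// (le_trans ler01)//.
pose l := dot (x - y) (a - b).
have l2 : l ^+ 2 <= 16 * C1 ^+ 2 * f ^+ 2.
  apply: le_trans (dot_CS _ _) _; rewrite -/f.
  have -> : 16 * C1 ^+ 2 * f ^+ 2 = f * (16 * C1 ^+ 2 * f) by ring.
  by rewrite ler_pM2l.
have l1 : `|l| <= 4 * C1 * f.
  apply: le_trans (dot_enorm _ _) _.
  have -> : 4 * C1 * f = enorm (x - y) * (4 * C1 * enorm (x - y)) by rewrite fr; ring.
  by rewrite ler_pM2l.
have qa : qf (Hg x) a <= 4 * C1.
  apply: le_trans (ler_norm _) _; apply: le_trans (gg_H gg _ Dx) _.
  have : dot a a <= 4 by rewrite -enorm_sq; have := enorm_ge0 a; move: a2; clear -gg; nra.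
  by move: c1; clear -gg; nra.
have qb : qf (Hg y) b <= 4 * C1.
  apply: le_trans (ler_norm _) _; apply: le_trans (gg_H gg _ Dy) _.
  have : dot b b <= 4 by rewrite -enorm_sq; have := enorm_ge0 b; move: b2; clear -gg; nra.
  by move: c1; clear -gg; nra.
have da : `|dot (Dg x) a| <= 2 * C1.
  apply: le_trans (dot_enorm _ _) _; rewrite mulrC.
  by apply: ler_pM; rewrite ?enorm_ge0//; exact: (gg_D gg Dx).
have db : `|dot (Dg y) b| <= 2 * C1.
  apply: le_trans (dot_enorm _ _) _; rewrite mulrC.
  by apply: ler_pM; rewrite ?enorm_ge0//; exact: (gg_D gg Dy).
have t1 : (g x + g y) * (4 * f * dot (a - b) (a - b) + 8 * l ^+ 2) <= 2 * C1 * (192 * C1 ^+ 2 * f ^+ 2).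
  have k1 : f * dot (a - b) (a - b) <= f * (16 * C1 ^+ 2 * f) by rewrite ler_pM2l.
  apply: ler_pM.
  - by clear -gg g1 g2; lra.
  - have := mulr_ge0 (ltW f0) (dot_ge0 (a - b)); have := sqr_ge0 l; clear -gg; lra.
  - by clear -gg h1 h2; lra.
  - by clear -gg k1 l2; lra.
have t2 : f ^+ 2 * (qf (Hg x) a + qf (Hg y) b) <= f ^+ 2 * (8 * C1).
  by rewrite ler_wpM2l ?sqr_ge0//; clear -gg qa qb; lra.
have t3 : 8 * f * l * (dot (Dg x) a + dot (Dg y) b) <= 8 * f * (4 * C1 * f * (4 * C1)).
  rewrite -[8 * f * l * _]mulrA ler_pM2l ?mulr_gt0//; apply: le_trans (ler_norm _) _.
  rewrite normrM; apply: ler_pM => //.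
  apply: le_trans (ler_normD _ _) _; clear -gg da db; lra.
(* 520 = 384 + 8 + 128 from the three summands, after raising the powers of C1 >= 1 to the third. *)
rewrite /hess_psi -/f -/l.
have C2 : C1 <= C1 ^+ 3.
  have : 1 <= C1 ^+ 2 by rewrite expr2 mulr_ege1.
  by move=> ?; rewrite [C1 ^+ 3]exprSr ler_peMl// (le_trans ler01).
have C3 : C1 ^+ 2 <= C1 ^+ 3 by rewrite [leRHS]exprSr ler_peMr// sqr_ge0.
have k1 : f ^+ 2 * C1 <= f ^+ 2 * C1 ^+ 3 by rewrite ler_wpM2l ?sqr_ge0.
have k2 : f ^+ 2 * C1 ^+ 2 <= f ^+ 2 * C1 ^+ 3 by rewrite ler_wpM2l ?sqr_ge0.
move: t1 t2 t3 k1 k2; clear -gg.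
have -> : 2 * C1 * (192 * C1 ^+ 2 * f ^+ 2) = 384 * (f ^+ 2 * C1 ^+ 3) by ring.
have -> : 8 * f * (4 * C1 * f * (4 * C1)) = 128 * (f ^+ 2 * C1 ^+ 2) by ring.
have -> : 520 * C1 ^+ 3 * f ^+ 2 = 520 * (f ^+ 2 * C1 ^+ 3) by ring.
move: (f ^+ 2 * C1 ^+ 3) (f ^+ 2 * C1 ^+ 2) => *; lra.
Qed.

(** The Lipschitz bound on [c] gains a factor r over |Dpsi| = O(r^3), and the lengths of the two
    gradients differ by at most the length of their sum, which is O(r^4). The forcing is thus of the
    order that the time weight absorbs. *)
Lemma Dpsi_forcing (c : V -> R) (Cc Lc : R) x y : D x -> D y -> enorm (x - y) <= 1 -> 0 <= Lc ->
  (forall x, D x -> `|c x| <= Cc) -> (forall x y, D x -> D y -> `|c x - c y| <= Lc * enorm (x - y)) ->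
  c x * enorm (Dpsi g Dg y x) - c y * enorm (Dpsi g Dg x y) <=
  (9 * Lc * C1 + 2 * Cc * C1) * dot (x - y) (x - y) ^+ 2.
Proof.
move=> Dx Dy r1 Lc0 hC hL.
have r0 := enorm_ge0 (x - y); have c1 := gg_C1 gg.
have -> : c x * enorm (Dpsi g Dg y x) - c y * enorm (Dpsi g Dg x y) =
  (c x - c y) * enorm (Dpsi g Dg y x) + c y * (enorm (Dpsi g Dg y x) - enorm (Dpsi g Dg x y)) by ring.
have fr : dot (x - y) (x - y) = enorm (x - y) ^+ 2 by rewrite enorm_sq.
rewrite [leRHS]mulrDl; apply: lerD.
  apply: le_trans (ler_norm _) _; rewrite normrM [`|enorm _|]ger0_norm ?enorm_ge0//.
  apply: (@le_trans _ _ ((Lc * enorm (x - y)) *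
    (C1 * (dot (x - y) (x - y) ^+ 2 + 8 * dot (x - y) (x - y) * enorm (x - y))))).
    by apply: ler_pM; rewrite ?enorm_ge0 ?hL// (Dpsi_le gg).
  rewrite fr; move: (enorm (x - y)) r0 r1 => r r0 r1.
  have -> : Lc * r * (C1 * (r ^+ 2 ^+ 2 + 8 * r ^+ 2 * r)) = Lc * C1 * (r ^+ 4 * r + 8 * r ^+ 4) by ring.
  have -> : 9 * Lc * C1 * r ^+ 2 ^+ 2 = Lc * C1 * (9 * r ^+ 4) by ring.
  rewrite ler_wpM2l ?mulr_ge0// ?(le_trans ler01)//.
  have : r ^+ 4 * r <= r ^+ 4 by rewrite ler_piMr// exprn_ge0.
  by clear -gg; move: (r ^+ 4) => *; lra.
apply: le_trans (ler_norm _) _; rewrite normrM.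
have -> : 2 * Cc * C1 * dot (x - y) (x - y) ^+ 2 = Cc * (2 * C1 * dot (x - y) (x - y) ^+ 2) by ring.
apply: ler_pM => //; first exact: hC.
rewrite -(enormN (Dpsi g Dg x y)); apply: le_trans (ler_dist_enorm _ _) _.
rewrite opprK Dpsi_add enormZ ger0_norm ?sqr_ge0// mulrC.
rewrite ler_wpM2r ?sqr_ge0//; apply: le_trans (enormD _ _) _.
have := gg_D gg Dx; have := gg_D gg Dy; clear -gg; lra.
Qed.

End estimates.

(** * The penalized doubling function *)

Section doubling_function.
Variables (R : realType) (n : nat).
Local Notation V := 'rV[R]_n.
Local Notation Z := 'rV[R]_(n + 1).
Local Notation W := 'rV[R]_((n + 1) + (n + 1)).
Variables (D B : set V) (nu : V -> V).
Variables (C0 C1 : R) (g : V -> R) (Dg : V -> V) (Hg : V -> 'M[R]_n).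
Hypothesis gg : good_geometry D B nu C0 C1 g Dg Hg.

Lemma mul_lsub m1 m2 (w : 'rV[R]_(m1 + m2)) : w *m col_mx 1%:M 0 = lsubmx w.
Proof. by rewrite -{1}[w]hsubmxK mul_row_col mulmx1 mulmx0 addr0. Qed.

Lemma mul_rsub m1 m2 (w : 'rV[R]_(m1 + m2)) : w *m col_mx 0 1%:M = rsubmx w.
Proof. by rewrite -{1}[w]hsubmxK mul_row_col mulmx1 mulmx0 add0r. Qed.

Lemma row_mx_rowE m n1 n2 (A : 'M[R]_(m, n1)) (A' : 'M[R]_(m, n2)) i :
  row i (row_mx A A') = row_mx (delta_mx 0 i *m A) (delta_mx 0 i *m A').
Proof. by rewrite row_row_mx !rowE. Qed.

Definition x1 (w : W) : V := spart (lsubmx w).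
Definition x2 (w : W) : V := spart (rsubmx w).
Definition t1 (w : W) : R := tpart (lsubmx w).
Definition t2 (w : W) : R := tpart (rsubmx w).

Lemma x1_row h h' : x1 (row_mx h h') = spart h. Proof. by rewrite /x1 row_mxKl. Qed.
Lemma x2_row h h' : x2 (row_mx h h') = spart h'. Proof. by rewrite /x2 row_mxKr. Qed.
Lemma t1_row h h' : t1 (row_mx h h') = tpart h. Proof. by rewrite /t1 row_mxKl. Qed.
Lemma t2_row h h' : t2 (row_mx h h') = tpart h'. Proof. by rewrite /t2 row_mxKr. Qed.

Lemma x1E w : x1 w = w *m (col_mx 1%:M 0 *m col_mx 1%:M 0).
Proof. by rewrite mulmxA mul_lsub mul_lsub. Qed.

Lemma x2E w : x2 w = w *m (col_mx 0 1%:M *m col_mx 1%:M 0).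
Proof. by rewrite mulmxA mul_rsub mul_lsub. Qed.

Lemma t1E w : t1 w = dot (row_mx (strow 0 1) 0) w.
Proof. by rewrite -{2}[w]hsubmxK dot_row_mx dot_strow !dot0l add0r mul1r addr0. Qed.

Lemma t2E w : t2 w = dot (row_mx 0 (strow 0 1)) w.
Proof. by rewrite -{2}[w]hsubmxK dot_row_mx dot_strow !dot0l !add0r mul1r. Qed.

Lemma x1D w d : x1 (w + d) = x1 w + x1 d. Proof. by rewrite !x1E mulmxDl. Qed.
Lemma x2D w d : x2 (w + d) = x2 w + x2 d. Proof. by rewrite !x2E mulmxDl. Qed.
Lemma t1D w d : t1 (w + d) = t1 w + t1 d. Proof. by rewrite !t1E dotDr. Qed.
Lemma t2D w d : t2 (w + d) = t2 w + t2 d. Proof. by rewrite !t2E dotDr. Qed.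

(* The summand with ga doubles the time variable, the one with Bc keeps maxima away
   from the final time, and psi g ~ |x - y|^4 has the right sign of the normal
   derivatives thanks to the weight g. *)
Definition phi (L ga eta Bc T1 : R) (m : nat) (w : W) : R :=
  L * ((1 + t1 w) ^+ m * psi g (x2 w) (x1 w)) +
  (ga * ((t1 w - t2 w) * (t1 w - t2 w)) +
  (eta * (t1 w + t2 w) +
   Bc * (Num.max (t1 w - T1) 0 ^+ 3 + Num.max (t2 w - T1) 0 ^+ 3))).

Lemma qjet_psi2 w : D (x1 w) -> D (x2 w) ->
  qjet (fun w => psi g (x2 w) (x1 w)) w
   (fun d => dot (Dpsi g Dg (x2 w) (x1 w)) (x1 d) + dot (Dpsi g Dg (x1 w) (x2 w)) (x2 d))
   (fun d => hess_psi g Dg Hg (x1 w) (x2 w) (x1 d) (x2 d)).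
Proof.
move=> D1 D2; set x := x1 w; set y := x2 w.
pose M1 : 'M[R]_(n + 1 + (n + 1), n) := col_mx 1%:M 0 *m col_mx 1%:M 0.
pose M2 : 'M[R]_(n + 1 + (n + 1), n) := col_mx 0 1%:M *m col_mx 1%:M 0.
have j1 : qjet (fun w => g (x1 w)) w (fun d => dot (Dg x) (x1 d)) (fun d => qf (Hg x) (x1 d)).
  have := qjet_lin (L := M1) (x := w) (f := g) (l := dot (Dg x)) (q := qf (Hg x)).
  rewrite -x1E => /(_ (qjet_sym (gg_jet gg D1))).
  by apply: qjet_eq => d; rewrite ?x1E.
have j2 : qjet (fun w => g (x2 w)) w (fun d => dot (Dg y) (x2 d)) (fun d => qf (Hg y) (x2 d)).
  have := qjet_lin (L := M2) (x := w) (f := g) (l := dot (Dg y)) (q := qf (Hg y)).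
  rewrite -x2E => /(_ (qjet_sym (gg_jet gg D2))).
  by apply: qjet_eq => d; rewrite ?x2E.
have jf : qjet (fun w => dot (x1 w - x2 w) (x1 w - x2 w)) w
    (fun d => 2 * dot (x - y) (x1 d - x2 d)) (fun d => 2 * dot (x1 d - x2 d) (x1 d - x2 d)).
  have := qjet_lin (L := M1 - M2) (qjet_dotself 0 (w *m (M1 - M2))).
  by apply: qjet_eq => d; rewrite /x /y !x1E !x2E ?subr0 !mulmxBr.
apply: qjet_eq (qjetM (qjetD j1 j2) (qjetM jf jf)) => d //.
- rewrite !dot_Dpsi -/x -/y.
  have -> : y - x = - (x - y) by rewrite opprB.
  move: (x - y) => e; rewrite !dotNl !dotNr opprK !dotBr; ring.
- rewrite /hess_psi /= -/x -/y; ring.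
Qed.

(** [tau] and [ka] are the two time derivatives. The second order part is made explicit only on
    increments without time components, since [stproj] produces no others. *)
Lemma qjet_phi L ga eta Bc T1 m w : D (x1 w) -> D (x2 w) ->
  let k := L * (1 + t1 w) ^+ m in
  let tau := L * psi g (x2 w) (x1 w) * (m%:R * (1 + t1 w) ^+ m.-1) + 2 * ga * (t1 w - t2 w)
      + eta + 3 * Bc * Num.max (t1 w - T1) 0 ^+ 2 in
  let ka := - (2 * ga * (t1 w - t2 w)) + eta + 3 * Bc * Num.max (t2 w - T1) 0 ^+ 2 in
  exists q, qjet (phi L ga eta Bc T1 m) w
    (fun d => dot (strow (k *: Dpsi g Dg (x2 w) (x1 w)) tau) (lsubmx d) +
              dot (strow (k *: Dpsi g Dg (x1 w) (x2 w)) ka) (rsubmx d)) q /\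
    forall d, t1 d = 0 -> t2 d = 0 ->
      q d = k * hess_psi g Dg Hg (x1 w) (x2 w) (x1 d) (x2 d).
Proof.
move=> D1 D2 /=.
have jt1 : qjet t1 w t1 (fun=> 0).
  by apply: qjet_eq (qjet_dot (row_mx (strow 0 1) 0) w) => d //; rewrite ?t1E.
have jt2 : qjet t2 w t2 (fun=> 0).
  by apply: qjet_eq (qjet_dot (row_mx 0 (strow 0 1)) w) => d //; rewrite ?t2E.
have shift (f l : W -> R) a : qjet f w l (fun=> 0) -> qjet (fun z => f z + a) w l (fun=> 0).
  by move=> jf; apply: qjet_eq (qjetD jf (qjet_cst a w)) => d //; rewrite ?addr0.
have j1t : qjet (fun z => 1 + t1 z) w t1 (fun=> 0).
  by apply: qjet_eq (shift _ _ 1 jt1) => d //; rewrite addrC.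
have [k0 jE] := qjet_pow m j1t.
have jd : qjet (fun z => t1 z - t2 z) w (fun d => t1 d - t2 d) (fun=> 0).
  apply: qjet_eq (qjetD jt1 (qjetZ (-1) jt2)) => d; rewrite ?mulN1r//.
  by rewrite subr0.
have [k1 jp1] := qjet_pos3 (shift _ _ (- T1) jt1).
have [k2 jp2] := qjet_pos3 (shift _ _ (- T1) jt2).
have J := qjetD (qjetZ L (qjetM jE (qjet_psi2 D1 D2)))
  (qjetD (qjetZ ga (qjetM jd jd)) (qjetD (qjetZ eta (qjetD jt1 jt2)) (qjetZ Bc (qjetD jp1 jp2)))).
eexists; split.
- apply: qjet_eq J => d //.
  rewrite !dot_strow !dotZl -/(x1 d) -/(x2 d) -/(t1 d) -/(t2 d).
  move: (dot _ (x1 d)) (dot _ (x2 d)) (psi _ _ _) (t1 w) (t2 w) => *; ring.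
- move=> d td sd; rewrite /= td sd.
  move: (hess_psi _ _ _ _ _ _ _) => *; ring.
Qed.

End doubling_function.

(** * Exclusion of interior maxima *)

Section no_interior_maximum.
Variables (R : realType) (n : nat).
Local Notation V := 'rV[R]_n.
Local Notation Z := 'rV[R]_(n + 1).
Local Notation W := 'rV[R]_((n + 1) + (n + 1)).
Variables (D B : set V) (nu : V -> V).
Variables (C0 C1 : R) (g : V -> R) (Dg : V -> V) (Hg : V -> 'M[R]_n).
Hypothesis gg : good_geometry D B nu C0 C1 g Dg Hg.

(** A quadratic majorant with exact first derivative, because subsolutions are tested by polynomials
    of degree two in time. *)
Lemma pos3_le (a : R) : exists2 de : R, 0 < de & forall z, `|z| < de ->
  Num.max (a + z) 0 ^+ 3 <= Num.max a 0 ^+ 3 + 3 * Num.max a 0 ^+ 2 * z + (3 * Num.max a 0 + 1) * z ^+ 2.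
Proof.
have [a0|a0] := ltP 0 a.
  exists (Num.min a 1); first by rewrite lt_min a0 ltr01.
  move=> z; rewrite lt_min !ltr_norml => /andP[/andP[z1 z2] /andP[z3 z4]].
  rewrite max_l; last by lra.
  have : z * z ^+ 2 <= 1 * z ^+ 2 by rewrite ler_wpM2r ?sqr_ge0// ltW.
  have -> : z * z ^+ 2 = z ^+ 3 by ring.
  have -> : (a + z) ^+ 3 = a ^+ 3 + 3 * a ^+ 2 * z + 3 * a * z ^+ 2 + z ^+ 3 by ring.
  by move: (z ^+ 3) (z ^+ 2) => *; lra.
exists 1 => // z z1; rewrite expr0n/= expr0n/= !mulr0 !add0r mul0r add0r mul1r.
have m0 : 0 <= Num.max (a + z) 0 by rewrite le_max lexx orbT.
have mz : Num.max (a + z) 0 <= `|z|.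
  by rewrite ge_max normr_ge0 andbT; apply: le_trans (ler_norm z); lra.
rewrite -[leRHS]real_normK ?num_real//.
apply: (@le_trans _ _ (`|z| ^+ 3)); first by rewrite lerXn2r// nnegrE.
by rewrite exprS ler_piMl ?sqr_ge0// ltW.
Qed.

Lemma touch_time c C u x t D' ga s eta Bc T1 : 0 <= C -> subsol D B nu c C u -> st_cont D u ->
  D x -> 0 < t -> 0 <= Bc ->
  (exists2 de : R, 0 < de & forall y z, D y -> 0 <= z -> `|y - x| < de -> `|z - t| < de ->
     u (y, z) <= u (x, t) + D' * dot (y - x) (y - x) ^+ 2 + ga * ((z - s) ^+ 2 - (t - s) ^+ 2)
       + eta * (z - t) + Bc * (Num.max (z - T1) 0 ^+ 3 - Num.max (t - T1) 0 ^+ 3)) ->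
  2 * ga * (t - s) + eta + 3 * Bc * Num.max (t - T1) 0 ^+ 2 <= 0.
Proof.
move=> C_0 su cu Dx t0 B0 [de de0 h]; have [d1 d10 h1] := pos3_le (t - T1).
apply: (touch_zero gg (D' := D') (b := ga + Bc * (3 * Num.max (t - T1) 0 + 1)) C_0 su cu Dx t0).
exists (Num.min de d1); first by rewrite lt_min de0.
move=> y z Dy z0; rewrite !lt_min => /andP[y1 y2] /andP[z1 z2].
apply: le_trans (h _ _ Dy z0 y1 z1) _.
have e1 : t - T1 + (z - t) = z - T1 by ring.
have := h1 _ z2; rewrite e1 => hh.
have := ler_wpM2l B0 hh.
move: (Num.max (z - T1) 0) (Num.max (t - T1) 0) (dot _ _ ^+ 2) (u _) => M1 M2 f U; lra.
Qed.

Variables (c : V -> R) (Cc Lc C : R) (u w : V * R -> R).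
Hypotheses (Lc0 : 0 <= Lc) (hC : forall x, D x -> `|c x| <= Cc) (C_ge0 : 0 <= C).
Hypothesis hL : forall x y, D x -> D y -> `|c x - c y| <= Lc * enorm (x - y).
Hypotheses (su : subsol D B nu c C u) (sw : subsol D B nu (fun x => - c x) C w).
Hypotheses (cu : st_cont D u) (cw : st_cont D w).

(** The constant of [hess_psi_proj], summed over n + 1 unit vectors, plus that of [Dpsi_forcing].
    The logarithmic derivative m/(1+t) of the weight has to dominate it. *)
Definition growth_rate : R := (n%:R + 1) * 520 * C1 ^+ 3 + 9 * Lc * C1 + 2 * Cc * C1.

Lemma spart_stproj (p : V) h : spart (h *m stproj p) = spart h *m ortho_proj p.
Proof.
by rewrite -{1}[h]strowK /strow /stproj mul_row_block !mulmx0 !addr0 [LHS]row_mxKl.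
Qed.

Lemma tpart_stproj (p : V) h : tpart (h *m stproj p) = 0.
Proof.
by rewrite -{1}[h]strowK /strow /stproj mul_row_block !mulmx0 !addr0 /tpart row_mxKr mxE.
Qed.

Lemma spart_stprojZ (p : V) h a : 0 < a ->
  spart (h *m stproj (a *: p)) = spart h *m ortho_proj p.
Proof. by move=> a0; rewrite spart_stproj projZ. Qed.

Lemma cont_coef_lip (f : V -> R) : (forall x y, D x -> D y -> `|f x - f y| <= Lc * enorm (x - y)) ->
  cont_coef D f.
Proof.
move=> h y Dy e e0; pose K := Lc * (n%:R + 1) + 1.
have n1 : (0 : R) < n%:R + 1 by rewrite ltr_wpDl.
have K0 : 0 < K by rewrite ltr_wpDl// mulr_ge0// ltW.
exists (e / K); first by rewrite divr_gt0.
move=> z Dz zy; apply: le_lt_trans (h _ _ Dz Dy) _.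
apply: (@le_lt_trans _ _ (K * `|z - y|)); last by rewrite mulrC -ltr_pdivlMr.
apply: (@le_trans _ _ (Lc * (n%:R + 1) * `|z - y|)).
  by rewrite -mulrA ler_wpM2l// enorm_le_norm.
by rewrite ler_wpM2r// lerDl.
Qed.

Lemma growth_rate_gt0 x : D x -> 0 < growth_rate.
Proof.
move=> Dx; have c1 := gg_C1 gg.
have Cc0 : 0 <= Cc by apply: le_trans (hC Dx).
have n1 : (0 : R) < n%:R + 1 by rewrite ltr_wpDl.
have c0 : 0 < C1 by rewrite (lt_le_trans ltr01).
have c3 : 0 < C1 ^+ 3 by rewrite exprn_gt0.
have a1 : 0 < (n%:R + 1) * C1 ^+ 3 by rewrite mulr_gt0.
have a2 : 0 <= Lc * C1 by rewrite mulr_ge0// ltW.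
have a3 : 0 <= Cc * C1 by rewrite mulr_ge0// ltW.
by rewrite /growth_rate; move: a1 a2 a3; clear -gg Lc0 hC C_ge0 hL su sw cu cw => *; lra.
Qed.

Lemma no_interior_max L ga eta Bc T1 m dg (z : W) :
  (forall x y, B x -> D y -> enorm (x - y) < dg -> g x + g y <= 3) ->
  0 < L -> 0 < eta -> 0 <= ga -> 0 <= Bc ->
  D (x1 z) -> D (x2 z) -> 0 < t1 z -> 0 < t2 z ->
  enorm (x1 z - x2 z) < dg -> C1 * enorm (x1 z - x2 z) <= 2 -> enorm (x1 z - x2 z) <= 1 ->
  growth_rate * (1 + t1 z) <= m%:R ->
  ~ exists2 de : R, 0 < de & forall d : W, `|d| < de -> D (x1 (z + d)) -> 0 <= t1 (z + d) ->
      D (x2 (z + d)) -> 0 <= t2 (z + d) ->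
      u (x1 (z + d), t1 (z + d)) + w (x2 (z + d), t2 (z + d)) - phi g L ga eta Bc T1 m (z + d) <=
      u (x1 z, t1 z) + w (x2 z, t2 z) - phi g L ga eta Bc T1 m z.
Proof.
move=> hdg L0 eta0 ga0 Bc0 Dx Dy t0 s0 xydg r2 r1 hm [de de0 loc].
set x := x1 z in Dx xydg r2 r1 loc *; set y := x2 z in Dy xydg r2 r1 loc *.
set t := t1 z in t0 hm loc *; set s := t2 z in s0 loc *.
have cD : closed D by apply: compact_closed; [exact: norm_hausdorff|exact: gg_compact gg].
have c1 := gg_C1 gg.
have Cc0 : 0 <= Cc by apply: le_trans (hC Dx).
have gr0 := growth_rate_gt0 Dx.
have M0 a : 0 <= Num.max a 0 ^+ 2 :> R by exact: sqr_ge0.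
(* If x = y, freezing one point leaves a penalty of fourth order in the other, so [touch_time]
   applies to each function separately. In the sum of the two inequalities the terms with ga cancel,
   and 2 eta plus nonnegative terms would be at most 0. *)
have [exy|xy] := eqVneq x y.
  have k1 := le_trans (ler_norm (L * (2 + t) ^+ m * (2 * C1))) (lexx _).
  have psile x' : D x' -> psi g y x' <= 2 * C1 * dot (x' - x) (x' - x) ^+ 2.
    move=> Dx'; rewrite /psi exy -expr2 ler_wpM2r ?sqr_ge0//.
    have := gg_le gg Dx'; have := gg_le gg Dy; lra.
  have z0 : psi g y x = 0 by rewrite /psi exy subrr dot0l !mulr0.
  have tz : 0 <= 1 + t by lra.
  have h1 := touch_time (x := x) (t := t) (D' := L * ((2 + t) ^+ m * (2 * C1))) (ga := ga) (s := s)
    (eta := eta) (Bc := Bc) (T1 := T1) C_ge0 su cu Dx t0 Bc0.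
  have {}h1 : 2 * ga * (t - s) + eta + 3 * Bc * Num.max (t - T1) 0 ^+ 2 <= 0.
    apply: h1; exists (Num.min de 1); first by rewrite lt_min de0 ltr01.
    move=> x' t' Dx' t'0; rewrite !lt_min => /andP[a1 _] /andP[a2 a3].
    pose d : W := row_mx (strow (x' - x) (t' - t)) 0.
    have ex1 : x1 (z + d) = x' by rewrite x1D /x1 row_mxKl spart_strow -/(x1 z) -/x subrKC.
    have ex2 : x2 (z + d) = y by rewrite x2D /x2 row_mxKr spart0 addr0.
    have et1 : t1 (z + d) = t' by rewrite t1D /t1 row_mxKl tpart_strow -/(t1 z) -/t subrKC.
    have et2 : t2 (z + d) = s by rewrite t2D /t2 row_mxKr tpart0 addr0.
    have dd : `|d| < de.
      apply: (@le_lt_trans _ _ (Num.max `|x' - x| `|t' - t|)); last by rewrite gt_max a1.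
      apply: norm_leP => [|i]; first by rewrite le_max normr_ge0.
      rewrite mxE; case: (fintype.split i) => j; last by rewrite mxE normr0 le_max normr_ge0.
      apply: le_trans (coord_norm _ _) _; apply: norm_strow; rewrite le_max ?normr_ge0 ?lexx ?orbT//.
    have := loc d dd; rewrite ex1 ex2 et1 et2 /phi ex1 ex2 et1 et2 -/x -/y -/t -/s z0 mulr0 => /(_ Dx' t'0 Dy (ltW s0)).
    have b1 : (1 + t') ^+ m <= (2 + t) ^+ m.
      rewrite lerXn2r ?nnegrE//; move: a3; rewrite ltr_norml => /andP[]; lra.
    have b2 : L * ((1 + t') ^+ m * psi g y x') <= L * ((2 + t) ^+ m * (2 * C1 * dot (x' - x) (x' - x) ^+ 2)).
      rewrite ler_pM2l//; apply: ler_pM => //; last exact: psile.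
      - by rewrite exprn_ge0//; lra.
      - rewrite /psi mulr_ge0 ?mulr_ge0 ?dot_ge0//.
        have := gg_half gg Dx'; have := gg_half gg Dy; lra.
    have eqm : L * ((2 + t) ^+ m * (2 * C1 * dot (x' - x) (x' - x) ^+ 2)) =
       L * ((2 + t) ^+ m * (2 * C1)) * dot (x' - x) (x' - x) ^+ 2 by ring.
    rewrite eqm in b2; move: b2; clear -gg Lc0 hC C_ge0 hL su sw cu cw.
    move: (L * _) (L * _ * _) (u _) (u _) (w _) (Num.max _ _ ^+ 3) (Num.max _ _ ^+ 3) (Num.max _ _ ^+ 3).
    by move=> *; lra.
  have psile2 y' : D y' -> psi g y' x <= 2 * C1 * dot (y' - y) (y' - y) ^+ 2.
    move=> Dy'; rewrite /psi exy -expr2 -[y - y']opprB dotNl dotNr opprK ler_wpM2r ?sqr_ge0//.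
    have := gg_le gg Dy'; have := gg_le gg Dy; lra.
  have h2 := touch_time (x := y) (t := s) (D' := L * ((1 + t) ^+ m * (2 * C1))) (ga := ga) (s := t)
    (eta := eta) (Bc := Bc) (T1 := T1) C_ge0 sw cw Dy s0 Bc0.
  have {}h2 : 2 * ga * (s - t) + eta + 3 * Bc * Num.max (s - T1) 0 ^+ 2 <= 0.
    apply: h2; exists de => // y' s' Dy' s'0 a1 a2.
    pose d : W := row_mx 0 (strow (y' - y) (s' - s)).
    have ex1 : x1 (z + d) = x by rewrite x1D /x1 row_mxKl spart0 addr0.
    have ex2 : x2 (z + d) = y' by rewrite x2D /x2 row_mxKr spart_strow -/(x2 z) -/y subrKC.
    have et1 : t1 (z + d) = t by rewrite t1D /t1 row_mxKl tpart0 addr0.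
    have et2 : t2 (z + d) = s' by rewrite t2D /t2 row_mxKr tpart_strow -/(t2 z) -/s subrKC.
    have dd : `|d| < de.
      apply: (@le_lt_trans _ _ (Num.max `|y' - y| `|s' - s|)); last by rewrite gt_max a1.
      apply: norm_leP => [|i]; first by rewrite le_max normr_ge0.
      rewrite mxE; case: (fintype.split i) => j; first by rewrite mxE normr0 le_max normr_ge0.
      apply: le_trans (coord_norm _ _) _; apply: norm_strow; rewrite le_max ?normr_ge0 ?lexx ?orbT//.
    have := loc d dd; rewrite ex1 ex2 et1 et2 /phi ex1 ex2 et1 et2 -/x -/y -/t -/s z0 mulr0 => /(_ Dx (ltW t0) Dy' s'0).
    have b2 : L * ((1 + t) ^+ m * psi g y' x) <= L * ((1 + t) ^+ m * (2 * C1 * dot (y' - y) (y' - y) ^+ 2)).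
      by rewrite ler_pM2l// ler_wpM2l ?exprn_ge0// psile2.
    have eqm : L * ((1 + t) ^+ m * (2 * C1 * dot (y' - y) (y' - y) ^+ 2)) =
       L * ((1 + t) ^+ m * (2 * C1)) * dot (y' - y) (y' - y) ^+ 2 by ring.
    rewrite eqm in b2; move: b2; clear -gg Lc0 hC C_ge0 hL su sw cu cw.
    move: (L * _) (L * _ * _) (w _) (w _) (u _) (Num.max _ _ ^+ 3) (Num.max _ _ ^+ 3) (Num.max _ _ ^+ 3).
    by move=> *; lra.
  have := mulr_ge0 Bc0 (M0 (t - T1)); have := mulr_ge0 Bc0 (M0 (s - T1)).
  move: h1 h2 eta0; clear -gg Lc0 hC C_ge0 hL su sw cu cw; move: (Num.max _ _ ^+ 2) (Num.max _ _ ^+ 2) => *; lra.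
have t10 : 0 < 1 + t by lra.
pose k := L * (1 + t) ^+ m; have k0 : 0 < k by rewrite mulr_gt0// exprn_gt0.
have [q [[P [A [jP As hP hq]]] hq0]] := qjet_phi gg L ga eta Bc T1 m Dx Dy.
pose tau := L * psi g y x * (m%:R * (1 + t) ^+ m.-1) + 2 * ga * (t - s) + eta + 3 * Bc * Num.max (t - T1) 0 ^+ 2.
pose ka := - (2 * ga * (t - s)) + eta + 3 * Bc * Num.max (s - T1) 0 ^+ 2.
rewrite -/x -/y -/t -/s -/k -/tau -/ka in hP hq0.
pose f := dot (x - y) (x - y); have f0 : 0 < f by rewrite dot_gt0// subr_eq0.
have r0 : 0 < enorm (x - y) by rewrite enorm_gt0// subr_eq0.
have p0 : Dpsi g Dg y x != 0.
  rewrite -enorm_eq0 gt_eqF//; apply: lt_le_trans (Dpsi_ge gg Dx Dy r2).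
  by rewrite !mulr_gt0.
have q0 : Dpsi g Dg x y != 0.
  have := @Dpsi_ge _ _ _ _ _ _ _ _ _ _ gg y x Dy Dx; rewrite [enorm (y - x)]enormBC => /(_ r2) hh.
  rewrite -enorm_eq0 gt_eqF//; apply: lt_le_trans hh.
  by rewrite -[y - x]opprB dotNl dotNr opprK !mulr_gt0.
have kp0 : k *: Dpsi g Dg y x != 0 by rewrite scaler_eq0 gt_eqF.
have kq0 : k *: Dpsi g Dg x y != 0 by rewrite scaler_eq0 gt_eqF.
have yx : y != x by rewrite eq_sym.
have yxdg : enorm (y - x) < dg by rewrite enormBC.
have key := theorem_on_sums (c := c) (c' := fun x => - c x) (x := x) (y := y) (t := t) (s := s)
  (p := k *: Dpsi g Dg y x) (q := k *: Dpsi g Dg x y) (tau := tau) (ka := ka) (A := A)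
  cD (cont_coef_lip hL) _ (@gg_nu _ _ _ _ _ _ _ _ _ _ gg) su sw cu cw Dx Dy t0 s0 kp0 kq0
  (points_outward_Dpsi gg hdg Dx Dy xy xydg k0) (points_outward_Dpsi gg hdg Dy Dx yx yxdg k0).
have {}key : tau + ka - c x * enorm (k *: Dpsi g Dg y x) - - c y * enorm (k *: Dpsi g Dg x y) <=
    \tr (row_mx (stproj (k *: Dpsi g Dg y x)) (stproj (k *: Dpsi g Dg x y)) *m A *m
      (row_mx (stproj (k *: Dpsi g Dg y x)) (stproj (k *: Dpsi g Dg x y)))^T).
  apply: key.
    by apply: cont_coef_lip => a b Da Db; rewrite opprK addrC distrC hL.
  move=> e e0; have [d1 d10 hd1] := jP _ e0.
  exists (Num.min d1 de); first by rewrite lt_min d10.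
  move=> h h'; rewrite !lt_min => /andP[a1 a2] /andP[b1 b2] Dh th Dh' th'.
  pose d : W := row_mx h h'.
  have dlt r : `|h| < r -> `|h'| < r -> `|d| < r.
    move=> hr hr'; apply: (@le_lt_trans _ _ (Num.max `|h| `|h'|)); last by rewrite gt_max hr.
    apply: norm_leP => [|i]; first by rewrite le_max normr_ge0.
    by rewrite mxE; case: (fintype.split i) => j; apply: le_trans (coord_norm _ _) _;
      rewrite le_max lexx ?orbT.
  have ex1 : x1 (z + d) = x + spart h by rewrite x1D /d /x1 row_mxKl.
  have ex2 : x2 (z + d) = y + spart h' by rewrite x2D /d /x2 row_mxKr.
  have et1 : t1 (z + d) = t + tpart h by rewrite t1D /d /t1 row_mxKl.
  have et2 : t2 (z + d) = s + tpart h' by rewrite t2D /d /t2 row_mxKr.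
  have := loc d (dlt _ a2 b2); rewrite ex1 ex2 et1 et2 => /(_ Dh th Dh' th').
  have := hd1 _ (dlt _ a1 b1); rewrite hP /d row_mxKl row_mxKr -/d ler_norml => /andP[_].
  rewrite /st_shift; clear -gg Lc0 hC C_ge0 hL su sw cu cw.
  move: (phi _ _ _ _ _ _ _ _) (phi _ _ _ _ _ _ _ _) (u _) (u _) (w _) (w _) (dot _ h) (dot _ h') (qf _ _) => *; lra.
have hb := Dpsi_forcing gg Dx Dy r1 Lc0 hC hL.
rewrite -/f in hb.
move: key; rewrite qf_row.
(* The rows of the two projections form the pairs (v P, v Q) for unit vectors v; their time
   components vanish, so the explicit part of [qjet_phi] applies. *)
have -> : \sum_i qf A (row i (row_mx (stproj (k *: Dpsi g Dg y x)) (stproj (k *: Dpsi g Dg x y)))) =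
   \sum_(i < n + 1) k * hess_psi g Dg Hg x y (spart (delta_mx 0 i) *m ortho_proj (Dpsi g Dg y x))
      (spart (delta_mx 0 i) *m ortho_proj (Dpsi g Dg x y)).
  have hcongr a b a' b' : a = a' -> b = b' ->
    k * hess_psi g Dg Hg x y a b = k * hess_psi g Dg Hg x y a' b' by move=> -> ->.
  apply: eq_bigr => i _; rewrite row_mx_rowE.
  rewrite (hq (row_mx _ _)).
  rewrite hq0.
  - rewrite x1_row x2_row; apply: hcongr.
    + exact: (spart_stprojZ (Dpsi g Dg y x) _ k0).
    + exact: (spart_stprojZ (Dpsi g Dg x y) _ k0).
  - by rewrite t1_row; exact: tpart_stproj.
  - by rewrite t2_row; exact: tpart_stproj.
have sumle : \sum_(i < n + 1) k * hess_psi g Dg Hg x y (spart (delta_mx 0 i) *m ortho_proj (Dpsi g Dg y x))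
      (spart (delta_mx 0 i) *m ortho_proj (Dpsi g Dg x y)) <= (n%:R + 1) * (k * (520 * C1 ^+ 3 * f ^+ 2)).
  apply: (@le_trans _ _ (\sum_(i < n + 1) k * (520 * C1 ^+ 3 * f ^+ 2))); last first.
    by rewrite sumr_const card_ord -[leLHS]mulr_natl natrD.
  apply: ler_sum => i _; rewrite ler_pM2l//; apply: (hess_psi_proj gg) => //.
  rewrite -(@ler_pXn2r _ 2)// ?nnegrE ?enorm_ge0// enorm_sq expr1n.
  have := dot_split (delta_mx 0 i : Z) (delta_mx 0 i). rewrite dot_delta mxE !eqxx/= => e1; rewrite [leRHS]e1.
  by rewrite lerDl -expr2 sqr_ge0.
move=> key; have {}key := le_trans key sumle.
rewrite !enormZ gtr0_norm// in key.
have psige : f ^+ 2 <= psi g y x.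
  rewrite /psi -/f -expr2 ler_peMl ?sqr_ge0//.
  have := gg_half gg Dx; have := gg_half gg Dy; lra.
(* Cancelling one factor 1 + t turns the hypothesis on m into this bound; m = 0 is ruled out because
   the growth rate is positive. *)
have em : k * growth_rate <= L * (m%:R * (1 + t) ^+ m.-1).
  rewrite /k -mulrA ler_pM2l//; case: (m) hm => [|m' hm'].
    by rewrite leNgt mulr_gt0.
  by rewrite exprS /= mulrAC ler_wpM2r ?(exprn_ge0 _ (ltW t10))// mulrC.
have big : k * growth_rate * f ^+ 2 <= L * psi g y x * (m%:R * (1 + t) ^+ m.-1).
  apply: (@le_trans _ _ (L * (m%:R * (1 + t) ^+ m.-1) * f ^+ 2)).
    by rewrite ler_wpM2r ?sqr_ge0.
  rewrite mulrAC ler_wpM2r//; last by rewrite ler_pM2l.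
  by rewrite mulr_ge0// exprn_ge0// ltW.
have hb' := ler_wpM2l (ltW k0) hb.
have B1 := mulr_ge0 Bc0 (M0 (t - T1)); have B2 := mulr_ge0 Bc0 (M0 (s - T1)).
move: key big hb' B1 B2 eta0; rewrite /tau /ka /growth_rate; clear -gg Lc0 hC C_ge0 hL su sw cu cw.
move: (Num.max _ _ ^+ 2) (Num.max _ _ ^+ 2) (psi _ _ _) (f ^+ 2) (C1 ^+ 3) (enorm _) (enorm _) => *; lra.
Qed.

End no_interior_maximum.

(** * Compact sets of pairs and the doubling estimate *)

Section pairs.
Variables (R : realType) (n : nat).
Local Notation V := 'rV[R]_n.
Local Notation W := 'rV[R]_((n + 1) + (n + 1)).
Implicit Types (D : set V) (z : W).

Definition pairs D (T : R) : set W :=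
  [set z | [/\ D (x1 z), D (x2 z), 0 <= t1 z <= T & 0 <= t2 z <= T]].

Lemma norm_lsub m1 m2 (w : 'rV[R]_(m1 + m2)) : `|lsubmx w| <= `|w|.
Proof. by apply: norm_leP => // i; rewrite mxE; exact: coord_norm. Qed.

Lemma norm_rsub m1 m2 (w : 'rV[R]_(m1 + m2)) : `|rsubmx w| <= `|w|.
Proof. by apply: norm_leP => // i; rewrite mxE; exact: coord_norm. Qed.

Lemma x1B z z' : x1 (z - z') = x1 z - x1 z'. Proof. by rewrite !x1E mulmxBl. Qed.
Lemma x2B z z' : x2 (z - z') = x2 z - x2 z'. Proof. by rewrite !x2E mulmxBl. Qed.
Lemma t1B z z' : t1 (z - z') = t1 z - t1 z'. Proof. by rewrite !t1E dotBr. Qed.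
Lemma t2B z z' : t2 (z - z') = t2 z - t2 z'. Proof. by rewrite !t2E dotBr. Qed.

Lemma norm_t1 z : `|t1 z| <= `|z|. Proof. exact: le_trans (norm_tpart _) (norm_lsub _). Qed.
Lemma norm_t2 z : `|t2 z| <= `|z|. Proof. exact: le_trans (norm_tpart _) (norm_rsub _). Qed.

Lemma x1_dist z z' : `|x1 z - x1 z'| <= `|z - z'|.
Proof.
rewrite -x1B; exact: le_trans (norm_spart _) (norm_lsub _).
Qed.

Lemma x2_dist z z' : `|x2 z - x2 z'| <= `|z - z'|.
Proof.
rewrite -x2B; exact: le_trans (norm_spart _) (norm_rsub _).
Qed.

Lemma t1_dist z z' : `|t1 z - t1 z'| <= `|z - z'|.
Proof.
rewrite -t1B; exact: le_trans (norm_tpart _) (norm_lsub _).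
Qed.

Lemma t2_dist z z' : `|t2 z - t2 z'| <= `|z - z'|.
Proof.
rewrite -t2B; exact: le_trans (norm_tpart _) (norm_rsub _).
Qed.

Lemma norm_row_mx m1 m2 (w : 'rV[R]_m1) (w' : 'rV[R]_m2) e :
  0 <= e -> `|w| <= e -> `|w'| <= e -> `|row_mx w w'| <= e.
Proof.
move=> e0 h h'; apply: norm_leP => // i.
by rewrite mxE; case: (fintype.split i) => j; apply: le_trans (coord_norm _ _) _.
Qed.

Lemma norm_pair (x y : V) t s e : 0 <= e -> `|x| <= e -> `|y| <= e -> `|t| <= e -> `|s| <= e ->
  `|row_mx (strow x t) (strow y s)| <= e.
Proof. by move=> e0 *; apply: norm_row_mx => //; exact: norm_strow. Qed.

Lemma pairK z : z = row_mx (strow (x1 z) (t1 z)) (strow (x2 z) (t2 z)).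
Proof. by rewrite /x1 /x2 /t1 /t2 !strowK hsubmxK. Qed.

Lemma pair_time_dist (x y : V) t s t' s' e : 0 <= e -> `|t - t'| <= e -> `|s - s'| <= e ->
  `|row_mx (strow x t) (strow y s) - row_mx (strow x t') (strow y s')| <= e.
Proof.
move=> e0 te se; rewrite [X in `|X|]pairK x1B x2B t1B t2B.
rewrite !x1_row !x2_row !t1_row !t2_row !spart_strow !tpart_strow !subrr.
by apply: norm_pair; rewrite ?normr0.
Qed.

Lemma closed_itv_norm T (f : W -> R) z : (forall z z', `|f z - f z'| <= `|z - z'|) ->
  (forall e : R, 0 < e -> exists2 k, 0 <= f k <= T & `|k - z| < e) -> 0 <= f z <= T.
Proof.
move=> hf h; apply/andP; split; apply/ler_addgt0Pl => e e0; have [k /andP[k1 k2] kz] := h _ e0.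
  by have := le_lt_trans (hf k z) kz; rewrite ltr_norml => /andP[]; lra.
by have := le_lt_trans (hf k z) kz; rewrite ltr_norml => /andP[]; lra.
Qed.

Lemma compact_pairs D T : compact D -> 0 <= T -> compact (pairs D T).
Proof.
move=> cD T0.
have clD : closed D by apply: compact_closed => //; exact: norm_hausdorff.
apply: bounded_closed_compact.
  have [M [_ hM]] := compact_bounded cD.
  have hM' x : D x -> `|x| <= `|M| + 1 by apply: hM; rewrite ltr_pwDr// ler_norm.
  exists (`|M| + 1 + T); split; first exact: num_real.
  move=> M' MM' z [D1 D2 /andP[a1 a2] /andP[b1 b2]]; rewrite [z]pairK.
  apply: le_trans (ltW MM'); have M0 := normr_ge0 M.
  apply: norm_pair; first by lra.
  - by apply: le_trans (hM' _ D1) _; lra.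
  - by apply: le_trans (hM' _ D2) _; lra.
  - by rewrite ger0_norm//; lra.
  - by rewrite ger0_norm//; lra.
apply/closed_normP => z hz; split.
- apply/(closed_normP D).1 => // e e0; have [k [Dk _ _ _] kz] := hz _ e0.
  by exists (x1 k) => //; exact: le_lt_trans (x1_dist _ _) kz.
- apply/(closed_normP D).1 => // e e0; have [k [_ Dk _ _] kz] := hz _ e0.
  by exists (x2 k) => //; exact: le_lt_trans (x2_dist _ _) kz.
- apply: closed_itv_norm; first exact: t1_dist.
  by move=> e e0; have [k [_ _ tk _] kz] := hz _ e0; exists k.
- apply: closed_itv_norm; first exact: t2_dist.
  by move=> e e0; have [k [_ _ _ tk] kz] := hz _ e0; exists k.
Qed.

Lemma cont_on_pairs1 D T (u : V * R -> R) : st_cont D u ->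
  cont_on (pairs D T) (fun z => u (x1 z, t1 z)).
Proof.
move=> cu z [Dz _ /andP[tz _] _] e e0; have [de de0 h] := cu _ _ Dz tz _ e0.
exists de => // k [Dk _ /andP[tk _] _] kz; apply: h => //.
- exact: le_lt_trans (x1_dist _ _) kz.
- exact: le_lt_trans (t1_dist _ _) kz.
Qed.

Lemma cont_on_pairs2 D T (u : V * R -> R) : st_cont D u ->
  cont_on (pairs D T) (fun z => u (x2 z, t2 z)).
Proof.
move=> cu z [_ Dz _ /andP[tz _]] e e0; have [de de0 h] := cu _ _ Dz tz _ e0.
exists de => // k [_ Dk _ /andP[tk _]] kz; apply: h => //.
- exact: le_lt_trans (x2_dist _ _) kz.
- exact: le_lt_trans (t2_dist _ _) kz.
Qed.

End pairs.

Section doubling.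
Variables (R : realType) (n : nat).
Local Notation V := 'rV[R]_n.
Local Notation W := 'rV[R]_((n + 1) + (n + 1)).
Variables (D B : set V) (nu : V -> V).
Variables (C0 C1 : R) (g : V -> R) (Dg : V -> V) (Hg : V -> 'M[R]_n).
Hypothesis gg : good_geometry D B nu C0 C1 g Dg Hg.

Lemma cont_on_phi L ga eta Bc T1 m T : cont_on (pairs D T) (phi g L ga eta Bc T1 m).
Proof.
move=> z [Dx Dy _ _] e e0.
have [q [[P [A [jP _ _ _]]] _]] := qjet_phi gg L ga eta Bc T1 m Dx Dy.
have /continuousP_norm/(_ _ e0)[de de0 h] := jet2_continuous jP.
by exists de => // y _; exact: h.
Qed.

Lemma psi_ge x y : D x -> D y -> dot (x - y) (x - y) ^+ 2 <= psi g y x.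
Proof.
move=> Dx Dy; rewrite /psi -expr2 ler_peMl ?sqr_ge0//.
have := gg_half gg Dx; have := gg_half gg Dy; lra.
Qed.

Variables (c : V -> R) (Cc Lc C : R) (u w : V * R -> R).
Hypotheses (Lc0 : 0 <= Lc) (hC : forall x, D x -> `|c x| <= Cc) (C_ge0 : 0 <= C).
Hypothesis hL : forall x y, D x -> D y -> `|c x - c y| <= Lc * enorm (x - y).
Hypotheses (su : subsol D B nu c C u) (sw : subsol D B nu (fun x => - c x) C w).
Hypotheses (cu : st_cont D u) (cw : st_cont D w).

(** The maximum is taken up to time T + 1. The cubic time penalty acts only after T, so it leaves
    the claimed range untouched and still keeps maxima below T + 1. *)
Lemma doubling T Bd m : 0 < T ->
  growth_rate n C1 Cc Lc * (2 + T) <= m%:R ->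
  (forall x t, D x -> 0 <= t <= T + 1 -> `|u (x, t)| <= Bd /\ `|w (x, t)| <= Bd) ->
  exists2 L0 : R, 0 < L0 & forall L m0, L0 <= L -> 0 <= m0 ->
   (forall x y, D x -> D y -> u (x, 0) + w (y, 0) <= m0 + L * dot (x - y) (x - y) ^+ 2) ->
   forall x y t, D x -> D y -> 0 <= t <= T ->
     u (x, t) + w (y, t) <= m0 + L * ((1 + t) ^+ m * psi g y x).
Proof.
move=> T0 hm hB.
have [dg dg0 hdg] := g_close gg.
have c1 := gg_C1 gg; have C10 : 0 < C1 by apply: lt_le_trans c1.
(* The three smallness conditions on |x - y| in [no_interior_max]. *)
pose d0 := Num.min dg (Num.min 1 (2 / C1)).
have d00 : 0 < d0 by rewrite !lt_min dg0 ltr01 divr_gt0.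
(* For such L the penalty is at least 2 Bd + 1 once |x - y| >= d0, more than [u + w] can
   compensate. *)
exists ((2 * `|Bd| + 1) / d0 ^+ 4); first by rewrite divr_gt0 ?exprn_gt0// ltr_wpDl// mulr_ge0.
move=> L m0 hL0 m00 init x0 y0 t0 Dx0 Dy0 /andP[t00 t0T].
have Bd0 : 0 <= Bd by have [] := hB x0 0 Dx0 ltac:(lra) => h _; exact: le_trans h.
rewrite ger0_norm// ler_pdivrMr ?exprn_gt0// in hL0.
have L0 : 0 < L.
  by rewrite -(@pmulr_lgt0 _ (d0 ^+ 4)) ?exprn_gt0//; apply: lt_le_trans hL0; lra.
rewrite leNgt; apply/negP => hlt.
pose th := u (x0, t0) + w (y0, t0) - (m0 + L * ((1 + t0) ^+ m * psi g y0 x0)).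
have th0 : 0 < th by rewrite subr_gt0.
(* At the chosen point the linear time term costs at most th/4, so three quarters of the excess
   survive. *)
pose eta := th / (8 * (T + 1)); have eta0 : 0 < eta by rewrite divr_gt0// mulr_gt0//; lra.
have etaT : eta * (8 * (T + 1)) = th by rewrite divfK// gt_eqF// mulr_gt0//; lra.
have T10 : 0 <= T + 1 by lra.
have cK := compact_pairs (gg_compact gg) T10.
have th4 : 0 < th / 4 by rewrite divr_gt0.
have [k1 k10 hk1] := cont_on_unif cK (cont_on_pairs1 (T := T + 1) cu) th4.
have [k2 k20 hk2] := cont_on_unif cK (cont_on_pairs2 (T := T + 1) cw) th4.
(* The next constant [ga] forces |t - s| < k, and k is a modulus of continuity for th/4. If one time
   vanishes at the maximum, the other can be replaced by 0 at that cost, and the initial bound is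
   violated. *)
pose k := Num.min k1 k2; have k0 : 0 < k by rewrite lt_min k10.
pose ga := (2 * Bd + 1) / k ^+ 2.
have ga0 : 0 < ga by rewrite divr_gt0 ?exprn_gt0//; lra.
have gak : ga * k ^+ 2 = 2 * Bd + 1 by rewrite divfK// gt_eqF// exprn_gt0.
(* At time T + 1 the cubed positive part equals 1, so the penalty exceeds [u + w] there. *)
pose Bc := 2 * Bd + 1.
pose Phi (z : W) := u (x1 z, t1 z) + w (x2 z, t2 z) - phi g L ga eta Bc T m z.
have cPhi : cont_on (pairs D (T + 1)) Phi.
  by apply: cont_onB; [apply: cont_onD; [exact: cont_on_pairs1|exact: cont_on_pairs2]|exact: cont_on_phi].
pose z0 : W := row_mx (strow x0 t0) (strow y0 t0).
have xz0 : x1 z0 = x0 by rewrite x1_row spart_strow.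
have yz0 : x2 z0 = y0 by rewrite x2_row spart_strow.
have tz0 : t1 z0 = t0 by rewrite t1_row tpart_strow.
have sz0 : t2 z0 = t0 by rewrite t2_row tpart_strow.
have Kz0 : pairs D (T + 1) z0.
  by rewrite /pairs /= xz0 yz0 tz0 sz0; split=> //; apply/andP; split=> //; lra.
have Phi0 : m0 + th * (3 / 4) <= Phi z0.
  rewrite /Phi /phi xz0 yz0 tz0 sz0 max_r; last by lra.
  rewrite expr0n/= addr0 mulr0 subrr !mulr0 add0r addr0.
  have : eta * (t0 + t0) <= th / 4 by rewrite -etaT -mulrA ler_pM2l//; lra.
  rewrite /th; move: (L * _) (u _) (w _) => *; lra.
have [z [Dx Dy /andP[tz tzT] /andP[sz szT]] zmax] := cont_on_max (ex_intro _ z0 Kz0) cK cPhi.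
have Phiz := le_trans Phi0 (zmax _ Kz0).
set x := x1 z in Dx *; set y := x2 z in Dy *; set t := t1 z in tz tzT *; set s := t2 z in sz szT *.
have [hu1 _] := hB x t Dx (introT andP (conj tz tzT)).
have [_ hw1] := hB y s Dy (introT andP (conj sz szT)).
have {}hu1 := le_trans (ler_norm _) hu1; have {}hw1 := le_trans (ler_norm _) hw1.
have pge := psi_ge Dx Dy.
have f20 : 0 <= dot (x - y) (x - y) ^+ 2 := sqr_ge0 _.
pose E := L * ((1 + t) ^+ m * psi g y x).
have Ege : L * dot (x - y) (x - y) ^+ 2 <= E.
  rewrite ler_pM2l//; apply: (le_trans pge); rewrite ler_peMl//; first exact: (le_trans f20 pge).
  by rewrite exprn_ege1//; lra.
have Lf : 0 <= L * dot (x - y) (x - y) ^+ 2 by rewrite mulr_ge0// ltW.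
pose G := ga * ((t - s) * (t - s)).
have G0 : 0 <= G by apply: mulr_ge0; [exact: ltW|rewrite -expr2 sqr_ge0].
pose P1 := Num.max (t - T) 0; pose P2 := Num.max (s - T) 0.
have P10 : 0 <= P1 ^+ 3 by rewrite exprn_ge0// le_max lexx orbT.
have P20 : 0 <= P2 ^+ 3 by rewrite exprn_ge0// le_max lexx orbT.
have B0 : 0 < Bc by rewrite /Bc ltr_wpDl// mulr_ge0.
have BP1 : 0 <= Bc * P1 ^+ 3 by rewrite mulr_ge0// ltW.
have BP2 : 0 <= Bc * P2 ^+ 3 by rewrite mulr_ge0// ltW.
have ets : 0 <= eta * (t + s) by apply: mulr_ge0; [exact: ltW|exact: addr_ge0].
have PhiE : Phi z = u (x, t) + w (y, s) - (E + (G + (eta * (t + s) + Bc * (P1 ^+ 3 + P2 ^+ 3)))) by [].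
have BcD : Bc * (P1 ^+ 3 + P2 ^+ 3) = Bc * P1 ^+ 3 + Bc * P2 ^+ 3 by rewrite mulrDr.
rewrite PhiE BcD in Phiz.
have PT a : T + 1 <= a -> a <= T + 1 -> Num.max (a - T) 0 ^+ 3 = 1.
  move=> a1 a2; have -> : a - T = 1 by (move: a1 a2; clear -gg Lc0 hC C_ge0 hL su sw cu cw => *; lra).
  rewrite max_l ?ler01//; exact: expr1n.
have tlt : t < T + 1.
  rewrite ltNge; apply/negP => tge; have e1 := PT _ tge tzT; rewrite -/P1 in e1.
  rewrite e1 in Phiz BP1; move: Phiz; rewrite mulr1 {1}/Bc.
  move: (u _) (w _) hu1 hw1 (Bc * _) BP2; clear -gg Lc0 hC C_ge0 hL su sw cu cw th0 m00 Lf Ege G0 ets Bd0 => *; lra.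
have slt : s < T + 1.
  rewrite ltNge; apply/negP => tge; have e1 := PT _ tge szT; rewrite -/P2 in e1.
  rewrite e1 in Phiz BP2; move: Phiz; rewrite mulr1 {2}/Bc.
  move: (u _) (w _) hu1 hw1 (Bc * _) BP1; clear -gg Lc0 hC C_ge0 hL su sw cu cw th0 m00 Lf Ege G0 ets Bd0 => *; lra.
have xyd : enorm (x - y) < d0.
  rewrite ltNge; apply/negP => dle.
  have : d0 ^+ 4 <= dot (x - y) (x - y) ^+ 2.
    rewrite -enorm_sq -exprM lerXn2r// ?nnegrE ?enorm_ge0//; exact: ltW.
  rewrite -(ler_pM2l L0) => h.
  move: (u _) (w _) hu1 hw1 (Bc * _) (Bc * _) BP1 BP2 Phiz; clear -gg Lc0 hC C_ge0 hL su sw cu cw th0 m00 Lf Ege G0 ets Bd0 h hL0 => *; lra.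
have ts : `|t - s| < k.
  rewrite ltNge; apply/negP => dle.
  have : k ^+ 2 <= (t - s) * (t - s).
    rewrite -expr2 -[leRHS]real_normK ?num_real// lerXn2r// ?nnegrE//; exact: ltW.
  rewrite -(ler_pM2l ga0) -/G gak => h.
  move: (u _) (w _) hu1 hw1 (Bc * _) (Bc * _) BP1 BP2 Phiz; clear -gg Lc0 hC C_ge0 hL su sw cu cw th0 m00 Lf Ege G0 ets Bd0 h => *; lra.
have Kz : pairs D (T + 1) z by split=> //; apply/andP.
have near0 a r : D a -> 0 <= r -> r <= T + 1 -> r < k ->
    `|u (a, r) - u (a, 0)| < th / 4 /\ `|w (a, r) - w (a, 0)| < th / 4.
  move=> Da r0 rT rk.
  pose z1 : W := row_mx (strow a r) (strow a r); pose z2 : W := row_mx (strow a 0) (strow a 0).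
  have K1 : pairs D (T + 1) z1.
    by rewrite /pairs /= x1_row x2_row t1_row t2_row !spart_strow !tpart_strow; split=> //; apply/andP.
  have K2 : pairs D (T + 1) z2.
    by rewrite /pairs /= x1_row x2_row t1_row t2_row !spart_strow !tpart_strow lexx T10.
  have z12 : `|z1 - z2| < k.
    by apply: le_lt_trans rk; apply: pair_time_dist => //; rewrite subr0 ger0_norm.
  split.
    have := hk1 _ _ K2 K1 (lt_le_trans z12 _); rewrite !x1_row !t1_row !spart_strow !tpart_strow.
    by apply; rewrite ge_min lexx.
  have := hk2 _ _ K2 K1 (lt_le_trans z12 _); rewrite !x2_row !t2_row !spart_strow !tpart_strow.
  by apply; rewrite ge_min lexx orbT.
have tp : 0 < t.
  rewrite lt_neqAle tz andbT; apply/eqP => e0t.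
  move: ts; rewrite -e0t sub0r normrN ger0_norm// => sk.
  have [_] := near0 _ _ Dy sz szT sk; rewrite ltr_norml => /andP[_ h].
  have := init _ _ Dx Dy; move: Phiz; rewrite -e0t.
  move: (u _) (w _) (w _) h (Bc * _) (Bc * _) BP1 BP2 ets; rewrite -e0t => *; lra.
have sp : 0 < s.
  rewrite lt_neqAle sz andbT; apply/eqP => e0t.
  move: ts; rewrite -e0t subr0 ger0_norm// => sk.
  have [+ _] := near0 _ _ Dx tz tzT sk; rewrite ltr_norml => /andP[_ h].
  have := init _ _ Dx Dy; move: Phiz; rewrite -e0t.
  move: (u _) (w _) (u _) h (Bc * _) (Bc * _) BP1 BP2 ets; rewrite -e0t => *; lra.
have hg : growth_rate n C1 Cc Lc * (1 + t) <= m%:R.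
  apply: le_trans hm; rewrite ler_wpM2l//; last first.
    by move: tzT; clear -gg Lc0 hC C_ge0 hL su sw cu cw; lra.
  by apply: ltW; exact: (growth_rate_gt0 gg Lc0 hC Dx).
move: xyd; rewrite !lt_min => /and3P[xy1 xy2 xy3].
apply: (no_interior_max gg Lc0 hC C_ge0 hL su sw cu cw (L := L) (ga := ga) (eta := eta) (Bc := Bc)
  (T1 := T) (m := m) (dg := dg) (z := z)) => //; try exact: ltW.
- by move: xy3; rewrite ltr_pdivlMr// mulrC => /ltW.
- exists (Num.min (T + 1 - t) (T + 1 - s)); first by rewrite lt_min !subr_gt0 tlt.
  move=> d; rewrite lt_min => /andP[d1 d2] e1 e2 e3 e4; apply: zmax; split=> //.
    rewrite e2 t1D -/t /= addrC -lerBrDr.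
    exact: le_trans (le_trans (ler_norm _) (norm_t1 d)) (ltW d1).
  rewrite e4 t2D -/s /= addrC -lerBrDr.
  exact: le_trans (le_trans (ler_norm _) (norm_t2 d)) (ltW d2).
Qed.

End doubling.

(** * From test functions to quadratic touching *)

Section c2_functions.
Variables (R : realType) (V : normedModType R).
Implicit Types (A : set V).

(* f1 v and f2 v w are the continuous extensions to closure A of the directional
   derivatives of f. *)
Record c2bar A (f : V -> R) (f1 : V -> V -> R) (f2 : V -> V -> V -> R) : Prop := {
  c2_cont : cont_on (closure A) f;
  c2_cont1 : forall v, cont_on (closure A) (f1 v);
  c2_cont2 : forall v w, cont_on (closure A) (f2 v w);
  c2_der1 : forall v x, A x -> is_derive x v f (f1 v x);
  c2_der2 : forall v w x, A x -> is_derive x w (f1 v) (f2 v w x)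
}.

Lemma extension_eq A g h z : cont_on (closure A) h -> (forall x, A x -> g x = h x) ->
  closure A z -> extension A g z = h z.
Proof.
move=> ch gh clz; rewrite /extension.
have pf : ProperFilter (within A (nbhs z)).
  apply: within_nbhs_proper; exact: clz.
apply: cvg_lim => //.
apply/cvgrPdist_lt => e e0; have [de de0 hde] := ch _ clz _ e0.
rewrite near_withinE; apply/nbhs_normP; exists de => //= y /= yz Ay.
by rewrite distrC (gh _ Ay) hde 1?distrC//; exact: subset_closure.
Qed.

Lemma open_near A (x : V) : open A -> A x -> \forall y \near x, A y.
Proof. by move=> oA Ax; exact: open_nbhs_nbhs. Qed.

Lemma c2bar_Cbar A f f1 f2 : open A -> c2bar A f f1 f2 -> Cbar 2 A f.
Proof.
move=> oA h; have d1 v x : A x -> 'D_v f x = f1 v x by move=> /(c2_der1 h v)[].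
have nd1 v x : A x -> \forall y \near x, f1 v y = 'D_v f y.
  by move=> Ax; near=> y; rewrite d1//; near: y; exact: open_near.
have d2 v w x : A x -> is_derive x w ('D_v f) (f2 v w x).
  by move=> Ax; apply: near_eq_is_derive (nd1 v x Ax) _; exact: (c2_der2 h).
split; first by apply/cont_onP; exact: (c2_cont h).
split; first by exists f; split=> //; apply/cont_onP; exact: (c2_cont h).
move=> v; split; first by move=> x /(c2_der1 h v)[].
split; first by exists (f1 v); split=> [|x /d1->//]; apply/cont_onP; exact: (c2_cont1 h).
move=> w; split; first by move=> x /(d2 v w)[].
split=> //; exists (f2 v w); split; first by apply/cont_onP; exact: (c2_cont2 h).
by move=> x /(d2 v w)[_ ->].
Unshelve. all: by end_near.
Qed.

Lemma Cbar_c2bar A (f : V -> R) : open A -> Cbar 2 A f -> exists f1 f2, c2bar A f f1 f2.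
Proof.
move=> oA [/cont_onP cf [_ h]].
have /choice[f1 hf1] v : exists h, cont_on (closure A) h /\ forall x, A x -> h x = 'D_v f x.
  by have [_ [[k [/cont_onP ck hk]] _]] := h v; exists k.
have /choice[f2 hf2] (p : V * V) : exists h, cont_on (closure A) h /\
    forall x, A x -> h x = 'D_p.2 ('D_p.1 f) x.
  have [_ [_ /(_ p.2)[_ [[k [/cont_onP ck hk]] _]]]] := h p.1.
  by exists k.
exists f1, (fun v w => f2 (v, w)); split=> //.
- by move=> v; have [] := hf1 v.
- by move=> v w; have [] := hf2 (v, w).
- by move=> v x Ax; have [_ ->//] := hf1 v; have [dv _] := h v; apply: DeriveDef => //; exact: dv.
- move=> v w x Ax; apply: (@near_eq_is_derive _ _ _ ('D_v f)).
    by near=> y; have [_ ->//] := hf1 v; near: y; exact: open_near.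
  have [_ ->//] := hf2 (v, w); have [_ [_ /(_ w)[dw _]]] := h v.
  by apply: DeriveDef => //; exact: dw.
Unshelve. all: by end_near.
Qed.

Lemma c2bar_extension1 A f f1 f2 v z : c2bar A f f1 f2 -> closure A z ->
  extension A ('D_v f) z = f1 v z.
Proof.
move=> h; apply: extension_eq; first exact: (c2_cont1 h).
by move=> x /(c2_der1 h v)[].
Qed.

Lemma c2bar_extension2 A f f1 f2 v w z : open A -> c2bar A f f1 f2 -> closure A z ->
  extension A ('D_w ('D_v f)) z = f2 v w z.
Proof.
move=> oA h; apply: extension_eq; first exact: (c2_cont2 h).
move=> x Ax; have [_ <-] := c2_der2 h v w Ax; apply: near_eq_derive.
near=> y; have Ay : A y by near: y; exact: open_near.
by have [_ ->] := c2_der1 h v Ay.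
Unshelve. all: by end_near.
Qed.

Lemma c2barD A f f1 f2 g g1 g2 : c2bar A f f1 f2 -> c2bar A g g1 g2 ->
  c2bar A (fun x => f x + g x) (fun v x => f1 v x + g1 v x) (fun v w x => f2 v w x + g2 v w x).
Proof.
move=> hf hg; split.
- by apply: cont_onD; [exact: (c2_cont hf)|exact: (c2_cont hg)].
- by move=> v; apply: cont_onD; [exact: (c2_cont1 hf)|exact: (c2_cont1 hg)].
- by move=> v w; apply: cont_onD; [exact: (c2_cont2 hf)|exact: (c2_cont2 hg)].
- by move=> v x Ax; apply: is_deriveD; [exact: (c2_der1 hf)|exact: (c2_der1 hg)].
- by move=> v w x Ax; apply: is_deriveD; [exact: (c2_der2 hf)|exact: (c2_der2 hg)].
Qed.

Lemma c2barN A f f1 f2 : c2bar A f f1 f2 ->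
  c2bar A (fun x => - f x) (fun v x => - f1 v x) (fun v w x => - f2 v w x).
Proof.
move=> hf; split.
- by apply: cont_onN; exact: (c2_cont hf).
- by move=> v; apply: cont_onN; exact: (c2_cont1 hf).
- by move=> v w; apply: cont_onN; exact: (c2_cont2 hf).
- by move=> v x Ax; apply: is_deriveN; exact: (c2_der1 hf).
- by move=> v w x Ax; apply: is_deriveN; exact: (c2_der2 hf).
Qed.

Lemma is_derive_quad f x v (l : V -> R) : (forall k d, l (k *: d) = k * l d) ->
  (exists K, exists2 de : R, 0 < de &
    forall d, `|d| < de -> `|f (x + d) - f x - l d| <= K * `|d| ^+ 2) ->
  is_derive x v f (l v).
Proof.
move=> lZ [K [de de0 h]].
have lim : (fun k : R => k^-1 *: ((f \o shift x) (k *: v) - f x)) @ 0^' --> (l v : R^o).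
  apply/cvgrPdist_lt => e e0; rewrite near_withinE.
  pose M := (`|K| + 1) * (`|v| + 1) ^+ 2.
  have v1 : 0 < `|v| + 1 by rewrite ltr_wpDl.
  have M0 : 0 < M by rewrite mulr_gt0 ?exprn_gt0// ltr_wpDl.
  exists (Num.min (de / (`|v| + 1)) (e / M)) => /=.
    by rewrite lt_min !divr_gt0.
  move=> k; rewrite /= sub0r normrN lt_min => /andP[k1 k2] k0.
  have kv : `|k *: v| < de.
    rewrite normrZ; apply: (@le_lt_trans _ _ (`|k| * (`|v| + 1))); last by rewrite -ltr_pdivlMr.
    by rewrite ler_wpM2l// lerDl.
  have {}h := h _ kv.
  have -> : l v - k^-1 *: (f (k *: v + x) - f x) = - (k^-1 * (f (x + k *: v) - f x - l (k *: v))).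
    rewrite [k *: v + x]addrC lZ; rewrite /GRing.scale/=; field.
    exact: k0.
  rewrite normrN normrM normfV ltr_pdivrMl ?normr_gt0//.
  apply: le_lt_trans h _; rewrite normrZ exprMn.
  apply: (@le_lt_trans _ _ (`|k| ^+ 2 * M)).
    rewrite mulrCA ler_wpM2l ?exprn_ge0// /M.
    apply: (@le_trans _ _ ((`|K| + 1) * `|v| ^+ 2)).
      by rewrite ler_wpM2r ?exprn_ge0// (le_trans (ler_norm _))// lerDl.
    by rewrite ler_wpM2l ?addr_ge0// lerXn2r ?nnegrE ?addr_ge0// lerDl.
  by rewrite expr2 -mulrA ltr_pM2l ?normr_gt0// -ltr_pdivlMr.
apply: DeriveDef; first by apply/cvg_ex; exists (l v).
exact: cvg_lim.
Qed.

End c2_functions.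

Section spacetime_functions.
Variables (R : realType) (n : nat).
Local Notation V := 'rV[R]_n.
Variable Omega : set V.
Hypothesis oO : open Omega.
Local Notation cyl := (cylinder Omega).

Lemma closure_normP (W : normedModType R) (A : set W) x :
  closure A x <-> forall e : R, 0 < e -> exists2 y, A y & `|y - x| < e.
Proof.
split=> [clx e e0|h B /nbhs_normP[e /= e0 eB]].
  have [y [Ay /= By]] := clx _ (nbhsx_ballx x e e0).
  by exists y => //; move: By; rewrite -ball_normE /= distrC.
have [y Ay yx] := h _ e0; exists y; split=> //; apply: eB => /=.
by rewrite distrC.
Qed.

Lemma norm_fst (z : V * R) : `|z.1| <= `|z|.
Proof. by rewrite [leRHS]/Num.norm /= le_max lexx. Qed.

Lemma norm_snd (z : V * R) : `|z.2| <= `|z|.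
Proof. by rewrite [leRHS]/Num.norm /= le_max lexx orbT. Qed.

Lemma norm_pair_lt (z : V * R) e : `|z.1| < e -> `|z.2| < e -> `|z| < e.
Proof. by move=> h1 h2; rewrite [ltLHS]/Num.norm /= gt_max h1. Qed.

Lemma open_cylinder : open cyl.
Proof.
have -> : cyl = (fst @^-1` Omega) `&` (snd @^-1` [set t | 0 < t]) by [].
apply: openI; apply: open_comp => //; try exact: open_gt.
- by move=> z _; exact: cvg_fst.
- by move=> z _; exact: cvg_snd.
Qed.

Lemma closure_cylinder : closure cyl = closed_cylinder Omega.
Proof.
apply/seteqP; split=> z.
- move=> /closure_normP h; split.
    apply/closure_normP => e e0; have [y [Oy _] yz] := h _ e0; exists y.1 => //.
    exact: le_lt_trans (norm_fst (y - z)) yz.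
  apply/ler_addgt0Pl => e e0; have [y [_ y0] yz] := h _ e0.
  have := le_lt_trans (norm_snd (y - z)) yz; rewrite ltr_norml /= => /andP[]; lra.
- move=> [/closure_normP h z0]; apply/closure_normP => e e0.
  have [y Oy yz] := h _ e0; exists (y, z.2 + e / 2) => /=.
    by split => //=; rewrite ltr_wpDl// divr_gt0.
  apply: norm_pair_lt => //=; rewrite addrAC subrr add0r gtr0_norm ?divr_gt0//; lra.
Qed.

Lemma c2bar_fst (h : V -> R) h1 h2 : c2bar Omega h h1 h2 ->
  c2bar cyl (fun z => h z.1) (fun v z => h1 v.1 z.1) (fun v w z => h2 v.1 w.1 z.1).
Proof.
move=> hh.
have cf (f : V -> R) : cont_on (closure Omega) f -> cont_on (closure cyl) (fun z => f z.1).
  rewrite closure_cylinder => cf z [Oz _] e e0; have [de de0 hde] := cf _ Oz _ e0.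
  exists de => // y [Oy _] yz; apply: hde => //.
  exact: le_lt_trans (norm_fst (y - z)) yz.
split=> [|v|v w|v x [Ox _]|v w x [Ox _]].
- exact/cf/(c2_cont hh).
- exact/cf/(c2_cont1 hh).
- exact/cf/(c2_cont2 hh).
- by have [d1 d2] := c2_der1 hh v.1 Ox; apply: DeriveDef.
- by have [d1 d2] := c2_der2 hh v.1 w.1 Ox; apply: DeriveDef.
Qed.

Record c2line (P P1 P2 : R -> R) : Prop := {
  c2_line1 : forall s : R, is_derive s (1 : R) P (P1 s);
  c2_line2 : forall s : R, is_derive s (1 : R) P1 (P2 s);
  c2_line_cont : continuous P2
}.

Lemma is_derive_dir (P : R -> R) (s l v : R) : is_derive s (1 : R) P l -> is_derive s v P (v * l).
Proof.
move=> [dP <-]; have df : differentiable P s by apply/derivable1_diffP.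
apply: DeriveDef; first exact: diff_derivable.
rewrite !deriveE//.
have {1}-> : v = v *: (1 : R) by rewrite /GRing.scale/= mulr1.
by rewrite linearZ.
Qed.

Lemma c2line_cont P P1 P2 : c2line P P1 P2 -> continuous P /\ continuous P1.
Proof.
move=> h; split=> s; apply: differentiable_continuous; apply/derivable1_diffP.
  by have [] := c2_line1 h s.
by have [] := c2_line2 h s.
Qed.

Lemma c2bar_snd P P1 P2 : c2line P P1 P2 ->
  c2bar cyl (fun z => P z.2) (fun v z => v.2 * P1 z.2) (fun v w z => v.2 * (w.2 * P2 z.2)).
Proof.
move=> hP; have [c0 c1] := c2line_cont hP.
have cf (f : R -> R) k : continuous f -> cont_on (closure cyl) (fun z => k * f z.2).
  move=> cf; apply: cont_onM; first exact: cont_on_cst.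
  move=> z _ e e0; have /continuousP_norm/(_ _ e0)[de de0 hde] := cf z.2.
  exists de => // y _ yz; apply: hde.
  exact: le_lt_trans (norm_snd (y - z)) yz.
split=> [|v|v w|v x _|v w x _].
- have := cf P 1 c0; congr cont_on; apply/funext => z; exact: mul1r.
- exact: cf.
- have := cf P2 (v.2 * w.2) (c2_line_cont hP); congr cont_on; apply/funext => z.
  by rewrite mulrA.
- by have [d1 d2] := is_derive_dir v.2 (c2_line1 hP x.2); apply: DeriveDef.
- have [d1 d2] := is_derive_dir w.2 (c2_line2 hP x.2).
  have dP : is_derive x w (fun z : V * R => P1 z.2) (w.2 * P2 x.2) by apply: DeriveDef.
  exact: is_deriveZ.
Qed.

Lemma c2lineD P P1 P2 Q Q1 Q2 : c2line P P1 P2 -> c2line Q Q1 Q2 ->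
  c2line (fun s => P s + Q s) (fun s => P1 s + Q1 s) (fun s => P2 s + Q2 s).
Proof.
move=> hP hQ; split=> s.
- by apply: is_deriveD; [exact: (c2_line1 hP)|exact: (c2_line1 hQ)].
- by apply: is_deriveD; [exact: (c2_line2 hP)|exact: (c2_line2 hQ)].
- by apply: cvgD; [exact: (c2_line_cont hP)|exact: (c2_line_cont hQ)].
Qed.

Lemma qjet_derive m (f : 'rV[R]_m -> R) x l q v : qjet f x l q -> is_derive x v f (l v).
Proof.
move=> [p [A [hj As hl hq]]]; rewrite -hl; apply: is_derive_quad.
  by move=> k d; rewrite dotZr.
have [K K0 [de de0 hde]] := jet2_lip hj.
by exists K, de => // d /hde[].
Qed.

End spacetime_functions.

Section space_part.
Variables (R : realType) (n : nat).
Local Notation V := 'rV[R]_n.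
Implicit Types (x y p v w : V).

Lemma qjet_continuous m (f : 'rV[R]_m -> R) (x : 'rV[R]_m) l q :
  qjet f x l q -> {for x, continuous f}.
Proof. by move=> [p [A [hj _ _ _]]]; exact: jet2_continuous hj. Qed.

Lemma c2bar_qjet (A : set V) (f : V -> R) f1 f2 :
  (forall y, exists q, qjet f y (f1^~ y) q) ->
  (forall v y, exists q, qjet (f1 v) y (fun w => f2 v w y) q) ->
  (forall v w, continuous (f2 v w)) -> c2bar A f f1 f2.
Proof.
move=> h1 h2 c2; split.
- by apply: cont_on_continuous => y; have [q] := h1 y; exact: qjet_continuous.
- by move=> v; apply: cont_on_continuous => y; have [q] := h2 v y; exact: qjet_continuous.
- by move=> v w; exact: cont_on_continuous.
- by move=> v y _; have [q j] := h1 y; exact: (qjet_derive v j).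
- by move=> v w y _; have [q j] := h2 v y; exact: (qjet_derive w j).
Qed.

Lemma qjet_dotB c x y : qjet (fun y => dot c (y - x)) y (dot c) (fun=> 0).
Proof.
apply: qjet_eq (qjetD (qjet_dot c y) (qjet_cst (- dot c x) y)) => d; rewrite ?addr0//.
by rewrite dotBr.
Qed.

Lemma qjet_quad X x y : X^T = X ->
  qjet (fun y => 2^-1 * qf X (y - x)) y (fun d => dot (d *m X) (y - x)) (qf X).
Proof.
move=> Xs; exists ((y - x) *m X), X; split=> //; last first.
  by move=> d; rewrite dot_mull Xs dotC.
move=> e e0; exists 1 => // d _.
suff -> : 2^-1 * qf X (y + d - x) - 2^-1 * qf X (y - x) - dot ((y - x) *m X) d - 2^-1 * qf X d = 0.
  by rewrite normr0 mulr_ge0 ?dot_ge0// ltW.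
have -> : y + d - x = (y - x) + d by rewrite addrAC.
move: (y - x) => z; rewrite /qf mulmxDl dotDl !dotDr [dot (d *m X) z]dot_mull Xs [dot d (z *m X)]dotC.
by field.
Qed.

(** The quartic term leaves the jet of order two at [x] unchanged and can be made to dominate away
    from [x]. *)
Definition quartic p X C x y : R :=
  dot p (y - x) + (2^-1 * qf X (y - x) + C * (dot (y - x) (y - x) * dot (y - x) (y - x))).

Lemma c2bar_quartic (A : set V) p X C x : X^T = X -> c2bar A (quartic p X C x)
  (fun v y => dot p v + (dot (v *m X) (y - x) + 4 * C * (dot (y - x) (y - x) * dot v (y - x))))
  (fun v w y => dot (v *m X) w + 4 * C * (dot (y - x) (y - x) * dot v w +
      dot v (y - x) * (2 * dot w (y - x)))).
Proof.
move=> Xs; apply: c2bar_qjet.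
- move=> y; eexists.
  have J := qjetD (qjet_dotB p x y) (qjetD (qjet_quad x y Xs)
    (qjetZ C (qjetM (qjet_dotself x y) (qjet_dotself x y)))).
  apply: qjet_eq J => // d.
  by rewrite [dot d (y - x)]dotC; congr (_ + (_ + _)); ring.
- move=> v y; eexists.
  have J := qjetD (qjet_cst (dot p v) y) (qjetD (qjet_dotB (v *m X) x y)
    (qjetZ (4 * C) (qjetM (qjet_dotself x y) (qjet_dotB v x y)))).
  by apply: qjet_eq J => // d; rewrite add0r [dot (y - x) d]dotC.
- move=> v w y.
  have J := qjetD (qjet_cst (dot (v *m X) w) y) (qjetZ (4 * C) (qjetD
    (qjetM (qjet_dotself x y) (qjet_cst (dot v w) y))
    (qjetM (qjet_dotB v x y) (qjetZ 2 (qjet_dotB w x y))))).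
  have [p' [B [hj _ _ _]]] := J.
  exact: jet2_continuous hj.
Qed.

End space_part.

(** * C^2 majorants in time *)

Section time_part.
Variable R : realType.
Local Notation pos s := (Num.max s 0).

Lemma pos3_derive (c s : R) :
  is_derive s (1 : R) (fun s => pos (s - c) ^+ 3) (3 * pos (s - c) ^+ 2).
Proof.
have -> : 3 * pos (s - c) ^+ 2 = (fun d => 3 * pos (s - c) ^+ 2 * d) 1 by rewrite mulr1.
apply: (@is_derive_quad _ _ _ s 1 (fun d : R => 3 * pos (s - c) ^+ 2 * d)).
  by move=> k d; rewrite mulrCA.
exists (6 * `|s - c| + 1), 1 => // h h1.
rewrite (addrAC s h (- c)) real_normK ?num_real//; move: (s - c) => a.
have [a0|a0] := leP 0 a; have [b0|b0] := leP 0 (a + h).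
- rewrite (ger0_norm a0).
  have -> : (a + h) ^+ 3 - a ^+ 3 - 3 * a ^+ 2 * h = (3 * a + h) * h ^+ 2 by ring.
  rewrite normrM [X in _ * X]ger0_norm ?sqr_ge0// ler_wpM2r ?sqr_ge0//.
  by apply: le_trans (ler_normD _ _) _; rewrite ger0_norm; lra.
- rewrite (ger0_norm a0).
  have ah : a < - h by lra.
  have -> : 0 ^+ 3 - a ^+ 3 - 3 * a ^+ 2 * h = a * (a * (- 3 * h - a)) by ring.
  rewrite ger0_norm; last by rewrite !mulr_ge0//; lra.
  apply: (@le_trans _ _ (a * (- h * (- 3 * h)))); first by rewrite ler_wpM2l// ler_pM//; lra.
  have := sqr_ge0 h; rewrite expr2 => ?; nra.
- rewrite (ltr0_norm a0).
  rewrite !expr0n/= !(mulr0, mul0r) !subr0 ger0_norm ?exprn_ge0//.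
  have hh : 0 <= h by lra.
  move: h1; rewrite ger0_norm// => h1.
  apply: (@le_trans _ _ (h ^+ 3)); first by rewrite lerXn2r ?nnegrE//; lra.
  rewrite exprSr mulrC ler_wpM2r ?sqr_ge0//; lra.
- rewrite !expr0n/= !(mulr0, mul0r) !subr0 normr0.
  by rewrite mulr_ge0 ?sqr_ge0// ltr0_norm//; lra.
Qed.

Lemma pos2_derive (c s : R) :
  is_derive s (1 : R) (fun s => 3 * pos (s - c) ^+ 2) (6 * pos (s - c)).
Proof.
have -> : 6 * pos (s - c) = (fun d => 6 * pos (s - c) * d) 1 by rewrite mulr1.
apply: (@is_derive_quad _ _ _ s 1 (fun d : R => 6 * pos (s - c) * d)).
  by move=> k d; rewrite mulrCA.
exists 9, 1 => // h h1.
rewrite (addrAC s h (- c)) real_normK ?num_real//; move: (s - c) => a.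
have h0 := sqr_ge0 h; rewrite expr2 in h0 *.
have [a0|a0] := leP 0 a; have [b0|b0] := leP 0 (a + h).
- have -> : 3 * (a + h) ^+ 2 - 3 * a ^+ 2 - 6 * a * h = 3 * (h * h) by ring.
  by rewrite ger0_norm; lra.
- have ah : a < - h by lra.
  have -> : 3 * 0 ^+ 2 - 3 * a ^+ 2 - 6 * a * h = 3 * (a * (- 2 * h - a)) by ring.
  rewrite ger0_norm; last by rewrite !mulr_ge0//; lra.
  have : a * (- 2 * h - a) <= - h * (- 2 * h) by rewrite ler_pM//; lra.
  lra.
- rewrite !expr0n/= !(mulr0, mul0r) !subr0 ger0_norm ?mulr_ge0 ?exprn_ge0//.
  have : (a + h) ^+ 2 <= h ^+ 2 by rewrite lerXn2r ?nnegrE//; lra.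
  rewrite [h ^+ 2]expr2; lra.
- rewrite !expr0n/= !(mulr0, mul0r) !subr0 normr0.
  by rewrite mulr_ge0.
Qed.

Lemma pos_continuous (c : R) : continuous (fun s => 6 * pos (s - c)).
Proof.
move=> s; apply/continuousP_norm => e e0; exists (e / 6); first by rewrite divr_gt0.
move=> y; rewrite ltr_pdivlMr// => ys; rewrite -mulrBr normrM gtr0_norm// mulrC.
apply: le_lt_trans ys; rewrite ler_wpM2r//.
rewrite ler_norml; have := ler_norm (y - s); have := ler_norm (- (y - s)); rewrite normrN.
by have [a0|a0] := leP 0 (s - c); have [b0|b0] := leP 0 (y - c);
  rewrite ?(max_l a0) ?(max_l b0) ?(max_r (ltW a0)) ?(max_r (ltW b0)) => *; apply/andP; split; lra.
Qed.

(* Maximizers are global in time, so that a test function has to dominate u on the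
   whole half line; this locally finite sum serves as a C^2 majorant. *)
Definition locsum (b : nat -> R) (T : R -> R -> R) (a s : R) : R :=
  \sum_(k < (Num.truncn (s - a)).+1) b k * T (a + k%:R) s.

Lemma sum_vanish (F : nat -> R) N M : (N <= M)%N -> (forall k, (N <= k)%N -> F k = 0) ->
  \sum_(k < M) F k = \sum_(k < N) F k.
Proof.
move=> NM F0; rewrite -!(big_mkord xpredT) (@big_cat_nat _ _ _ N)//=.
by rewrite [X in _ + X]big_nat_cond [X in _ + X]big1 ?addr0// => k /andP[/andP[/F0]].
Qed.

(** Additional terms vanish, so near a given time the number of terms can be frozen and the sum
    differentiated as a finite one. *)
Lemma locsumE b T a s N : (forall c s, s <= c -> T c s = 0) -> s - a <= N%:R ->
  locsum b T a s = \sum_(k < N) b k * T (a + k%:R) s.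
Proof.
move=> T0 sN; have F0 M : s - a <= M%:R -> forall k, (M <= k)%N -> b k * T (a + k%:R) s = 0.
  move=> sM k Mk; rewrite T0 ?mulr0//.
  have : (M%:R : R) <= k%:R by rewrite ler_nat.
  lra.
have sM : s - a <= (Num.truncn (s - a)).+1%:R by rewrite ltW// truncnS_gt.
rewrite /locsum; have [NM|/ltnW MN] := leqP N (Num.truncn (s - a)).+1.
- exact: (sum_vanish (F := fun k => b k * T (a + k%:R) s) NM (F0 _ sN)).
- by apply/esym; exact: (sum_vanish (F := fun k => b k * T (a + k%:R) s) MN (F0 _ sM)).
Qed.

Lemma locsum_derive b T T' a (s : R) : (forall c s, s <= c -> T c s = 0) ->
  (forall c s, s <= c -> T' c s = 0) ->
  (forall c s, is_derive s (1 : R) (T c) (T' c s)) ->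
  is_derive s (1 : R) (locsum b T a) (locsum b T' a s).
Proof.
move=> T0 T'0 h; have sN := truncnS_gt (s - a); set N := (Num.truncn (s - a)).+1 in sN.
rewrite (locsumE b T'0 (ltW sN)).
apply: (@near_eq_is_derive _ _ _ (fun r => \sum_(k < N) b k * T (a + k%:R) r)).
  near=> r; apply/esym/locsumE => //; rewrite lerBlDr ltW//; near: r.
  by apply: lt_nbhsl; rewrite -ltrBlDr.
elim: N {sN} => [|N IH].
  rewrite big_ord0; have d0 : is_derive s (1 : R) (cst (0 : R) : R -> R) 0 by exact: is_derive_cst.
  by apply: near_eq_is_derive d0; near=> r; rewrite big_ord0.
rewrite big_ord_recr/=.
have dN : is_derive s (1 : R) (b N \*: (T (a + N%:R) : R -> R)) (b N *: T' (a + N%:R) s).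
  exact: is_deriveZ.
by apply: near_eq_is_derive (is_deriveD IH dN); near=> r; rewrite big_ord_recr.
Unshelve. all: by end_near.
Qed.

Lemma locsum_continuous b T a : (forall c s, s <= c -> T c s = 0) ->
  (forall c, continuous (T c)) -> continuous (locsum b T a).
Proof.
move=> T0 h s; have sN := truncnS_gt (s - a); set N := (Num.truncn (s - a)).+1 in sN.
have cN : {for s, continuous (fun r => \sum_(k < N) b k * T (a + k%:R) r)}.
  elim: N {sN} => [|N IH].
    have -> : (fun r => \sum_(k < 0) b k * T (a + k%:R) r) = cst 0.
      by apply/funext => r; rewrite big_ord0.
    exact: cst_continuous.
  have -> : (fun r => \sum_(k < N.+1) b k * T (a + k%:R) r) =
      (fun r => \sum_(k < N) b k * T (a + k%:R) r + b N * T (a + N%:R) r).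
    by apply/funext => r; rewrite big_ord_recr.
  by apply: cvgD; [exact: IH|apply: cvgM; [exact: cvg_cst|exact: h]].
rewrite /continuous_at (locsumE b T0 (ltW sN)); apply: cvg_trans cN; apply: near_eq_cvg.
near=> r; apply/esym/locsumE => //; rewrite lerBlDr ltW//; near: r.
by apply: lt_nbhsl; rewrite -ltrBlDr.
Unshelve. all: by end_near.
Qed.

Lemma majorant (U : R -> R) (t : R) : 0 <= t ->
  (forall M, exists K, forall s, 0 <= s <= M -> U s <= K) ->
  exists P P1 P2, [/\ c2line P P1 P2, (forall s, s <= t -> P s = 0 /\ P1 s = 0),
    (forall s, 0 <= P s) & forall s, t + 1 <= s -> U s <= P s].
Proof.
move=> t0 /choice[K hK].
(* For s in [t+1+k, t+2+k] the cubic factor of term k is at least 1 and its coefficient bounds [U]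
   up to time t+2+k. *)
pose b k := `|K (t + 2 + k%:R)|.
exists (locsum b (fun c s => pos (s - c) ^+ 3) t), (locsum b (fun c s => 3 * pos (s - c) ^+ 2) t),
  (locsum b (fun c s => 6 * pos (s - c)) t).
have p0 (c s : R) : s <= c -> pos (s - c) = 0 by move=> sc; rewrite max_r// subr_le0.
have T3 (c s : R) : s <= c -> pos (s - c) ^+ 3 = 0 by move=> /p0->; rewrite expr0n.
have T2 (c s : R) : s <= c -> 3 * pos (s - c) ^+ 2 = 0 by move=> /p0->; rewrite expr0n/= mulr0.
have T1 (c s : R) : s <= c -> 6 * pos (s - c) = 0 by move=> /p0->; rewrite mulr0.
have pp (r : R) : 0 <= pos r ^+ 3 by rewrite exprn_ge0// le_max lexx orbT.
split.
- split.
  + by move=> s; apply: locsum_derive => // c r; exact: pos3_derive.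
  + by move=> s; apply: locsum_derive => // c r; exact: pos2_derive.
  + by apply: locsum_continuous => // c; exact: pos_continuous.
- move=> s st; have st0 : s - t <= 0%:R by rewrite subr_le0.
  by rewrite (locsumE b T3 st0) (locsumE b T2 st0) !big_ord0.
- by move=> s; apply: sumr_ge0 => k _; rewrite mulr_ge0 /b.
- move=> s st; pose k := Num.truncn (s - (t + 1)).
  have s0 : 0 <= s - (t + 1) by lra.
  have /andP[k1 k2] := truncn_itv s0; rewrite -/k in k1 k2.
  have kN : (k < (Num.truncn (s - t)).+1)%N.
    rewrite -(ltr_nat R); apply: le_lt_trans k1 _.
    by apply: lt_trans (truncnS_gt _); lra.
  rewrite /locsum (bigD1 (Ordinal kN))//=.
  rewrite -natr1 in k2.
  apply: (@le_trans _ _ (b k * pos (s - (t + k%:R)) ^+ 3)); last first.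
    by rewrite lerDl sumr_ge0// => j _; rewrite mulr_ge0 /b.
  apply: (@le_trans _ _ (b k)).
    apply: le_trans (ler_norm _) => //; apply: hK; apply/andP; split; lra.
  rewrite ler_peMr /b//; have one : 1 <= pos (s - (t + k%:R)) by rewrite le_max; apply/orP; left; lra.
  exact: exprn_ege1.
Qed.

End time_part.

Section polynomial_time.
Variable R : realType.

Lemma c2line_horner (p : {poly R}) : c2line (horner p) (horner p^`()) (horner p^`()^`()).
Proof.
by split=> [s|s|]; [exact: is_derive_poly|exact: is_derive_poly|exact: continuous_horner].
Qed.

End polynomial_time.

Section interface.
Variables (R : realType) (n : nat).
Local Notation V := 'rV[R]_n.
Variables (Omega : set V) (nu : V -> V) (c : V -> R) (u : V * R -> R).
Hypothesis oO : open Omega.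
Local Notation D := (closure Omega).
Local Notation cyl := (cylinder Omega).

(* Shared form of both halves of the definition: -u is a raw_subsol for -c when u is
   a supersolution. *)
Definition raw_subsol : Prop := forall phi, Cbar 2 cyl phi ->
  forall z, maximizer Omega (fun z' => u z' - phi z') z -> 0 < z.2 ->
  (Omega z.1 -> ((dt Omega phi z)%:E <= F_upper Omega c z.1 (Dx Omega phi z) (D2x Omega phi z))%E) /\
  (boundary Omega z.1 ->
     ((dt Omega phi z)%:E <= F_upper Omega c z.1 (Dx Omega phi z) (D2x Omega phi z))%E \/
     dnu Omega nu phi z <= 0).

Lemma st_bounded : compact D -> st_cont D u -> forall M, 0 <= M ->
  exists K, forall y s, D y -> 0 <= s <= M -> `|u (y, s)| <= K.
Proof.
move=> cD cu M M0.
have [K _ hK] := cont_on_bounded (compact_pairs cD M0) (cont_on_pairs1 (T := M) cu).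
exists K => y s Dy sM; pose z := row_mx (strow y s) (strow y s).
have := hK z; rewrite /pairs /= /z x1_row x2_row t1_row t2_row !spart_strow !tpart_strow.
by apply.
Qed.

Hypotheses (cD : compact D) (cu : st_cont D u) (su : raw_subsol).

(** Turns a local contact into a global maximum. Quartic terms dominate away from the contact up to
    time t + 1, and [majorant] takes over afterwards; neither changes the first derivatives or the
    spatial Hessian at the contact. The function [h] admits test functions that are only C^2, such
    as the initial datum. *)
Lemma raw_touch (h : V -> R) h1 h2 x t p X tau b : c2bar Omega h h1 h2 ->
  D x -> 0 < t -> X^T = X ->
  (exists2 de : R, 0 < de & forall y s, D y -> 0 <= s -> `|y - x| < de -> `|s - t| < de ->
     u (y, s) <= u (x, t) + (h y - h x) + dot p (y - x) + 2^-1 * qf X (y - x)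
       + tau * (s - t) + b * (s - t) ^+ 2) ->
  forall q Y, q = \row_i h1 (delta_mx 0 i) x + p ->
  Y = \matrix_(i, j) h2 (delta_mx 0 i) (delta_mx 0 j) x + X ->
  (boundary Omega x -> 0 < dot q (nu x)) ->
  (tau%:E <= F_upper Omega c x q Y)%E.
Proof.
move=> hh xD t0 Xs [de de0 touch] q Y qE YE hq.
pose E y s := u (y, s) - u (x, t) - (h y - h x) - dot p (y - x) - 2^-1 * qf X (y - x)
       - tau * (s - t) - b * (s - t) ^+ 2.
have bE M : 0 <= M -> exists2 K, 0 <= K & forall y s, D y -> 0 <= s <= M -> E y s <= K.
  move=> M0; have [K1 hK1] := st_bounded cD cu M0.
  have c2 : cont_on D (fun y => - h y - quartic p X 0 x y).
    apply: cont_onB; first by apply: cont_onN; exact: (c2_cont hh).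
    exact: c2_cont (c2bar_quartic _ p 0 x Xs).
  have [K2 K20 hK2] := cont_on_bounded cD c2.
  have K10 : 0 <= K1 by apply: le_trans (hK1 x 0 xD _); rewrite ?lexx.
  pose K3 := `|- u (x, t) + h x| + `|tau| * (M + t) + `|b| * (M + t) ^+ 2.
  exists (K1 + K2 + K3).
    by rewrite !addr_ge0 ?mulr_ge0 ?exprn_ge0 ?addr_ge0// ltW.
  move=> y s Dy /andP[s0 sM]; rewrite /E.
  have e1 := le_trans (ler_norm _) (hK1 y s Dy ltac:(by rewrite s0)).
  have := le_trans (ler_norm _) (hK2 y Dy); rewrite /quartic mul0r addr0 => e2.
  have st : `|s - t| <= M + t by rewrite ler_norml; apply/andP; split; lra.
  have e3 : - (tau * (s - t)) <= `|tau| * (M + t).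
    by apply: le_trans (ler_norm _) _; rewrite normrN normrM ler_wpM2l.
  have e4 : - (b * (s - t) ^+ 2) <= `|b| * (M + t) ^+ 2.
    apply: le_trans (ler_norm _) _; rewrite normrN normrM ler_wpM2l// normrX lerXn2r// nnegrE//.
    by rewrite addr_ge0// ltW.
  have e5 := ler_norm (- u (x, t) + h x).
  rewrite /K3; move: e1 e2 e3 e4 e5; clear -oO cD cu su => *; lra.
have [G [G1 [G2 [hG G0 Gp Gmaj]]]] : exists P P1 P2, [/\ c2line P P1 P2,
    (forall s, s <= t -> P s = 0 /\ P1 s = 0), (forall s, 0 <= P s) &
    forall y s, D y -> t + 1 <= s -> E y s <= P s].
  (* The supremum over space, finite by compactness, leaves one function of time to be dominated. *)
  pose U s := sup [set r | exists2 y, D y & r = E y s].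
  have supU s K : 0 <= s -> (forall y, D y -> E y s <= K) -> U s <= K.
    move=> s0 hK; apply: ge_sup; first by exists (E x s), x.
    by move=> _ [y Dy ->]; exact: hK.
  have [|P [P1 [P2 [hP P0 Pp PU]]]] := majorant (U := U) (ltW t0).
    move=> M; have [K K0 hK] := bE `|M| (normr_ge0 _).
    exists K => s /andP[s0 sM]; apply: supU => // y Dy; apply: hK => //.
    by rewrite s0 (le_trans sM)// ler_norm.
  exists P, P1, P2; split=> // y s Dy ts; apply: le_trans (PU _ ts).
  have s0 : 0 <= s by lra.
  have [K K0 hK] := bE s s0.
  apply: ub_le_sup; last by exists y.
  by exists K => _ [y' Dy' ->]; apply: hK => //; rewrite s0 lexx.
have [K K0 hK] := bE (t + 1) ltac:(lra).
(* Outside the contact neighbourhood, in space or in time, one quartic term is at least C de^4 = K,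
   which bounds the excess up to time t + 1. *)
pose C := K / de ^+ 4.
have C0 : 0 <= C by rewrite divr_ge0// exprn_ge0// ltW.
have hC r : de <= r -> K <= C * r ^+ 4.
  move=> dr; rewrite /C mulrAC ler_pdivlMr ?exprn_gt0// ler_wpM2l// lerXn2r// nnegrE ?ltW//.
  exact: lt_le_trans dr.
pose P : {poly R} := tau *: ('X - t%:P) + b *: ('X - t%:P) ^+ 2 + C *: ('X - t%:P) ^+ 4.
have hP : c2line _ _ _ := c2lineD (c2line_horner P) hG.
have PE s : P.[s] = tau * (s - t) + b * (s - t) ^+ 2 + C * (s - t) ^+ 4 by rewrite /P !hornerE.
have dPE : P^`().[t] = tau.
  rewrite /P !derivD !derivZ !deriv_exp derivXsubC !hornerE /=; ring.
have hphi := c2barD (c2bar_fst hh) (c2barD (c2bar_fst (c2bar_quartic Omega p C x Xs)) (c2bar_snd Omega hP)).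
set phi := fun z => _ in hphi.
have ocyl := open_cylinder oO.
have clz : closure cyl (x, t) by rewrite closure_cylinder; split=> //=; exact: ltW.
have [Gt G1t] := G0 t (lexx _).
have q0 : quartic p X C x x = 0 by rewrite /quartic subrr !dot0r qf0r !mulr0 !addr0.
have mx : maximizer Omega (fun z' => u z' - phi z') (x, t).
  split; first by rewrite -closure_cylinder.
  move=> [y s] [/= Dy s0].
  suff EE : E y s <= C * (dot (y - x) (y - x) * dot (y - x) (y - x)) + C * (s - t) ^+ 4 + G s.
    move: EE; rewrite /phi /= q0 PE PE subrr !expr0n/= Gt !(mulr0, addr0) /E /quartic.
    by move: (u _) (u _) (dot p _) (qf _ _) => *; lra.
  have f0 : 0 <= C * (dot (y - x) (y - x) * dot (y - x) (y - x)).
    by rewrite mulr_ge0// mulr_ge0 ?dot_ge0.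
  have s40 : 0 <= C * (s - t) ^+ 4 by rewrite mulr_ge0// exprn_even_ge0.
  have Gs := Gp s.
  have [ts|ts] := leP (t + 1) s.
    by apply: le_trans (Gmaj _ _ Dy ts) _; move: (C * _) (C * _) f0 s40 => *; lra.
  have [d1|d1] := leP de `|y - x|.
    have : E y s <= K by apply: hK => //; rewrite s0 ltW.
    have := hC _ (le_trans d1 (norm_le_enorm _)).
    have -> : enorm (y - x) ^+ 4 = dot (y - x) (y - x) * dot (y - x) (y - x).
      by rewrite -!enorm_sq; ring.
    by move: (C * _) (C * _) f0 s40 => *; lra.
  have [d2|d2] := leP de `|s - t|.
    have : E y s <= K by apply: hK => //; rewrite s0 ltW.
    have := hC _ d2.
    have -> : `|s - t| ^+ 4 = (s - t) ^+ 4 by rewrite -normrX ger0_norm// exprn_even_ge0.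
    by move: (C * _) (C * _) f0 s40 => *; lra.
  have := touch _ _ Dy s0 d1 d2.
  rewrite /E; move: (C * _) (C * _) f0 s40 (u _) (u _) (dot p _) (qf _ _) => *; lra.
have [si sb] := su (c2bar_Cbar ocyl hphi) mx t0.
(* The time direction has zero spatial component, so this value of [h1] enters [dt]. It vanishes in
   Omega as a derivative along 0, and at boundary points by uniqueness of the continuous
   extension. *)
have h10 : h1 0 x = 0.
  have e1 := extension_eq (@c2_cont1 _ _ _ _ _ _ hh 0) (fun y _ => erefl (h1 0 y)) xD.
  have c0 : cont_on D (fun=> (0 : R)) by exact: cont_on_cst.
  rewrite -e1; apply: extension_eq xD => // y Oy.
  by have [_ <-] := c2_der1 hh 0 Oy; rewrite derive0.
have dtE : dt Omega phi (x, t) = tau.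
  rewrite /dt (c2bar_extension1 _ hphi clz) /= h10 dPE G1t subrr !(dot0r, dot0l, mul0mx).
  by rewrite !(mulr0, mul0r, addr0, add0r) mul1r.
have DxE : Dx Omega phi (x, t) = q.
  rewrite qE; apply/rowP => i; rewrite !mxE (c2bar_extension1 _ hphi clz) /= subrr !dot0r dot_delta.
  by rewrite !(mulr0, mul0r, addr0).
have D2E : D2x Omega phi (x, t) = Y.
  rewrite YE; apply/matrixP => i j; rewrite !mxE (c2bar_extension2 _ _ ocyl hphi clz) /= subrr !dot0r.
  by rewrite dot_delta -rowE mxE !(mulr0, mul0r, addr0).
move: si sb; rewrite dtE /dnu DxE D2E /= => si sb.
have [Ox|nOx] := pselect (Omega x); first exact: si.
have Bx : boundary Omega x by split=> //; rewrite (interior_id Omega).1.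
by case: (sb Bx) => // /(lt_le_trans (hq Bx)); rewrite ltxx.
Qed.

End interface.

(** * Semicontinuous envelopes of the operator *)

Section envelopes.
Variables (R : realType) (n : nat).
Local Notation V := 'rV[R]_n.
Implicit Types (X Y : 'M[R]_n).

Definition entry_sum X : R := \sum_i \sum_j `|X i j|.

Lemma entry_sum_ge0 X : 0 <= entry_sum X.
Proof. by apply: sumr_ge0 => i _; apply: sumr_ge0. Qed.

Lemma entry_sumD X Y : entry_sum (X + Y) <= entry_sum X + entry_sum Y.
Proof.
rewrite /entry_sum -big_split; apply: ler_sum => i _; rewrite -big_split.
by apply: ler_sum => j _; rewrite mxE ler_normD.
Qed.

Lemma entry_sum_norm X : entry_sum X <= n%:R * n%:R * `|X|.
Proof.
apply: (@le_trans _ _ (\sum_(i < n) \sum_(j < n) `|X|)).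
  apply: ler_sum => i _; apply: ler_sum => j _.
  by rewrite [leRHS]/Num.norm /= mx_normrE; apply: (le_bigmax _ (fun k => `|X k.1 k.2|) (i, j)).
by rewrite !sumr_const !card_ord -mulrnA -natrM mulr_natl.
Qed.

Lemma tr_entry_sum X : `|\tr X| <= entry_sum X.
Proof.
apply: le_trans (ler_norm_sum _ _ _) _; apply: ler_sum => i _.
by rewrite (bigD1 i)//= lerDl sumr_ge0.
Qed.

Lemma qf_entry_sum X d : `|qf X d| <= entry_sum X * dot d d.
Proof.
rewrite /qf [dot (d *m X) d]/dot.
under eq_bigr do rewrite mxE mulr_suml.
rewrite exchange_big/= mulr_suml.
apply: le_trans (ler_norm_sum _ _ _) _; apply: ler_sum => i _.
rewrite mulr_suml; apply: le_trans (ler_norm_sum _ _ _) _; apply: ler_sum => j _.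
rewrite mulrAC !normrM mulrC ler_wpM2l//.
apply: le_trans (norm_sq_le_dot d); rewrite expr2 ler_pM// coord_norm//.
Qed.

Lemma FE (c : V -> R) x p X : F c x p X = \tr X - qf X (uvec p) + c x * enorm p.
Proof.
have uu : (uvec p)^T *m uvec p = (enorm p ^+ 2)^-1 *: (p^T *m p).
  apply/matrixP => i j; rewrite !mxE !big_ord1 !mxE -exprVn; ring.
by rewrite -tr_proj_mul /F /ortho_proj uu.
Qed.

Variables (Omega : set V) (c : V -> R).
Local Notation D := (closure Omega).

Lemma F_upper_le x p X (a : R) :
  (forall e : R, 0 < e -> exists2 de : R, 0 < de & forall y q Y, D y -> q != 0 -> Y^T = Y ->
     `|y - x| < de -> `|q - p| < de -> `|Y - X| < de -> F c y q Y <= a + e) ->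
  (F_upper Omega c x p X <= a%:E)%E.
Proof.
move=> h; apply/lee_addgt0Pr => e e0; have [de de0 hde] := h _ e0.
rewrite /F_upper limf_esupE; apply: ge_ereal_inf; exists (ereal_sup ((fun w => (F c w.1.1 w.1.2 w.2)%:E) @` [set w | F c w.1.1 w.1.2 w.2 <= a + e])).
  exists [set w | F c w.1.1 w.1.2 w.2 <= a + e] => //.
    rewrite /F_filter /within /=.
    have : \forall w \near (x, p, X), `|w.1.1 - x| < de /\ `|w.1.2 - p| < de /\ `|w.2 - X| < de.
      have nd (W : normedModType R) (w : W) : nbhs w [set w' | `|w' - w| < de].
        by apply/nbhs_normP; exists de => // y /=; rewrite distrC.
      exists ([set z | `|z.1 - x| < de /\ `|z.2 - p| < de], [set Y | `|Y - X| < de]) => /=.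
        split; last exact: nd.
        by exists ([set y | `|y - x| < de], [set q | `|q - p| < de]) => //=; split; exact: nd.
      by move=> [[y q] Y] /= [[]].
    by apply: filterS => -[[y q] Y] /= [h1 [h2 h3]] [Dy q0 Ys]; exact: hde.
  apply: ge_ereal_sup => _ [w /= hw <-]; by rewrite -EFinD lee_fin.
Qed.

Lemma enorm_near (p q : V) de : `|q - p| < de -> enorm q <= enorm p + (n%:R + 1) * de.
Proof.
move=> qp; have := enormD p (q - p); rewrite subrKC => /le_trans; apply.
by rewrite lerD2l; apply: le_trans (enorm_le_norm _) _; rewrite ler_wpM2l// ?ltW// addr_ge0.
Qed.

(** Valid also at p = 0, where it gives the second clause of [subsol]: this linear growth is what
    the quartic contacts with vanishing gradient exploit. *)
Lemma F_upper_bound Cc x p X : 0 <= Cc -> (forall y, D y -> `|c y| <= Cc) ->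
  (F_upper Omega c x p X <= ((2 + Cc) * (entry_sum X + enorm p))%:E)%E.
Proof.
move=> C0 hC; apply: F_upper_le => e e0.
pose K := 2 * (n%:R * n%:R) + Cc * (n%:R + 1) + 1.
have K0 : 0 < K by rewrite /K ltr_wpDl// addr_ge0// ?mulr_ge0// addr_ge0.
exists (e / K); first by rewrite divr_gt0.
move=> y q Y Dy q0 Ys yx qp YX; rewrite FE.
have h1 := le_trans (ler_norm _) (tr_entry_sum Y).
have h2 := qf_entry_sum Y (uvec q); rewrite dot_uvec// mulr1 in h2.
have {}h2 := le_trans (ler_norm _) (eq_ind_r (fun r => r <= _) h2 (normrN (qf Y (uvec q)))).
have h3 : c y * enorm q <= Cc * enorm q.
  by rewrite ler_wpM2r ?enorm_ge0// (le_trans (ler_norm _))// hC.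
have h4 := ler_wpM2l C0 (enorm_near qp).
have h5 := entry_sumD X (Y - X); rewrite subrKC in h5.
have h6 : entry_sum (Y - X) <= n%:R * n%:R * (e / K).
  by apply: le_trans (entry_sum_norm _) _; rewrite ler_wpM2l ?mulr_ge0// ltW.
have eK : K * (e / K) = e by rewrite mulrC divfK// gt_eqF.
have X0 := entry_sum_ge0 X; have p0 := enorm_ge0 p.
have eK0 : 0 < e / K by rewrite divr_gt0.
have CX := mulr_ge0 C0 X0.
have eKle : 2 * (n%:R * n%:R) * (e / K) + Cc * (n%:R + 1) * (e / K) <= e.
  have kk : 2 * (n%:R * n%:R) + Cc * (n%:R + 1) <= K by rewrite /K lerDl.
  by rewrite -mulrDl -[leRHS]eK ler_wpM2r// ltW.
clear eK hC; move: (e / K) (n%:R) (entry_sum X) (entry_sum _) (entry_sum _) (enorm p) (enorm q) h1 h2 h3 h4 h5 h6 X0 p0 eK0 CX eKle => *.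
lra.
Qed.

(** Away from p = 0 the operator is continuous, and the upper envelope does not exceed its value. *)
Lemma F_upper_cont x p X : cont_on D c -> D x -> p != 0 -> X^T = X ->
  (F_upper Omega c x p X <= (\tr X - qf X (uvec p) + c x * enorm p)%:E)%E.
Proof.
move=> cc Dx p0 Xs; apply: F_upper_le => e e0.
have ep := enorm_gt0 p0.
have e4 : 0 < e / 4 by rewrite divr_gt0.
have /continuousP_norm/(_ _ e4)[d1 d10 hd1] := jet2_continuous (jet2_qf (uvec p) Xs).
have n1 : 0 < n%:R + 1 :> R by rewrite ltr_wpDl.
have P1 : 0 < 4 * (enorm p + (n%:R + 1)) by rewrite mulr_gt0// addr_gt0.
have e5 : 0 < e / (4 * (enorm p + (n%:R + 1))) by rewrite divr_gt0.
have [d2 d20 hd2] := cc _ Dx _ e5.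
pose K : R := 2 * (n%:R * n%:R) + 1.
have K0 : 0 < K by rewrite /K ltr_wpDl// !mulr_ge0.
pose K3 := `|c x| * (n%:R + 1) + 1.
have K30 : 0 < K3 by rewrite /K3 ltr_wpDl// mulr_ge0// ltW.
pose d3 := Num.min (e / 4 / K) (Num.min (e / 4 / K3) (Num.min 1 (d1 * enorm p / (2 * (n%:R + 1))))).
have d30 : 0 < d3 by rewrite !lt_min ltr01 (divr_gt0 e4 K0) (divr_gt0 e4 K30) divr_gt0 ?mulr_gt0.
exists (Num.min d2 d3); first by rewrite lt_min d20.
move=> y q Y Dy q0 Ys; rewrite !lt_min => /andP[yx _] /andP[_ /and4P[q1 q2 q3 q4]] /andP[_ /and4P[Y1 _ _ _]].
rewrite FE.
have h1 := le_trans (ler_norm _) (tr_entry_sum (Y - X)).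
have h2 := qf_entry_sum (Y - X) (uvec q); rewrite dot_uvec// mulr1 in h2.
move: h1 h2; rewrite raddfB /= qfD qfN ler_norml => h1 /andP[h2 _].
have h6 : entry_sum (Y - X) <= n%:R * n%:R * (e / 4 / K).
  by apply: le_trans (entry_sum_norm _) _; rewrite ler_wpM2l ?mulr_ge0// ltW.
have h7 : K * (e / 4 / K) = e / 4 by rewrite mulrC divfK// gt_eqF.
have h8 : 0 < e / 4 / K by rewrite divr_gt0.
have h9 : 2 * entry_sum (Y - X) <= e / 4.
  rewrite -h7 /K mulrDl mul1r; move: h6 h8; move: (e / 4 / _) (entry_sum _) => a b *; lra.
have hq : `|uvec q - uvec p| < d1.
  apply: le_lt_trans (norm_le_enorm _) _; rewrite enormBC.
  apply: le_lt_trans (uvec_dist p0 q0) _; rewrite ltr_pdivrMr// enormBC.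
  apply: le_lt_trans (_ : 2 * ((n%:R + 1) * `|q - p|) < _); first by rewrite ler_pM2l// enorm_le_norm.
  by rewrite mulrA mulrC -ltr_pdivlMr// mulr_gt0.
have := hd1 _ hq; rewrite ltr_norml => /andP[g1 _].
have g2 : c y * enorm q <= c x * enorm p + e / 4 + e / 4.
  have -> : c y * enorm q = c x * enorm p + (c y - c x) * enorm q + c x * (enorm q - enorm p) by ring.
  apply: lerD; first rewrite lerD2l.
    apply: le_trans (ler_norm _) _; rewrite normrM [`|enorm q|]ger0_norm ?enorm_ge0//.
    apply: (@le_trans _ _ (e / (4 * (enorm p + (n%:R + 1))) * (enorm p + (n%:R + 1)))).
      apply: ler_pM; rewrite ?enorm_ge0//; first by rewrite ltW// hd2.
      by have := enorm_near q3; rewrite mulr1.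
    rewrite invfM mulrA divfK// gt_eqF// addr_gt0//.
  apply: le_trans (ler_norm _) _; rewrite normrM.
  apply: (@le_trans _ _ (`|c x| * ((n%:R + 1) * (e / 4 / K3)))).
    rewrite ler_wpM2l//; apply: le_trans (ler_dist_enorm _ _) _.
    by apply: le_trans (enorm_le_norm _) _; rewrite ler_pM2l// ltW.
  have k7 : K3 * (e / 4 / K3) = e / 4 by rewrite mulrC divfK// gt_eqF.
  have kk : `|c x| * (n%:R + 1) <= K3 by rewrite lerDl.
  by rewrite [leLHS]mulrA -[leRHS]k7; apply: ler_wpM2r kk; exact: ltW (divr_gt0 e4 K30).
move: h1 h2 h9 g1 g2; move: (c y * _) (c x * _) (entry_sum _) (qf _ _) (qf _ _) (qf _ _) => *; lra.
Qed.

End envelopes.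

Section from_definitions.
Variables (R : realType) (n : nat).
Local Notation V := 'rV[R]_n.
Variables (Omega : set V) (nu : V -> V) (c u0 : V -> R) (u : V * R -> R).
Hypothesis oO : open Omega.
Local Notation D := (closure Omega).
Local Notation B := (boundary Omega).
Local Notation cyl := (cylinder Omega).

Lemma F_filterP x p (X : 'M[R]_n) A : F_filter Omega x p X A <->
  exists2 de : R, 0 < de & forall y q (Y : 'M[R]_n), D y -> q != 0 -> Y^T = Y ->
     `|y - x| < de -> `|q - p| < de -> `|Y - X| < de -> A (y, q, Y).
Proof.
have nd (W : normedModType R) (w : W) de : 0 < de -> nbhs w [set w' | `|w' - w| < de].
  by move=> de0; apply/nbhs_normP; exists de => // y /=; rewrite distrC.
split=> [[[A1 A2] /= [[[A3 A4] /= [/nbhs_normP[d1 /= d10 h1] /nbhs_normP[d2 /= d20 h2]] h12]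
    /nbhs_normP[d3 /= d30 h3]] h]|[de de0 h]].
- exists (Num.min d1 (Num.min d2 d3)); first by rewrite !lt_min d10 d20.
  move=> y q Y Dy q0 Ys; rewrite !lt_min => /and3P[y1 _ _] /and3P[_ q1 _] /and3P[_ _ Y1].
  apply: (h (y, q, Y)) => //=; split; last by apply: h3 => /=; rewrite distrC.
  by apply: h12; split => /=; [apply: h1 => /=|apply: h2 => /=]; rewrite distrC.
- exists ([set z | `|z.1 - x| < de /\ `|z.2 - p| < de], [set Y | `|Y - X| < de]) => /=.
    split; last exact: nd.
    by exists ([set y | `|y - x| < de], [set q | `|q - p| < de]) => //=; split; exact: nd.
  by move=> [[y q] Y] /= [[h1 h2] h3] [Dy q0 Ys]; exact: h.
Qed.

(** This symmetry turns a supersolution [u] for [c] into a subsolution [- u] for [- c], so that one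
    set of estimates serves both. *)
Lemma FN (d : V -> R) x p (X : 'M[R]_n) : F (fun y => - d y) x (- p) (- X) = - F d x p X.
Proof.
rewrite /F enormN; have -> : (- p)^T *m (- p) = p^T *m p.
  by apply/matrixP => i j; rewrite !mxE !big_ord1 !mxE mulrNN.
by rewrite mulmxN raddfN /= mulNr -opprD.
Qed.

(** Reflection in p and X maps neighbourhoods to neighbourhoods and, by [FN], infima of one operator
    to suprema of the other. *)
Lemma F_lowerN x p (X : 'M[R]_n) :
  (- F_lower Omega c x (- p) (- X) <= F_upper Omega (fun y => - c y)%R x p X)%E.
Proof.
rewrite /F_lower limf_einfE leeNl.
rewrite /F_upper limf_esupE leeNl; apply: le_ereal_inf_tmp => _ [A /F_filterP[de de0 hA] <-].
rewrite leeNl.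
pose A' : set (V * V * 'M[R]_n) := [set w | A (w.1.1, - w.1.2, - w.2)].
apply: (@le_trans _ _ (ereal_inf ((fun w => (F c w.1.1 w.1.2 w.2)%:E) @` A'))).
  apply: le_ereal_inf_tmp => _ [w Aw <-]; rewrite leeNl -EFinN -FN.
  by apply: ereal_sup_ubound; exists (w.1.1, - w.1.2, - w.2).
apply: ereal_sup_ubound; exists A' => //.
apply/F_filterP; exists de => // y q Y Dy q0 Ys yx qp YX /=; apply: hA => //.
- by rewrite oppr_eq0.
- by apply/matrixP => i j; rewrite !mxE -{1}Ys mxE.
- by rewrite -normrN opprD opprK; move: qp; rewrite opprK.
- by rewrite -normrN opprD opprK; move: YX; rewrite opprK.
Qed.

Lemma subsolution_raw : viscosity_subsolution Omega nu c u0 u -> raw_subsol Omega nu c u.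
Proof.
move=> [_ _ h] phi cphi z mz z0; have /= [h1 h2] := h phi cphi z mz z0.
split=> [/h1|/h2]; first by rewrite sube_le0.
by rewrite ge_min sube_le0 lee_fin => /orP.
Qed.

Lemma supersolution_raw : viscosity_supersolution Omega nu c u0 u ->
  raw_subsol Omega nu (fun x => - c x) (fun z => - u z).
Proof.
move=> [_ _ h] phi cphi z mz z0; have ocyl := open_cylinder oO.
have [f1 [f2 hf]] := Cbar_c2bar ocyl cphi.
have hN := c2barN hf; have clz : closure cyl z by rewrite closure_cylinder; exact: mz.1.
have mz' : minimizer Omega (fun z' => u z' - - phi z') z.
  split; first exact: mz.1.
  by move=> z' cz'; have := mz.2 z' cz'; rewrite !opprK -!opprD lerN2.
have /= [h1 h2] := h _ (c2bar_Cbar ocyl hN) z mz' z0.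
have dtN : dt Omega (fun z => - phi z) z = - dt Omega phi z.
  by rewrite /dt (c2bar_extension1 _ hN clz) (c2bar_extension1 _ hf clz).
have DxN : Dx Omega (fun z => - phi z) z = - Dx Omega phi z.
  by apply/rowP => i; rewrite !mxE (c2bar_extension1 _ hN clz) (c2bar_extension1 _ hf clz).
have D2N : D2x Omega (fun z => - phi z) z = - D2x Omega phi z.
  apply/matrixP => i j; rewrite [LHS]mxE [RHS]mxE [X in - X]mxE.
  by rewrite (c2bar_extension2 _ _ ocyl hN clz) (c2bar_extension2 _ _ ocyl hf clz).
move: h1 h2; rewrite /dnu dtN DxN D2N dotNl => h1 h2.
have key : (0 <= (- dt Omega phi z)%:E - F_lower Omega c z.1 (- Dx Omega phi z) (- D2x Omega phi z))%E ->
    ((dt Omega phi z)%:E <= F_upper Omega (fun x => - c x)%R z.1 (Dx Omega phi z) (D2x Omega phi z))%E.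
  rewrite sube_ge0 ?orbT// => hh; apply: le_trans (F_lowerN _ _ _).
  by rewrite leeNr -EFinN.
split=> [/h1|/h2]; first exact: key.
by rewrite le_max lee_fin oppr_ge0 => /orP[/key|]; [left|right].
Qed.

End from_definitions.

Section subsolutions.
Variables (R : realType) (n : nat).
Local Notation V := 'rV[R]_n.
Variables (Omega : set V) (nu : V -> V) (c : V -> R) (Cc : R) (u : V * R -> R).
Local Notation D := (closure Omega).
Local Notation B := (boundary Omega).
Hypotheses (oO : open Omega) (cD : compact D).
Hypotheses (cc : cont_on D c) (Cc0 : 0 <= Cc) (hC : forall x, D x -> `|c x| <= Cc).
Hypotheses (cu : st_cont D u) (su : raw_subsol Omega nu c u).

Lemma raw_subsol_quadratic : subsol D B nu c (2 + Cc) u.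
Proof.
move=> x t p X tau b Dx t0 Xs touch hB.
have h0 : c2bar Omega (fun=> 0) (fun _ _ => 0) (fun _ _ _ => 0).
  apply: c2bar_qjet; [| |by move=> *; exact: cst_continuous].
  - by move=> y; exists (fun=> 0); exact: qjet_cst.
  - by move=> v y; exists (fun=> 0); exact: qjet_cst.
have key : (tau%:E <= F_upper Omega c x p X)%E.
  apply: (raw_touch oO cD cu su h0 Dx t0 Xs (p := p) (tau := tau) (b := b)) => //.
  - have [de de0 h] := touch; exists de => // y s Dy s0 yx st.
    by rewrite subrr addr0 h.
  - by apply/rowP => i; rewrite !mxE add0r.
  - by apply/matrixP => i j; rewrite !mxE add0r.
split.
  by move=> p0; rewrite -lee_fin; apply: le_trans key _; exact: F_upper_cont.
by rewrite -lee_fin; apply: le_trans key _; exact: F_upper_bound.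
Qed.

Lemma subsol_translate (E : R) h : 0 <= h -> subsol D B nu c E u ->
  subsol D B nu c E (fun z => u (z.1, z.2 + h)).
Proof.
move=> h0 sE x t p X tau b Dx t0 Xs [de de0 touch] hB.
apply: (sE x (t + h) p X tau b Dx _ Xs _ hB); first by rewrite ltr_pwDl.
(* The bound by t keeps the shifted time s - h nonnegative. *)
exists (Num.min de t); first by rewrite lt_min de0.
move=> y s Dy s0; rewrite !lt_min => /andP[y1 y2] /andP[s1 s2].
have e1 : s - (t + h) = s - h - t by ring.
rewrite e1 in s1 s2 *.
have sh : 0 <= s - h by move: s2; rewrite ltr_norml => /andP[]; lra.
by have := touch y (s - h) Dy sh y1 s1; rewrite /= subrK.
Qed.

Lemma st_cont_translate h : 0 <= h -> st_cont D (fun z => u (z.1, z.2 + h)).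
Proof.
move=> h0 x t Dx t0 e e0; have [de de0 hde] := cu Dx (addr_ge0 t0 h0) e0.
exists de => // y s Dy s0 yx st; apply: hde => //; first exact: addr_ge0.
by have -> : s + h - (t + h) = s - t by ring.
Qed.

End subsolutions.

(** * Barriers at the initial time *)

Section barrier.
Variables (R : realType) (n : nat).
Local Notation V := 'rV[R]_n.
Local Notation W := 'rV[R]_((n + 1) + (n + 1)).
Variables (Omega : set V) (nu : V -> V) (c : V -> R) (Cc : R) (u : V * R -> R).
Local Notation D := (closure Omega).
Local Notation B := (boundary Omega).
Variables (C0 C1 : R) (g : V -> R) (Dg : V -> V) (Hg : V -> 'M[R]_n).
Hypotheses (oO : open Omega) (gg : good_geometry D B nu C0 C1 g Dg Hg).
Hypotheses (cc : cont_on D c) (Cc0 : 0 <= Cc) (hC : forall x, D x -> `|c x| <= Cc).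
Hypotheses (cu : st_cont D u) (su : raw_subsol Omega nu c u).

Lemma st_cont_within : {within closed_cylinder Omega, continuous u} -> st_cont D u.
Proof.
move=> /cont_onP h x t Dx t0 e e0; have [de de0 hde] := h (x, t) (conj Dx t0) _ e0.
exists de => // y s Dy s0 yx st; apply: hde => //=.
exact: norm_pair_lt.
Qed.

Lemma compact_bounded_family (I : finType) (f : I -> V -> R) : compact D ->
  (forall i, cont_on D (f i)) -> exists K : I -> R, forall i, 0 < K i /\ forall x, D x -> `|f i x| <= K i.
Proof.
move=> cD cf; have /choice[K hK] i : exists K, 0 < K /\ forall x, D x -> `|f i x| <= K.
  by have [K K0 hK] := cont_on_bounded cD (cf i); exists K.
by exists K.
Qed.

(** A small multiple of [g] is added to [h + M t]: the normal derivative of [h] vanishes on the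
    boundary, and the test function needs a strictly positive one. The constant M only has to exceed
    the operator on the test function. *)
Lemma barrier (h : V -> R) h1 h2 : c2bar Omega h h1 h2 ->
  (forall x, B x -> dot (\row_i h1 (delta_mx 0 i) x) (nu x) = 0) ->
  (forall x, D x -> u (x, 0) <= h x) ->
  exists2 M, 0 < M & forall x t, D x -> 0 <= t -> u (x, t) <= h x + M * t.
Proof.
move=> hh hneu init; have cD := gg_compact gg.
have [K1 hK1] := compact_bounded_family cD (fun i => c2_cont1 hh (delta_mx 0 i)).
have [K2 hK2] := compact_bounded_family cD
  (fun ij : 'I_n * 'I_n => c2_cont2 hh (delta_mx 0 ij.1) (delta_mx 0 ij.2)).
pose S1 := \sum_i K1 i; pose S2 := \sum_i \sum_j K2 (i, j).
have S10 : 0 <= S1 by apply: sumr_ge0 => i _; exact: ltW (hK1 i).1.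
have S20 : 0 <= S2 by apply: sumr_ge0 => i _; apply: sumr_ge0 => j _; exact: ltW (hK2 (i, j)).1.
have c1 := gg_C1 gg; have C10 : 0 < C1 by apply: lt_le_trans c1.
have n1 : (0 : R) <= n%:R by [].
(* [F_upper_bound] on the test function: second derivatives of [h], the paraboloid above the
   multiple of [g], and the two gradients. Since ka <= 1, it does not depend on ka. *)
pose Q := (2 + Cc) * (S2 + n%:R * n%:R * (C1 + 1) + ((n%:R + 1) * S1 + C1)).
have Q0 : 0 <= Q.
  rewrite /Q mulr_ge0 ?addr_ge0 ?mulr_ge0 ?addr_ge0// ltW//.
exists (Q + 1); first by rewrite ltr_wpDl.
move=> x0 t0 Dx0 t00; rewrite leNgt; apply/negP => hlt.
pose M := Q + 1.
pose th := u (x0, t0) - (h x0 + M * t0); have th0 : 0 < th by rewrite subr_gt0.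
(* The perturbation consumes at most half of the excess [th]. *)
pose ka := Num.min 1 (th / (2 * C1)).
have ka0 : 0 < ka by rewrite lt_min ltr01 divr_gt0// mulr_gt0.
have ka1 : ka <= 1 by rewrite ge_min lexx.
have kaC : ka * C1 <= th / 2.
  apply: (@le_trans _ _ (th / (2 * C1) * C1)); first by apply: ler_wpM2r; [exact: ltW|rewrite ge_min lexx orbT].
  by rewrite invfM mulrA divfK// gt_eqF.
have T10 : 0 <= t0 + 1 by lra.
(* The function maximized below depends on the first point of a pair only; pairs serve as the
   compact space-time set. *)
have cK := compact_pairs cD T10.
have ch : cont_on (pairs D (t0 + 1)) (fun z => h (x1 z)).
  apply: (cont_on_comp (D := D)) (c2_cont hh); first by move=> z [].
  by move=> z z' _ _; exact: x1_dist.
have cg : cont_on (pairs D (t0 + 1)) (fun z => g (x1 z)).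
  apply: (cont_on_comp (D := D)) (gg_cont gg); first by move=> z [].
  by move=> z z' _ _; exact: x1_dist.
have ct (f : R -> R) : continuous f -> cont_on (pairs D (t0 + 1)) (fun z => f (t1 z)).
  move=> cf; apply: (cont_on_comp (D := setT)) (cont_on_continuous cf) => //.
  by move=> z z' _ _; exact: t1_dist.
have [Kd Kd0 hKd] := cont_on_bounded cK (cont_onB (cont_on_pairs1 (T := t0 + 1) cu) ch).
(* The cubic penalty vanishes up to t0 and exceeds [u - h] at t0 + 1, so the maximum lies before t0
   + 1. *)
pose Bc := Kd + 1; have B0 : 0 < Bc by rewrite /Bc; lra.
pose pen s : R := M * s + Bc * Num.max (s - t0) 0 ^+ 3.
have cpos : continuous (fun s : R => Num.max (s - t0) 0 ^+ 3).
  move=> s; apply: differentiable_continuous; apply/derivable1_diffP.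
  by have [] := pos3_derive t0 s.
have cpen : continuous pen.
  move=> s; apply: cvgD; first exact: mulrl_continuous.
  by apply: cvgM; [exact: cvg_cst|exact: cpos].
pose Phi (z : W) := u (x1 z, t1 z) - h (x1 z) - ka * g (x1 z) - pen (t1 z).
have cPhi : cont_on (pairs D (t0 + 1)) Phi.
  apply: cont_onB; last exact: ct.
  apply: cont_onB; last by apply: cont_onM => //; exact: cont_on_cst.
  by apply: cont_onB => //; exact: cont_on_pairs1.
pose pt x t : W := row_mx (strow x t) (strow x t).
have Kpt x t : D x -> 0 <= t <= t0 + 1 -> pairs D (t0 + 1) (pt x t).
  by move=> Dx tt; rewrite /pairs /= x1_row x2_row t1_row t2_row !spart_strow !tpart_strow.
have xpt x t : x1 (pt x t) = x by rewrite x1_row spart_strow.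
have tpt x t : t1 (pt x t) = t by rewrite t1_row tpart_strow.
have Kz0 : pairs D (t0 + 1) (pt x0 t0) by apply: Kpt => //; apply/andP; split=> //; lra.
have [z Kz zmax] := cont_on_max (ex_intro _ _ Kz0) cK cPhi.
have [Dx _ /andP[tz tzT] _] := Kz.
set x := x1 z in Dx *; set t := t1 z in tz tzT *.
have hgx y : D y -> 0 <= ka * g y <= th / 2.
  move=> Dy; have := gg_half gg Dy => h12; have := gg_le gg Dy => h13.
  have g0 : 0 <= g y by lra.
  apply/andP; split; first exact: mulr_ge0 (ltW ka0) g0.
  by apply: le_trans kaC; rewrite ler_pM2l.
have P0 r : 0 <= Bc * Num.max r 0 ^+ 3 by rewrite mulr_ge0 ?(ltW B0)// exprn_ge0// le_max lexx orbT.
have Phi0 : th / 2 <= Phi z.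
  apply: le_trans (zmax _ Kz0); rewrite /Phi xpt tpt /pen subrr maxxx expr0n/= mulr0 addr0.
  have /andP[_ hg] := hgx _ Dx0.
  by rewrite /th in th0 hg *; move: (ka * _) (M * _) (u _) (h _) hg => *; lra.
have Q10 : 0 < M by rewrite /M ltr_wpDl.
have PhiE : Phi z = u (x, t) - h x - ka * g x - (M * t + Bc * Num.max (t - t0) 0 ^+ 3) by [].
have [hg0 _] := andP (hgx _ Dx).
have Mt0 : 0 <= M * t by rewrite mulr_ge0// ltW.
have tlt : t < t0 + 1.
  rewrite ltNge; apply/negP => tge.
  have e1 : t - t0 = 1 by lra.
  have hk : u (x, t) - h x <= Kd by exact: le_trans (ler_norm _) (hKd z Kz).
  move: Phi0; rewrite PhiE e1 max_l// expr1n mulr1 {1}/Bc.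
  by move: (ka * _) (M * _) hg0 Mt0 (u _) (h _) hk => *; lra.
have tp : 0 < t.
  rewrite lt_neqAle tz andbT; apply/eqP => e0t.
  have := init _ Dx; have := P0 (t - t0); move: Phi0; rewrite PhiE -e0t.
  by rewrite mulr0 add0r; move: (ka * _) hg0 (u _) (h _) (Bc * _) => *; lra.
have [d1 d10 hd1] := pos3_le (t - t0).
have half0 : (0 : R) < 2^-1 by rewrite invr_gt0.
have [d2 d20 hd2] := gg_jet gg Dx half0.
pose m := Num.max (t - t0) 0.
(* The Hessian of [g] is bounded by C1, and 1 = 2 * 2^-1 absorbs its Peano remainder. *)
pose a := ka * (C1 + 1); have a0 : 0 <= a by rewrite mulr_ge0 ?(ltW ka0)//; lra.
have tau_le : M <= M + Bc * (3 * m ^+ 2).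
  by rewrite lerDl mulr_ge0 ?(ltW B0)// mulr_ge0// sqr_ge0.
have touch : exists2 de : R, 0 < de & forall y s, D y -> 0 <= s -> `|y - x| < de -> `|s - t| < de ->
     u (y, s) <= u (x, t) + (h y - h x) + dot (ka *: Dg x) (y - x) + 2^-1 * qf a%:M (y - x)
       + (M + Bc * (3 * m ^+ 2)) * (s - t) + (Bc * (3 * m + 1)) * (s - t) ^+ 2.
  exists (Num.min d1 (Num.min d2 (t0 + 1 - t))); first by rewrite !lt_min d10 d20 subr_gt0.
  move=> y s Dy s0; rewrite !lt_min => /and3P[_ y2 _] /and3P[s1 _ s3].
  have sT : s <= t0 + 1 by move: s3; rewrite ltr_norml => /andP[]; lra.
  have Kp : pairs D (t0 + 1) (pt y s) by apply: Kpt => //; apply/andP.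
  have := zmax _ Kp; rewrite PhiE /Phi xpt tpt.
  have := hd2 _ y2; rewrite [x + (y - x)]subrKC ler_norml => /andP[_ g1].
  have := gg_H gg (y - x) Dx; rewrite ler_norml => /andP[_ g2].
  have g3 : ka * (g y - g x) <= dot (ka *: Dg x) (y - x) + 2^-1 * qf a%:M (y - x).
    rewrite dotZl qf_scalar /a.
    have -> : ka * dot (Dg x) (y - x) + 2^-1 * (ka * (C1 + 1) * dot (y - x) (y - x)) =
      ka * (dot (Dg x) (y - x) + 2^-1 * ((C1 + 1) * dot (y - x) (y - x))) by ring.
    rewrite ler_pM2l//; move: g1 g2; clear -gg cc Cc0 hC cu su oO => *; lra.
  have := hd1 _ s1; have -> : t - t0 + (s - t) = s - t0 by ring.
  rewrite -/m => g4; have {}g4 := ler_wpM2l (ltW B0) g4.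
  move: g3 g4; rewrite /pen mulrBr -/m; clear -gg cc Cc0 hC cu su oO; clearbody m ka a M Bc x t.
  move: (Num.max _ 0 ^+ 3) (dot _ _) (2^-1 * qf _ _) => *; lra.
have key := raw_touch oO cD cu su hh Dx tp (tr_scalar_mx _ _) touch (erefl _) (erefl _).
have hB : B x -> 0 < dot (\row_i h1 (delta_mx 0 i) x + ka *: Dg x) (nu x).
  move=> Bx; rewrite dotDl hneu// add0r dotZl mulr_gt0//.
  by apply: lt_le_trans (gg_dnu gg Bx); have := gg_C0 gg; lra.
have {}key := key hB.
have {key} := le_trans key (F_upper_bound _ _ _ Cc0 hC); rewrite lee_fin => /(le_trans tau_le).
apply/negP; rewrite -ltNge /M ltr_pwDr// /Q ler_wpM2l ?addr_ge0//.
apply: lerD.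
  apply: le_trans (entry_sumD _ _) _; apply: lerD.
    apply: ler_sum => i _; apply: ler_sum => j _; rewrite mxE.
    exact: (hK2 (i, j)).2.
  apply: (@le_trans _ _ (\sum_(i < n) \sum_(j < n) (C1 + 1))).
    apply: ler_sum => i _; apply: ler_sum => j _; rewrite mxE.
    have aC : a <= C1 + 1 by rewrite ler_piMl//; lra.
    by case: (i == j); rewrite ?mulr1n ?mulr0n ?normr0 ?ger0_norm//; lra.
  by rewrite !sumr_const !card_ord -mulrnA -natrM mulr_natl.
apply: le_trans (enormD _ _) _; apply: lerD.
  apply: le_trans (enorm_le_norm _) _; rewrite ler_wpM2l ?addr_ge0//.
  apply: norm_leP => // i; rewrite mxE; apply: le_trans ((hK1 i).2 _ Dx) _.
  by rewrite /S1 (bigD1 i)//= lerDl sumr_ge0// => j _; exact: ltW (hK1 j).1.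
rewrite enormZ gtr0_norm//; apply: le_trans (gg_D gg Dx).
by rewrite ler_piMl ?enorm_ge0.
Qed.

End barrier.

(** * Geometry of the domain *)

Section mean_value.
Variables (R : realType) (V : normedModType R).
Implicit Types (x v d : V).

Lemma is_derive_line (f : V -> R) x v (s l : R) : is_derive (x + s *: v) v f l ->
  is_derive s (1 : R) (fun s => f (x + s *: v)) l.
Proof.
move=> [df dl]; have E : (fun h : R => h^-1 *: (((fun s => f (x + s *: v)) \o shift s) (h *: 1) -
    f (x + s *: v))) = (fun h => h^-1 *: ((f \o shift (x + s *: v)) (h *: v) - f (x + s *: v))).
  apply/funext => h /=; congr (_ *: (f _ - _)).
  have -> : h *: (1 : R) = h by rewrite /GRing.scale/= mulr1.
  by rewrite scalerDl addrCA.
by apply: DeriveDef; rewrite /derivable /derive E.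
Qed.

Lemma is_derive_scale (f : V -> R) x v (a l : R) : is_derive x v f l ->
  is_derive x (a *: v) f (a * l).
Proof.
move=> df; have h0 : is_derive (0 : R) (1 : R) (fun s => f (x + s *: v)) l.
  by apply: is_derive_line; rewrite scale0r addr0.
have [d1 d2] := is_derive_dir a h0.
have E : (fun h : R => h^-1 *: (((fun s => f (x + s *: v)) \o shift 0) (h *: a) - f (x + 0 *: v))) =
    (fun h => h^-1 *: ((f \o shift x) (h *: (a *: v)) - f x)).
  apply/funext => h /=; rewrite scale0r !addr0 scalerA; congr (_ *: (f _ - _)).
  by rewrite addrC.
by apply: DeriveDef; rewrite /derivable /derive -E.
Qed.

Lemma segment_mvt (f : V -> R) x d (F : R -> R) :
  (forall s, 0 <= s <= 1 -> is_derive (x + s *: d) d f (F s)) ->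
  exists2 s, 0 <= s <= 1 & f (x + d) - f x = F s.
Proof.
move=> h; have dg (s : R) : 0 <= s <= 1 -> is_derive s (1 : R) (fun s => f (x + s *: d)) (F s).
  by move=> /h; exact: is_derive_line.
have [||s] := @MVT_segment R (fun s : R => f (x + s *: d)) F 0 1 ler01.
- by move=> s; rewrite in_itv/= => /andP[s0 s1]; apply: dg; rewrite !ltW.
- apply: derivable_within_continuous => s; rewrite in_itv/= => s01.
  by have [] := dg s s01.
- rewrite in_itv/= => s01; rewrite scale1r scale0r addr0 subr0 mulr1 => E.
  by exists s.
Qed.

End mean_value.

Section continuously_differentiable.
Variables (R : realType) (n : nat).
Local Notation V := 'rV[R]_n.
Variables (A : set V) (f : V -> R) (f1 : V -> V -> R).
Hypothesis oA : open A.
Hypothesis df : forall v x, A x -> is_derive x v f (f1 v x).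
Hypothesis cf : forall v, cont_on A (f1 v).

Definition grad1 (x : V) : V := \row_i f1 (delta_mx 0 i) x.

(** The successive values of k give the corners of an axis-parallel path from 0 to d. *)
Definition head (k : nat) (d : V) : V := \row_i (if (i < k)%N then d 0 i else 0).

Lemma headS (k : 'I_n) d : head k.+1 d = head k d + d 0 k *: delta_mx 0 k.
Proof.
apply/rowP => i; rewrite !mxE eqxx/= ltnS leq_eqVlt.
have [->|ik] := eqVneq i k; first by rewrite eqxx ltnn mulr1 add0r.
have -> : (i == k :> nat) = false by apply/negbTE.
by rewrite /= mulr0 addr0.
Qed.

Lemma ball_in x : A x -> exists2 r : R, 0 < r & forall y, `|y - x| < r -> A y.
Proof.
move=> Ax; have /nbhs_normP[r /= r0 h] := open_nbhs_nbhs (conj oA Ax).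
by exists r => // y yx; apply: h => /=; rewrite distrC.
Qed.

Lemma uniform_family (I : finType) (F : I -> V -> R) x : (forall i, cont_on A (F i)) -> A x ->
  forall e, 0 < e -> exists2 de : R, 0 < de &
  forall y, `|y - x| < de -> A y /\ forall i, `|F i y - F i x| < e.
Proof.
move=> cF Ax e e0; have [r r0 hr] := ball_in Ax.
have /choice[d hd] i : exists de, 0 < de /\ forall y, A y -> `|y - x| < de -> `|F i y - F i x| < e.
  by have [de de0 h] := cF i x Ax e e0; exists de.
exists (\big[Num.min/r]_i d i).
  by apply: lt_bigmin => // i _; exact: (hd i).1.
move=> y /bigmin_gtP[yr yd]; split; first exact: hr.
by move=> i; apply: (hd i).2; [exact: hr|exact: yd].
Qed.

(** Continuous partial derivatives give total differentiability: the mean value theorem is applied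
    on each axis-parallel piece of the path from x to x + d. *)
Lemma grad1_jet x : A x -> forall e, 0 < e -> exists2 de : R, 0 < de &
  forall d, `|d| < de -> `|f (x + d) - f x - dot (grad1 x) d| <= e * `|d|.
Proof.
move=> Ax e e0; have n1 : (0 : R) < n%:R + 1 by rewrite ltr_wpDl.
have [de de0 hde] := uniform_family (fun i => cf (delta_mx 0 i)) Ax (divr_gt0 e0 n1).
exists de => // d dd.
have step (k : 'I_n) : `|f (x + head k.+1 d) - f (x + head k d) - grad1 x 0 k * d 0 k| <= e / (n%:R + 1) * `|d|.
  have hb s : 0 <= s <= 1 -> `|x + head k d + s *: (d 0 k *: delta_mx 0 k) - x| < de.
    move=> /andP[s0 s1]; rewrite addrAC [x + _ - x]addrAC subrr add0r; apply: le_lt_trans dd.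
    apply: norm_leP => // i; rewrite !mxE eqxx/=.
    have [->|ik] := eqVneq i k; last first.
      rewrite !mulr0 addr0; case: ifP => _; rewrite ?normr0//; exact: coord_norm.
    rewrite ltnn mulr1 add0r normrM ger0_norm//.
    by apply: le_trans (coord_norm d k); rewrite ler_piMl.
  have [|s s01] := @segment_mvt _ _ f (x + head k d) (d 0 k *: delta_mx 0 k)
     (fun s => d 0 k * f1 (delta_mx 0 k) (x + head k d + s *: (d 0 k *: delta_mx 0 k))).
    by move=> s s01; apply: is_derive_scale; apply: df; exact: (hde _ (hb s s01)).1.
  rewrite headS addrA => ->.
  rewrite mxE [f1 _ x * _]mulrC -mulrBr normrM mulrC; apply: ler_pM => //.
    by apply: ltW; exact: (hde _ (hb s s01)).2.
  exact: coord_norm.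
have tele : f (x + d) - f x - dot (grad1 x) d =
    \sum_(k < n) (f (x + head k.+1 d) - f (x + head k d) - grad1 x 0 k * d 0 k).
  rewrite big_split sumrN /dot; congr (_ - _).
  have -> : x + d = x + head n d by congr (_ + _); apply/rowP => i; rewrite mxE ltn_ord.
  have -> : f x = f (x + head 0 d).
    by congr f; rewrite (_ : head 0 d = 0) ?addr0//; apply/rowP => i; rewrite !mxE.
  by rewrite -(big_mkord xpredT (fun k => f (x + head k.+1 d) - f (x + head k d))) telescope_sumr.
rewrite tele; apply: le_trans (ler_norm_sum _ _ _) _.
apply: (@le_trans _ _ (\sum_(k < n) e / (n%:R + 1) * `|d|)); first exact: ler_sum.
rewrite sumr_const card_ord -[leLHS]mulr_natl mulrA ler_wpM2r//.
by rewrite mulrCA ger_pMr// ler_pdivrMr// mul1r lerDl.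
Qed.

Lemma is_derive_lin (g : V -> R) x v (p : V) :
  (forall e, 0 < e -> exists2 de : R, 0 < de &
    forall d, `|d| < de -> `|g (x + d) - g x - dot p d| <= e * `|d|) ->
  is_derive x v g (dot p v).
Proof.
move=> h.
have lim : (fun k : R => k^-1 *: ((g \o shift x) (k *: v) - g x)) @ 0^' --> (dot p v : R^o).
  apply/cvgrPdist_lt => e e0; rewrite near_withinE.
  have v1 : 0 < `|v| + 1 by rewrite ltr_wpDl.
  have [de de0 hde] := h (e / (`|v| + 1)) (divr_gt0 e0 v1).
  exists (de / (`|v| + 1)) => /=; first by rewrite divr_gt0.
  move=> k; rewrite /= sub0r normrN => k1 k0.
  have kv : `|k *: v| < de.
    rewrite normrZ; apply: (@le_lt_trans _ _ (`|k| * (`|v| + 1))); last by rewrite -ltr_pdivlMr.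
    by rewrite ler_wpM2l// lerDl.
  have {}hde := hde _ kv.
  have -> : dot p v - k^-1 *: (g (k *: v + x) - g x) = - (k^-1 * (g (x + k *: v) - g x - dot p (k *: v))).
    rewrite [k *: v + x]addrC dotZr /GRing.scale/=; field.
    exact: k0.
  rewrite normrN normrM normfV ltr_pdivrMl ?normr_gt0//.
  apply: le_lt_trans hde _; rewrite normrZ mulrCA ltr_pM2l ?normr_gt0//.
  by rewrite mulrAC ltr_pdivrMr// ltr_pM2l// ltrDl.
apply: DeriveDef; first by apply/cvg_ex; exists (dot p v).
exact: cvg_lim.
Qed.

Lemma f1_linear v x : A x -> f1 v x = dot (grad1 x) v.
Proof.
move=> Ax; have [_ <-] := df v Ax; have [_ <-//] := is_derive_lin v (grad1_jet Ax).
Qed.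

End continuously_differentiable.

Section twice_differentiable.
Variables (R : realType) (n : nat).
Local Notation V := 'rV[R]_n.
Variables (A : set V) (f : V -> R) (f1 : V -> V -> R) (f2 : V -> V -> V -> R).
Hypothesis oA : open A.
Hypothesis df : forall v x, A x -> is_derive x v f (f1 v x).
Hypothesis df1 : forall v w x, A x -> is_derive x w (f1 v) (f2 v w x).
Hypothesis cf1 : forall v, cont_on A (f1 v).
Hypothesis cf2 : forall v w, cont_on A (f2 v w).

(** Symmetrized, because tests by quadratic polynomials use symmetric matrices; the associated
    quadratic form is unaffected. *)
Definition hess1 (x : V) : 'M[R]_n :=
  \matrix_(i, j) (2^-1 * (f2 (delta_mx 0 i) (delta_mx 0 j) x + f2 (delta_mx 0 j) (delta_mx 0 i) x)).

Lemma hess1_sym x : (hess1 x)^T = hess1 x.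
Proof. by apply/matrixP => i j; rewrite !mxE addrC. Qed.

Lemma f2_bilinear v w x : A x ->
  f2 v w x = \sum_i v 0 i * \sum_j w 0 j * f2 (delta_mx 0 i) (delta_mx 0 j) x.
Proof.
move=> Ax; have h i : f2 (delta_mx 0 i) w x = \sum_j w 0 j * f2 (delta_mx 0 i) (delta_mx 0 j) x.
  rewrite (f1_linear oA (df1 (delta_mx 0 i)) (cf2 (delta_mx 0 i)))// /dot.
  by apply: eq_bigr => j _; rewrite mxE mulrC.
under eq_bigr do rewrite -h.
have d1 : is_derive x w (\sum_i (v 0 i \*: (f1 (delta_mx 0 i) : V -> R))) (\sum_i v 0 i * f2 (delta_mx 0 i) w x).
  by apply: is_derive_sum => i; apply: is_deriveZ; exact: df1.
have [_ <-] := df1 v w Ax; have [_ <-] := d1; apply: near_eq_derive.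
have [r r0 hr] := ball_in oA Ax.
apply/nbhs_normP; exists r => // y /=; rewrite distrC => /hr Ay.
rewrite (f1_linear oA df cf1)// fct_sumE /dot; apply: eq_bigr => i _.
by rewrite mxE mulrC.
Qed.

Lemma qf_hess1 d x : A x -> qf (hess1 x) d = f2 d d x.
Proof.
move=> Ax; rewrite f2_bilinear// /qf /dot.
have -> : \sum_i d 0 i * (\sum_j d 0 j * f2 (delta_mx 0 i) (delta_mx 0 j) x) =
    \sum_i \sum_j 2^-1 * (d 0 i * d 0 j * (f2 (delta_mx 0 i) (delta_mx 0 j) x + f2 (delta_mx 0 j) (delta_mx 0 i) x)).
  have E : \sum_i \sum_j d 0 i * d 0 j * f2 (delta_mx 0 j) (delta_mx 0 i) x =
      \sum_i \sum_j d 0 i * d 0 j * f2 (delta_mx 0 i) (delta_mx 0 j) x.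
    by rewrite exchange_big; apply: eq_bigr => i _; apply: eq_bigr => j _; rewrite [d 0 j * _]mulrC.
  transitivity (2^-1 * (\sum_i \sum_j d 0 i * d 0 j * f2 (delta_mx 0 i) (delta_mx 0 j) x +
     \sum_i \sum_j d 0 i * d 0 j * f2 (delta_mx 0 j) (delta_mx 0 i) x)).
    have hS (S : R) : 2^-1 * (S + S) = S by field.
    rewrite E hS.
    by apply: eq_bigr => i _; rewrite mulr_sumr; apply: eq_bigr => j _; rewrite mulrA.
  rewrite -big_split mulr_sumr; apply: eq_bigr => i _.
  by rewrite -big_split mulr_sumr; apply: eq_bigr => j _; rewrite /= -mulrDr.
rewrite exchange_big; apply: eq_bigr => i _ /=.
rewrite !mxE mulr_suml; apply: eq_bigr => j _; rewrite !mxE.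
by ring.
Qed.

Lemma first_order_mvt x d : (forall s, 0 <= s <= 1 -> A (x + s *: d)) ->
  exists2 s, 0 <= s <= 1 & f (x + d) - f x = f1 d (x + s *: d).
Proof. by move=> h; apply: segment_mvt => s /h; exact: df. Qed.

Lemma gradient_mvt x d s : (forall s, 0 <= s <= 1 -> A (x + s *: d)) -> 0 <= s <= 1 ->
  exists2 r, 0 <= r <= 1 & f1 d (x + s *: d) - f1 d x = s * qf (hess1 (x + r *: d)) d.
Proof.
move=> h /andP[s0 s1].
have hs r : 0 <= r <= 1 -> 0 <= r * s <= 1 by move=> /andP[r0 r1]; rewrite mulr_ge0//= mulr_ile1.
have [|r r01 ->] := @segment_mvt _ _ (f1 d) x (s *: d) (fun r => s * f2 d d (x + r *: (s *: d))).
  move=> r r01; apply: is_derive_scale; apply: df1.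
  by rewrite scalerA; apply/h/hs.
exists (r * s); first exact: hs.
by rewrite qf_hess1 ?scalerA//; apply/h/hs.
Qed.

Lemma C2_jet x : A x -> jet2 f x (grad1 f1 x) (hess1 x).
Proof.
move=> Ax e e0.
pose F (ij : 'I_n * 'I_n) y := hess1 y ij.1 ij.2.
have cF ij : cont_on A (F ij).
  have -> : F ij = fun y => 2^-1 * (f2 (delta_mx 0 ij.1) (delta_mx 0 ij.2) y + f2 (delta_mx 0 ij.2) (delta_mx 0 ij.1) y).
    by apply/funext => y; rewrite /F mxE.
  by apply: cont_onM; [exact: cont_on_cst|apply: cont_onD; exact: cf2].
have N0 : (0 : R) < n%:R * n%:R + 1 by rewrite ltr_wpDl// mulr_ge0.
have [de de0 hde] := uniform_family oA cF Ax (divr_gt0 e0 N0).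
exists de => // d dd.
have hA s : 0 <= s <= 1 -> `|x + s *: d - x| < de.
  move=> /andP[s0 s1]; rewrite addrAC subrr add0r normrZ ger0_norm//.
  by apply: le_lt_trans dd; rewrite ler_piMl.
have hA' s : 0 <= s <= 1 -> A (x + s *: d) by move=> /hA/hde[].
pose X := hess1 x; pose p := grad1 f1 x.
have Xs : X^T = X := hess1_sym x.
have dq := c2_der1 (c2bar_quartic setT p 0 x Xs) d.
(* Mean value theorem for f minus its Taylor polynomial of order two ([quartic] with zero quartic
   term), then once more for the derivative along d. *)
have [|s s01] := @segment_mvt _ _ (fun y => f y - quartic p X 0 x y) x d
  (fun s => f1 d (x + s *: d) - (dot p d + (dot (d *m X) (x + s *: d - x) + 4 * 0 *
    (dot (x + s *: d - x) (x + s *: d - x) * dot d (x + s *: d - x))))).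
  move=> s s01; apply: is_deriveB; first by apply: df; exact: hA'.
  exact: dq.
rewrite /quartic subrr !dot0r qf0r !(mulr0, mul0r, addr0, subr0).
have -> : x + d - x = d by rewrite addrAC subrr add0r.
have -> : x + s *: d - x = s *: d by rewrite addrAC subrr add0r.
have [r r01 hr] := gradient_mvt hA' s01.
have pd : dot p d = f1 d x by rewrite /p -(f1_linear oA df cf1).
rewrite pd dotZr -/(qf X d) => E.
have -> : f (x + d) - f x - f1 d x - 2^-1 * qf X d = s * qf (hess1 (x + r *: d) - X) d.
  rewrite qfD qfN mulrDr -hr; move: E; move: (f _) (f x) (f1 d _) (f1 d x) => a b c' d'.
  by move=> E; lra.
have /andP[s0 s1] := s01.
rewrite normrM ger0_norm//; apply: (@le_trans _ _ `|qf (hess1 (x + r *: d) - X) d|).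
  by rewrite ler_piMl.
apply: le_trans (qf_entry_sum _ _) _; rewrite ler_wpM2r ?dot_ge0//.
apply: (@le_trans _ _ (\sum_(i < n) \sum_(j < n) e / (n%:R * n%:R + 1))).
  apply: ler_sum => i _; apply: ler_sum => j _; rewrite mxE [X in _ + X]mxE ltW//.
  exact: ((hde _ (hA _ r01)).2 (i, j)).
rewrite !sumr_const !card_ord -mulrnA -[leLHS]mulr_natl natrM mulrCA.
by rewrite ger_pMr// ler_pdivrMr// mul1r lerDl.
Qed.

Lemma C11_bound x d K : (forall s, 0 <= s <= 1 -> A (x + s *: d)) ->
  (forall s, 0 <= s <= 1 -> entry_sum (hess1 (x + s *: d)) <= K) ->
  `|f (x + d) - f x - dot (grad1 f1 x) d| <= K * dot d d.
Proof.
move=> hA hK; have [s s01 ->] := first_order_mvt hA.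
have Ax : A x by have := hA 0; rewrite scale0r addr0 lexx ler01; exact.
rewrite -(f1_linear oA df cf1)//; have [r r01 ->] := gradient_mvt hA s01.
have /andP[s0 s1] := s01.
rewrite normrM ger0_norm//; apply: (@le_trans _ _ `|qf (hess1 (x + r *: d)) d|).
  by rewrite ler_piMl.
by apply: le_trans (qf_entry_sum _ _) _; rewrite ler_wpM2r ?dot_ge0// hK.
Qed.

End twice_differentiable.

(** * Boundary charts and the normal *)

Section charts.
Variables (R : realType) (n : nat).
Local Notation V := 'rV[R]_n.
Variable Omega : set V.
Hypothesis oO : open Omega.

Record c1bar (A : set V) (f : V -> R) (f1 : V -> V -> R) : Prop := {
  c1_cont : cont_on (closure A) f;
  c1_cont1 : forall v, cont_on (closure A) (f1 v);
  c1_der1 : forall v x, A x -> is_derive x v f (f1 v x)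
}.

Lemma Cbar_c1bar A f : open A -> Cbar 1 A f -> exists f1, c1bar A f f1.
Proof.
move=> oA [/cont_onP cf [_ h]].
have /choice[f1 hf1] v : exists h, cont_on (closure A) h /\ forall x, A x -> h x = 'D_v f x.
  by have [_ [[k [/cont_onP ck hk]] _]] := h v; exists k.
exists f1; split=> //; first by move=> v; have [] := hf1 v.
by move=> v x Ax; have [_ ->//] := hf1 v; have [dv _] := h v; apply: DeriveDef => //; exact: dv.
Qed.

Lemma c2bar_c1bar A (f : V -> R) f1 f2 : c2bar A f f1 f2 -> c1bar A f f1.
Proof. by move=> h; split; [exact: c2_cont h|exact: c2_cont1 h|exact: c2_der1 h]. Qed.

Lemma c1bar_jet f f1 x : c1bar setT f f1 -> forall e, 0 < e -> exists2 de : R, 0 < de &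
  forall d, `|d| < de -> `|f (x + d) - f x - dot (grad1 f1 x) d| <= e * `|d|.
Proof.
move=> h; have := c1_cont1 h; rewrite closureT => cf1.
exact: (grad1_jet (A := setT) openT (c1_der1 h) cf1).
Qed.

Lemma c1bar_grad f f1 x : c1bar setT f f1 -> grad f x = grad1 f1 x.
Proof.
by move=> h; apply/rowP => i; rewrite !mxE; have [_ ->] := c1_der1 h (delta_mx 0 i) (x := x) I.
Qed.

Lemma chart_closure x0 e r gamma y : below_graph Omega x0 e r gamma -> cont_on setT gamma ->
  closure Omega y -> enorm (y - x0) < r -> dot y e <= gamma y.
Proof.
move=> [e1 r0 _ hg] cg /closure_normP cly yr; rewrite leNgt; apply/negP => lt.
pose a := dot y e - gamma y; have a0 : 0 < a by rewrite subr_gt0.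
have a2 : 0 < a / 2 by rewrite divr_gt0.
have [de de0 hde] := cg y I _ a2.
have n1 : (0 : R) < n%:R + 1 by rewrite ltr_wpDl.
have b0 : 0 < (r - enorm (y - x0)) by rewrite subr_gt0.
have m0 : 0 < Num.min de (Num.min ((r - enorm (y - x0)) / (n%:R + 1)) (a / 2 / (n%:R + 1))).
  by rewrite !lt_min de0 !divr_gt0.
have [y' Oy'] := cly _ m0; rewrite !lt_min => /and3P[y1 y2 y3].
have E : enorm (y' - y) < r - enorm (y - x0).
  by apply: le_lt_trans (enorm_le_norm _) _; rewrite mulrC -ltr_pdivlMr.
have y'r : enorm (y' - x0) < r.
  have := enormD (y' - y) (y - x0); rewrite addrA subrK; lra.
have /hg[h _] := y'r; have {}h := h Oy'.
have := hde y' I y1; rewrite ltr_norml => /andP[_ g1].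
have E2 : enorm (y' - y) < a / 2.
  by apply: le_lt_trans (enorm_le_norm _) _; rewrite mulrC -ltr_pdivlMr.
have := dot_enorm (y - y') e; rewrite e1 mulr1 enormBC => /(le_trans (ler_norm _)).
rewrite dotBl; rewrite /a in E2 g1; lra.
Qed.

Lemma chart_boundary x0 e r gamma x : below_graph Omega x0 e r gamma -> cont_on setT gamma ->
  boundary Omega x -> enorm (x - x0) < r -> dot x e = gamma x.
Proof.
move=> bg cg [clx nix] xr; apply/eqP; rewrite eq_le (chart_closure bg cg clx xr) /=.
have [_ _ _ hg] := bg; rewrite leNgt; apply/negP => /(hg _ xr).2 Ox.
by apply: nix; rewrite (interior_id Omega).1.
Qed.

Lemma chart_recentre x0 e r gamma x : below_graph Omega x0 e r gamma -> enorm (x - x0) < r ->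
  below_graph Omega x e (r - enorm (x - x0)) gamma.
Proof.
move=> [e1 r0 inv hg] xr; split=> //; first by rewrite subr_gt0.
move=> y yx; apply: hg; have := enormD (y - x) (x - x0); rewrite addrA subrK; lra.
Qed.

Lemma grad_orth x0 e r gamma f1 x : below_graph Omega x0 e r gamma -> c1bar setT gamma f1 ->
  dot (grad1 f1 x) e = 0.
Proof.
move=> [_ _ inv _] h; have := c1_cont1 h; rewrite closureT => cf1.
rewrite -(f1_linear openT (c1_der1 h) cf1)//.
have d0 : is_derive (0 : R) (1 : R) (fun s => gamma (x + s *: e)) (f1 e x).
  by apply: is_derive_line; rewrite scale0r addr0; exact: (c1_der1 h).
have E : (fun s => gamma (x + s *: e)) = cst (gamma x) by apply/funext => s; rewrite inv.
by move: d0; rewrite E => -[_ <-]; rewrite derive_cst.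
Qed.

(** Its component along the unit vector [e] is 1, as the gradient of [gamma] is orthogonal to
    [e]. *)
Lemma conormal_ge1 x0 e r gamma f1 x : below_graph Omega x0 e r gamma -> c1bar setT gamma f1 ->
  1 <= enorm (e - grad1 f1 x).
Proof.
move=> bg h; have := grad_orth x bg h; have [e1 _ _ _] := bg => go.
have := dot_enorm (e - grad1 f1 x) e; rewrite e1 mulr1 => /(le_trans (ler_norm _)).
by rewrite dotBl go subr0 -enorm_sq e1 expr1n.
Qed.

(** The first order expansion of [gamma] decides on which side of the graph a short segment from [x]
    lies. This is intrinsic to Omega and allows different charts to be compared. *)
Lemma chart_side e r gamma f1 x d : below_graph Omega x e r gamma -> c1bar setT gamma f1 ->
  dot x e = gamma x -> dot (e - grad1 f1 x) d != 0 ->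
  exists2 s0, 0 < s0 & forall s, 0 < s < s0 ->
    (Omega (x + s *: d) <-> dot (e - grad1 f1 x) d < 0).
Proof.
move=> [e1 r0 _ hg] h hx; set k := dot _ d => k0.
have d1 : 0 < `|d| + 1 by rewrite ltr_wpDl.
have n1 : (0 : R) < n%:R + 1 by rewrite ltr_wpDl.
have k2 : 0 < `|k| / 2 / (`|d| + 1) by rewrite !divr_gt0// normr_gt0.
have [de de0 hde] := c1bar_jet x h k2.
exists (Num.min (de / (`|d| + 1)) (r / ((n%:R + 1) * (`|d| + 1)))).
  by rewrite lt_min !divr_gt0 ?mulr_gt0.
move=> s; rewrite lt_min => /andP[s0 /andP[]]; rewrite ltr_pdivlMr// ltr_pdivlMr ?mulr_gt0// => s1 s2.
have sd : `|s *: d| <= s * (`|d| + 1) by rewrite normrZ gtr0_norm// ler_pM2l// lerDl.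
have hy : enorm (x + s *: d - x) < r.
  rewrite addrAC subrr add0r; apply: le_lt_trans (enorm_le_norm _) _; apply: le_lt_trans s2.
  by rewrite mulrCA ler_pM2l.
have {}hg := hg _ hy.
have := hde (s *: d) (le_lt_trans sd s1); rewrite dotZr => E.
have {}E : `|gamma (x + s *: d) - gamma x - s * dot (grad1 f1 x) d| <= s * (`|k| / 2).
  apply: le_trans E _; apply: le_trans (ler_wpM2l (ltW k2) sd) _.
  by rewrite mulrCA divfK// gt_eqF.
have kE : s * k = s * dot e d - s * dot (grad1 f1 x) d by rewrite -mulrBr -dotBl.
have ye : dot (x + s *: d) e = gamma x + s * dot e d by rewrite dotDl hx dotZl [dot d e]dotC.
move: hg E; rewrite ye ler_norml => hg /andP[g1 g2].
have [kn|kp] := ltP k 0.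
  have sk : s * k < 0 by rewrite nmulr_llt0.
  rewrite (ltr0_norm kn) mulrA mulrN in g1 g2.
  split=> // _; apply/hg; lra.
have kp' : 0 < k by rewrite lt_neqAle eq_sym k0.
have sk : 0 < s * k by rewrite mulr_gt0.
rewrite (gtr0_norm kp') mulrA in g1 g2.
by split=> // /hg; lra.
Qed.

Lemma uvec_dot_lt1 (p q : V) : enorm p = 1 -> enorm q = 1 -> p != q -> dot p q < 1.
Proof.
move=> p1 q1 pq; have : 0 < dot (p - q) (p - q) by rewrite dot_gt0// subr_eq0.
rewrite dotBl !dotBr -!enorm_sq p1 q1 [dot q p]dotC; lra.
Qed.

(* If two unit normals p and q were different, the points x + s (q - p), s > 0 small,
   would lie inside Omega for one chart and outside for the other. *)
Lemma chart_normal x0 e r gamma f1 x nu : below_graph Omega x0 e r gamma -> c1bar setT gamma f1 ->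
  boundary Omega x -> enorm (x - x0) < r -> outward_unit_normal Omega x nu ->
  nu = uvec (e - grad1 f1 x).
Proof.
move=> bg h Bx xr [e' [r' [gamma' [bg' C1g' ->]]]].
have [f1' h'] := Cbar_c1bar openT C1g'.
rewrite (c1bar_grad x h') -/(uvec _).
have bgx := chart_recentre bg xr.
have cg := c1_cont h; have cg' := c1_cont h'; rewrite closureT in cg cg'.
have e0 (v : V) : enorm (v - v) = 0 by rewrite subrr enorm0.
have [_ r'0 _ _] := bg'.
have N1 := conormal_ge1 x bg h; have N2 := conormal_ge1 x bg' h'.
set p := e - _ in N1 *; set q := e' - _ in N2 *.
have p0 : p != 0 by rewrite -enorm_eq0 gt_eqF//; lra.
have q0 : q != 0 by rewrite -enorm_eq0 gt_eqF//; lra.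
apply/eqP; apply/contraT => ne.
have l1 : dot (uvec q) (uvec p) < 1 by apply: uvec_dot_lt1; rewrite ?enorm_uvec.
pose d := uvec q - uvec p.
have pE : p = enorm p *: uvec p by rewrite /uvec scalerA divff ?scale1r// enorm_eq0.
have qE : q = enorm q *: uvec q by rewrite /uvec scalerA divff ?scale1r// enorm_eq0.
have dp : dot p d < 0.
  by rewrite pE dotZl /d dotBr dot_uvec// pmulr_rlt0 ?subr_lt0 1?dotC//; lra.
have dq : 0 < dot q d.
  by rewrite qE dotZl /d dotBr dot_uvec// pmulr_rgt0 ?subr_gt0//; lra.
have [s1 s10 hs1] := chart_side bgx h (chart_boundary bg cg Bx xr) (ltr0_neq0 dp).
have xr' : enorm (x - x) < r' by rewrite e0.
have [s2 s20 hs2] := chart_side bg' h' (chart_boundary bg' cg' Bx xr') (lt0r_neq0 dq).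
pose s := Num.min s1 s2 / 2.
have m0 : 0 < Num.min s1 s2 by rewrite lt_min s10.
have s0 : 0 < s by rewrite divr_gt0.
have sm : s < Num.min s1 s2 by rewrite ltr_pdivrMr//; lra.
have /hs1 h1 : 0 < s < s1 by rewrite s0 (lt_le_trans sm)// ge_min lexx.
have /hs2 h2 : 0 < s < s2 by rewrite s0 (lt_le_trans sm)// ge_min lexx orbT.
have := h2.1 (h1.2 dp); by rewrite ltNge (ltW dq).
Qed.

(** As y lies below the graph and x on it, the conormal component of y - x is at most the first
    order Taylor remainder of [gamma], which is quadratic. Normalizing divides by a length of at
    least 1. *)
Lemma exterior_local x0 e r gamma f1 f2 nu : below_graph Omega x0 e r gamma ->
  c2bar setT gamma f1 f2 -> (forall x, boundary Omega x -> outward_unit_normal Omega x (nu x)) ->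
  exists2 de : R, 0 < de & exists2 K, 0 <= K & forall x y, boundary Omega x -> closure Omega y ->
    `|x - x0| < de -> `|y - x0| < de -> dot (y - x) (nu x) <= K * dot (y - x) (y - x).
Proof.
move=> bg h hnu; have h1 := c2bar_c1bar h; have [e1 r0 _ _] := bg.
have cg := c1_cont h1; rewrite closureT in cg.
have n1 : (0 : R) < n%:R + 1 by rewrite ltr_wpDl.
have de0 : 0 < r / (n%:R + 1) by rewrite divr_gt0.
have [c1 c2] := (c2_cont1 h, c2_cont2 h); rewrite closureT in c1 c2.
have hr z : `|z - x0| < r / (n%:R + 1) -> enorm (z - x0) < r.
  by move=> zz; apply: le_lt_trans (enorm_le_norm _) _; rewrite mulrC -ltr_pdivlMr.
pose Bl := [set z : V | `|z - x0| <= r / (n%:R + 1)].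
have cB : compact Bl.
  apply: bounded_closed_compact.
    exists (`|x0| + r / (n%:R + 1)); split; first exact: num_real.
    move=> M MM z zB; apply: le_trans (ltW MM); rewrite -[z](subrK x0) addrC.
    by apply: le_trans (ler_normD _ _) _; rewrite lerD2l.
  apply/closed_normP => z hz; apply/ler_addgt0Pl => eps eps0.
  have [y yB yz] := hz _ eps0.
  have -> : z - x0 = (y - x0) + (z - y) by rewrite [RHS]addrC addrA subrK.
  by rewrite [leRHS]addrC; apply: le_trans (ler_normD _ _) _; apply: lerD => //; rewrite distrC ltW.
have cH (ij : 'I_n * 'I_n) : cont_on Bl (fun z => hess1 f2 z ij.1 ij.2).
  have -> : (fun z => hess1 f2 z ij.1 ij.2) = fun y => 2^-1 * (f2 (delta_mx 0 ij.1) (delta_mx 0 ij.2) y + f2 (delta_mx 0 ij.2) (delta_mx 0 ij.1) y).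
    by apply/funext => y; rewrite mxE.
  apply: (cont_on_sub (K' := setT)) => //.
  by apply: cont_onM; [exact: cont_on_cst|apply: cont_onD; exact: c2].
have /choice[K hK] ij : exists K, 0 < K /\ forall x, Bl x -> `|hess1 f2 x ij.1 ij.2| <= K.
  by have [K K0 hK] := cont_on_bounded cB (cH ij); exists K.
pose S := \sum_i \sum_j K (i, j).
have S0 : 0 <= S by apply: sumr_ge0 => i _; apply: sumr_ge0 => j _; exact: ltW (hK (i, j)).1.
exists (r / (n%:R + 1)) => //; exists S => // x y Bx cly xr yr.
have seg s : 0 <= s <= 1 -> Bl (x + s *: (y - x)).
  move=> /andP[s0 s1]; rewrite /Bl /=.
  have -> : x + s *: (y - x) - x0 = (1 - s) *: (x - x0) + s *: (y - x0).
    by apply/rowP => i; rewrite !mxE; ring.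
  apply: le_trans (ler_normD _ _) _; rewrite !normrZ (ger0_norm s0) ger0_norm ?subr_ge0//.
  have := ler_wpM2l s0 (ltW yr); have s1' : 0 <= 1 - s by lra.
  by have := ler_wpM2l s1' (ltW xr); lra.
have := @C11_bound _ _ setT gamma f1 f2 openT (c2_der1 h) (c2_der2 h) c1 c2 x (y - x) S
  (fun _ _ => I).
rewrite [x + (y - x)]subrKC => bd.
have {}bd := bd ltac:(move=> s /seg hs; apply: ler_sum => i _; apply: ler_sum => j _; exact: (hK (i, j)).2).
have gx := chart_boundary bg cg Bx (hr _ xr).
have gy := chart_closure bg cg cly (hr _ yr).
rewrite (chart_normal bg h1 Bx (hr _ xr) (hnu _ Bx)) /uvec dotZr.
have N1 := conormal_ge1 x bg h1.
have num : dot (y - x) (e - grad1 f1 x) <= S * dot (y - x) (y - x).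
  move: bd; rewrite ler_norml => /andP[_ bd].
  rewrite dotBr dotBl gx [dot (y - x) (grad1 f1 x)]dotC; lra.
have N0 : 0 < enorm (e - grad1 f1 x) by lra.
rewrite mulrC ler_pdivrMr//; apply: le_trans num _.
by rewrite ler_peMr// mulr_ge0// dot_ge0.
Qed.

End charts.

(** * Lipschitz continuity up to the boundary *)

Section lipschitz.
Variables (R : realType) (n : nat).
Local Notation V := 'rV[R]_n.
Variable Omega : set V.
Hypothesis oO : open Omega.
Local Notation D := (closure Omega).

Lemma segment_lip (A : set V) (f : V -> R) f1 K x d : (forall v x, A x -> is_derive x v f (f1 v x)) ->
  (forall v x, A x -> `|f1 v x| <= K * enorm v) -> (forall s, 0 <= s <= 1 -> A (x + s *: d)) ->
  `|f (x + d) - f x| <= K * enorm d.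
Proof.
move=> df hK hA; have [|s s01 ->] := @segment_mvt _ _ f x d (fun s => f1 d (x + s *: d)).
  by move=> s /hA; exact: df.
by apply: hK; exact: hA.
Qed.

Lemma ball_convex (x0 x y : V) r s : enorm (x - x0) < r -> enorm (y - x0) < r -> 0 <= s <= 1 ->
  enorm (x + s *: (y - x) - x0) < r.
Proof.
move=> xr yr /andP[s0 s1].
have -> : x + s *: (y - x) - x0 = (1 - s) *: (x - x0) + s *: (y - x0).
  by apply/rowP => i; rewrite !mxE; ring.
apply: le_lt_trans (enormD _ _) _; rewrite !enormZ (ger0_norm s0) ger0_norm ?subr_ge0//.
have [->|sp] := eqVneq s 0; first by rewrite mul0r addr0 subr0 mul1r.
have sp' : 0 < s by rewrite lt_neqAle eq_sym sp.
have h1 : s * enorm (y - x0) < s * r by rewrite ltr_pM2l.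
have s1' : 0 <= 1 - s by lra.
by have := ler_wpM2l s1' (ltW xr); lra.
Qed.

Lemma linear_bound (A : set V) (f : V -> R) f1 (K : 'I_n -> R) x v : open A ->
  (forall v x, A x -> is_derive x v f (f1 v x)) -> (forall v, cont_on A (f1 v)) -> A x ->
  (forall i, 0 <= K i) -> (forall i, `|f1 (delta_mx 0 i) x| <= K i) ->
  `|f1 v x| <= (n%:R + 1) * (\sum_i K i) * enorm v.
Proof.
move=> oA df cf Ax K0 hK; rewrite (f1_linear oA df cf)//; apply: le_trans (dot_enorm _ _) _.
rewrite ler_wpM2r ?enorm_ge0//; apply: le_trans (enorm_le_norm _) _.
rewrite ler_wpM2l ?addr_ge0//; apply: norm_leP => [|i]; first exact: sumr_ge0.
by rewrite mxE; apply: le_trans (hK i) _; rewrite (bigD1 i)//= lerDl sumr_ge0.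
Qed.

Lemma graph_lip (gamma : V -> R) g1 x0 : c1bar setT gamma g1 ->
  exists2 r : R, 0 < r & exists2 L, 0 <= L & forall x y, enorm (x - x0) < r -> enorm (y - x0) < r ->
    `|gamma y - gamma x| <= L * enorm (y - x).
Proof.
move=> h; have c1 := c1_cont1 h; rewrite closureT in c1.
have [r r0 hr] := uniform_family openT (fun i => c1 (delta_mx 0 i)) (I : setT x0) ltr01.
pose K i := `|g1 (delta_mx 0 i) x0| + 1.
have K0 i : 0 <= K i by rewrite addr_ge0.
exists r => //; exists ((n%:R + 1) * (\sum_i K i)).
  by rewrite mulr_ge0 ?addr_ge0// sumr_ge0.
move=> x y xr yr; have := @segment_lip [set z | enorm (z - x0) < r] gamma g1 ((n%:R + 1) * (\sum_i K i)) x (y - x).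
rewrite subrKC; apply.
- by move=> v z _; exact: (c1_der1 h).
- move=> v z zr; apply: (linear_bound v openT (c1_der1 h) c1 I K0) => i.
  have [_ /(_ i)] := hr z (le_lt_trans (norm_le_enorm _) zr) => /ltW hz.
  rewrite /K -lerBlDl; exact: le_trans (lerB_dist _ _) hz.
- by move=> s s01; exact: ball_convex.
Qed.

Variables (f : V -> R) (f1 : V -> V -> R).
Hypotheses (hf : c1bar Omega f f1) (cD : compact D).

Lemma c1bar_gradient_bound : exists2 K, 0 <= K & forall v x, Omega x -> `|f1 v x| <= K * enorm v.
Proof.
have /choice[K hK] (i : 'I_n) : exists K, 0 < K /\ forall x, D x -> `|f1 (delta_mx 0 i) x| <= K.
  by have [K K0 hK] := cont_on_bounded cD (c1_cont1 hf (delta_mx 0 i)); exists K.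
exists ((n%:R + 1) * (\sum_i K i)).
  by rewrite mulr_ge0 ?addr_ge0// sumr_ge0// => i _; exact: ltW (hK i).1.
move=> v x Ox; apply: (linear_bound v oO (c1_der1 hf)) => // [w|i|i].
- apply: cont_on_sub (c1_cont1 hf w); exact: subset_closure.
- exact: ltW (hK i).1.
- by apply: (hK i).2; exact: subset_closure.
Qed.

Lemma lip_closure x0 r L : 0 <= L ->
  (forall x y, Omega x -> Omega y -> enorm (x - x0) < r -> enorm (y - x0) < r ->
    `|f y - f x| <= L * enorm (y - x)) ->
  forall x y, D x -> D y -> enorm (x - x0) < r -> enorm (y - x0) < r ->
    `|f y - f x| <= L * enorm (y - x).
Proof.
move=> L0 h x y Dx Dy xr yr.
have n1 : (0 : R) < n%:R + 1 by rewrite ltr_wpDl.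
have ap z e : D z -> enorm (z - x0) < r -> 0 < e -> exists2 z', Omega z' &
    [/\ enorm (z' - x0) < r, enorm (z' - z) < e & `|f z' - f z| < e].
  move=> Dz zr e0; have [de de0 hde] := c1_cont hf Dz e0.
  pose m := Num.min e (r - enorm (z - x0)).
  have m0 : 0 < m by rewrite lt_min e0 subr_gt0.
  have M0 : 0 < Num.min de (m / (n%:R + 1)) by rewrite lt_min de0 divr_gt0.
  have [z' Oz'] := (closure_normP _ _).1 Dz _ M0; rewrite lt_min => /andP[z1 z2].
  have zm : enorm (z' - z) < m.
    by apply: le_lt_trans (enorm_le_norm _) _; rewrite mulrC -ltr_pdivlMr.
  move: zm; rewrite lt_min => /andP[z3 z4]; exists z' => //; split=> //.
    by have := enormD (z' - z) (z - x0); rewrite addrA subrK; lra.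
  by apply: hde => //; exact: subset_closure.
apply/ler_addgt0Pl => e e0.
pose e' := e / (2 * L + 2).
have P0 : 0 < 2 * L + 2 by lra.
have e'0 : 0 < e' by rewrite divr_gt0.
have [x' Ox' [x1 x2 x3]] := ap _ _ Dx xr e'0.
have [y' Oy' [y1 y2 y3]] := ap _ _ Dy yr e'0.
have hxy := h _ _ Ox' Oy' x1 y1.
have t1 : enorm (y' - x') <= e' + enorm (y - x) + e'.
  have -> : y' - x' = (y' - y) + (y - x) + (x - x').
    by apply/rowP => i; rewrite !mxE; ring.
  apply: le_trans (enormD _ _) _; apply: lerD; last by rewrite enormBC ltW.
  by apply: le_trans (enormD _ _) _; rewrite lerD2r ltW.
have t2 := ler_wpM2l L0 t1.
have E : (2 * L + 2) * e' = e by rewrite mulrC divfK// gt_eqF.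
have -> : f y - f x = - (f y' - f y) + (f y' - f x') + (f x' - f x) by ring.
apply: le_trans (ler_normD _ _) _.
have := ler_normD (- (f y' - f y)) (f y' - f x'); rewrite normrN.
move: hxy t2 x3 y3 E; clear -cD hf oO.
move: (enorm (y - x)) (enorm _) `|f y' - f x'| `|f x' - f x| `|f y' - f y| `|- _ + _| => *; lra.
Qed.

Lemma lip_interior x0 : Omega x0 ->
  exists2 r : R, 0 < r & exists2 L, 0 <= L & forall x y, Omega x -> Omega y ->
    enorm (x - x0) < r -> enorm (y - x0) < r -> `|f y - f x| <= L * enorm (y - x).
Proof.
move=> Ox; have [r r0 hr] := ball_in oO Ox; have [K K0 hK] := c1bar_gradient_bound.
exists r => //; exists K => // x y _ _ xr yr.
have := @segment_lip Omega f f1 K x (y - x) (c1_der1 hf) hK; rewrite subrKC; apply.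
move=> s s01; apply: hr; apply: le_lt_trans (norm_le_enorm _) _; exact: ball_convex.
Qed.

(* x and y are joined inside Omega by going down along e, across, and up again. *)
Lemma lip_chart x0 e r gamma g1 : below_graph Omega x0 e r gamma -> c1bar setT gamma g1 ->
  exists2 r : R, 0 < r & exists2 L, 0 <= L & forall x y, Omega x -> Omega y ->
    enorm (x - x0) < r -> enorm (y - x0) < r -> `|f y - f x| <= L * enorm (y - x).
Proof.
move=> [e1 r0 inv hg] h; have [rg rg0 [Lg Lg0 hLg]] := graph_lip x0 h.
have [K K0 hK] := c1bar_gradient_bound.
(* The detour stays within rho + h' + a <= (2 Lg + 5) rho of x0, which is less than P rho = m. *)
pose P := 2 * Lg + 6; have P0 : 0 < P by rewrite /P; lra.
pose m := Num.min r rg; have m0 : 0 < m by rewrite lt_min r0.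
pose rho := m / P; have rho0 : 0 < rho by rewrite divr_gt0.
have rhoP : P * rho = m by rewrite mulrC divfK// gt_eqF.
have mr z : enorm (z - x0) < m -> enorm (z - x0) < r by rewrite lt_min => /andP[].
have mg z : enorm (z - x0) < m -> enorm (z - x0) < rg by rewrite lt_min => /andP[].
(* The detour has length 2 h' + a = (2 Lg + 3) a. *)
exists rho => //; exists (K * (2 * Lg + 3)); first by rewrite mulr_ge0//; lra.
move=> x y Ox Oy xr yr; pose a := enorm (y - x); have a0 : 0 <= a by exact: enorm_ge0.
have a2 : a <= 2 * rho.
  have := enormD (y - x0) (x0 - x); rewrite addrA subrK [enorm (x0 - x)]enormBC /a; lra.
(* Along the segment the graph may drop by Lg a and the height along [e] may rise by a; this descent
   compensates both. *)
pose h' := (Lg + 1) * a; have h0 : 0 <= h' by rewrite mulr_ge0//; lra.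
have h2 : h' <= (Lg + 1) * (2 * rho) by rewrite ler_wpM2l//; lra.
have Lr := mulr_ge0 Lg0 (ltW rho0).
have bnd : rho + h' + a < m by rewrite -rhoP /P; lra.
have sh0 s : 0 <= s <= 1 -> 0 <= s * h' <= h'.
  by move=> /andP[s0 s1]; rewrite mulr_ge0//= ler_piMl.
have down z tau : Omega z -> enorm (z - x0) < rho -> 0 <= tau <= h' -> Omega (z - tau *: e).
  move=> Oz zr /andP[t0 th].
  have zt : enorm (z - tau *: e - x0) < m.
    rewrite addrAC; apply: le_lt_trans (enormD _ _) _.
    by rewrite enormN enormZ e1 mulr1 ger0_norm//; lra.
  apply/(hg _ (mr _ zt)); rewrite dotBl dotZl -enorm_sq e1 expr1n mulr1 -scaleNr inv.
  have zm : enorm (z - x0) < m by lra.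
  by have := (hg _ (mr _ zm)).1 Oz; lra.
have across s : 0 <= s <= 1 -> Omega (x - h' *: e + s *: (y - x)).
  move=> s01; have /andP[s0 s1] := s01.
  have xs : enorm (x + s *: (y - x) - x0) < rho by exact: ball_convex.
  have E : x - h' *: e + s *: (y - x) = x + s *: (y - x) + (- h') *: e.
    by rewrite addrAC scaleNr.
  have zm : enorm (x - h' *: e + s *: (y - x) - x0) < m.
    rewrite E addrAC; apply: le_lt_trans (enormD _ _) _.
    by rewrite scaleNr enormN enormZ e1 mulr1 ger0_norm//; lra.
  apply/(hg _ (mr _ zm)); rewrite E inv dotDl dotZl -enorm_sq e1 expr1n mulr1 dotDl dotZl.
  have xm : enorm (x - x0) < m by lra.
  have xsm : enorm (x + s *: (y - x) - x0) < m by lra.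
  have g1' := (hg _ (mr _ xm)).1 Ox.
  have := hLg x _ (mg _ xm) (mg _ xsm); rewrite [x + s *: _ - x]addrAC subrr add0r enormZ (ger0_norm s0).
  rewrite ler_norml => /andP[g2 _].
  have g3 : dot (y - x) e <= a.
    by apply: le_trans (ler_norm _) _; apply: le_trans (dot_enorm _ _) _; rewrite e1 mulr1.
  have g4 : s * dot (y - x) e <= s * a by rewrite ler_wpM2l.
  have g5 : s * a <= a by rewrite ler_piMl.
  have g6 : Lg * (s * a) <= Lg * a by rewrite ler_wpM2l.
  move: g1' g2 g4 g5 g6; rewrite -/a /h'; lra.
have dh : enorm (- h' *: e) = h' by rewrite scaleNr enormN enormZ e1 mulr1 ger0_norm.
have dn z : Omega z -> enorm (z - x0) < rho -> `|f (z - h' *: e) - f z| <= K * h'.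
  move=> Oz zr; have := @segment_lip Omega f f1 K z (- h' *: e) (c1_der1 hf) hK.
  rewrite dh scaleNr; apply; move=> s s01; rewrite scalerN scalerA; apply: down => //.
  exact: sh0.
have s1 := dn _ Ox xr; have s2 := dn _ Oy yr.
have := @segment_lip Omega f f1 K (x - h' *: e) (y - x) (c1_der1 hf) hK across.
have -> : x - h' *: e + (y - x) = y - h' *: e by rewrite addrAC subrKC.
rewrite -/a => s3.
have -> : f y - f x = - (f (y - h' *: e) - f y) + (f (y - h' *: e) - f (x - h' *: e)) +
    (f (x - h' *: e) - f x) by ring.
apply: le_trans (ler_normD _ _) _.
have := ler_normD (- (f (y - h' *: e) - f y)) (f (y - h' *: e) - f (x - h' *: e)); rewrite normrN.
have : K * h' = K * (Lg + 1) * a by rewrite /h' mulrA.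
move: s1 s2 s3; move: `|f (y - _) - f y| `|f (x - _) - f x| `|f (y - _) - f (x - _)| `|- _ + _| => *; lra.
Qed.

Hypothesis charts : forall x0, boundary Omega x0 -> exists e r gamma g1,
  below_graph Omega x0 e r gamma /\ c1bar setT gamma g1.

(** Local bounds hold around every point of the closure; pairs at a definite distance are handled by
    the supremum of |f|. *)
Lemma lipschitz_closure : exists2 L, 0 <= L & forall x y, D x -> D y -> `|f x - f y| <= L * enorm (x - y).
Proof.
have n1 : (0 : R) < n%:R + 1 by rewrite ltr_wpDl.
have loc x0 : D x0 -> exists2 r : R, 0 < r & exists2 L, 0 <= L & forall x y, D x -> D y ->
    enorm (x - x0) < r -> enorm (y - x0) < r -> `|f y - f x| <= L * enorm (y - x).
  move=> Dx0; have [Ox0|nOx0] := pselect (Omega x0).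
    have [r r0 [L L0 h]] := lip_interior Ox0; exists r => //; exists L => //.
    exact: lip_closure.
  have Bx0 : boundary Omega x0 by split=> //; rewrite (interior_id Omega).1.
  have [e [r0 [gamma [g1 [bg hg]]]]] := charts Bx0.
  have [r r1 [L L0 h]] := lip_chart bg hg; exists r => //; exists L => //.
  exact: lip_closure.
have [M M0 hM] := cont_on_bounded cD (c1_cont hf).
have [||L L0 h] := compact_uniform (K := D)
  (P := fun C x => forall y, D y -> `|f x - f y| <= C * enorm (x - y)) cD.
- move=> C C' x CC h y Dy; apply: le_trans (h y Dy) _.
  by rewrite ler_wpM2r ?enorm_ge0.
- move=> x0 Dx0; have [r r0 [L L0 h]] := loc _ Dx0.
  exists (r / 2 / (n%:R + 1)); first by rewrite !divr_gt0.
  (* If y is outside the ball, |x - y| >= r/2, and 2 M <= (4 M / r) |x - y|. *)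
  exists (L + 4 * M / r) => x Dx xx y Dy.
  have xr : enorm (x - x0) < r / 2.
    by apply: le_lt_trans (enorm_le_norm _) _; rewrite mulrC -ltr_pdivlMr.
  have Mr : 0 <= 4 * M / r by rewrite divr_ge0 ?mulr_ge0// ltW.
  have e0 := enorm_ge0 (x - y).
  have [yr|yr] := ltP (enorm (y - x0)) r.
    rewrite distrC enormBC; apply: le_trans (h x y Dx Dy _ yr) _; first by lra.
    by rewrite ler_wpM2r ?enorm_ge0// lerDl.
  have xy : r / 2 <= enorm (x - y).
    have := enormD (y - x) (x - x0); rewrite addrA subrK [enorm (y - x)]enormBC; lra.
  apply: (@le_trans _ _ (4 * M / r * (r / 2))).
    have -> : 4 * M / r * (r / 2) = M + M by field; rewrite gt_eqF.
    by apply: le_trans (ler_normB _ _) _; apply: lerD; exact: hM.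
  apply: (@le_trans _ _ (4 * M / r * enorm (x - y))); first exact: ler_wpM2l.
  by rewrite ler_wpM2r// lerDr.
- by exists L; [exact: ltW|move=> x y Dx Dy; exact: h].
Qed.

End lipschitz.

Lemma near_within_dist (R : realType) (W : normedModType R) (K : set W) x (P : W -> Prop) :
  (exists2 de : R, 0 < de & forall y, K y -> `|y - x| < de -> P y) ->
  \forall y \near within K (nbhs x), P y.
Proof.
move=> [de de0 h]; rewrite near_withinE; apply/nbhs_normP; exists de => // y /=.
by rewrite distrC => yx Ky; exact: h.
Qed.

Lemma pos_dist (R : realType) (a b : R) : `|Num.max a 0 - Num.max b 0| <= `|a - b|.
Proof.
rewrite ler_norml; have := ler_norm (a - b); have := ler_norm (- (a - b)); rewrite normrN.
by have [a0|a0] := leP 0 a; have [b0|b0] := leP 0 b => h1 h2; apply/andP; split; lra.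
Qed.

(** * The defining function and the boundary weight *)

Section c2_maps.
Variables (R : realType) (n : nat).
Local Notation V := 'rV[R]_n.
Variable K : set V.
Hypothesis cK : compact K.

(** The regularity demanded by [good_geometry], in a form closed under sums, products and cubes of
    positive parts. *)
Record c2map (f : V -> R) (Df : V -> V) (Hf : V -> 'M[R]_n) : Prop := {
  c2map_jet : forall x, K x -> jet2 f x (Df x) (Hf x);
  c2map_cont : cont_on K f;
  c2map_cont1 : forall i, cont_on K (fun x => Df x 0 i);
  c2map_bound : exists2 M, 0 <= M & forall x d, K x -> `|qf (Hf x) d| <= M * dot d d
}.

Lemma cont_on_sum (I : Type) (s : seq I) (F : I -> V -> R) :
  (forall i, cont_on K (F i)) -> cont_on K (fun x => \sum_(i <- s) F i x).
Proof.
move=> h; elim: s => [|i s IH].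
  by have := @cont_on_cst _ _ K 0; congr cont_on; apply/funext => x; rewrite big_nil.
by have := cont_onD (h i) IH; congr cont_on; apply/funext => x; rewrite big_cons.
Qed.

Lemma cont_on_dot (P Q : V -> V) : (forall i, cont_on K (fun x => P x 0 i)) ->
  (forall i, cont_on K (fun x => Q x 0 i)) -> cont_on K (fun x => dot (P x) (Q x)).
Proof. by move=> hP hQ; apply: cont_on_sum => i; exact: cont_onM. Qed.

Lemma within_continuous_row (P : V -> V) : (forall i, cont_on K (fun x => P x 0 i)) ->
  {within K, continuous P}.
Proof.
move=> h; apply/subspace_continuousP => x Kx; apply/cvgrPdist_lt => e e0.
have e2 : 0 < e / 2 by rewrite divr_gt0.
have hi i : \forall y \near within K (nbhs x), `|P y 0 i - P x 0 i| < e / 2.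
  have [de de0 hde] := h i x Kx _ e2.
  by apply: near_within_dist; exists de.
near=> y; apply: (@le_lt_trans _ _ (e / 2)); last by rewrite ltr_pdivrMr//; lra.
apply: norm_leP => [|i]; first exact: ltW.
rewrite !mxE distrC ltW//; move: i; near: y; exact: filter_forall.
Unshelve. all: by end_near.
Qed.

Lemma c2map_grad_bound f Df Hf : c2map f Df Hf ->
  exists2 M, 0 <= M & forall x, K x -> enorm (Df x) <= M.
Proof.
move=> h; have [M M0 hM] := cont_on_bounded cK (cont_on_dot (c2map_cont1 h) (c2map_cont1 h)).
exists (M + 1); first by lra.
move=> x Kx; rewrite -(@ler_pXn2r _ 2)// ?nnegrE ?enorm_ge0//; last by lra.
rewrite enorm_sq; apply: le_trans (ler_norm _) _; apply: le_trans (hM _ Kx) _.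
rewrite expr2; nra.
Qed.

Lemma c2map_cst a : c2map (fun=> a) (fun=> 0) (fun=> 0).
Proof.
split.
- by move=> x _; exact: jet2_cst.
- exact: cont_on_cst.
- by move=> i; apply: cont_on_cst.
- by exists 0 => // x d _; rewrite qf0 normr0 mul0r.
Qed.

Lemma c2mapD f Df Hf g Dg Hg : c2map f Df Hf -> c2map g Dg Hg ->
  c2map (fun x => f x + g x) (fun x => Df x + Dg x) (fun x => Hf x + Hg x).
Proof.
move=> hf hg; split.
- by move=> x Kx; apply: jet2D; [exact: (c2map_jet hf)|exact: (c2map_jet hg)].
- by apply: cont_onD; [exact: (c2map_cont hf)|exact: (c2map_cont hg)].
- move=> i; have := cont_onD (c2map_cont1 hf i) (c2map_cont1 hg i).
  by congr cont_on; apply/funext => x; rewrite mxE.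
- have [[M1 M10 h1] [M2 M20 h2]] := (c2map_bound hf, c2map_bound hg).
  exists (M1 + M2); first exact: addr_ge0.
  move=> x d Kx; rewrite qfD mulrDl; apply: le_trans (ler_normD _ _) _.
  by apply: lerD; [exact: h1|exact: h2].
Qed.

Lemma c2mapZ a f Df Hf : c2map f Df Hf ->
  c2map (fun x => a * f x) (fun x => a *: Df x) (fun x => a *: Hf x).
Proof.
move=> hf; split.
- by move=> x Kx; apply: jet2Z; exact: (c2map_jet hf).
- by apply: cont_onM; [exact: cont_on_cst|exact: (c2map_cont hf)].
- move=> i; have := cont_onM (@cont_on_cst _ _ K a) (c2map_cont1 hf i).
  by congr cont_on; apply/funext => x; rewrite mxE.
- have [M1 M10 h1] := c2map_bound hf.
  exists (`|a| * M1); first exact: mulr_ge0.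
  by move=> x d Kx; rewrite qfZ normrM -mulrA ler_wpM2l// h1.
Qed.

Lemma qf_outer_bound (p q d : V) M1 M2 : enorm p <= M1 -> enorm q <= M2 ->
  `|qf (p^T *m q) d| <= M1 * M2 * dot d d.
Proof.
move=> h1 h2; rewrite qf_outer normrM -enorm_sq expr2.
have -> : M1 * M2 * (enorm d * enorm d) = (M1 * enorm d) * (M2 * enorm d) by ring.
by apply: ler_pM => //; apply: le_trans (dot_enorm _ _) _; rewrite ler_wpM2r ?enorm_ge0.
Qed.

Lemma c2mapM f Df Hf g Dg Hg : c2map f Df Hf -> c2map g Dg Hg ->
  c2map (fun x => f x * g x) (fun x => f x *: Dg x + g x *: Df x)
    (fun x => f x *: Hg x + g x *: Hf x + ((Df x)^T *m Dg x + (Dg x)^T *m Df x)).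
Proof.
move=> hf hg; split.
- by move=> x Kx; apply: jet2M; [exact: (c2map_jet hf)|exact: (c2map_jet hg)].
- by apply: cont_onM; [exact: (c2map_cont hf)|exact: (c2map_cont hg)].
- move=> i; have := cont_onD (cont_onM (c2map_cont hf) (c2map_cont1 hg i))
    (cont_onM (c2map_cont hg) (c2map_cont1 hf i)).
  by congr cont_on; apply/funext => x; rewrite !mxE.
- have [[M1 M10 h1] [M2 M20 h2]] := (c2map_bound hf, c2map_bound hg).
  have [Mf Mf0 hMf] := cont_on_bounded cK (c2map_cont hf).
  have [Mg Mg0 hMg] := cont_on_bounded cK (c2map_cont hg).
  have [Gf Gf0 hGf] := c2map_grad_bound hf; have [Gg Gg0 hGg] := c2map_grad_bound hg.
  exists (Mf * M2 + Mg * M1 + (Gf * Gg + Gg * Gf)).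
    by rewrite !addr_ge0 ?mulr_ge0// ltW.
  move=> x d Kx; rewrite !qfD !qfZ !mulrDl.
  apply: le_trans (ler_normD _ _) _; apply: lerD.
    apply: le_trans (ler_normD _ _) _; apply: lerD; rewrite normrM -mulrA.
      by apply: ler_pM => //; [exact: hMf|exact: h2].
    by apply: ler_pM => //; [exact: hMg|exact: h1].
  apply: le_trans (ler_normD _ _) _; apply: lerD; apply: qf_outer_bound; by [exact: hGf|exact: hGg].
Qed.

Lemma c2map_pos3 f Df Hf : c2map f Df Hf ->
  c2map (fun x => Num.max (f x) 0 ^+ 3) (fun x => 3 * Num.max (f x) 0 ^+ 2 *: Df x)
    (fun x => 3 * Num.max (f x) 0 ^+ 2 *: Hf x + 6 * Num.max (f x) 0 *: ((Df x)^T *m Df x)).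
Proof.
move=> hf.
have cm : cont_on K (fun x => Num.max (f x) 0).
  move=> x Kx e e0; have [de de0 hde] := c2map_cont hf Kx e0; exists de => // y Ky yx.
  by apply: le_lt_trans (hde _ Ky yx); exact: pos_dist.
have [Mf Mf0 hMf] := cont_on_bounded cK cm.
split.
- by move=> x Kx; apply: jet2_pos3; exact: (c2map_jet hf).
- by have := cont_onM (cont_onM cm cm) cm; congr cont_on; apply/funext => x; ring.
- move=> i; have := cont_onM (cont_onM (@cont_on_cst _ _ K 3) (cont_onM cm cm)) (c2map_cont1 hf i).
  by congr cont_on; apply/funext => x; rewrite mxE expr2.
- have [M1 M10 h1] := c2map_bound hf; have [Gf Gf0 hGf] := c2map_grad_bound hf.
  exists (3 * Mf ^+ 2 * M1 + 6 * Mf * (Gf * Gf)).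
    by rewrite addr_ge0 ?mulr_ge0 ?sqr_ge0// ltW.
  move=> x d Kx; rewrite qfD !qfZ [leRHS]mulrDl; apply: le_trans (ler_normD _ _) _; apply: lerD.
    rewrite normrM -mulrA; apply: ler_pM => //; last exact: h1.
    by rewrite normrM ger0_norm// ler_wpM2l// normrX lerXn2r ?nnegrE ?(ltW Mf0)// hMf.
  rewrite normrM -mulrA; apply: ler_pM => //; last by apply: qf_outer_bound; exact: hGf.
  by rewrite normrM ger0_norm// ler_wpM2l// hMf.
Qed.

Lemma c2map_c2bar f f1 f2 : c2bar setT f f1 f2 -> c2map f (grad1 f1) (hess1 f2).
Proof.
move=> h; have [c1 c2] := (c2_cont1 h, c2_cont2 h); rewrite closureT in c1 c2.
have cf := c2_cont h; rewrite closureT in cf.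
split.
- by move=> x _; exact: (C2_jet openT (c2_der1 h) (c2_der2 h) c1 c2).
- exact: cont_on_sub cf.
- move=> i; have := cont_on_sub (@subsetT _ K) (c1 (delta_mx 0 i)).
  by congr cont_on; apply/funext => x; rewrite mxE.
- have cH (ij : 'I_n * 'I_n) : cont_on K (fun z => hess1 f2 z ij.1 ij.2).
    have -> : (fun z => hess1 f2 z ij.1 ij.2) = fun y => 2^-1 * (f2 (delta_mx 0 ij.1) (delta_mx 0 ij.2) y + f2 (delta_mx 0 ij.2) (delta_mx 0 ij.1) y).
      by apply/funext => y; rewrite mxE.
    apply: (cont_on_sub (K' := setT)) => //.
    by apply: cont_onM; [exact: cont_on_cst|apply: cont_onD; exact: c2].
  have /choice[S hS] ij : exists S, 0 < S /\ forall x, K x -> `|hess1 f2 x ij.1 ij.2| <= S.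
    by have [S S0 hS] := cont_on_bounded cK (cH ij); exists S.
  exists (\sum_i \sum_j S (i, j)).
    by apply: sumr_ge0 => i _; apply: sumr_ge0 => j _; exact: ltW (hS (i, j)).1.
  move=> x d Kx; apply: le_trans (qf_entry_sum _ _) _; rewrite ler_wpM2r ?dot_ge0//.
  by apply: ler_sum => i _; apply: ler_sum => j _; exact: (hS (i, j)).2.
Qed.

Lemma c2map_dot e : c2map (dot e) (fun=> e) (fun=> 0).
Proof.
split.
- by move=> x _; exact: jet2_dot.
- apply: cont_on_continuous => x; apply: jet2_continuous; exact: jet2_dot.
- by move=> i; exact: cont_on_cst.
- by exists 0 => // x d _; rewrite qf0 normr0 mul0r.
Qed.

End c2_maps.

Section defining_function.
Variables (R : realType) (n : nat).
Local Notation V := 'rV[R]_n.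
Variables (Omega : set V) (nu : V -> V).
Local Notation D := (closure Omega).
Local Notation B := (boundary Omega).
Hypotheses (oO : open Omega) (cD : compact D).
Hypothesis hnu : forall x, B x -> outward_unit_normal Omega x (nu x).

(** Stable under sums: the gradients at x are nonnegative multiples of the same vector [nu x], so
    contributions of different charts cannot cancel. *)
Definition normal_derivative_ge0 (S : set V) (rho : V -> R) (Drho : V -> V) : Prop :=
  forall x, B x -> rho x = 0 /\ exists2 a, 0 <= a & Drho x = a *: nu x /\ (S x -> 0 < a).

Lemma quartic_dist (x0 x : V) : quartic 0 (2%:M) 0 x0 x = dot (x - x0) (x - x0) :> R.
Proof. by rewrite /quartic dot0l qf_scalar mul0r addr0 add0r mulrA mulVf ?mul1r. Qed.

(** A cut-off in the chart ball times e.x - gamma x. On the boundary inside the ball the second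
    factor vanishes, so the gradient is the cut-off times the conormal; outside the ball the cut-off
    and its gradient vanish. *)
Lemma bump x0 e r gamma g1 g2 : below_graph Omega x0 e r gamma -> c2bar setT gamma g1 g2 ->
  exists rho Drho Hrho, c2map D rho Drho Hrho /\
    normal_derivative_ge0 [set x | enorm (x - x0) < r] rho Drho.
Proof.
move=> bg hg; have h1 := c2bar_c1bar hg; have cg := c1_cont h1; rewrite closureT in cg.
have [e1 r0 _ _] := bg.
have md : c2map D _ _ _ := c2map_c2bar cD (c2bar_quartic setT 0 0 x0 (tr_scalar_mx n (2 : R))).
have mw := c2mapD (c2map_cst D (r ^+ 2)) (c2mapZ (-1) md).
have mdel := c2mapD (c2map_dot D e) (c2mapZ (-1) (c2map_c2bar cD hg)).
have mrho := c2mapM cD (c2map_pos3 cD mw) mdel.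
eexists _, _, _; split; first exact: mrho.
move=> x Bx /=; rewrite quartic_dist -enorm_sq mulN1r.
have [xr|xr] := ltP (enorm (x - x0)) r.
  have gx := chart_boundary oO bg cg Bx xr.
  have -> : dot e x + -1 * gamma x = 0 by rewrite dotC gx mulN1r subrr.
  rewrite mulr0 scale0r addr0; split=> //.
  have w0 : 0 < Num.max (r ^+ 2 - enorm (x - x0) ^+ 2) 0.
    by rewrite lt_max subr_gt0 ltrXn2r ?nnegrE ?enorm_ge0// ltW.
  have N1 := conormal_ge1 x bg h1.
  have chi0 : 0 < Num.max (r ^+ 2 - enorm (x - x0) ^+ 2) 0 ^+ 3 by rewrite exprn_gt0.
  exists (Num.max (r ^+ 2 - enorm (x - x0) ^+ 2) 0 ^+ 3 * enorm (e - grad1 g1 x)).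
    by rewrite mulr_ge0 ?enorm_ge0// ltW.
  split; last by move=> _; rewrite mulr_gt0//; lra.
  rewrite (chart_normal oO bg h1 Bx xr (hnu Bx)) /uvec scalerA mulfK ?scaleN1r//.
  by rewrite gt_eqF//; lra.
have -> : Num.max (r ^+ 2 - enorm (x - x0) ^+ 2) 0 = 0.
  by rewrite max_r// subr_le0 lerXn2r ?nnegrE ?enorm_ge0// ltW.
rewrite !expr0n/= mulr0 !scale0r mul0r scaler0 addr0; split=> //.
by exists 0 => //; rewrite scale0r; split=> //= ; rewrite ltNge xr.
Qed.

Hypothesis charts : forall x0, B x0 -> exists e r gamma g1 g2,
  below_graph Omega x0 e r gamma /\ c2bar setT gamma g1 g2.

Lemma compact_boundary : compact B.
Proof.
apply: subclosed_compact cD _; last by move=> x [].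
by apply: closedI; [exact: closed_closure|apply: open_closedC; exact: open_interior].
Qed.

(* rho is a sum of local defining functions e.x - gamma x, cut off by bumps; on the
   boundary its gradient is a positive multiple of the normal, in every chart. *)
Lemma boundary_defining_function : exists rho Drho Hrho, c2map D rho Drho Hrho /\
  normal_derivative_ge0 B rho Drho.
Proof.
have /choice[rad hrad] (x0 : V) : exists r, B x0 -> 0 < r /\ exists rho Drho Hrho,
    c2map D rho Drho Hrho /\ normal_derivative_ge0 [set x | enorm (x - x0) < r] rho Drho.
  have [Bx0|nB] := pselect (B x0); last by exists 0.
  have [e [r [gamma [g1 [g2 [bg hg]]]]]] := charts Bx0.
  by exists r => _; split; [case: bg|exact: bump bg hg].
have n1 : (0 : R) < n%:R + 1 by rewrite ltr_wpDl.
have := compact_boundary; rewrite compact_cover => /(_ V B (fun x0 => ball x0 (rad x0 / (n%:R + 1)))).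
case.
- by move=> x0 Bx0; exact: ball_open.
- move=> x Bx; exists x => //; apply: ballxx.
  by rewrite divr_gt0//; exact: (hrad x Bx).1.
move=> s sB cover.
suff [rho [Drho [Hrho [m nd]]]] : exists rho Drho Hrho, c2map D rho Drho Hrho /\
    normal_derivative_ge0 [set x | exists2 x0, x0 \in finmap.enum_fset s & enorm (x - x0) < rad x0] rho Drho.
  exists rho, Drho, Hrho; split=> // x Bx; have [-> [a a0 [E h]]] := nd x Bx; split=> //.
  exists a => //; split=> // _; apply: h; have [x0 sx0 bx] := cover _ Bx.
  exists x0 => //; apply: le_lt_trans (enorm_le_norm _) _; rewrite mulrC -ltr_pdivlMr//.
  by move: bx; rewrite -ball_normE /= distrC.
have {}sB x0 : x0 \in finmap.enum_fset s -> B x0 by move=> /sB; rewrite inE.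
elim: (finmap.enum_fset s) sB => [_|x1 l IH sB].
  exists (fun=> 0), (fun=> 0), (fun=> 0); split; first exact: c2map_cst.
  by move=> x _; split=> //; exists 0 => //; rewrite scale0r; split=> // -[].
have [|r1 [D1 [H1 [m1 nd1]]]] := IH.
  by move=> x0 x0l; apply: sB; rewrite inE x0l orbT.
have [_ [r2 [D2 [H2 [m2 nd2]]]]] := hrad x1 (sB x1 (mem_head _ _)).
exists (fun x => r1 x + r2 x), (fun x => D1 x + D2 x), (fun x => H1 x + H2 x); split; first exact: c2mapD.
move=> x Bx; have [-> [a a0 [E h]]] := nd1 x Bx; have [-> [b b0 [E' h']]] := nd2 x Bx.
rewrite addr0; split=> //; exists (a + b); first exact: addr_ge0.
split; first by rewrite E E' scalerDl.
move=> [x0]; rewrite inE => /predU1P[->|x0l] hx; first by rewrite ltr_wpDl// h'.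
by rewrite ltr_pwDl// h//; exists x0.
Qed.

Lemma enorm_normal x : B x -> enorm (nu x) = 1.
Proof.
move=> Bx; have [e [r [gamma [g1 [g2 [bg hg]]]]]] := charts Bx.
have [_ r0 _ _] := bg; have h1 := c2bar_c1bar hg.
rewrite (chart_normal oO bg h1 Bx _ (hnu Bx)) ?subrr ?enorm0//; apply: enorm_uvec.
by rewrite -enorm_eq0 gt_eqF//; have := conormal_ge1 x bg h1; lra.
Qed.

Lemma exterior_constant : exists2 C0 : R, 0 < C0 & forall x y, B x -> D y ->
  dot (y - x) (nu x) <= C0 * dot (y - x) (y - x).
Proof.
have [||C0 C00 h] := compact_uniform (K := B)
  (P := fun C x => forall y, D y -> dot (y - x) (nu x) <= C * dot (y - x) (y - x)) compact_boundary.
- move=> C C' x CC h y Dy; apply: le_trans (h y Dy) _.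
  by rewrite ler_wpM2r ?dot_ge0.
- move=> x0 Bx0; have [e [r [gamma [g1 [g2 [bg hg]]]]]] := charts Bx0.
  have [de de0 [K K0 h]] := exterior_local oO bg hg hnu.
  exists (de / 2); first by rewrite divr_gt0.
  (* For y far away |y - x| >= de/2, hence |y - x| <= (2/de) |y - x|^2. *)
  exists (K + 2 / de) => x Bx xx y Dy.
  have q0 : 0 <= 2 / de by rewrite divr_ge0// ltW.
  have [yx|yx] := ltP `|y - x0| de.
    apply: le_trans (h x y Bx Dy _ yx) _; first by lra.
    by rewrite ler_wpM2r ?dot_ge0// lerDl.
  have nx : de / 2 <= enorm (y - x).
    apply: le_trans (norm_le_enorm _).
    by have := ler_normD (y - x) (x - x0); rewrite addrA subrK; lra.
  apply: le_trans (ler_norm _) _; apply: le_trans (dot_enorm _ _) _.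
  rewrite enorm_normal// mulr1; apply: (@le_trans _ _ (2 / de * dot (y - x) (y - x))).
    rewrite -enorm_sq expr2 mulrA ler_peMl ?enorm_ge0//.
    by rewrite mulrAC ler_pdivlMr// mul1r; lra.
  by rewrite ler_wpM2r ?dot_ge0// lerDr.
- by exists C0 => // x y Bx Dy; exact: h.
Qed.

Lemma good_geometry_exists : exists C0 C1 g Dg Hg, good_geometry D B nu C0 C1 g Dg Hg.
Proof.
have [C0 C00 hext] := exterior_constant.
have [rho [Drho [Hrho [m nd]]]] := boundary_defining_function.
(* On the boundary Drho = a nu with |nu| = 1, so a^2 = |Drho|^2 is continuous there; its minimum
   over the compact boundary bounds a from below. *)
have [a0 a00 ha0] : exists2 a0 : R, 0 < a0 & forall x, B x -> a0 <= dot (Drho x) (nu x).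
  have [B0|/set0P/negP/negPn/eqP B0] := pselect (B !=set0); last by exists 1 => // x; rewrite B0.
  have cdd := cont_onN (cont_on_sub (_ : B `<=` D) (cont_on_dot (c2map_cont1 m) (c2map_cont1 m))).
  have [z Bz hz] := cont_on_max B0 compact_boundary (cdd ltac:(by move=> x [])).
  have [_ [b b0 [Eb bp]]] := nd z Bz.
  have dz x a : B x -> Drho x = a *: nu x -> dot (Drho x) (Drho x) = a ^+ 2 /\ dot (Drho x) (nu x) = a.
    by move=> Bx ->; rewrite !dotZl dotZr -enorm_sq enorm_normal// expr1n !mulr1 expr2.
  exists b; first exact: bp.
  move=> x Bx; have [_ [a a0 [Ea _]]] := nd x Bx.
  have := hz x Bx; rewrite lerN2 (dz _ _ Bx Ea).1 (dz _ _ Bz Eb).1 (dz _ _ Bx Ea).2.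
  by rewrite ler_pXn2r.
pose A := (12 * C0 + 1) / a0; have A0 : 0 < A by rewrite divr_gt0//; lra.
have m1 := c2mapD (c2map_cst D 1) (c2mapZ A m).
(* g = (1 + (1 + A rho)^2)/2 is at least 1/2 whatever the sign of rho, and on the boundary it equals
   1 with gradient A Drho; A was chosen to make the normal derivative at least 12 C0 + 1. *)
have m2 := c2mapZ 2^-1 (c2mapD (c2map_cst D 1) (c2mapM cD m1 m1)).
have [M1 M10 hM1] := cont_on_bounded cD (c2map_cont m2).
have [M2 M20 hM2] := c2map_grad_bound cD m2.
have [M3 M30 hM3] := c2map_bound m2.
eexists C0, (1 + M1 + M2 + M3), _, _, _; split.
- exact: cD.
- by move=> x [].
- by move=> x Bx; rewrite enorm_normal.
- exact: C00.
- by lra.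
- exact: hext.
- exact: (c2map_jet m2).
- exact: (c2map_cont m2).
- exact: within_continuous_row (c2map_cont1 m2).
- move=> x Dx; rewrite ler_peMr ?invr_ge0// lerDl -expr2 sqr_ge0//.
- by move=> x Dx; apply: le_trans (le_trans (ler_norm _) (hM1 _ Dx)) _; lra.
- by move=> x Dx; apply: le_trans (hM2 _ Dx) _; lra.
- move=> x d Dx; apply: le_trans (hM3 _ d Dx) _; rewrite ler_wpM2r ?dot_ge0//; lra.
- by move=> x Bx /=; rewrite (nd x Bx).1 mulr0 addr0 mulr1 mulVf.
- move=> x Bx /=; rewrite (nd x Bx).1 mulr0 !addr0 !add0r !scale1r -scalerDl scalerA.
  have -> : 2^-1 * (A + A) = A by field.
  rewrite dotZl /A mulrAC ler_pdivlMr// ler_pM2l ?ha0//; lra.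
Qed.

End defining_function.

(** * Lipschitz estimates *)

Section lipschitz_propagation.
Variables (R : realType) (n : nat).
Local Notation V := 'rV[R]_n.
Variables (Omega : set V) (nu : V -> V) (C0 C1 : R) (g : V -> R) (Dg : V -> V) (Hg : V -> 'M[R]_n).
Local Notation D := (closure Omega).
Local Notation B := (boundary Omega).
Hypothesis gg : good_geometry D B nu C0 C1 g Dg Hg.
Variables (c : V -> R) (Cc Lc C : R).
Hypotheses (Lc0 : 0 <= Lc) (hC : forall x, D x -> `|c x| <= Cc) (C_ge0 : 0 <= C).
Hypothesis hL : forall x y, D x -> D y -> `|c x - c y| <= Lc * enorm (x - y).

(** For r <= lam the first summand suffices, for r >= lam the second. *)
Lemma linear_le_quartic (L lam r : R) : 0 <= L -> 0 < lam -> 0 <= r ->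
  L * r <= L * lam + L / lam ^+ 3 * r ^+ 4.
Proof.
move=> L0 l0 r0; have l3 : 0 < lam ^+ 3 by rewrite exprn_gt0.
have [rl|/ltW rl] := leP r lam.
  by rewrite ler_wpDr ?ler_wpM2l// mulr_ge0 ?exprn_ge0// divr_ge0// ltW.
rewrite ler_wpDl ?mulr_ge0 ?(ltW l0)// -mulrA ler_wpM2l// mulrC ler_pdivlMr//.
have -> : r ^+ 4 = r * r ^+ 3 by ring.
by rewrite ler_wpM2l// lerXn2r// nnegrE// ltW.
Qed.

(* The penalty L |x - y|^4 with L ~ lam^-3 costs an additive error of order lam; the
   choice lam = |x - y| turns this into a Lipschitz bound. *)
Lemma propagation (a b : V * R -> R) (m0 L0 : R) : subsol D B nu c C a ->
  subsol D B nu (fun x => - c x) C b -> st_cont D a -> st_cont D b -> 0 <= m0 -> 0 <= L0 ->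
  (forall x y, D x -> D y -> a (x, 0) + b (y, 0) <= m0 + L0 * enorm (x - y)) ->
  forall T, 0 < T -> exists2 K, 0 < K & forall x y t, D x -> D y -> 0 <= t <= T ->
    a (x, t) + b (y, t) <= m0 + K * enorm (x - y).
Proof.
move=> sa sb ca cb m00 L00 init T T0; have cD := gg_compact gg.
have T1 : 0 <= T + 1 by lra.
have [Ka hKa] := st_bounded cD ca T1; have [Kb hKb] := st_bounded cD cb T1.
pose m := (Num.truncn (growth_rate n C1 Cc Lc * (2 + T))).+1.
have hm : growth_rate n C1 Cc Lc * (2 + T) <= m%:R by rewrite ltW// truncnS_gt.
pose Bd := Num.max (Num.max Ka Kb) 0.
have Bd0 : 0 <= Bd by rewrite le_max lexx orbT.
have hB x t : D x -> 0 <= t <= T + 1 -> `|a (x, t)| <= Bd /\ `|b (x, t)| <= Bd.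
  move=> Dx tT; split; [apply: le_trans (hKa _ _ Dx tT) _|apply: le_trans (hKb _ _ Dx tT) _];
    by rewrite !le_max lexx ?orbT.
have [L1 L10 key] := doubling gg Lc0 hC C_ge0 hL sa sb ca cb T0 hm hB.
pose L := L0 + 1; have Lp : 0 < L by rewrite /L; lra.
(* For lam <= lT <= 1 one has L / lam^3 >= L / lam >= L1, as [doubling] requires. *)
pose lT := Num.min 1 (L / L1); have lT0 : 0 < lT by rewrite lt_min ltr01 divr_gt0.
have c1 := gg_C1 gg.
pose G := (1 + T) ^+ m * (2 * C1); have G0 : 0 <= G by rewrite mulr_ge0 ?exprn_ge0//; lra.
have main lam x y t : 0 < lam -> lam <= lT -> D x -> D y -> 0 <= t <= T ->
    a (x, t) + b (y, t) <= m0 + L * lam + L / lam ^+ 3 * (G * enorm (x - y) ^+ 4).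
  move=> l0 ll Dx Dy tT; have l3 : 0 < lam ^+ 3 by rewrite exprn_gt0.
  have Ll : L1 <= L / lam ^+ 3.
    move: ll; rewrite le_min => /andP[l1 l2].
    rewrite ler_pdivlMr// mulrC -ler_pdivlMr//; apply: le_trans l2.
    by rewrite exprS ler_piMr ?(ltW l0)// expr_le1// ltW.
  have Lp' : 0 <= L / lam ^+ 3 by rewrite divr_ge0 ?ltW.
  apply: le_trans (_ : m0 + L * lam + L / lam ^+ 3 * ((1 + t) ^+ m * psi g y x) <= _).
    apply: (key (L / lam ^+ 3) (m0 + L * lam) Ll) => //; first by rewrite addr_ge0// mulr_ge0// ltW.
    move=> x' y' Dx' Dy'; apply: le_trans (init x' y' Dx' Dy') _.
    rewrite -addrA lerD2l -enorm_sq -exprM.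
    apply: le_trans (linear_le_quartic (ltW Lp) l0 (enorm_ge0 _)).
    by rewrite ler_wpM2r ?enorm_ge0// /L lerDl.
  rewrite lerD2l ler_wpM2l// /G -mulrA; have /andP[t0 tT'] := tT.
  apply: ler_pM; rewrite ?exprn_ge0//; first by lra.
  - rewrite /psi mulr_ge0 ?mulr_ge0 ?dot_ge0//.
    have := gg_half gg Dx; have := gg_half gg Dy; lra.
  - by rewrite lerXn2r ?nnegrE//; lra.
  - rewrite /psi -!enorm_sq -exprD ler_wpM2r ?exprn_ge0 ?enorm_ge0//.
    have := gg_le gg Dx; have := gg_le gg Dy; lra.
pose K := L * (1 + G) + 2 * Bd / lT.
have q0 : 0 <= 2 * Bd / lT by rewrite divr_ge0 ?mulr_ge0// ltW.
exists K; first by rewrite ltr_wpDr// mulr_gt0//; lra.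
move=> x y t Dx Dy tT; set r := enorm (x - y); have r0 : 0 <= r by exact: enorm_ge0.
(* Beyond distance lT the bound follows from [|a|, |b| <= Bd], which accounts for the second summand
   of K. *)
have [rl|/ltW rl] := leP r lT; last first.
  have /andP[t0 tT'] := tT.
  have [h1 h2] := (hB x t Dx ltac:(by rewrite t0; lra), hB y t Dy ltac:(by rewrite t0; lra)).
  have s1 := le_trans (ler_norm _) h1.1; have s2 := le_trans (ler_norm _) h2.2.
  have s3 : 2 * Bd <= 2 * Bd / lT * r.
    by rewrite mulrAC ler_pdivlMr// ler_wpM2l// mulr_ge0.
  have s4 : 0 <= L * (1 + G) * r by rewrite !mulr_ge0 ?addr_ge0 ?(ltW Lp).
  move: s1 s2 s3 s4; rewrite /K mulrDl; clear -m00 gg Lc0 hC C_ge0 hL; lra.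
have [er|rn0] := eqVneq r 0.
  (* For x = y the choice lam = r is impossible; instead lam tends to 0, and the additive error L
     lam disappears. *)
  rewrite er mulr0 addr0; apply/ler_addgt0Pl => e e0.
  pose lam := Num.min lT (e / L); have l0 : 0 < lam by rewrite lt_min lT0 divr_gt0.
  have := main lam x y t l0 ltac:(by rewrite ge_min lexx) Dx Dy tT.
  rewrite -/r er expr0n/= !mulr0 addr0 => /le_trans; apply; rewrite addrC lerD2r.
  by rewrite mulrC -ler_pdivlMr// ge_min lexx orbT.
have rp : 0 < r by rewrite lt_neqAle eq_sym rn0.
apply: le_trans (main r x y t rp rl Dx Dy tT) _.
have -> : L / r ^+ 3 * (G * enorm (x - y) ^+ 4) = L * G * r.
  by rewrite -/r; field.
have qr : 0 <= 2 * Bd / lT * r by rewrite mulr_ge0.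
rewrite /K; move: qr; clear -gg Lc0 hC C_ge0 hL; lra.
Qed.

End lipschitz_propagation.

Lemma compact_closure (R : realType) n (Omega : set 'rV[R]_n) : bounded_set Omega ->
  compact (closure Omega).
Proof.
move=> [M [_ hM]]; apply: bounded_closed_compact; last exact: closed_closure.
exists (`|M| + 2); split; first exact: num_real.
move=> M' MM x /closure_normP/(_ 1 ltr01)[y Oy yx].
have yM : `|y| <= `|M| + 1 by apply: hM => //; rewrite ltr_pwDr// ler_norm.
by have := ler_normB y (y - x); rewrite subKr /=; lra.
Qed.

Theorem theorem1p1 (R : realType) (n : nat) (hn : (2 <= n)%N)
  (theta : R) (htheta : 0 < theta < 1)
  (Omega : set 'rV[R]_n) (hOmega : bounded_C2theta_domain theta Omega)
  (nu : 'rV[R]_n -> 'rV[R]_n)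
  (hnu : forall x, boundary Omega x -> outward_unit_normal Omega x (nu x))
  (c : 'rV[R]_n -> R) (hc : Cbar 1 Omega c)
  (u0 : 'rV[R]_n -> R) (hu0 : C2theta theta Omega u0)
  (hu0nu : forall x, boundary Omega x -> dot (gradbar Omega u0 x) (nu x) = 0)
  (u : 'rV[R]_n * R -> R) (hu : viscosity_solution Omega nu c u0 u) :
  exists M : R, 0 < M /\
    forall T : R, 0 < T -> exists CT : R, 0 < CT /\
      forall (x y : 'rV[R]_n) (t s : R),
        closure Omega x -> closure Omega y -> 0 <= t <= T -> 0 <= s <= T ->
        `|u (x, t) - u (x, s)| <= M * `|t - s| /\
        `|u (x, t) - u (y, t)| <= CT * enorm (x - y).
Proof.
have [_ oO _ bO chO] := hOmega; have cD := compact_closure bO.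
have charts x0 : boundary Omega x0 -> exists e r gamma g1 g2,
    below_graph Omega x0 e r gamma /\ c2bar setT gamma g1 g2.
  move=> /chO[e [r [gamma [bg [/(Cbar_c2bar openT)[g1 [g2 hg]] _]]]]].
  by exists e, r, gamma, g1, g2.
have charts1 x0 : boundary Omega x0 -> exists e r gamma g1,
    below_graph Omega x0 e r gamma /\ c1bar setT gamma g1.
  move=> /charts[e [r [gamma [g1 [g2 [bg hg]]]]]]; exists e, r, gamma, g1; split=> //.
  exact: c2bar_c1bar hg.
have [C0 [C1 [g [Dg [Hg gg]]]]] := good_geometry_exists oO cD hnu charts.
have [c1 hc1] := Cbar_c1bar oO hc; have cc := c1_cont hc1.
have [Lc Lc0 hLc] := lipschitz_closure oO hc1 cD charts1.
have [Cc /ltW Cc0 hCc] := cont_on_bounded cD cc.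
have [h1 [h2 hh]] := Cbar_c2bar oO hu0.1.
have [L0 L00 hL0] := lipschitz_closure oO (c2bar_c1bar hh) cD charts1.
have [cu0 subu supu] := hu.
have cu := st_cont_within cu0.
have cw : st_cont (closure Omega) (fun z => - u z).
  move=> x t Dx t0 e e0; have [de de0 h] := cu x t Dx t0 e e0; exists de => // y s *.
  by rewrite -opprD normrN h.
have ru := subsolution_raw subu; have rw := supersolution_raw oO supu.
have ccN : cont_on (closure Omega) (fun x => - c x) by exact: cont_onN.
have hCcN x : closure Omega x -> `|- c x| <= Cc by rewrite normrN; exact: hCc.
have su := raw_subsol_quadratic oO cD cc Cc0 hCc cu ru.
have sw := raw_subsol_quadratic oO cD ccN Cc0 hCcN cw rw.
have neu x : boundary Omega x -> dot (\row_i h1 (delta_mx 0 i) x) (nu x) = 0.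
  move=> Bx; rewrite -(hu0nu x Bx); congr dot; apply/rowP => i; rewrite !mxE.
  by rewrite (c2bar_extension1 _ hh Bx.1).
have [M1 M10 hM1] := barrier oO gg Cc0 hCc cu ru hh neu (let: And3 _ i _ := subu in i).
have neuN x : boundary Omega x -> dot (\row_i - h1 (delta_mx 0 i) x) (nu x) = 0.
  move=> Bx; rewrite -[RHS]oppr0 -(neu x Bx) -dotNl; congr dot.
  by apply/rowP => i; rewrite !mxE.
(* The same barrier for [- u], with [- c] and [- u0], bounds u from below. *)
have [M2 M20 hM2] := barrier oO gg Cc0 hCcN cw rw (c2barN hh) neuN
  (fun x Dx => ltac:(rewrite lerN2; exact: (let: And3 _ i _ := supu in i) x Dx)).
have C_ge0 : 0 <= 2 + Cc by rewrite addr_ge0.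
pose M := M1 + M2.
have u00 x : closure Omega x -> u (x, 0) = u0 x.
  move=> Dx; apply/eqP; rewrite eq_le; have [_ i1 _] := subu; have [_ i2 _] := supu.
  by rewrite i1// i2.
have hM x h : closure Omega x -> 0 <= h -> `|u (x, h) - u0 x| <= M * h.
  move=> Dx hh0; rewrite ler_norml; apply/andP; split.
    have := hM2 x h Dx hh0; have := mulr_ge0 (ltW M10) hh0; rewrite /M; lra.
  have := hM1 x h Dx hh0; have := mulr_ge0 (ltW M20) hh0; rewrite /M; lra.
have hL0' x y : closure Omega x -> closure Omega y -> u0 x - u0 y <= L0 * enorm (x - y).
  by move=> Dx Dy; exact: le_trans (ler_norm _) (hL0 x y Dx Dy).
have timeL x t h : closure Omega x -> 0 <= t -> 0 <= h -> `|u (x, t + h) - u (x, t)| <= M * h.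
  move=> Dx t0 h0; have Mh : 0 <= M * h by rewrite mulr_ge0// addr_ge0// ltW.
  have tp : 0 < t + 1 by lra.
  have tt : 0 <= t <= t + 1 by rewrite t0 lerDl ler01.
  (* The functions are u and the time translate of -u, or the reverse, with m0 = M h. At x = y the
     spatial term vanishes, and with it the constant K depending on t; the bound M h is uniform in
     time. *)
  rewrite ler_norml; apply/andP; split.
    have [|K _ hK] := propagation gg Lc0 hCc C_ge0 hLc su (subsol_translate h0 sw) cu
      (st_cont_translate cw h0) Mh L00 _ tp.
      move=> x' y' Dx' Dy' /=; rewrite add0r u00//.
      have := hM y' h Dy' h0; rewrite ler_norml => /andP[]; have := hL0' x' y' Dx' Dy'; lra.
    have := hK x x t Dx Dx tt; rewrite subrr enorm0 mulr0 addr0 /=; lra.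
  have [|K _ hK] := propagation gg Lc0 hCc C_ge0 hLc (subsol_translate h0 su) sw
    (st_cont_translate cu h0) cw Mh L00 _ tp.
    move=> x' y' Dx' Dy' /=; rewrite add0r u00//.
    have := hM x' h Dx' h0; rewrite ler_norml => /andP[]; have := hL0' x' y' Dx' Dy'; lra.
  have := hK x x t Dx Dx tt; rewrite subrr enorm0 mulr0 addr0 /=; lra.
exists M; split; first exact: addr_gt0.
move=> T T0.
have [|K K0 hK] := propagation gg Lc0 hCc C_ge0 hLc su sw cu cw (lexx 0) L00 _ T0.
  by move=> x' y' Dx' Dy'; rewrite !u00// add0r; exact: hL0'.
exists K; split=> // x y t s Dx Dy tT /andP[s0 sT]; have /andP[t0 _] := tT; split.
  have [st|/ltW ts] := leP s t.
    have := timeL x s (t - s) Dx s0; rewrite subr_ge0 => /(_ st).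
    by rewrite subrKC [`|t - s|]ger0_norm// subr_ge0.
  have := timeL x t (s - t) Dx t0; rewrite subr_ge0 => /(_ ts).
  by rewrite subrKC distrC [`|t - s|]distrC [`|s - t|]ger0_norm// subr_ge0.
rewrite ler_norml; apply/andP; split.
  by have := hK y x t Dy Dx tT; rewrite add0r enormBC; lra.
by have := hK x y t Dx Dy tT; rewrite add0r.
Qed.
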